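(* Let $X=\Gamma\backslash\mathbb{D}$ be a compact Riemann surface of genus $g\ge 2$ with injectivity radius $r_X$, and let $$C(r_X)=\left\{\frac{4\pi}{3}\left[1-\left(\frac{4e^{r_X}}{(e^{r_X}+1)^2}\right)^3\right]\right\}^{-\frac12}.$$ At the point of the moduli space $\mathcal{M}_g$ of compact Riemann surfaces of genus $g$ corresponding to $X$, the holomorphic sectional curvatures and the sectional curvatures of the Weil--Petersson metric are bounded below by $-2C(r_X)^2$.
   Context: $\mathbb{D}$ is the open unit disc in $\mathbb{C}$, with hyperbolic metric density $\rho(z)=\frac{4}{(1-|z|^2)^2}$ (the metric $\rho(z)|dz|^2$ has constant curvature $-1$), and $d^2z$ is Lebesgue measure. A compact Riemann surface $X$ of genus $g\geq 2$ is written $X=\Gamma\backslash\mathbb{D}$ with $\Gamma\subset \mathrm{PSU}(1,1)$ a Fuchsian group (torsion-free, cocompact), and carries the induced hyperbolic metric with distance $d$. For $z\in X$, the injectivity radius $inj(X;z)$ is the supremum of all $r>0$ for which the open set $\{w\in X: d(z,w)<r\}$ is isometric to a disc (a hyperbolic disc of radius $r$ in $\mathbb{D}$). The injectivity radius of $X$ is $r_X=inj(X)=\inf_{z\in X} inj(X;z)$. $\Omega^{2,0}(\mathbb{D},\Gamma)$ is the space of holomorphic functions $q$ on $\mathbb{D}$ with $q(\gamma(z))\gamma'(z)^2=q(z)$ for all $\gamma\in\Gamma$. The space of harmonic Beltrami differentials is $\Omega^{-1,1}(\mathbb{D},\Gamma)=\{\nu=\rho^{-1}\overline{q}: q\in\Omega^{2,0}(\mathbb{D},\Gamma)\}$;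 it has complex dimension $3g-3$ and is identified with the holomorphic tangent space, at the point corresponding to $X$, of Teichmüller space $T_g$ (of which $\mathcal{M}_g$ is the quotient by the mapping class group). The Weil--Petersson metric is the Hermitian metric $$\langle \nu_\alpha,\nu_\beta\rangle_{WP}=\iint_{\Gamma\backslash\mathbb{D}}\nu_\alpha\overline{\nu_\beta}\,\rho\, d^2z ,\qquad \|\nu\|_{WP}^2=\langle\nu,\nu\rangle_{WP},$$ which is modular invariant and descends to $\mathcal{M}_g$. Let $\Delta=-\rho^{-1}\partial\bar\partial$ be the (nonnegative) Laplace--Beltrami operator on $X$, where $\partial=\partial/\partial z$, $\bar\partial=\partial/\partial\bar z$, and $G=\frac12\left(\Delta+\frac12\right)^{-1}$ acting on $L^2(X,\rho\,d^2z)$. The Riemann curvature tensor of the Weil--Petersson metric at $X$ is (Wolpert's formula, in the sign convention used here) $$R_{\alpha\bar\beta\lambda\bar\delta}=-\iint_{\Gamma\backslash\mathbb{D}}G(\nu_\alpha\bar\nu_\beta)\,\nu_\lambda\bar\nu_\delta\,\rho\,d^2z-\iint_{\Gamma\backslash\mathbb{D}}G(\nu_\alpha\bar\nu_\delta)\,\nu_\lambda\bar\nu_\beta\,\rho\,d^2z .$$ Holomorphic sectional curvature in the direction of $\nu_\alpha$ with $\|\nu_\alpha\|_{WP}=1$: $s_\alpha=R_{\alpha\bar\alpha\alpha\bar\alpha}=-2\iint_{\Gamma\backslash\mathbb{D}}G(|\nu_\alpha|^2)|\nu_\alpha|^2\rho\,d^2z$. Sectional curvature of the real plane spanned by the real tangent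 vectors corresponding to $\nu_\alpha,\nu_\beta$, where $\|\nu_\alpha\|_{WP}=\|\nu_\beta\|_{WP}=1$ and these vectors are orthogonal (i.e. $\mathrm{Re}\langle\nu_\alpha,\nu_\beta\rangle_{WP}=0$): $$K_{\alpha,\beta}=\tfrac14\left(R_{\alpha\bar\beta\beta\bar\alpha}+R_{\beta\bar\alpha\alpha\bar\beta}-R_{\alpha\bar\beta\alpha\bar\beta}-R_{\beta\bar\alpha\beta\bar\alpha}\right).$$ ''Bounded below by $-2C(r_X)^2$'' means $s_\alpha\ge -2C(r_X)^2$ for all such $\nu_\alpha$ and $K_{\alpha,\beta}\ge-2C(r_X)^2$ for all such pairs. *)

(* Defs.v *)
From HB Require Import structures.
From mathcomp Require Import all_boot all_order all_algebra.
From mathcomp Require Import all_classical all_reals all_analysis.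
From mathcomp Require Import complex.

Set Implicit Arguments.
Unset Strict Implicit.
Unset Printing Implicit Defensive.

Import Order.TTheory GRing.Theory Num.Theory.
Import numFieldNormedType.Exports.
Import Normc.

Local Open Scope classical_set_scope.
Local Open Scope ring_scope.
Local Open Scope complex_scope.

(* The topology of R[i] is the one of the normed field R[i]; in particular
   [derivable f z 1] and [derive1 f z] for f : R[i] -> R[i] are the complex
   differentiability and the complex derivative of f at z. *)
HB.instance Definition _ (R : rcfType) := NormedModule.copy R[i] R[i]^o.

Section Disc.
Variable R : realType.
Implicit Types (z w : R[i]) (f q nu : R[i] -> R[i]) (A : 'M[R[i]]_2).
Implicit Types (Gamma : set 'M[R[i]]_2) (c : R -> R[i]).

Definition disc : set R[i] := [set z | normc z < 1].

Definition rho z : R := 4 / (1 - normc z ^+ 2) ^+ 2.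

Definition SU11 : set 'M[R[i]]_2 :=
  [set A : 'M[R[i]]_2 |
    [/\ A 1 0 = (A 0 1)^*%C, A 1 1 = (A 0 0)^*%C & \det A = 1]].

Definition mobius A z : R[i] :=
  (A 0 0 * z + A 0 1) / (A 1 0 * z + A 1 1).

(* A subgroup of PSU(1,1) = SU(1,1)/{1, -1} is represented by its full preimage
   in SU(1,1), that is, by a subgroup of SU(1,1) containing -1.  "Torsion-free"
   is meant in PSU(1,1). *)
Record surface_group Gamma : Prop := {
  surface_group_sub : Gamma `<=` SU11;
  surface_group_N1 : Gamma (- 1);
  surface_group_mul : forall A B, Gamma A -> Gamma B -> Gamma (A * B);
  surface_group_inv : forall A, Gamma A -> Gamma A^-1;
  surface_group_discrete : exists2 e : R, 0 < e &
    forall A, Gamma A ->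
      (forall i j, normc (A i j - (1 : 'M[R[i]]_2) i j) < e) -> A = 1;
  surface_group_torsion_free : forall A n, Gamma A -> (0 < n)%N ->
    A ^+ n = 1 \/ A ^+ n = - 1 -> A = 1 \/ A = - 1;
  surface_group_cocompact : exists K : set R[i],
    [/\ compact K, K `<=` disc &
        forall z, disc z -> exists2 A, Gamma A & K (mobius A z)] }.

Definition same_orbit Gamma z w : Prop := exists2 A, Gamma A & w = mobius A z.

Definition Gamma_invariant Gamma f : Prop :=
  forall A z, Gamma A -> disc z -> f (mobius A z) = f z.

(* Holomorphic f on the disc such that f(z)dz^k is Gamma-invariant. *)
Definition holomorphic_form Gamma (k : nat) f : Prop :=
  (forall z, disc z -> derivable f z 1) /\
  (forall A z, Gamma A -> disc z ->
     f (mobius A z) * derive1 (mobius A) z ^+ k = f z).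

(* The genus of Gamma\disc is the dimension of its space of holomorphic
   1-forms. *)
Definition has_genus Gamma (g : nat) : Prop :=
  exists om : 'I_g -> R[i] -> R[i],
    (forall i, holomorphic_form Gamma 1 (om i)) /\
    (forall f, holomorphic_form Gamma 1 f ->
       exists! a : 'rV[R[i]]_g,
         forall z, disc z -> f z = \sum_(i < g) a 0 i * om i z).

Definition harmonic_beltrami Gamma nu : Prop :=
  exists2 q, holomorphic_form Gamma 2 q &
    forall z, disc z -> nu z = ((rho z)^-1)%:C * (q z)^*%C.

Definition rderivable c (t : R) : Prop :=
  derivable (fun s => complex.Re (c s)) t 1 /\
  derivable (fun s => complex.Im (c s)) t 1.

Definition rderive c (t : R) : R[i] :=
  derive1 (fun s => complex.Re (c s)) t +i*
  derive1 (fun s => complex.Im (c s)) t.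

(* Paths are parametrized by [0, 1]; a C^1 path on [0, 1] always extends to a
   C^1 map on the line. *)
Definition C1_path z w : set (R -> R[i]) :=
  [set c | [/\ forall t, rderivable c t /\ {for t, continuous (rderive c)},
               forall t, 0 <= t <= 1 -> disc (c t), c 0 = z & c 1 = w]].

Definition hlength c : R :=
  \int[lebesgue_measure]_(t in `[0, 1])
    (Num.sqrt (rho (c t)) * normc (rderive c t)).

(* The Riemannian distance of the metric rho |dz|^2 on the disc. *)
Definition hdist z w : R := inf [set hlength c | c in C1_path z w].

(* Points of X = Gamma\disc are represented by points of the disc. *)
Definition surface_dist Gamma z w : R :=
  inf [set hdist z (mobius A w) | A in Gamma].

Definition hball w (r : R) : set R[i] := [set p | disc p /\ hdist w p < r].

Definition surface_ball Gamma z (r : R) : set R[i] :=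
  [set w | disc w /\ surface_dist Gamma z w < r].

(* The open set {w in X | d(z,w) < r} is isometric, as a Riemannian surface, to
   a hyperbolic disc of radius r: phi is a bijection (modulo Gamma on the side
   of X) which preserves distances locally.  Preservation of the restriction of
   d to the whole ball would be a stronger condition: a geodesic of X between
   two points of an embedded disc may leave that disc. *)
Definition isometric_to_disc Gamma z (r : R) : Prop :=
  exists w0 : R[i], exists phi : R[i] -> R[i],
    [/\ disc w0,
        forall p, hball w0 r p -> surface_ball Gamma z r (phi p),
        forall p p', hball w0 r p -> hball w0 r p' ->
          same_orbit Gamma (phi p) (phi p') -> p = p',
        forall w, surface_ball Gamma z r w ->
          exists2 p, hball w0 r p & same_orbit Gamma (phi p) w &
        forall p, hball w0 r p -> exists2 e : R, 0 < e &
          forall p1 p2, (hball w0 r `&` hball p e) p1 ->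
            (hball w0 r `&` hball p e) p2 ->
            surface_dist Gamma (phi p1) (phi p2) = hdist p1 p2].

Definition inj_radius_at Gamma z : R :=
  sup [set r : R | 0 < r /\ isometric_to_disc Gamma z r].

Definition inj_radius Gamma : R := inf [set inj_radius_at Gamma z | z in disc].

Definition dx f z : R[i] := rderive (fun t : R => f (z + t%:C)) 0.
Definition dy f z : R[i] := rderive (fun t : R => f (z + t *i)) 0.
Definition dz f z : R[i] := 2^-1 * (dx f z - 'i%C * dy f z).
Definition dzbar f z : R[i] := 2^-1 * (dx f z + 'i%C * dy f z).

Definition laplacian f z : R[i] := - ((rho z)^-1)%:C * dz (dzbar f) z.

Fixpoint class_C (n : nat) f : Prop :=
  (forall z, disc z -> {for z, continuous f}) /\
  (if n is m.+1 then
     [/\ forall z, disc z -> rderivable (fun t : R => f (z + t%:C)) 0,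
         forall z, disc z -> rderivable (fun t : R => f (z + t *i)) 0,
         class_C m (dx f) & class_C m (dy f)]
   else True).

Definition smooth f : Prop := forall n, class_C n f.

Definition of_plane (p : measurableTypeR R * measurableTypeR R) : R[i] :=
  p.1 +i* p.2.

Definition area := (@lebesgue_measure R \x @lebesgue_measure R)%E.

(* Integrals over Gamma\disc are integrals over a Borel set F of representatives
   of the Gamma-orbits; for Gamma-invariant integrands (against rho d^2z) they
   do not depend on F. *)
Definition fundamental_set Gamma (F : set R[i]) : Prop :=
  [/\ measurable (of_plane @^-1` F), F `<=` disc &
      forall z, disc z -> exists! w, F w /\ same_orbit Gamma z w].

Definition integral_d2z (F : set R[i]) f : R[i] :=
  (\int[area]_(p in of_plane @^-1` F) complex.Re (f (of_plane p))) +i*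
  (\int[area]_(p in of_plane @^-1` F) complex.Im (f (of_plane p))).

Definition L2_sqnorm (F : set R[i]) f : \bar R :=
  (\int[area]_(p in of_plane @^-1` F)
     (normc (f (of_plane p)) ^+ 2 * rho (of_plane p))%:E)%E.

Definition L2_surface Gamma (F : set R[i]) f : Prop :=
  [/\ Gamma_invariant Gamma f,
      measurable_fun (of_plane @^-1` disc)
        (fun p => complex.Re (f (of_plane p))),
      measurable_fun (of_plane @^-1` disc)
        (fun p => complex.Im (f (of_plane p))) &
      (L2_sqnorm F f < +oo)%E].

(* The graph of the (self-adjoint) Laplacian on L^2(X, rho d^2z): the closure of
   the graph of the Laplacian on the smooth functions on X. *)
Definition L2_laplacian Gamma (F : set R[i]) (u h : R[i] -> R[i]) : Prop :=
  [/\ L2_surface Gamma F u, L2_surface Gamma F h &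
      exists phi : nat -> R[i] -> R[i],
        [/\ forall n, Gamma_invariant Gamma (phi n) /\ smooth (phi n),
            (fun n => L2_sqnorm F (fun z => phi n z - u z)) @ \oo --> 0%E &
            (fun n => L2_sqnorm F (fun z => laplacian (phi n) z - h z))
              @ \oo --> 0%E]].

(* (Laplacian + 1/2)^-1 f is the v, unique up to null sets, for which
   Laplacian(v) = f - v/2 in L^2. *)
Definition resolvent Gamma (F : set R[i]) f : R[i] -> R[i] :=
  xget (fun => 0)
    [set v | L2_laplacian Gamma F v (fun z => f z - 2^-1 * v z)].

Definition green Gamma (F : set R[i]) f : R[i] -> R[i] :=
  fun z => 2^-1 * resolvent Gamma F f z.

Section WeilPetersson.
Variables (Gamma : set 'M[R[i]]_2) (F : set R[i]).
Implicit Types al be la de : R[i] -> R[i].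

Definition wp_product al be : R[i] :=
  integral_d2z F (fun z => al z * (be z)^*%C * (rho z)%:C).

Definition wp_norm al : R := Num.sqrt (complex.Re (wp_product al al)).

(* R_{al, conj be, la, conj de}, by Wolpert's formula. *)
Definition wp_curvature al be la de : R[i] :=
  - integral_d2z F (fun z =>
      green Gamma F (fun w => al w * (be w)^*%C) z
        * la z * (de z)^*%C * (rho z)%:C)
  - integral_d2z F (fun z =>
      green Gamma F (fun w => al w * (de w)^*%C) z
        * la z * (be z)^*%C * (rho z)%:C).

Definition holomorphic_sectional_curvature al : R[i] :=
  wp_curvature al al al al.

Definition sectional_curvature al be : R[i] :=
  4^-1 * (wp_curvature al be be al + wp_curvature be al al be
          - wp_curvature al be al be - wp_curvature be al be al).

End WeilPetersson.

Definition C_const (r : R) : R :=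
  (4 * pi / 3 * (1 - (4 * expR r / (expR r + 1) ^+ 2) ^+ 3)) `^ (- 2^-1).

End Disc.

(* Main.v *)
(* Let K = C(r_X)^2.  A unit harmonic Beltrami differential nu = conj q / rho
   satisfies |nu|^2 <= K: transport a point z to 0 by a Moebius map, so that
   |nu|^2 becomes |q|^2 / rho^2; its hyperbolic integral over the disc of
   hyperbolic radius r_X is at least |q(0)|^2 times the integral of 1 / rho (mean
   value property of q), that is |nu(z)|^2 / K, and at most 1 because this disc
   injects into X.

   The only property of the Laplacian D that matters is positivity on C^2
   invariant functions, which follows from the vanishing of the integral over X of
   the Laplacian of U = f^2.  For the latter, the mean of U over a ball of fixed
   small radius, minus U, has integral 0 over X because the kernel 1_{d(z,w) < r}
   is symmetric; divided by r^2 it tends boundedly to a multiple of the Laplacian.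
   Passing to the closure, w_f = (D + 1/2)^-1 f satisfies <w_f,f> >= |w_f|^2 / 2,
   is unique, and commutes with conjugation; if f has no preimage, [resolvent f] is
   0 and has the same properties.

   With al conj(be) = u + iv, a = |al|^2 and b = |be|^2, the sectional curvature is
     1/4 (<w_u,u> - 3 <w_v,v> - 1/2 <w_a,b> - 1/2 <w_b,a>),
   where <w_u,u> >= 0 and the other products are at most 2K, since
   <w_f,g> <= |f|^2 + |g|^2 and the squared norms of v, a and b are at most K. *)

From HB Require Import structures.
Require Import Defs.
From mathcomp Require Import all_boot all_order all_algebra.
From mathcomp Require Import all_classical all_reals all_analysis.
From mathcomp Require Import measurable_realfun.
From mathcomp Require Import complex ring lra.
Set Implicit Arguments.
Unset Strict Implicit.
Unset Printing Implicit Defensive.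
Import Order.TTheory GRing.Theory Num.Theory.
Import numFieldNormedType.Exports.
Import Normc.
Local Open Scope classical_set_scope.
Local Open Scope ring_scope.
Local Open Scope complex_scope.

(** * Change of variables in the plane *)

(** Holomorphic means complex differentiable on the disc, with no continuity of the derivative
    granted. The mean value property therefore rests on Goursat's bisection, applied in logarithmic
    polar coordinates x + i y, where circles about 0 become segments and two opposite sides cancel
    by periodicity. The invariance of hyperbolic area under Moebius maps is reduced to substitutions
    on the line: affine maps, and the inversion read in slope coordinates. An integral over X is an
    integral over an arbitrary Borel set F of representatives, and global statements pass through
    unfolding along Gamma / {1, -1}. [isometric_to_disc] supplies only a locally isometric
    bijection, whose centre need not correspond to z. To conclude that the ball about z injects, the
    bijection is lifted locally, shown to be rigid, and continued along segments. The constant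
    arises as 4 pi / 3 = 16 pi / 12, where 16 is rho(0)^2 and pi / 12 (1 - (1 - m)^3) is the
    Euclidean integral of 1 / rho over |z|^2 < m, with m = tanh^2(r / 2), r = r_X, so that 1 - m = 4
    e^r / (e^r + 1)^2. *)

Section Density.
Local Open Scope ereal_scope.
Context d (T : measurableType d) (R : realType).
Variables (mu : {measure set T -> \bar R}) (j : T -> R).
Hypotheses (mj : measurable_fun setT j) (j0 : forall x, (0 <= j x)%R).

(** The two proofs are arguments so that the measure structure declared below can be found from the
    term alone. *)
Definition density_measure_def
  (_ : measurable_fun setT j) (_ : forall x, (0 <= j x)%R) (S : set T) : \bar R :=
  \int[mu]_(x in S) (j x)%:E.

Local Notation dens := (density_measure_def mj j0).

Let dens0 : dens set0 = 0.
Proof. by rewrite /density_measure_def integral_set0. Qed.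

Let dens_ge0 S : 0 <= dens S.
Proof. by apply: integral_ge0 => x _; rewrite lee_fin. Qed.

Let dens_sigma_additive : semi_sigma_additive dens.
Proof.
move=> /= F mF tF mUF.
rewrite /density_measure_def ge0_integral_bigcup//=; last 2 first.
  - by apply/measurable_EFinP; exact: measurable_funTS.
  - by move=> x _; rewrite lee_fin.
apply: is_cvg_ereal_nneg_natsum_cond => n _ _.
by apply: integral_ge0 => /= x ?; rewrite lee_fin.
Qed.

HB.instance Definition _ := isMeasure.Build _ _ _
  dens dens0 dens_ge0 dens_sigma_additive.

Import HBNNSimple.

(** Both sides commute with increasing limits of simple functions, by monotone convergence, and with
    finite sums; this leaves the indicator of a level set, where the equality is the definition of
    the density measure. *)
Lemma ge0_integral_density (f : T -> \bar R) :
  measurable_fun setT f -> (forall x, 0 <= f x) ->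
  \int[dens]_x f x = \int[mu]_x (f x * (j x)%:E).
Proof.
move=> mf f0.
pose h := nnsfun_approx measurableT mf.
have hcvg x : EFin \o h ^~ x @ \oo --> f x.
  by apply: cvg_nnsfun_approx.
have -> : \int[dens]_x f x = lim (\int[dens]_x (EFin \o h n) x @[n --> \oo]).
  have fE x : setT x -> f x = lim ((EFin \o h n) x @[n --> \oo]).
    by move=> _; apply/esym/cvg_lim => //; exact: hcvg.
  under eq_integral => x xT do rewrite fE//.
  apply: monotone_convergence => //.
  - by move=> n; apply/measurable_EFinP; exact/measurable_funP.
  - by move=> n x _ //=; rewrite lee_fin.
  - by move=> x _ a b ab; rewrite lee_fin; exact/lefP/nd_nnsfun_approx.
have -> : \int[mu]_x (f x * (j x)%:E) =
    lim (\int[mu]_x ((EFin \o h n) \* (EFin \o j)) x @[n --> \oo]).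
  have fg x : setT x -> f x * (j x)%:E = lim (((EFin \o h n) \* (EFin \o j)) x @[n --> \oo]).
    move=> _; apply/esym/cvg_lim => //; apply: cvgeZr => //; exact: hcvg.
  under eq_integral => x xT do rewrite fg//.
  apply: monotone_convergence => //.
  - by move=> n; apply/emeasurable_funM; apply/measurable_EFinP.
  - by move=> n x _ /=; rewrite mule_ge0 ?lee_fin.
  - by move=> x _ a b ab/=; rewrite lee_wpmul2r ?lee_fin//; exact/lefP/nd_nnsfun_approx.
suff suf n : \int[mu]_x ((EFin \o h n) x * (j x)%:E) =
    \int[dens]_x (EFin \o h n) x.
  by congr (limn _); apply/funext => n; rewrite -suf.
transitivity (\int[dens]_x
   (\sum_(y \in range (h n)) (y * \1_(h n @^-1` [set y]) x)%:E)); last first.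
  by apply: eq_integral => t tE; rewrite /= fimfunE -fsumEFin.
have indich m r : measurable_fun setT (fun x => (r * \1_(h m @^-1` [set r]) x)%:E).
  by apply: (measurable_comp measurableT) => //; exact: measurable_funM.
rewrite ge0_integral_fsum//; last by move=> m y Ey; exact: nnfun_muleindic_ge0.
transitivity (\int[mu]_x (\sum_(y \in range (h n))
    (y * \1_(h n @^-1` [set y]) x)%:E * (j x)%:E)).
  apply: eq_integral => x _; rewrite /= fimfunE -fsumEFin//.
  rewrite ge0_mule_fsuml//.
  by move=> r; exact: nnfun_muleindic_ge0.
rewrite ge0_integral_fsum//; last 2 first.
  - by move=> r; apply/emeasurable_funM => //; exact/measurable_EFinP.
  - by move=> m y _; apply: mule_ge0; rewrite ?lee_fin//; exact: nnfun_muleindic_ge0.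
apply: eq_fsbigr => r /[!inE] -[x _ hx].
have r0 : (0 <= r)%R by rewrite -hx.
under eq_integral do rewrite EFinM -muleA.
rewrite ge0_integralZl//; last 2 first.
  - by apply/emeasurable_funM; apply/measurable_EFinP.
  - by move=> y _; rewrite mule_ge0 ?lee_fin.
under [RHS]eq_integral do rewrite EFinM.
rewrite ge0_integralZl//; last exact/measurable_EFinP.
congr (_ * _); rewrite integral_indic// setIT /density_measure_def [RHS]integral_mkcond.
apply: eq_integral => y _; rewrite patchE indicE.
by case: ifPn => _; rewrite ?mul1e ?mul0e.
Qed.
End Density.


Lemma FTC_is_derive (R : realType) (f F : R -> R) (a b : R) : a <= b ->
  (forall x, a <= x <= b -> is_derive x 1 F (f x)) ->
  (forall x, a <= x <= b -> {for x, continuous f}) ->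
  (\int[lebesgue_measure]_(x in `[a, b]) (f x)%:E = (F b - F a)%:E)%E.
Proof.
move=> ab dF cf.
have cF x : a <= x <= b -> {for x, continuous F}.
  by move=> /dF [dFx _]; apply/differentiable_continuous/derivable1_diffP.
move: ab; rewrite le_eqVlt => /orP[/eqP <-|ab].
  by rewrite set_itv1 integral_set1 subrr.
rewrite (@continuous_FTC2 _ f F)//.
- apply: continuous_in_subspaceT => x /[!inE] /= /[!in_itv] /=; exact: cf.
- split.
  + by move=> x /[!in_itv]/= /andP[/ltW ? /ltW ?]; have [] := dF x; rewrite // ?(introT andP).
  + by apply: cvg_at_right_filter; apply: cF; rewrite lexx ltW.
  + by apply: cvg_at_left_filter; apply: cF; rewrite lexx ltW.
- move=> x /[!in_itv]/= /andP[/ltW ? /ltW ?].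
  have := dF x; rewrite (introT andP)// => /(_ isT) H.
  by rewrite derive1E derive_val.
Qed.

Section ChangeOfVariables.
Context {R : realType}.
Local Notation M := R.
Local Notation leb := (@lebesgue_measure R).
Local Notation P := (M * M)%type.

(** The substitution formula itself is taken as the definition: the measure with density [j] is
    pushed forward by [g] to Lebesgue measure. In this form the notion composes and is insensitive
    to null sets on which [g] is not a diffeomorphism. *)
Definition change1 (g j : M -> M) : Prop :=
  [/\ measurable_fun setT g, measurable_fun setT j, forall x, 0 <= j x &
   forall f : M -> \bar R, measurable_fun setT f -> (forall x, (0 <= f x)%E) ->
     (\int[leb]_x (f (g x) * (j x)%:E) = \int[leb]_x f x)%E].

Definition change2 (g : P -> P) (j : P -> M) : Prop :=
  [/\ measurable_fun setT g, measurable_fun setT j, forall x, 0 <= j x &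
   forall f : P -> \bar R, measurable_fun setT f -> (forall x, (0 <= f x)%E) ->
     (\int[@area R]_x (f (g x) * (j x)%:E) = \int[@area R]_x f x)%E].

Local Notation N := (measurableTypeR R).
(** The push-forward of the density measure agrees with Lebesgue measure on half-open intervals,
    hence everywhere by uniqueness. *)
Let integral_change_intervals (g j : N -> N) :
  measurable_fun setT g -> measurable_fun setT j -> (forall x, (0 : R) <= j x) ->
  (forall a b : R, a < b ->
     (\int[leb]_(x in g @^-1` `]a, b]) (j x)%:E = (b - a)%:E)%E) ->
  forall f : N -> \bar R, measurable_fun setT f -> (forall x, (0 <= f x)%E) ->
     (\int[leb]_x (f (g x) * (j x)%:E) = \int[leb]_x f x)%E.
Proof.
move=> mg mj j0 H f mf f0.
pose g' : {mfun N >-> N} := mfun_Sub (mem_set mg).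
pose nu := density_measure_def leb mj j0.
have nuE A : measurable A -> leb A = pushforward nu g' A.
  apply: (@lebesgue_measure_unique R (pushforward nu g')).
  move=> X [[a b] _ <-] /=; rewrite /pushforward /= /nu /density_measure_def.
  rewrite lebesgue_measure_itv /= lte_fin; case: ltP => [ab|ba].
    by rewrite H// EFinB.
  by rewrite set_itv_ge ?preimage_set0 ?integral_set0// bnd_simp -leNgt.
rewrite -(@ge0_integral_density _ _ _ _ _ mj j0 (f \o g)); last 2 first.
- exact: measurableT_comp.
- by move=> x /=.
transitivity (\int[pushforward nu g']_x f x)%E.
  by rewrite ge0_integral_pushforward//= preimage_setT.
by apply: eq_measure_integral => A mA _; exact/esym/nuE.
Qed.

Lemma change1_intervals (g j : M -> M) :
  measurable_fun setT g -> measurable_fun setT j -> (forall x, 0 <= j x) ->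
  (forall a b : R, a < b ->
     (\int[leb]_(x in g @^-1` `]a, b]) (j x)%:E = (b - a)%:E)%E) ->
  change1 g j.
Proof. by move=> mg mj j0 H; split => // f mf f0; exact: integral_change_intervals. Qed.

Lemma measurable_inv : measurable_fun setT (fun x : M => x^-1 : M).
Proof.
rewrite -(setUv [set~ (0 : M)]) setCK; apply/measurable_funU => //.
- exact: measurableC.
split.
  apply: open_continuous_measurable_fun.
    by rewrite openC; apply/accessible_closed_set1/hausdorff_accessible/Rhausdorff.
  by move=> x /[!inE]/eqP x0; apply: inv_continuous.
by move=> _ Y mY; have [Y0|Y0] := pselect (Y 0); [rewrite (_ : _ `&` _ = [set 0])|rewrite (_ : _ `&` _ = set0)] => //;
  apply/seteqP; split => x //=; [move=> []|move=> ->; rewrite invr0|move=> [-> /=]; rewrite invr0].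
Qed.

Lemma change1_affine (a b : R) : a != 0 ->
  change1 (fun x => a * x + b) (fun=> `|a|).
Proof.
move=> a0; apply: change1_intervals => //.
- apply: measurable_funD => //; exact: measurable_funM.
- move=> c d cd.
  rewrite integral_cst; last first.
    rewrite -[X in measurable X]setTI.
    by apply: (measurable_funD (measurable_funM (@measurable_cst _ _ _ _ _ _) (@measurable_id _ _ _)) (@measurable_cst _ _ _ _ _ _)).
  have [agt|alt|] := ltrgtP a 0; last by move/eqP: a0.
  + have -> : (fun x : M => a * x + b) @^-1` `]c, d] = `[(d - b) / a, (c - b) / a[%classic.
      apply/seteqP; split => x /=; rewrite !in_itv/=.
        move=> /andP[h1 h2]; rewrite ler_ndivrMr// ltr_ndivlMr//; apply/andP; split; lra.
      by rewrite ler_ndivrMr// ltr_ndivlMr// => /andP[h1 h2]; apply/andP; split; lra.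
    rewrite -[X in (_ * X)%E]/(lebesgue_measure _) lebesgue_measure_itv/= lte_fin ltr_ndivrMr// divfK// ltrD2r cd -EFinB -EFinM ltr0_norm//.
    by congr (_%:E); field.
  + have -> : (fun x : M => a * x + b) @^-1` `]c, d] = `](c - b) / a, (d - b) / a]%classic.
      apply/seteqP; split => x /=; rewrite !in_itv/=.
        move=> /andP[h1 h2]; rewrite ler_pdivlMr// ltr_pdivrMr//; apply/andP; split; lra.
      by rewrite ler_pdivlMr// ltr_pdivrMr// => /andP[h1 h2]; apply/andP; split; lra.
    rewrite -[X in (_ * X)%E]/(lebesgue_measure _) lebesgue_measure_itv/= lte_fin ltr_pdivrMr// divfK// ltrD2r cd -EFinB -EFinM gtr0_norm//.
    by congr (_%:E); field.
Qed.




(** Only the positive half-line is inverted, so that preimages of half-open intervals remain one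
    interval or two. The full reciprocal is obtained afterwards by alternating this map with x ->
    -x. *)
Lemma change1_recip : change1 (fun x => if 0 < x then x^-1 else x)
   (fun x => if 0 < x then x ^- 2 else 1).
Proof.
have mpos : measurable_fun setT (fun x : M => (0 : M) < x).
  by apply: measurable_fun_ltr.
have minv : measurable_fun setT (fun x : M => if 0 < x then x^-1 else x).
  by apply: measurable_fun_ifT => //; exact: measurable_inv.
have mj : measurable_fun setT (fun x : M => if 0 < x then x ^- 2 else 1 : M).
  apply: measurable_fun_ifT => //.
  by apply: (measurableT_comp measurable_inv); exact: measurable_funX.
have mjE : measurable_fun setT (fun x : M => (if 0 < x then x ^- 2 else 1 : M)%:E).
  exact/measurable_EFinP.
have j0 (x : R) : 0 <= (if 0 < x then x ^- 2 else 1 : R).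
  by case: ifP => // x0; rewrite invr_ge0 exprn_ge0 ?ltW.
apply: change1_intervals => //.
pose f (x : R) : R := x ^- 2; pose F (x : R) : R := - x^-1.
have dF (x : R) : 0 < x -> is_derive x 1 F (f x).
  move=> x0; rewrite /F /f.
  have -> : x ^- 2 = - (- x ^- 2 *: 1) by rewrite scaleNr opprK /GRing.scale/= mulr1.
  by apply: is_deriveN; apply: is_deriveV; rewrite ?gt_eqF.
have cf (x : R) : 0 < x -> {for x, continuous f}.
  move=> x0; apply: (@continuous_comp _ _ _ (fun x : R => x ^+ 2) (fun x : R => x^-1)).
    exact: exprn_continuous.
  by apply: inv_continuous; rewrite expf_neq0 ?gt_eqF.
have mf D : measurable D -> measurable_fun D (fun x => (f x)%:E).
  move=> mD; apply/measurable_EFinP/measurable_funTS.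
  by apply: (measurableT_comp measurable_inv); exact: measurable_funX.
have pos_int (u v : R) : 0 < u -> u < v ->
  (\int[leb]_(x in `[u, v[) (f x)%:E = (u^-1 - v^-1)%:E)%E.
  move=> u0 uv; rewrite integral_itv_bndo_bndc; last exact: mf.
  transitivity ((F v - F u)%:E); last by rewrite /F; congr (_%:E); lra.
  apply: FTC_is_derive; first exact: ltW.
  - by move=> x /andP[ux _]; apply: dF; exact: lt_le_trans ux.
  - by move=> x /andP[ux _]; apply: cf; exact: lt_le_trans ux.
have pos_inty (u : R) : 0 < u ->
  (\int[leb]_(x in `[u, +oo[) (f x)%:E = (u^-1)%:E)%E.
  move=> u0; rewrite (@ge0_continuous_FTC2y _ f F u 0) //.
  - by rewrite -EFinB /F; congr (_%:E); lra.
  - by move=> x ux; rewrite /f invr_ge0 exprn_ge0// (le_trans _ ux)// ltW.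
  - apply: continuous_in_subspaceT => x /[!inE] /= /[!in_itv] /= /andP[ux _].
    by apply: cf; exact: lt_le_trans ux.
  - rewrite /F -oppr0; apply: cvgN.
    by apply/gtr0_cvgV0; [exact: nbhs_pinfty_gt|exact: cvg_id].
  - by move=> x ux; have [] := dF x (lt_trans u0 ux).
  - apply: cvg_at_right_filter; apply: differentiable_continuous.
    by apply/derivable1_diffP; have [] := dF u u0.
  - move=> x /[!in_itv]/= /andP[ux _]; have H := dF x (lt_trans u0 ux).
    by rewrite derive1E derive_val.
move=> c d cd.
have posE (D : set M) : measurable D -> D `<=` [set x : R | 0 < x] -> (\int[leb]_(x in D)
      (if 0 < x then x ^- 2 else 1)%:E = \int[leb]_(x in D) (f x)%:E)%E.
  by move=> mD D0; apply: eq_integral => x /[!inE] /D0 /= ->.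
have negE (D : set M) : measurable D -> D `<=` [set x : R | x <= 0] -> (\int[leb]_(x in D)
      (if 0 < x then x ^- 2 else 1)%:E = leb D)%E.
  move=> mD D0; rewrite -[RHS]mul1e -integral_cst//.
  by apply: eq_integral => x /[!inE] /D0 /= x0; rewrite ltNge x0.
have [c0|c0] := ltP 0 c.
  have d0 : 0 < d by exact: lt_trans cd.
  have -> : (fun x : M => if 0 < x then x^-1 else x) @^-1` `]c, d] = `[d^-1, c^-1[%classic.
    apply/seteqP; split => x /=; rewrite !in_itv/=.
      case: ifPn => x0; last by rewrite -leNgt in x0; lra.
      move=> /andP[h1 h2].
      by rewrite -[x]invrK lef_pV2 ?ltf_pV2 ?h1 ?h2 ?posrE ?invr_gt0.
    move=> /andP[h1 h2].
    have x0 : 0 < x by rewrite (lt_le_trans _ h1)// invr_gt0.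
    by rewrite x0 -[c]invrK -[d]invrK lef_pV2 ?ltf_pV2 ?h1 ?h2 ?posrE ?invr_gt0.
  rewrite posE//; last first.
    by move=> x /=; rewrite in_itv /= => /andP[h _]; rewrite (lt_le_trans _ h)// invr_gt0.
  by rewrite pos_int ?invr_gt0 ?ltf_pV2 ?posrE// !invrK.
have [d0|d0] := leP d 0.
  have -> : (fun x : M => if 0 < x then x^-1 else x) @^-1` `]c, d] = `]c, d]%classic.
    apply/seteqP; split => x /=; rewrite !in_itv/=.
      by case: ifPn => // x0 /andP[_ h2]; have := invr_gt0 x; rewrite x0 ltNge (le_trans h2).
    move=> /andP[h1 h2]; have x0 : x <= 0 := le_trans h2 d0.
    by case: ifPn => [|_]; [rewrite ltNge x0|rewrite h1].
  rewrite negE//; last by move=> x /=; rewrite in_itv/= => /andP[_ h]; exact: le_trans d0.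
  by rewrite lebesgue_measure_itv/= lte_fin cd -EFinB.
(* Here c <= 0 < d: the positive part of the interval comes from a half-line, of mass d for the
   density x^-2, and the rest contributes -c. *)
have -> : (fun x : M => if 0 < x then x^-1 else x) @^-1` `]c, d] = `[d^-1, +oo[%classic `|` `]c, 0]%classic.
  apply/seteqP; split => x /=; rewrite !in_itv/= ?andbT.
    case: ifPn => x0 /andP[h1 h2]; [left|right].
      by rewrite -[x]invrK lef_pV2 ?posrE ?invr_gt0.
    by rewrite h1 leNgt.
  case=> [h|/andP[h1 h2]].
    have x0 : 0 < x by rewrite (lt_le_trans _ h)// invr_gt0.
    by rewrite x0 (le_lt_trans c0) ?invr_gt0//= -[d]invrK lef_pV2 ?posrE ?invr_gt0.
  case: ifPn => [|_]; first by rewrite ltNge h2.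
  by rewrite h1 (le_trans h2)// ltW.
rewrite ge0_integral_setU//; last 3 first.
- exact: measurable_funTS.
- by move=> x _; rewrite lee_fin.
- apply/disj_setPS => x /= []; rewrite !in_itv/= andbT => h1 /andP[_ h2].
  by have := lt_le_trans (_ : 0 < d^-1) (le_trans h1 h2); rewrite invr_gt0 ltxx => /(_ d0).
rewrite posE//; last first.
  by move=> x /=; rewrite in_itv /= andbT => h; rewrite (lt_le_trans _ h)// invr_gt0.
rewrite negE//; last by move=> x /=; rewrite in_itv/= => /andP[_ h].
rewrite pos_inty ?invr_gt0// lebesgue_measure_itv/= lte_fin.
by rewrite invrK; case: ltP => h; rewrite -?EFinB -EFinD; congr (_%:E); lra.
Qed.

Lemma tonelli1 (f : P -> \bar R) : measurable_fun setT f ->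
  (forall p, (0 <= f p)%E) ->
  (\int[@area R]_p f p = \int[leb]_x \int[leb]_y f (x, y))%E.
Proof. by move=> mf f0; exact: fubini_tonelli1. Qed.

Lemma tonelli2 (f : P -> \bar R) : measurable_fun setT f ->
  (forall p, (0 <= f p)%E) ->
  (\int[@area R]_p f p = \int[leb]_y \int[leb]_x f (x, y))%E.
Proof. by move=> mf f0; exact: fubini_tonelli2. Qed.

Lemma measurable_tonelli1 (f : P -> \bar R) : measurable_fun setT f ->
  (forall p, (0 <= f p)%E) ->
  measurable_fun setT (fun x : R => \int[leb]_y f (x, y))%E.
Proof. by move=> mf f0; exact: (@measurable_fun_fubini_tonelli_F _ _ _ _ _ leb f mf f0). Qed.

Lemma change2_comp (g h : P -> P) (j k : P -> M) :
  change2 g j -> change2 h k -> change2 (h \o g) (fun p => k (g p) * j p).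
Proof.
move=> [mg mj j0 Hg] [mh mk k0 Hh]; split.
- exact: measurableT_comp.
- by apply: measurable_funM => //; exact: measurableT_comp.
- by move=> x; rewrite mulr_ge0.
- move=> f mf f0.
  rewrite -(Hh f)// -(Hg (fun p => f (h p) * (k p)%:E)%E).
  + by apply: eq_integral => p _; rewrite /= EFinM muleA.
  + by apply: emeasurable_funM; [exact: measurableT_comp|exact/measurable_EFinP].
  + by move=> p; rewrite mule_ge0// lee_fin.
Qed.

(** Values of the map where the Jacobian vanishes are irrelevant; this absorbs the default values of
    quotients at a pole. *)
Lemma change2_eq (g h : P -> P) (j k : P -> M) :
  change2 g j -> measurable_fun setT h -> measurable_fun setT k ->
  (forall p, k p = j p /\ (j p != 0 -> h p = g p)) -> change2 h k.
Proof.
move=> [mg mj j0 Hg] mh mk E; split => //.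
- by move=> p; rewrite (E p).1.
- move=> f mf f0; rewrite -(Hg f)//; apply: eq_integral => p _.
  have [-> H] := E p; have [->|/H->//] := eqVneq (j p) 0.
  by rewrite !mule0.
Qed.

(* Tonelli in the fibres [y = const]. *)
Lemma change2_fst (g j : P -> M) :
  measurable_fun setT g -> measurable_fun setT j ->
  (forall y, change1 (fun x => g (x, y)) (fun x => j (x, y))) ->
  change2 (fun p => (g p, p.2)) j.
Proof.
move=> mg mj H.
have mG : measurable_fun setT (fun p : P => (g p, p.2)).
  exact: measurable_fun_pair.
have j0 p : 0 <= j p by case: p => x y; have [_ _ ] := H y.
split => // f mf f0.
have m1 : measurable_fun setT (fun p : P => f (g p, p.2) * (j p)%:E)%E.
  by apply: emeasurable_funM; [exact: measurableT_comp|exact/measurable_EFinP].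
have p1 p : (0 <= f (g p, p.2) * (j p)%:E)%E by rewrite mule_ge0// lee_fin.
rewrite (tonelli2 m1 p1) (tonelli2 mf f0); apply: eq_integral => y _.
have [_ _ _ Hy] := H y; rewrite /=.
rewrite -(Hy (fun x => f (x, y)))//.
exact: measurableT_comp.
Qed.

(** Tonelli in the fibres x = const. The fibre over 0 is null and may be exceptional, which admits
    the slope map (x, t) -> (x, x t). *)
Lemma change2_snd (g j : P -> M) :
  measurable_fun setT g -> measurable_fun setT j -> (forall p, 0 <= j p) ->
  (forall x, x != 0 -> change1 (fun y => g (x, y)) (fun y => j (x, y))) ->
  change2 (fun p => (p.1, g p)) j.
Proof.
move=> mg mj j0 H.
have mG : measurable_fun setT (fun p : P => (p.1, g p)).
  exact: measurable_fun_pair.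
split => // f mf f0.
have m1 : measurable_fun setT (fun p : P => f (p.1, g p) * (j p)%:E)%E.
  by apply: emeasurable_funM; [exact: measurableT_comp|exact/measurable_EFinP].
have p1 p : (0 <= f (p.1, g p) * (j p)%:E)%E by rewrite mule_ge0// lee_fin.
rewrite (tonelli1 m1 p1) (tonelli1 mf f0).
apply: ge0_ae_eq_integral => //.
- exact: (measurable_tonelli1 m1 p1).
- exact: measurable_tonelli1.
- by move=> x _; apply: integral_ge0.
- by move=> x _; apply: integral_ge0.
exists [set 0]; split => //; first exact: lebesgue_measure_set1.
move=> x /= /not_implyP[_ Hx]; apply: contrapT => /eqP x0; apply: Hx.
have [_ _ _ Hy] := H x x0; rewrite /=.
rewrite -(Hy (fun y => f (x, y)))//.
exact: measurableT_comp.
Qed.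

End ChangeOfVariables.

(** * Complex substitutions: translations, multiplications, inversion *)

Section ComplexChange.
Context {R : realType}.
Local Notation M := R.
Local Notation leb := (@lebesgue_measure R).
Local Notation P := (M * M)%type.
Local Notation C := R[i].

Lemma change1_comp (g h j k : M -> M) :
  change1 g j -> change1 h k -> change1 (h \o g) (fun p => k (g p) * j p).
Proof.
move=> [mg mj j0 Hg] [mh mk k0 Hh]; split.
- exact: measurableT_comp.
- by apply: measurable_funM => //; exact: measurableT_comp.
- by move=> x; rewrite mulr_ge0.
- move=> f mf f0.
  rewrite -(Hh f)// -(Hg (fun p => f (h p) * (k p)%:E)%E).
  + by apply: eq_integral => p _; rewrite /= EFinM muleA.
  + by apply: emeasurable_funM; [exact: measurableT_comp|exact/measurable_EFinP].
  + by move=> p; rewrite mule_ge0// lee_fin.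
Qed.

(* The Jacobian is given the value 1 at the origin, where the map has the junk
   value 0. *)
Lemma change1_inv (c : R) : 0 < c ->
  change1 (fun x => (c * x)^-1) (fun x => if x == 0 then c else c^-1 * x ^- 2).
Proof.
move=> c0.
have n1 : -1 != 0 :> R by rewrite oppr_eq0 oner_eq0.
have N := @change1_affine R (-1) 0 n1.
have A := @change1_affine R c 0 (lt0r_neq0 c0).
have := change1_comp A (change1_comp (change1_comp (@change1_recip R) N)
  (change1_comp (@change1_recip R) N)).
congr change1; apply/funext => x /=; rewrite ?addr0.
- case: (ltrgtP x 0) => [xl|xg|->].
  + have h : c * x < 0 by rewrite pmulr_rlt0.
    have -> : (0 < c * x) = false by rewrite ltNge (ltW h).
    rewrite !mulN1r oppr_gt0 h; field.
    by rewrite (ltr0_neq0 xl) (lt0r_neq0 c0).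
  + have h : 0 < c * x by rewrite pmulr_rgt0.
    have h' : 0 < (c * x)^-1 by rewrite invr_gt0.
    by rewrite h !mulN1r oppr_gt0 [_^-1 < 0]ltNge (ltW h')/= opprK.
  + by rewrite mulr0 ltxx mulr0 ltxx mulr0 invr0.
- rewrite normrN1 gtr0_norm//; case: (ltrgtP x 0) => [xl|xg|->].
  + have h : c * x < 0 by rewrite pmulr_rlt0.
    have -> : (0 < c * x) = false by rewrite ltNge (ltW h).
    rewrite !mulN1r oppr_gt0 h; field.
    by rewrite (ltr0_neq0 xl) (lt0r_neq0 c0).
  + have h : 0 < c * x by rewrite pmulr_rgt0.
    have h' : 0 < (c * x)^-1 by rewrite invr_gt0.
    rewrite h !mulN1r oppr_gt0 [_^-1 < 0]ltNge (ltW h')/=; field.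
    by rewrite !lt0r_neq0.
  + by rewrite !mulr0 ltxx mulr0 ltxx; lra.
Qed.

(** Inversion in the unit circle, that is, z -> 1 / conj z; composed with conjugation it gives the
    complex inverse. *)
Definition plane_inv (p : P) : P :=
  (p.1 / (p.1 ^+ 2 + p.2 ^+ 2), p.2 / (p.1 ^+ 2 + p.2 ^+ 2)).

Lemma measurable_sqn : measurable_fun setT (fun p : P => p.1 ^+ 2 + p.2 ^+ 2 : M).
Proof.
by apply: measurable_funD; apply: measurable_funX;
  [exact: measurable_fst|exact: measurable_snd].
Qed.

Lemma change2_inv : change2 plane_inv (fun p => (p.1 ^+ 2 + p.2 ^+ 2) ^- 2).
Proof.
have minv : measurable_fun setT (fun p : P => (p.1 ^+ 2 + p.2 ^+ 2)^-1 : M).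
  by apply: (measurableT_comp measurable_inv); exact: measurable_sqn.
have mI : measurable_fun setT plane_inv.
  by apply: measurable_fun_pair; apply: measurable_funM => //.
have mJ : measurable_fun setT (fun p : P => (p.1 ^+ 2 + p.2 ^+ 2) ^- 2 : M).
  apply: (measurableT_comp measurable_inv); apply: measurable_funX.
  exact: measurable_sqn.
have J0 (p : P) : 0 <= (p.1 ^+ 2 + p.2 ^+ 2) ^- 2 :> R.
  by rewrite invr_ge0 exprn_ge0// addr_ge0 ?sqr_ge0.
(* Slope coordinates (x, y) = (x, x t) turn the inversion into a map of x. *)
have S : change2 (fun p : P => (p.1, p.1 * p.2 + 0)) (fun p => `|p.1|).
  apply: (@change2_snd _ (fun p : P => p.1 * p.2 + 0)) => //.
  - apply: measurable_funD => //; apply: measurable_funM => //.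
  - by apply: measurableT_comp.
  - by move=> x x0; exact: change1_affine.
have m1t : measurable_fun setT (fun p : P => 1 + p.2 ^+ 2 : M).
  by apply: measurable_funD => //; apply: measurable_funX.
have Q : change2 (fun p : P => (((1 + p.2 ^+ 2) * p.1)^-1, p.2))
  (fun p => if p.1 == 0 then 1 + p.2 ^+ 2 else (1 + p.2 ^+ 2)^-1 * p.1 ^- 2).
  apply: (@change2_fst _ (fun p : P => ((1 + p.2 ^+ 2) * p.1)^-1)).
  - apply: (measurableT_comp measurable_inv); apply: measurable_funM => //.
  - apply: measurable_fun_ifT => //.
    + by apply: measurable_fun_eqr.
    + apply: measurable_funM; first exact: (measurableT_comp measurable_inv).
      apply: (measurableT_comp measurable_inv); apply: measurable_funX.
      exact: measurable_fst.
  - by move=> y /=; apply: change1_inv; rewrite ltr_pwDl ?sqr_ge0.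
split => // f mf f0.
have [mS _ _ HS] := S; have [_ _ _ HSQ] := change2_comp Q S.
rewrite -(HSQ f)// -(HS (fun p => f (plane_inv p) * ((p.1 ^+ 2 + p.2 ^+ 2) ^- 2)%:E)%E); last 2 first.
- apply: emeasurable_funM; first exact: measurableT_comp.
  exact/measurable_EFinP.
- by move=> p; rewrite mule_ge0// lee_fin.
apply: eq_integral => -[x t] _ /=; rewrite -muleA -EFinM.
have c0 : 0 < 1 + t ^+ 2 by rewrite ltr_pwDl ?sqr_ge0.
have [->|x0] := eqVneq x 0.
  by rewrite !(mulr0, invr0, normr0, mul0r) !mule0.
have xe : x ^+ 2 + (x * t + 0) ^+ 2 = (1 + t ^+ 2) * x ^+ 2 by ring.
congr (f _ * _%:E)%E.
  by rewrite /plane_inv /= xe; congr pair; field; rewrite ?x0 ?lt0r_neq0.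
rewrite xe normfV normrM (gtr0_norm c0).
have : x ^+ 2 = `|x| ^+ 2 by rewrite real_normK ?num_real.
by move=> ->; field; rewrite normr_eq0 ?x0 ?lt0r_neq0.
Qed.

Definition to_plane (z : C) : P := (complex.Re z, complex.Im z).
(** The squared modulus is polynomial in the coordinates and free of square roots, which keeps later
    identities within reach of [ring] and [field]. *)
Definition sqn (z : C) : R := complex.Re z ^+ 2 + complex.Im z ^+ 2.

Definition changeC (T : C -> C) (J : C -> R) : Prop :=
  change2 (fun p => to_plane (T (of_plane p))) (fun p => J (of_plane p)).

Lemma of_planeK z : of_plane (to_plane z) = z. Proof. by case: z. Qed.
Lemma to_planeK (p : P) : to_plane (of_plane p) = p. Proof. by case: p. Qed.

Lemma sqnM z w : sqn (z * w) = sqn z * sqn w.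
Proof. by case: z => a b; case: w => c d; rewrite /sqn /=; ring. Qed.

Lemma sqn_ge0 z : 0 <= sqn z. Proof. by rewrite addr_ge0 ?sqr_ge0. Qed.

Lemma sqn_eq0 z : (sqn z == 0) = (z == 0).
Proof. by case: z => a b; rewrite eq_complex /sqn /= paddr_eq0 ?sqr_ge0// !sqrf_eq0. Qed.

Lemma sqnV z : sqn z^-1 = (sqn z)^-1.
Proof.
have [->|z0] := eqVneq z 0; first by rewrite invr0 /sqn /= expr0n/= addr0 invr0.
apply: (@mulIf _ (sqn z)); rewrite ?sqn_eq0// -sqnM !mulVf ?sqn_eq0//.
by rewrite /sqn /= expr1n expr0n/= addr0.
Qed.

Lemma changeC_comp (T S : C -> C) (J K : C -> R) :
  changeC T J -> changeC S K -> changeC (S \o T) (fun z => K (T z) * J z).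
Proof.
move=> HT HS; have := change2_comp HT HS.
by congr change2; apply/funext => p /=; rewrite !of_planeK.
Qed.

Lemma changeC_translate c : changeC (fun z => z + c) (fun=> 1).
Proof.
have H1 : change2 (fun p : P => (1 * p.1 + complex.Re c, p.2)) (fun=> `|1|).
  apply: (@change2_fst _ (fun p : P => 1 * p.1 + complex.Re c)) => //.
    by apply: measurable_funD => //; apply: measurable_funM.
  by move=> y; apply: change1_affine; exact: oner_neq0.
have H2 : change2 (fun p : P => (p.1, 1 * p.2 + complex.Im c)) (fun=> `|1|).
  apply: (@change2_snd _ (fun p : P => 1 * p.2 + complex.Im c)) => //.
    by apply: measurable_funD => //; apply: measurable_funM.
  by move=> y _; apply: change1_affine; exact: oner_neq0.
have := change2_comp H1 H2.
congr change2; apply/funext => -[x y] /=; last by rewrite normr1 mulr1.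
by case: c {H1 H2} => a b; rewrite /to_plane /= !mul1r.
Qed.

(** The matrix of the multiplication is a product of two triangular ones, each changing a single
    coordinate affinely; the factorization divides by the real part. *)
Lemma changeC_scale_aux (c1 c2 : R) : c1 != 0 ->
  changeC (fun z => (c1 +i* c2) * z) (fun=> c1 ^+ 2 + c2 ^+ 2).
Proof.
move=> c10.
have H1 : change2 (fun p : P => (p.1, c1 * p.2 + c2 * p.1)) (fun=> `|c1|).
  apply: (@change2_snd _ (fun p : P => c1 * p.2 + c2 * p.1)) => //.
    by apply: measurable_funD => //; apply: measurable_funM.
  by move=> y _ /=; exact: change1_affine.
have n0 : 0 < c1 ^+ 2 + c2 ^+ 2.
  by rewrite ltr_pwDl ?sqr_ge0// lt0r sqr_ge0 sqrf_eq0 c10.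
have n1 : (c1 ^+ 2 + c2 ^+ 2) / c1 != 0.
  by rewrite mulf_neq0 ?invr_neq0// lt0r_neq0.
have H2 : change2 (fun p : P => ((c1 ^+ 2 + c2 ^+ 2) / c1 * p.1 + - (c2 / c1) * p.2, p.2))
   (fun=> `|(c1 ^+ 2 + c2 ^+ 2) / c1|).
  apply: (@change2_fst _ (fun p : P => (c1 ^+ 2 + c2 ^+ 2) / c1 * p.1 + - (c2 / c1) * p.2)) => //.
    by apply: measurable_funD => //; apply: measurable_funM.
  by move=> y /=; exact: change1_affine.
have := change2_comp H1 H2.
congr change2; apply/funext => -[x y] /=.
  by rewrite /to_plane /=; congr pair; field.
rewrite normrM normfV gtr0_norm//; field.
by rewrite normr_eq0.
Qed.

Lemma changeC_scale c : c != 0 -> changeC (fun z => c * z) (fun=> sqn c).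
Proof.
case: c => c1 c2; have [->|c10 _] := eqVneq c1 0; last exact: changeC_scale_aux.
rewrite eq_complex /= eqxx /= => c20.
have c20' : c2 / 2 != 0 by rewrite mulf_neq0 ?invr_neq0.
(* A purely imaginary factor is split into two factors with nonzero real part: i c = (c / 2) (1 + i)
   (1 + i). *)
have := changeC_comp (@changeC_scale_aux (c2 / 2) (c2 / 2) c20')
  (@changeC_scale_aux 1 1 (oner_neq0 _)).
congr changeC; apply/funext => -[x y] /=; last by rewrite /sqn/=; field.
by congr Complex; field.
Qed.

Lemma changeC_inv : changeC (fun z => z^-1) (fun z => (sqn z) ^- 2).
Proof.
have H : change2 (fun p : P => (p.1, -1 * p.2 + 0)) (fun=> `|-1|).
  apply: (@change2_snd _ (fun p : P => -1 * p.2 + 0)) => //.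
    by apply: measurable_funD => //; apply: measurable_funM.
  by move=> y _; apply: change1_affine; rewrite oppr_eq0 oner_neq0.
have := change2_comp change2_inv H.
congr change2; apply/funext => -[x y] /=.
  by rewrite /plane_inv /to_plane /= addr0 mulN1r.
by rewrite normrN1 mul1r.
Qed.

End ComplexChange.

(** * Moebius maps of the disc *)

Section ComplexTopology.
Context {R : realType}.
Local Notation C := R[i].
Implicit Types z w : C.

Lemma normc_sqn z : normc z ^+ 2 = sqn z.
Proof. by case: z => a b; rewrite /sqn /= sqr_sqrtr// addr_ge0 ?sqr_ge0. Qed.

Lemma normc_ge0 z : 0 <= normc z.
Proof. by case: z => a b; exact: sqrtr_ge0. Qed.

Lemma normcE z : `|z| = (normc z)%:C. Proof. by case: z. Qed.

Lemma normc_lt (z : C) (e : R) : 0 < e -> (normc z < e) = (sqn z < e ^+ 2).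
Proof. by move=> e0; rewrite -normc_sqn ltr_pXn2r// nnegrE ?normc_ge0// ltW. Qed.

Lemma disc_sqn z : disc z <-> sqn z < 1.
Proof. by rewrite /disc /= normc_lt// expr1n. Qed.

(** The norm of [R[i]] takes its values in [R[i]], where a positive radius has zero imaginary part;
    real radii and [normc] therefore describe the same neighbourhoods. *)
Lemma nbhs_normc z (U : set C) :
  nbhs z U <-> exists2 e : R, 0 < e & forall w, normc (w - z) < e -> U w.
Proof.
split.
  move=> /nbhs_ballP[e /= e0 H].
  have [r0 er] : 0 < complex.Re e /\ e = (complex.Re e)%:C.
    move: e0; rewrite ltcE /= => /andP[/eqP i0 re]; split => //.
    by case: e i0 {re H} => a b /= ->.
  exists (complex.Re e) => // w wz; apply: H.
  by rewrite /ball /= distrC er normcE ltcR.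
move=> [e e0 H]; apply/nbhs_ballP; exists e%:C => /=; first by rewrite ltcR.
by move=> w; rewrite /ball /= distrC normcE ltcR; exact: H.
Qed.

Lemma continuous_normcP (f : C -> C) z : {for z, continuous f} <->
  forall e : R, 0 < e -> exists2 d : R, 0 < d & forall w, normc (w - z) < d ->
    normc (f w - f z) < e.
Proof.
split.
  move=> cf e e0.
  have /cf/nbhs_normc[d d0 Hd] : nbhs (f z) [set y | normc (y - f z) < e].
    by apply/nbhs_normc; exists e.
  by exists d.
move=> H U /nbhs_normc[e /H[d d0 Hd] HU]; apply/nbhs_normc.
by exists d => // w wz; apply: HU; exact: Hd.
Qed.

Lemma dnbhs0_normc (U : set C) : nbhs (0 : C)^' U <->
  exists2 e : R, 0 < e & forall w, w != 0 -> normc w < e -> U w.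
Proof.
split.
  move=> /nbhs_normc[e e0 H]; exists e => // w w0 we; apply: H => //.
  by rewrite subr0.
move=> [e e0 H]; apply/nbhs_normc; exists e => // w; rewrite subr0 => we w0.
exact: H.
Qed.

Lemma cderivP (f : C -> C) z (l : C) : is_derive z 1 f l <->
  (forall e : R, 0 < e -> exists2 d : R, 0 < d & forall h, h != 0 ->
     normc h < d -> normc (h^-1 * (f (z + h) - f z) - l) < e).
Proof.
have E h : h^-1 *: ((f \o shift z) (h *: 1) - f z) = h^-1 * (f (z + h) - f z).
  by rewrite /= /GRing.scale /= mulr1 (addrC h).
split.
  move=> [+ +] e e0; rewrite /derivable /derive => /cvg_ex[/= l' H] dl; have l'E : l' = l.
    by rewrite -dl; apply/esym/cvg_lim.
  rewrite l'E in H.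
  have := H [set y | normc (y - l) < e].
  have /[swap] /[apply] : nbhs l [set y | normc (y - l) < e].
    by apply/nbhs_normc; exists e.
  move=> /dnbhs0_normc[d d0 Hd]; exists d => // h h0 hd.
  by have := Hd h h0 hd; rewrite /= /GRing.scale /= mulr1 (addrC h).
move=> H.
have cl : (fun h => h^-1 *: ((f \o shift z) (h *: 1) - f z)) @ 0^' --> l.
  move=> U /nbhs_normc[e /H[d d0 Hd] HU]; apply/dnbhs0_normc; exists d => // h h0 hd.
  by apply: HU; rewrite E; exact: Hd.
split; first by apply/cvg_ex; exists l.
exact/cvg_lim.
Qed.

Lemma cderive_continuous (f : C -> C) z : derivable f z 1 -> {for z, continuous f}.
Proof. by move=> df; apply: differentiable_continuous; exact/derivable1_diffP. Qed.

Lemma derive1_is_cderive (f : C -> C) z (l : C) : is_derive z 1 f l -> derive1 f z = l.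
Proof. by move=> [_ <-]; rewrite derive1E. Qed.

Lemma continuous_of_planeP (p : R * R) :
  {for p, continuous (fun p : R * R => of_plane p : C)}.
Proof.
move=> U /nbhs_normc[e e0 H]; apply/nbhs_ballP; exists (e / 2) => /=; first by rewrite divr_gt0.
move=> q [] /=; rewrite /ball /= => h1 h2; apply: H.
case: p q h1 h2 => x y [u v] /= h1 h2.
change (normc ((u - x) +i* (v - y)) < e); rewrite normc_lt// /sqn /=.
have s1 : (u - x) ^+ 2 < (e / 2) ^+ 2.
  by rewrite -[X in X < _]real_normK ?num_real// ltr_pXn2r ?nnegrE ?divr_ge0 ?(ltW e0)// distrC.
have s2 : (v - y) ^+ 2 < (e / 2) ^+ 2.
  by rewrite -[X in X < _]real_normK ?num_real// ltr_pXn2r ?nnegrE ?divr_ge0 ?(ltW e0)// distrC.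
have e2 : 0 < e ^+ 2 by rewrite exprn_gt0.
have e4 : (e / 2) ^+ 2 = e ^+ 2 / 4 by field.
rewrite e4 in s1 s2; lra.
Qed.

Lemma continuous_Re z : {for z, continuous (fun z => complex.Re z)}.
Proof.
move=> U /nbhs_ballP[e /= e0 H]; apply/nbhs_normc; exists e => // w; rewrite normc_lt// => h.
apply: H; rewrite /ball /= distrC -(ltr_pXn2r (_ : (0 < 2)%N))// ?nnegrE ?(ltW e0)//.
rewrite real_normK ?num_real//; apply: le_lt_trans h.
by case: z w => a b [c d]; rewrite /sqn /= lerDl sqr_ge0.
Qed.

Lemma continuous_Im z : {for z, continuous (fun z => complex.Im z)}.
Proof.
move=> U /nbhs_ballP[e /= e0 H]; apply/nbhs_normc; exists e => // w; rewrite normc_lt// => h.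
apply: H; rewrite /ball /= distrC -(ltr_pXn2r (_ : (0 < 2)%N))// ?nnegrE ?(ltW e0)//.
rewrite real_normK ?num_real//; apply: le_lt_trans h.
by case: z w => a b [c d]; rewrite /sqn /= lerDr sqr_ge0.
Qed.


Lemma mulmx2E (A B : 'M[C]_2) i j : (A * B) i j = A i 0 * B 0 j + A i 1 * B 1 j.
Proof.
rewrite mxE !big_ord_recl big_ord0 addr0.
by have -> : lift ord0 ord0 = 1 :> 'I_2 by apply/val_inj.
Qed.

Lemma det_mx2 (A : 'M[C]_2) : \det A = A 0 0 * A 1 1 - A 0 1 * A 1 0.
Proof.
rewrite (expand_det_row _ 0) !big_ord_recl big_ord0 addr0 /cofactor !det_mx11 !mxE /=.
have l1 : lift ord0 ord0 = 1 :> 'I_2 by apply/val_inj.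
have l0 : lift 1 0 = 0 :> 'I_2 by apply/val_inj.
by rewrite l1 !l0 expr0 expr1 mul1r mulN1r mulrN.
Qed.

Lemma mx2P (A B : 'M[C]_2) : A 0 0 = B 0 0 -> A 0 1 = B 0 1 ->
  A 1 0 = B 1 0 -> A 1 1 = B 1 1 -> A = B.
Proof.
move=> h00 h01 h10 h11; apply/matrixP => i j.
have two (k : 'I_2) : k = 0 \/ k = 1.
  by case: k => [[|[|//]] ?]; [left|right]; apply/val_inj.
by case: (two i) => ->; case: (two j) => ->.
Qed.

End ComplexTopology.

(** * The action of SU(1,1) on the disc *)

Section Mobius.
Context {R : realType}.
Local Notation C := R[i].
Implicit Types (z w : C) (A B : 'M[C]_2).

Definition su_mx (a b : C) : 'M[C]_2 :=
  \matrix_(i < 2, j < 2) if i == 0 then (if j == 0 then a else b)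
                         else (if j == 0 then b^*%C else a^*%C).

Lemma su_mxE a b : [/\ su_mx a b 0 0 = a, su_mx a b 0 1 = b,
  su_mx a b 1 0 = b^*%C & su_mx a b 1 1 = a^*%C].
Proof. by rewrite !mxE. Qed.

Lemma sqn_conj z : (sqn z)%:C = z * z^*%C.
Proof. by case: z => a b; rewrite /sqn /=; simpc; congr Complex; ring. Qed.

Lemma sqnJ z : sqn z^*%C = sqn z.
Proof. by case: z => a b; rewrite /sqn /= sqrrN. Qed.

Lemma sqnN z : sqn (- z) = sqn z.
Proof. by case: z => a b; rewrite /sqn /= !sqrrN. Qed.

Lemma SU11_mx a b : sqn a - sqn b = 1 -> SU11 (su_mx a b).
Proof.
have [e00 e01 e10 e11] := su_mxE a b.
move=> h; split; rewrite ?e00 ?e01 ?e10 ?e11 //.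
by rewrite det_mx2 e00 e01 e10 e11 -!sqn_conj -rmorphB h.
Qed.

Lemma SU11E A : SU11 A -> A = su_mx (A 0 0) (A 0 1).
Proof.
by case=> h1 h2 _; have [e00 e01 e10 e11] := su_mxE (A 0 0) (A 0 1);
  apply: mx2P; rewrite ?e00 ?e01 ?e10 ?e11.
Qed.

Lemma SU11_sqn A : SU11 A -> sqn (A 0 0) - sqn (A 0 1) = 1.
Proof.
case=> h1 h2; rewrite det_mx2 h1 h2 -!sqn_conj -rmorphB => /eqP.
by rewrite -(rmorph1 (real_complex R)) => /eqP /complexI.
Qed.

Lemma SU11_ind (P : 'M[C]_2 -> Prop) :
  (forall a b, sqn a - sqn b = 1 -> P (su_mx a b)) -> forall A, SU11 A -> P A.
Proof. by move=> H A sA; rewrite (SU11E sA); apply: H; exact: SU11_sqn. Qed.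

Definition den A z := A 1 0 * z + A 1 1.
Definition num A z := A 0 0 * z + A 0 1.

(** SU(1,1) preserves the Hermitian form |v2|^2 - |v1|^2, here evaluated at the vector (z, 1).
    Preservation of the disc, of the area and of [sigma] all follow from this identity. *)
Lemma sqn_den A z : SU11 A -> sqn (den A z) - sqn (num A z) = 1 - sqn z.
Proof.
move: A; apply: SU11_ind => a b; have [e00 e01 e10 e11] := su_mxE a b.
rewrite /den /num e00 e01 e10 e11.
case: a {e00 e01 e10 e11} => a1 a2; case: b => b1 b2; case: z => x y; rewrite /sqn /= => h.
have -> : 1 = (a1 ^+ 2 + a2 ^+ 2 - (b1 ^+ 2 + b2 ^+ 2)) by [].
transitivity ((a1 ^+ 2 + a2 ^+ 2 - (b1 ^+ 2 + b2 ^+ 2)) * (1 - (x ^+ 2 + y ^+ 2))); first by ring.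
by rewrite h mul1r.
Qed.

Lemma sqn_den_gt0 A z : SU11 A -> disc z -> 0 < sqn (den A z).
Proof.
move=> sA /disc_sqn zd; have := sqn_den z sA; have := sqn_ge0 (num A z); lra.
Qed.

Lemma den_neq0 A z : SU11 A -> disc z -> den A z != 0.
Proof. by move=> sA zd; rewrite -sqn_eq0 gt_eqF// sqn_den_gt0. Qed.

Lemma mobius_sqn A z : SU11 A -> disc z ->
  1 - sqn (mobius A z) = (1 - sqn z) / sqn (den A z).
Proof.
move=> sA zd; rewrite /mobius -/(den A z) -/(num A z) sqnM sqnV.
rewrite -(sqn_den z sA); field; exact: lt0r_neq0 (sqn_den_gt0 sA zd).
Qed.

Lemma mobius_disc A z : SU11 A -> disc z -> disc (mobius A z).
Proof.
move=> sA zd; apply/disc_sqn; rewrite -subr_gt0 mobius_sqn// divr_gt0 ?sqn_den_gt0//.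
by rewrite subr_gt0; apply/disc_sqn.
Qed.

Lemma SU11_1 : SU11 (1 : 'M[C]_2).
Proof.
have -> : (1 : 'M[C]_2) = su_mx 1 0.
  by have [e00 e01 e10 e11] := su_mxE 1 0; apply: mx2P; rewrite ?e00 ?e01 ?e10 ?e11 !mxE ?conjc0 ?conjc1.
by apply: SU11_mx; rewrite /sqn /= expr1n expr0n/= !addr0 subr0.
Qed.

Lemma SU11M A B : SU11 A -> SU11 B -> SU11 (A * B).
Proof.
case=> a1 a2 a3 [b1 b2 b3]; split.
- by rewrite !mulmx2E a1 a2 b1 b2 rmorphD !rmorphM /= conjcK [LHS]addrC.
- by rewrite !mulmx2E a1 a2 b1 b2 rmorphD !rmorphM /= conjcK [LHS]addrC.
- by rewrite det_mulmx a3 b3 mulr1.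
Qed.

Lemma SU11_invE A : SU11 A -> A^-1 = su_mx (A 0 0)^*%C (- A 0 1).
Proof.
move: A; apply: SU11_ind => a b h; have [e00 e01 e10 e11] := su_mxE a b.
have [f00 f01 f10 f11] := su_mxE a^*%C (- b).
have cab : a * a^*%C - b * b^*%C = 1 by rewrite -!sqn_conj -rmorphB h.
have h1 : su_mx a b * su_mx a^*%C (- b) = 1.
  apply: mx2P; rewrite mulmx2E ?e00 ?e01 ?e10 ?e11 ?f00 ?f01 ?f10 ?f11 ?conjcK ?rmorphN /= !mxE /=.
  - by rewrite -cab mulrN.
  - by rewrite mulrN mulrC addNr.
  - by rewrite mulrN mulrC subrr.
  - by rewrite -cab addrC mulrC mulrN [b^*%C * _]mulrC.
have u : su_mx a b \is a GRing.unit by have [] := mulmx1_unit h1.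
by rewrite e00 e01 -[RHS]mul1r -(mulVr u) -mulrA h1 mulr1.
Qed.

Lemma SU11V A : SU11 A -> SU11 A^-1.
Proof.
move=> sA; rewrite SU11_invE//; apply: SU11_mx.
by rewrite sqnJ sqnN SU11_sqn.
Qed.

Lemma SU11_unit A : SU11 A -> A \is a GRing.unit.
Proof. by case=> _ _ h; rewrite unitmxE h unitr1. Qed.

Lemma mobiusM A B z : SU11 A -> SU11 B -> disc z ->
  mobius (A * B) z = mobius A (mobius B z).
Proof.
move=> sA sB zd; have d1 := den_neq0 sB zd; have d2 := den_neq0 (SU11M sA sB) zd.
have d3 := den_neq0 sA (mobius_disc sB zd).
move: d2 d3; rewrite /mobius /den !mulmx2E -/(den B z) -/(num B z) => d2 d3.
have e i : A i 0 * (num B z / den B z) + A i 1 =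
    ((A i 0 * B 0 0 + A i 1 * B 1 0) * z + (A i 0 * B 0 1 + A i 1 * B 1 1)) / den B z.
  by apply: (mulIf d1); rewrite mulrDl mulrA !divfK// /num /den; ring.
rewrite !e invfM invrK mulrACA -mulrA; congr (_ * _).
by rewrite mulVf// mulr1.
Qed.

Lemma mobius1 z : mobius 1 z = z.
Proof. by rewrite /mobius !mxE /= mul1r mul0r add0r addr0 divr1. Qed.

Lemma mobiusN A z : mobius (- A) z = mobius A z.
Proof.
rewrite /mobius !mxE !mulNr -!opprD invrN mulrNN //.
Qed.

Lemma SU11_mulV A : SU11 A -> A^-1 * A = 1.
Proof. by move=> /SU11_unit u; exact: (mulVr u). Qed.

Lemma SU11_mulr A : SU11 A -> A * A^-1 = 1.
Proof. by move=> /SU11_unit u; exact: (mulrV u). Qed.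

Lemma mobiusK A z : SU11 A -> disc z -> mobius A^-1 (mobius A z) = z.
Proof.
by move=> sA zd; rewrite -(mobiusM (SU11V sA) sA zd) SU11_mulV// mobius1.
Qed.

Lemma mobiusVK A z : SU11 A -> disc z -> mobius A (mobius A^-1 z) = z.
Proof.
by move=> sA zd; rewrite -(mobiusM sA (SU11V sA) zd) SU11_mulr// mobius1.
Qed.

Lemma mobius_diff A z w : SU11 A -> den A z != 0 -> den A w != 0 ->
  mobius A z - mobius A w = (z - w) / (den A z * den A w).
Proof.
case=> _ _; rewrite det_mx2 /mobius /den => h d1 d2.
transitivity ((A 0 0 * A 1 1 - A 0 1 * A 1 0) * (z - w) / ((A 1 0 * z + A 1 1) * (A 1 0 * w + A 1 1))).
  by field; rewrite d1 d2.
by rewrite h mul1r.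
Qed.

(** This is sinh^2(d / 2) for the hyperbolic distance d. As a rational point-pair invariant it
    stands in for the distance, which is defined by an infimum over paths and computed only
    later. *)
Definition sigma z w : R := sqn (z - w) / ((1 - sqn z) * (1 - sqn w)).

Lemma sigma_mobius A z w : SU11 A -> disc z -> disc w ->
  sigma (mobius A z) (mobius A w) = sigma z w.
Proof.
move=> sA zd wd; rewrite /sigma mobius_diff ?den_neq0// !mobius_sqn// sqnM sqnV sqnM.
have /lt0r_neq0 h1 := sqn_den_gt0 sA zd; have /lt0r_neq0 h2 := sqn_den_gt0 sA wd.
have z1 : 1 - sqn z != 0 by move/disc_sqn: zd => ?; rewrite gt_eqF// subr_gt0.
have w1 : 1 - sqn w != 0 by move/disc_sqn: wd => ?; rewrite gt_eqF// subr_gt0.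
by field; rewrite h1 h2 z1 w1.
Qed.

Lemma sigmaC z w : sigma z w = sigma w z.
Proof. by rewrite /sigma -sqnN opprB mulrC [(1 - sqn z) * _]mulrC mulrC. Qed.

(** The map v -> (v + w) / (1 + conj(w) v), which carries 0 to w, normalized to determinant 1. *)
Definition shift_mx w : 'M[C]_2 :=
  su_mx ((Num.sqrt (1 - sqn w))^-1)%:C (((Num.sqrt (1 - sqn w))^-1)%:C * w).

Lemma SU11_shift w : disc w -> SU11 (shift_mx w).
Proof.
move=> /disc_sqn wd; apply: SU11_mx; rewrite sqnM.
have h : 0 < 1 - sqn w by rewrite subr_gt0.
have -> : sqn ((Num.sqrt (1 - sqn w))^-1)%:C = (1 - sqn w)^-1.
  by rewrite {1}/sqn /= expr0n/= addr0 exprVn sqr_sqrtr// ltW.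
by field; rewrite gt_eqF.
Qed.

Lemma mobius_shift0 w : disc w -> mobius (shift_mx w) 0 = w.
Proof.
move=> /disc_sqn wd; rewrite /mobius /shift_mx; set s := (_^-1)%:C.
have [-> -> -> ->] := su_mxE s (s * w).
have s0 : s != 0.
  by rewrite /s fmorph_eq0 invr_eq0 gt_eqF// sqrtr_gt0 subr_gt0.
by rewrite !mulr0 !add0r conjc_real mulrC mulKf.
Qed.

Lemma disc0 : disc (0 : C). Proof. by apply/disc_sqn; rewrite /sqn /= expr0n/= addr0. Qed.

Lemma shift0_mobius w : disc w -> mobius (shift_mx w)^-1 w = 0.
Proof.
move=> wd; rewrite -{2}(mobius_shift0 wd); apply: mobiusK disc0; exact: SU11_shift.
Qed.


(** The difference of two values is exactly (z - w) / (den z den w), so only the continuity of 1 /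
    den at z is needed. *)
Lemma is_derive_mobius A z : SU11 A -> disc z ->
  is_derive z 1 (mobius A) ((den A z) ^- 2).
Proof.
move=> sA zd; apply/cderivP => e e0.
have dz := den_neq0 sA zd.
have cV : {for den A z, continuous (fun x : C => x^-1)} by exact: inv_continuous.
have e1 : 0 < e / (normc (den A z)^-1 + 1).
  by rewrite divr_gt0// ltr_pwDr// normc_ge0.
have [d1 d10 H1] := (continuous_normcP _ _).1 cV _ e1.
have nd : 0 < normc (den A z).
  by rewrite lt0r normc_ge0 andbT; apply: contra dz => /eqP/eq0_normc ->.
(* Bounding the change of the denominator by its modulus keeps it away from 0, and [d1] makes its
   inverse close; the added 1 avoids a division by 0. *)
have d2 : 0 < Num.min d1 (normc (den A z)) / (normc (A 1 0) + 1).
  by rewrite divr_gt0 ?lt_min ?d10 ?nd// ltr_pwDr// normc_ge0.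
exists (Num.min d1 (normc (den A z)) / (normc (A 1 0) + 1)) => // h h0 hd.
have dE : den A (z + h) - den A z = A 1 0 * h by rewrite /den; ring.
have hd' : normc (A 1 0 * h) < Num.min d1 (normc (den A z)).
  rewrite normcM; move: hd; rewrite ltr_pdivlMr; last by rewrite ltr_pwDr// normc_ge0.
  by apply: le_lt_trans; rewrite mulrC ler_wpM2l ?normc_ge0// lerDl.
have dz' : den A (z + h) != 0.
  apply: contraTneq hd' => d0; rewrite -dE d0 add0r normcN -leNgt.
  by rewrite ge_min lexx orbT.
rewrite mobius_diff//.
have -> : h^-1 * ((z + h - z) / (den A (z + h) * den A z)) - den A z ^- 2
   = (den A z)^-1 * ((den A (z + h))^-1 - (den A z)^-1).
  by field; rewrite h0 dz dz'.
rewrite normcM.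
have := H1 (den A (z + h)); rewrite dE => /(_ (lt_le_trans hd' _)).
rewrite ge_min lexx => /(_ isT) H.
apply: le_lt_trans (_ : normc (den A z)^-1 * (e / (normc (den A z)^-1 + 1)) < e).
  by rewrite ler_wpM2l ?normc_ge0// ltW.
rewrite mulrCA gtr_pMr// ltr_pdivrMr ?mul1r ?ltrDl//.
by rewrite ltr_pwDr// normc_ge0.
Qed.

Local Notation P := (R * R)%type.

Definition cmeasurable (f : C -> C) : Prop :=
  measurable_fun setT (fun p : P => complex.Re (f (of_plane p))) /\
  measurable_fun setT (fun p : P => complex.Im (f (of_plane p))).

Lemma cmeasurable_plane f : cmeasurable f ->
  measurable_fun setT (fun p : P => to_plane (f (of_plane p))).
Proof. by case=> h1 h2; exact: measurable_fun_pair. Qed.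

Lemma cmeasurable_cst c : cmeasurable (fun=> c).
Proof. by split. Qed.

Lemma cmeasurable_id : cmeasurable id.
Proof. by split; [exact: measurable_fst|exact: measurable_snd]. Qed.

Lemma cmeasurableD f g : cmeasurable f -> cmeasurable g ->
  cmeasurable (fun z => f z + g z).
Proof.
move=> [f1 f2] [g1 g2]; split.
  have := measurable_funD f1 g1; congr measurable_fun; apply/funext => p /=.
  by case: (f _) (g _) => [? ?] [].
have := measurable_funD f2 g2; congr measurable_fun; apply/funext => p /=.
by case: (f _) (g _) => [? ?] [].
Qed.

Lemma cmeasurableM f g : cmeasurable f -> cmeasurable g ->
  cmeasurable (fun z => f z * g z).
Proof.
move=> [f1 f2] [g1 g2]; split.
  have := measurable_funB (measurable_funM f1 g1) (measurable_funM f2 g2).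
  congr measurable_fun; apply/funext => p /=; by case: (f _) (g _) => [? ?] [].
have := measurable_funD (measurable_funM f1 g2) (measurable_funM f2 g1).
congr measurable_fun; apply/funext => p /=; by case: (f _) (g _) => [? ?] [].
Qed.

Lemma measurable_csqn f : cmeasurable f ->
  measurable_fun setT (fun p : P => sqn (f (of_plane p))).
Proof. by move=> [f1 f2]; apply: measurable_funD; apply: measurable_funX. Qed.

Lemma cmeasurableV f : cmeasurable f -> cmeasurable (fun z => (f z)^-1).
Proof.
move=> mf; have mn := measurableT_comp measurable_inv (measurable_csqn mf).
case: mf => f1 f2; split.
  have := measurable_funM f1 mn; congr measurable_fun; apply/funext => p /=.
  by case: (f _).
have := measurable_funM (measurable_funN f2) mn; congr measurable_fun; apply/funext => p /=.
by rewrite /sqn; case: (f _) => x y /=; rewrite mulNr.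
Qed.

Lemma cmeasurable_den A : cmeasurable (den A).
Proof.
by apply: cmeasurableD; [apply: cmeasurableM|]; rewrite /=; try exact: cmeasurable_cst; exact: cmeasurable_id.
Qed.

Lemma cmeasurable_mobius A : cmeasurable (mobius A).
Proof.
apply: cmeasurableM; last exact: cmeasurableV (cmeasurable_den A).
by apply: cmeasurableD; [apply: cmeasurableM|]; rewrite /=; try exact: cmeasurable_cst; exact: cmeasurable_id.
Qed.

(** A diagonal matrix acts as multiplication by a / conj a, of modulus 1. Otherwise, with c = conj b
    and d = conj a, (a z + b) / (c z + d) = a / c - c^-2 / (z + d / c) is a chain of translations,
    an inversion and a multiplication. *)
Lemma changeC_mobius A : SU11 A -> changeC (mobius A) (fun z => (sqn (den A z)) ^- 2).
Proof.
move=> sA; have [a1 a2 dA] := sA; rewrite det_mx2 a1 a2 in dA.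
have [b0|b0] := eqVneq (A 0 1) 0.
  rewrite b0 mul0r subr0 in dA.
  have a0 : A 0 0 != 0 by apply: contra_eq_neq dA => ->; rewrite mul0r eq_sym oner_neq0.
  have sa : sqn (A 0 0) = 1 by have := SU11_sqn sA; rewrite b0 {2}/sqn /= expr0n/= addr0 subr0.
  have := @changeC_scale R (A 0 0 / (A 0 0)^*%C).
  rewrite mulf_neq0 ?invr_neq0 ?conjc_eq0// => /(_ isT).
  congr changeC; apply/funext => z.
    rewrite /mobius a1 a2 b0 conjc0 mul0r add0r addr0; ring.
  rewrite /den a1 a2 b0 conjc0 mul0r add0r sqnM sqnV sqnJ sa invr1 mulr1.
  by rewrite expr1n invr1.
set b := A 0 1 in b0 *; set a := A 0 0 in a2 dA *.
have b0' : b^*%C != 0 by rewrite conjc_eq0.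
have c0 : - (b^*%C ^- 2) != 0 by rewrite oppr_eq0 invr_neq0// expf_neq0.
have H := changeC_comp (changeC_comp (changeC_comp
   (changeC_translate (a^*%C / b^*%C)) changeC_inv) (changeC_scale c0)) (changeC_translate (a / b^*%C)).
apply: (change2_eq H).
- exact: cmeasurable_plane (cmeasurable_mobius A).
- apply: (measurableT_comp measurable_inv); apply: measurable_funX.
  exact: measurable_csqn (cmeasurable_den A).
- move=> p; set z := of_plane p; rewrite /den a1 a2 -/b /=; split.
    rewrite !mul1r mulr1 sqnN sqnV -[sqn (_ + _)]mul1r.
    have -> : b^*%C * z + a^*%C = b^*%C * (z + a^*%C / b^*%C) by field.
    rewrite sqnM; have [->|h] := eqVneq (sqn (z + a^*%C / b^*%C)) 0.
      by rewrite !mul1r mulr0 !expr0n/= !invr0 mulr0.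
    rewrite mul1r; have hb : sqn b^*%C != 0 by rewrite sqn_eq0.
    have -> : sqn (b^*%C ^+ 2) = sqn b^*%C ^+ 2 by rewrite expr2 sqnM.
    by field; rewrite h hb.
  rewrite mul1r mulf_eq0 negb_or => /andP[_]; rewrite mulr1 invr_eq0 expf_eq0 /= sqn_eq0 => h.
  congr to_plane; rewrite /mobius -/a -/b a1 a2 -/b.
  have -> : b^*%C * z + a^*%C = b^*%C * (z + a^*%C / b^*%C) by field.
  have -> : a * z + b = (a * (b^*%C * (z + a^*%C / b^*%C)) - 1) / b^*%C.
    by rewrite -dA -/b; field.
  move: (z + _) h => t h.
  by field; rewrite b0' h.
Qed.

End Mobius.

(** * Hyperbolic area and unfolding *)

Section PlaneMeasure.
Context {R : realType}.
Local Notation C := R[i].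
Local Notation P := (R * R)%type.
Local Notation leb := (@lebesgue_measure R).

(** An open set is the union of the rational squares that it contains, and these are countably
    many. *)
Lemma open_plane_measurable (U : set P) : open U -> measurable U.
Proof.
move=> oU.
pose box (a b r : rat) : set P :=
  [set p | ball (ratr a : R) (ratr r) p.1 /\ ball (ratr b : R) (ratr r) p.2].
have mbox a b r : measurable (box a b r).
  have -> : box a b r = ball (ratr a : R) (ratr r) `*` ball (ratr b : R) (ratr r) by [].
  by apply: measurableX; exact: measurable_ball.
have -> : U = \bigcup_(a in [set: rat]) \bigcup_(b in [set: rat])
   \bigcup_(r in [set: rat]) (if `[< box a b r `<=` U >] then box a b r else set0).
  apply/seteqP; split => [p Up|p [a _ [b _ [r _]]]]; last first.
    by case: asboolP => // H; exact: H.
  have /nbhs_ballP[e /= e0 H] : nbhs p U by exact: open_nbhs_nbhs.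
  have e42 : e / 4 < e / 2 by lra.
  have [r] := rat_in_itvoo e42; rewrite in_itv /= => /andP[r1 r2].
  have r0 : 0 < ratr r :> R by lra.
  have ha : p.1 - ratr r < p.1 + ratr r by lra.
  have [a] := rat_in_itvoo ha.
  rewrite in_itv /= => /andP[a1 a2].
  have hb : p.2 - ratr r < p.2 + ratr r by lra.
  have [b] := rat_in_itvoo hb.
  rewrite in_itv /= => /andP[b1 b2].
  exists a => //; exists b => //; exists r => //.
  have -> : `[< box a b r `<=` U >] = true.
    apply/asboolP => q [/= q1 q2]; apply: H; rewrite /ball /= /ball /= in q1 q2 *.
    move: q1 q2; rewrite /ball_ /= => q1 q2.
    split => /=; rewrite /ball /= /ball_ /= ltr_norml.
      move: q1; rewrite !ltr_norml => /andP[? ?]; apply/andP; split; lra.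
    move: q2; rewrite !ltr_norml => /andP[? ?]; apply/andP; split; lra.
  split; rewrite /= /ball /= /ball_ /= ltr_norml; apply/andP; split; lra.
apply: countable_bigcupT_measurable => // a; apply: countable_bigcupT_measurable => // b.
apply: countable_bigcupT_measurable => // r; by case: ifP.
Qed.

Lemma open_normc_measurable (U : set C) : (forall z, U z -> nbhs z U) ->
  measurable (@of_plane R @^-1` U : set P).
Proof.
move=> oU; apply: open_plane_measurable; rewrite openE => p /= /oU.
exact: continuous_of_planeP.
Qed.

Lemma open_disc z : disc z -> nbhs z (@disc R).
Proof.
rewrite /disc /= => zd; apply/nbhs_normc; exists (1 - normc z); first by rewrite subr_gt0.
move=> w wz; have := le_normcD (w - z) z; rewrite subrK /=; lra.
Qed.

Lemma measurable_disc : measurable (@of_plane R @^-1` @disc R : set P).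
Proof. by apply: open_normc_measurable; exact: open_disc. Qed.

Lemma continuous_measurable_plane (U : set C) (g : C -> R) :
  (forall z, U z -> nbhs z U) ->
  (forall z, U z -> {for z, continuous g}) ->
  measurable_fun (@of_plane R @^-1` U : set P) (fun p => g (of_plane p)).
Proof.
move=> oU cg; apply: (measurability _ (RGenOpens.measurableE R)).
move=> _ [_ [a [b ->] <-]].
rewrite (_ : _ `&` _ = @of_plane R @^-1` (U `&` (g @^-1` `]a, b[))) //.
apply: open_normc_measurable => z [Uz gz].
apply: filterI; first exact: oU.
by apply: cg => //; apply: open_nbhs_nbhs; split => //; exact: interval_open.
Qed.

Lemma ccontinuous_measurable (U : set C) (f : C -> C) :
  (forall z, U z -> nbhs z U) ->
  (forall z, U z -> {for z, continuous f}) ->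
  measurable_fun (@of_plane R @^-1` U : set P) (fun p => complex.Re (f (of_plane p))) /\
  measurable_fun (@of_plane R @^-1` U : set P) (fun p => complex.Im (f (of_plane p))).
Proof.
move=> oU cf; split.
  apply: (@continuous_measurable_plane U (fun z => complex.Re (f z))) => // z Uz.
  by apply: (@continuous_comp _ _ _ f (fun z => complex.Re z)); [exact: cf|exact: continuous_Re].
apply: (@continuous_measurable_plane U (fun z => complex.Im (f z))) => // z Uz.
by apply: (@continuous_comp _ _ _ f (fun z => complex.Im z)); [exact: cf|exact: continuous_Im].
Qed.

Lemma rhoE (z : C) : rho z = 4 / (1 - sqn z) ^+ 2.
Proof. by rewrite /rho normc_sqn. Qed.

Lemma rho_ge0 (z : C) : 0 <= rho z.
Proof. by rewrite rhoE divr_ge0// sqr_ge0. Qed.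

Lemma rho_gt0 (z : C) : disc z -> 0 < rho z.
Proof.
by move=> /disc_sqn h; rewrite rhoE divr_gt0// exprn_gt0// subr_gt0.
Qed.

Lemma measurable_rho : measurable_fun setT (fun p : P => rho (of_plane p)).
Proof.
under eq_fun do rewrite rhoE.
apply: measurable_funM => //; apply: (measurableT_comp measurable_inv).
apply: measurable_funX; apply: measurable_funB => //.
exact: (measurable_csqn cmeasurable_id).
Qed.

Definition hint (S : set C) (f : C -> \bar R) : \bar R :=
  (\int[@area R]_(p in @of_plane R @^-1` S) (f (of_plane p) * (rho (of_plane p))%:E))%E.

Definition pmeasurable (S : set C) (f : C -> \bar R) : Prop :=
  measurable_fun (@of_plane R @^-1` S : set P) (fun p => f (of_plane p)).

Lemma mobius_nodisc A (z : C) : SU11 A -> den A z != 0 -> ~ disc z -> ~ disc (mobius A z).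
Proof.
move=> sA d0 zd /disc_sqn; rewrite /mobius -/(den A z) -/(num A z) sqnM sqnV.
have dp : 0 < sqn (den A z) by rewrite lt0r sqn_eq0 d0 sqn_ge0.
rewrite ltr_pdivrMr// mul1r -subr_gt0 sqn_den// subr_gt0 => h.
by apply: zd; apply/disc_sqn.
Qed.

(** The Jacobian |den|^-4 cancels the factor by which rho(A z) exceeds rho(z). *)
Lemma hint_mobius A (S : set C) (f : C -> \bar R) : SU11 A ->
  measurable (@of_plane R @^-1` S : set P) -> S `<=` @disc R ->
  pmeasurable S f -> (forall z, S z -> (0 <= f z)%E) ->
  hint [set z | disc z /\ S (mobius A z)] (fun z => f (mobius A z)) = hint S f.
Proof.
move=> sA mS Sd mf f0.
have [mA mJ J0 H] := changeC_mobius sA.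
pose F (p : P) : \bar R := ((fun p => f (of_plane p) * (rho (of_plane p))%:E)%E \_ (@of_plane R @^-1` S)) p.
have mF : measurable_fun setT F.
  apply/(measurable_restrictT _ mS)/emeasurable_funM => //.
  by apply/measurable_EFinP/measurable_funTS; exact: measurable_rho.
have F0 p : (0 <= F p)%E.
  rewrite /F patchE; case: ifPn => // /[!inE] Sp.
  by rewrite mule_ge0 ?f0// lee_fin rho_ge0.
rewrite /hint [RHS]integral_mkcond [LHS]integral_mkcond -(H F)//; apply: eq_integral => p _.
rewrite /F !patchE; set z := of_plane p; rewrite of_planeK.
(* At the pole the Jacobian has the default value 0, in agreement with the left-hand side: the pole
   lies outside the disc. *)
have [d0|d0] := eqVneq (den A z) 0.
  have -> : sqn (den A z) = 0 by apply/eqP; rewrite sqn_eq0 d0.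
  rewrite expr0n /= invr0 mule0.
  case: ifPn => // /[!inE] -[/= zd _].
  by have := den_neq0 sA zd; rewrite d0 eqxx.
have [[zd Sz]|nz] := pselect (disc z /\ S (mobius A z)); last first.
  rewrite memNset//; case: ifPn => [/[!inE] /=|]; last by rewrite mul0e.
  rewrite of_planeK => h.
  exfalso; apply: nz; split => //; apply: contrapT => zd.
  by apply: (mobius_nodisc sA d0 zd); exact: Sd.
rewrite !mem_set//=; last by rewrite of_planeK.
rewrite -muleA -EFinM; congr (_ * _%:E)%E.
rewrite !rhoE mobius_sqn//; field.
have h1 := lt0r_neq0 (sqn_den_gt0 sA zd).
by rewrite h1 /= gt_eqF// subr_gt0; apply/disc_sqn.
Qed.

End PlaneMeasure.

Section PlaneArea.
Variable R : realType.
Local Notation leb := (@lebesgue_measure R).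
Local Notation PM := (measurableTypeR R * measurableTypeR R)%type.

(** The measure [area] under a name of its own, to carry the sigma-finite structure that Tonelli
    requires on pairs of points of the plane. *)
Definition plane_area : set PM -> \bar R := (leb \x leb)%E.

HB.instance Definition _ := Measure.on plane_area.

Let plane_area_sigma_finite : sigma_finite setT plane_area.
Proof.
have /sigma_finiteP[F [TF ndF Foo]] := sigma_finiteT leb.
exists (fun n => F n `*` F n).
  rewrite -setXTT TF predeqE => -[x y]; split.
    move=> [/= [n _ Fnx] [k _ Gky]]; exists (maxn n k) => //; split.
    - by move: x Fnx; exact/subsetPset/ndF/leq_maxl.
    - by move: y Gky; exact/subsetPset/ndF/leq_maxr.
  by move=> [n _ []/= ? ?]; split; exists n.
move=> k; have [? ?] := Foo k.
split; first exact: measurableX.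
by rewrite /plane_area product_measure1E// lte_mul_pinfty// ge0_fin_numE.
Qed.

HB.instance Definition _ := Measure_isSigmaFinite.Build _ _ _ plane_area plane_area_sigma_finite.

Local Notation P := (R * R)%type.
Variable f : P * P -> \bar R.
Hypotheses (mf : measurable_fun setT f) (f0 : forall x, (0 <= f x)%E).

Lemma measurable_area1 : measurable_fun setT (fun p : P => \int[@area R]_q f (p, q))%E.
Proof. exact: (@measurable_fun_fubini_tonelli_F _ _ _ _ R plane_area f mf f0). Qed.

Lemma measurable_area2 : measurable_fun setT (fun q : P => \int[@area R]_p f (p, q))%E.
Proof. exact: (@measurable_fun_fubini_tonelli_G _ _ _ _ R plane_area f mf f0). Qed.

Lemma tonelli_area :
  (\int[@area R]_p \int[@area R]_q f (p, q) = \int[@area R]_q \int[@area R]_p f (p, q))%E.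
Proof. exact: (@fubini_tonelli _ _ _ _ R plane_area plane_area f mf f0). Qed.

End PlaneArea.

(** * Bounds on compact sets and pointwise continuity *)

Section CompactBounds.
Context {R : realType}.
Local Notation C := R[i].

(** The inverse of g is continuous, hence bounded, on K. A positive lower bound is asked for instead
    of an attained minimum, so that K may be empty. *)
Lemma compact_pos_min (K : set C) (g : C -> R) : compact K ->
  (forall z, K z -> {for z, continuous g}) -> (forall z, K z -> 0 < g z) ->
  exists2 c : R, 0 < c & forall z, K z -> c <= g z.
Proof.
move=> cK cg g0.
have ck : {within K, continuous (fun z => (g z)^-1)}.
  apply: continuous_in_subspaceT => z /[!inE] Kz.
  apply: (@continuous_comp _ _ _ g (fun x : R => x^-1)); first exact: cg.
  by apply: inv_continuous; rewrite gt_eqF// g0.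
have [M [Mr HM]] := compact_bounded (continuous_compact ck cK).
pose N := Num.max (M + 1) 1.
have N0 : 0 < N by rewrite lt_max ltr01 orbT.
exists N^-1; first by rewrite invr_gt0.
move=> z Kz; rewrite -[g z]invrK lef_pV2 ?posrE ?invr_gt0 ?g0//.
have := HM N; rewrite lt_max ltrDl ltr01 => /(_ isT (g z)^-1) /=.
by rewrite gtr0_norm ?invr_gt0 ?g0//; apply; exists z.
Qed.

Lemma continuous_normc (z : C) : {for z, continuous (@normc R)}.
Proof.
move=> U /nbhs_ballP[e /= e0 H]; apply/nbhs_normc; exists e => // w h.
apply: H; rewrite /ball /= ltr_norml.
have h1 := le_normcD (w - z) z; have h2 := le_normcD (z - w) w.
rewrite !subrK in h1 h2; rewrite -opprB normcN in h2.
by move: h h1 h2 => /= h h1 h2; apply/andP; split; lra.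
Qed.

Lemma compact_disc_radius (K : set C) : compact K -> K `<=` @disc R ->
  exists2 k : R, 0 <= k < 1 & forall z, K z -> normc z <= k.
Proof.
move=> cK Kd.
have [c c0 H] : exists2 c : R, 0 < c & forall z, K z -> c <= 1 - normc z.
  apply: compact_pos_min => // [z _|z /Kd]; last by rewrite subr_gt0.
  apply: (@continuous_comp _ _ _ (@normc R) (fun x : R => 1 - x)).
    exact: continuous_normc.
  by apply: continuousB; [exact: cvg_cst|exact: cvg_id].
exists (1 - Num.min c 1).
  by apply/andP; split; rewrite ?subr_ge0 ?ge_min ?lexx ?orbT// ltrBlDr ltrDl lt_min c0 ltr01.
move=> z /H; rewrite lerBrDr addrC -lerBrDr => /le_trans; apply.
by rewrite lerD2l lerN2 ge_min lexx.
Qed.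

Lemma continuous_sqn (z : C) : {for z, continuous (@sqn R)}.
Proof.
have -> : @sqn R = (fun z => normc z ^+ 2) by apply/funext => x; rewrite normc_sqn.
apply: (@continuous_comp _ _ _ (@normc R) (fun x => x ^+ 2)); first exact: continuous_normc.
exact: exprn_continuous.
Qed.

Section PointwiseContinuity.
Variables (T : topologicalType) (z : T).
Implicit Types (f g : T -> C) (u v : T -> R).

Lemma ccont_cst (c : C) : {for z, continuous (fun _ : T => c)}.
Proof. exact: cvg_cst. Qed.

Lemma ccontD f g : {for z, continuous f} -> {for z, continuous g} ->
  {for z, continuous (fun w => f w + g w)}.
Proof. by move=> hf hg; exact: (continuousD hf hg). Qed.

Lemma ccontB f g : {for z, continuous f} -> {for z, continuous g} ->
  {for z, continuous (fun w => f w - g w)}.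
Proof. by move=> hf hg; exact: (continuousB hf hg). Qed.

Lemma ccontM f g : {for z, continuous f} -> {for z, continuous g} ->
  {for z, continuous (fun w => f w * g w)}.
Proof. by move=> hf hg; exact: (continuousM hf hg). Qed.

Lemma rcont_cst (c : R) : {for z, continuous (fun _ : T => c)}.
Proof. exact: cvg_cst. Qed.

Lemma rcontD u v : {for z, continuous u} -> {for z, continuous v} ->
  {for z, continuous (fun w => u w + v w)}.
Proof. by move=> hf hg; exact: (continuousD hf hg). Qed.

Lemma rcontB u v : {for z, continuous u} -> {for z, continuous v} ->
  {for z, continuous (fun w => u w - v w)}.
Proof. by move=> hf hg; exact: (continuousB hf hg). Qed.

Lemma rcontM u v : {for z, continuous u} -> {for z, continuous v} ->
  {for z, continuous (fun w => u w * v w)}.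
Proof. by move=> hf hg; exact: (continuousM hf hg). Qed.

Lemma rcontV u : u z != 0 -> {for z, continuous u} ->
  {for z, continuous (fun w => (u w)^-1)}.
Proof.
move=> u0 hu; apply: (@continuous_comp _ _ _ u (fun x : R => x^-1)) => //.
exact: inv_continuous.
Qed.

Lemma rcont_sqn f : {for z, continuous f} -> {for z, continuous (fun w => sqn (f w))}.
Proof.
by move=> hf; apply: (@continuous_comp _ _ _ f (@sqn R)) => //; exact: continuous_sqn.
Qed.

End PointwiseContinuity.

Lemma ccont_id (z : C) : {for z, continuous (fun w : C => w)}.
Proof. exact: cvg_id. Qed.

End CompactBounds.

(** * Proper discontinuity, displacement, and unfolding *)

Section Discrete.
Context {R : realType}.
Local Notation C := R[i].
Variable Gamma : set 'M[C]_2.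
Hypothesis GammaS : surface_group Gamma.
Implicit Types (A B : 'M[C]_2) (z w : C).

Lemma Gamma_SU A : Gamma A -> SU11 A.
Proof. exact: surface_group_sub. Qed.

Lemma GammaM A B : Gamma A -> Gamma B -> Gamma (A * B).
Proof. exact: surface_group_mul. Qed.

Lemma GammaV A : Gamma A -> Gamma A^-1.
Proof. exact: surface_group_inv. Qed.

Lemma Gamma1 : Gamma 1.
Proof.
have := GammaM (surface_group_N1 GammaS) (surface_group_N1 GammaS).
by rewrite mulrNN mulr1.
Qed.

Lemma GammaN A : Gamma A -> Gamma (- A).
Proof. by move=> GA; rewrite -mulN1r; apply: GammaM => //; exact: surface_group_N1. Qed.

Lemma GammaX A n : Gamma A -> Gamma (A ^+ n).
Proof.
by move=> GA; elim: n => [|n IH]; [rewrite expr0; exact: Gamma1|rewrite exprS; exact: GammaM].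
Qed.

Lemma finite_set_inj (T : pointedType) (U : choiceType) (S : set T) (f : T -> U) :
  {in S &, injective f} -> finite_set (f @` S) -> finite_set S.
Proof.
move=> fi fin.
apply: (sub_finite_set _ (finite_image (fun y => xget point [set x | S x /\ f x = y]) fin)).
move=> x Sx; exists (f x); first by exists x.
have [Sy fy] : [set y | S y /\ f y = f x] (xget point [set y | S y /\ f y = f x]).
  by apply: (@xgetPex _ point); exists x.
by apply: fi; rewrite ?inE.
Qed.

Lemma mx2_entry_bound A (M : R) : SU11 A -> sqn (A 0 0) <= M -> forall i j, sqn (A i j) <= M.
Proof.
move=> sA h i j; have [a1 a2 _] := sA; have := SU11_sqn sA => s.
have h2 : sqn (A 0 1) <= M by lra.
have two (k : 'I_2) : k = 0 \/ k = 1.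
  by case: k => [[|[|//]] ?]; [left|right]; apply/val_inj.
by case: (two i) => ->; case: (two j) => -> //; rewrite ?a1 ?a2 sqnJ.
Qed.

(** Pigeonhole: the entries are sorted into finitely many small cells. If A and B fall into the same
    cells, then B^-1 A is so close to 1 that discreteness forces A = B. *)
Lemma finite_Gamma_bounded (M : R) :
  finite_set [set A | Gamma A /\ sqn (A 0 0) <= M].
Proof.
have [e e0 He] := surface_group_discrete GammaS.
pose N := Num.max M 1.
have N1 : 1 <= N by rewrite le_max lexx orbT.
(* Cells have side 1 / k. Entries in common cells differ by at most 2 k^-2 in squared modulus;
   multiplied by an entry of B^-1, of squared modulus at most N, the difference has modulus at most
   e / 4, and two such terms are added. *)
pose k := 8 * N / e.
have k0 : 0 < k by rewrite divr_gt0// mulr_gt0//; lra.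
pose L := Num.trunc (2 * N * k).
pose fl (x : R) : 'I_L.+1 := inord (Num.trunc ((x + N) * k)).
pose f A := (fl (complex.Re (A 0 0)), fl (complex.Im (A 0 0)),
             fl (complex.Re (A 0 1)), fl (complex.Im (A 0 1))).
have flI (x y : R) : x ^+ 2 <= N -> y ^+ 2 <= N -> fl x = fl y -> `|x - y| < k^-1.
  move=> hx hy.
  have bd (t : R) : t ^+ 2 <= N -> 0 <= (t + N) * k <= 2 * N * k.
    move=> ht; have tN : t ^+ 2 <= N ^+ 2 by rewrite (le_trans ht)// expr2 ler_peMl//; lra.
    have : `|t| <= N by rewrite -(ler_pXn2r (_ : (0 < 2)%N))// ?nnegrE ?real_normK ?num_real//; lra.
    rewrite ler_norml => /andP[t1 t2].
    by apply/andP; split; [rewrite mulr_ge0//; lra|rewrite ler_wpM2r//; lra].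
  have tr (t : R) : t ^+ 2 <= N -> (Num.trunc ((t + N) * k) < L.+1)%N.
    move=> ht; rewrite ltnS; apply: le_truncn; exact: (andP (bd _ ht)).2.
  move=> /(congr1 val); rewrite /= !inordK ?tr// => E.
  have /truncn_itv := (andP (bd _ hx)).1; have /truncn_itv := (andP (bd _ hy)).1.
  rewrite E -!natr1 => /andP[h1 h2] /andP[h3 h4].
  rewrite -(ltr_pM2r k0) mulVf ?gt_eqF//.
  have -> : `|x - y| * k = `|(x + N) * k - (y + N) * k|.
    by rewrite -mulrBl normrM (gtr0_norm k0); congr (`|_| * _); ring.
  by rewrite ltr_norml; apply/andP; split; lra.
apply: (@finite_set_inj _ _ _ f); last by apply: (@sub_finite_set _ _ setT) => //; exact: finite_finset.
move=> A B /[!inE] -[GA hA] [GB hB] [] E1 E2 E3 E4.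
have sA := Gamma_SU GA; have sB := Gamma_SU GB.
have bA i j : sqn (A i j) <= N by apply: (mx2_entry_bound sA); rewrite (le_trans hA)// le_max lexx.
have bB i j : sqn (B i j) <= N by apply: (mx2_entry_bound sB); rewrite (le_trans hB)// le_max lexx.
have rN (z : C) : sqn z <= N -> complex.Re z ^+ 2 <= N /\ complex.Im z ^+ 2 <= N.
  rewrite /sqn => h; have := sqr_ge0 (complex.Re z); have := sqr_ge0 (complex.Im z); split; lra.
have close (z w : C) : sqn z <= N -> sqn w <= N -> fl (complex.Re z) = fl (complex.Re w) ->
   fl (complex.Im z) = fl (complex.Im w) -> sqn (z - w) <= 2 * k ^- 2.
  move=> /rN[r1 i1] /rN[r2 i2] /flI h1 /flI h2.
  have {}h1 := h1 r1 r2; have {}h2 := h2 i1 i2.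
  have q (t : R) : `|t| < k^-1 -> t ^+ 2 <= k ^- 2.
    move=> ht; rewrite -exprVn -[t ^+ 2]real_normK ?num_real//.
    by rewrite ler_pXn2r ?nnegrE ?normr_ge0 ?invr_ge0 ?(ltW k0) ?(ltW ht).
  have := q _ h1; have := q _ h2; move: h1 h2 => _ _.
  by case: z {r1 i1} => a b; case: w {r2 i2} => c d; rewrite /sqn /=; lra.
have c00 : sqn (A 0 0 - B 0 0) <= 2 * k ^- 2 by exact: close.
have c01 : sqn (A 0 1 - B 0 1) <= 2 * k ^- 2 by exact: close.
have [a1 a2 _] := sA; have [b1 b2 _] := sB.
have cc i j : sqn (A i j - B i j) <= 2 * k ^- 2.
  have two (l : 'I_2) : l = 0 \/ l = 1.
    by case: l => [[|[|//]] ?]; [left|right]; apply/val_inj.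
  by case: (two i) => ->; case: (two j) => -> //; rewrite ?a1 ?a2 ?b1 ?b2 -rmorphB sqnJ.
have : B^-1 * A = 1.
  apply: He; first by apply: GammaM => //; exact: GammaV.
  move=> i j; have -> : (B^-1 * A) i j - (1 : 'M[C]_2) i j =
      B^-1 i 0 * (A 0 j - B 0 j) + B^-1 i 1 * (A 1 j - B 1 j).
    by rewrite -(SU11_mulV sB) !mulmx2E; ring.
  have bV i' j' : sqn (B^-1 i' j') <= N.
    apply: mx2_entry_bound; first exact: SU11V.
    by rewrite SU11_invE//; have [-> _ _ _] := su_mxE (B 0 0)^*%C (- B 0 1); rewrite sqnJ.
  have pr (z w : C) : sqn z <= N -> sqn w <= 2 * k ^- 2 -> normc (z * w) <= e / 4.
    move=> hz hw; rewrite -(ler_pXn2r (_ : (0 < 2)%N))// ?nnegrE ?normc_ge0 ?divr_ge0 ?(ltW e0)//.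
    rewrite normc_sqn sqnM.
    apply: le_trans (_ : N * (2 * k ^- 2) <= _).
      by apply: ler_pM; rewrite ?sqn_ge0.
    rewrite /k.
    have -> : N * (2 * (8 * N / e) ^- 2) = (e ^+ 2 / 32) * N^-1.
      by field; rewrite !gt_eqF//; lra.
    have NV : N^-1 <= 1 by rewrite invf_le1//; lra.
    have := ler_wpM2l (_ : 0 <= e ^+ 2 / 32) NV; rewrite divr_ge0 ?exprn_ge0 ?(ltW e0)// => /(_ isT).
    rewrite mulr1 => /le_trans; apply; rewrite exprMn exprVn.
    by have := exprn_ge0 2 (ltW e0); lra.
  have := le_normcD (B^-1 i 0 * (A 0 j - B 0 j)) (B^-1 i 1 * (A 1 j - B 1 j)).
  have := pr _ _ (bV i 0) (cc 0 j); have := pr _ _ (bV i 1) (cc 1 j) => /= h1 h2 h3.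
  lra.
by move=> h; rewrite -[A]mul1r -(SU11_mulr sB) -mulrA h mulr1.
Qed.

(** Since |b| <= |a|, the denominator satisfies |den| >= |a| - |b| |z| >= |a| (1 - |z|). An image
    point that stays away from the circle thus bounds the matrix. *)
Lemma SU11_entry_le A z : SU11 A -> disc z ->
  sqn (A 0 0) * (1 - normc z) ^+ 2 * (1 - sqn (mobius A z)) <= 1 - sqn z.
Proof.
move=> sA zd; rewrite mobius_sqn//.
have dp := sqn_den_gt0 sA zd.
have z1 : 0 < 1 - sqn z by rewrite subr_gt0; apply/disc_sqn.
have z2 : 0 < 1 - normc z by rewrite subr_gt0.
rewrite mulrA ler_pdivrMr// mulrC ler_wpM2l// ?(ltW z1)//.
rewrite -!normc_sqn -exprMn ler_pXn2r ?nnegrE ?normc_ge0 ?mulr_ge0 ?normc_ge0 ?(ltW z2)//.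
have [a1 a2 _] := sA.
have h1 := le_normcD (den A z) (- (A 1 0 * z)).
have e1 : den A z + - (A 1 0 * z) = (A 0 0)^*%C by rewrite /den a2; ring.
have nJ (t : C) : normc t^*%C = normc t by case: t => x y /=; rewrite sqrrN.
rewrite e1 normcN normcM a1 !nJ in h1.
have h2 : normc (A 0 1) <= normc (A 0 0).
  rewrite -(ler_pXn2r (_ : (0 < 2)%N))// ?nnegrE ?normc_ge0// !normc_sqn.
  by have := SU11_sqn sA; lra.
have := ler_wpM2r (normc_ge0 z) h2; lra.
Qed.

Lemma proper_discontinuity (k l : R) : 0 <= k < 1 -> 0 < l ->
  finite_set [set A | Gamma A /\ exists2 z, normc z <= k & l <= 1 - sqn (mobius A z)].
Proof.
move=> /andP[k0 k1] l0.
apply: (sub_finite_set _ (finite_Gamma_bounded (((1 - k) ^+ 2 * l)^-1))).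
move=> A [GA [z zk hl]]; split => //.
have zd : disc z by rewrite /disc /=; exact: le_lt_trans k1.
have := SU11_entry_le (Gamma_SU GA) zd.
have kk : 0 < (1 - k) ^+ 2 by rewrite exprn_gt0// subr_gt0.
have kl : 0 < (1 - k) ^+ 2 * l by rewrite mulr_gt0.
move=> h; rewrite -[_^-1]mul1r ler_pdivlMr//.
apply: (@le_trans _ _ (1 - sqn z)); last by have := sqn_ge0 z; lra.
apply: le_trans h; rewrite -mulrA ler_wpM2l ?sqn_ge0//.
apply: ler_pM => //; rewrite ?exprn_ge0 ?(ltW l0) ?subr_ge0 ?(ltW k1)//.
rewrite ler_pXn2r ?nnegrE ?subr_ge0 ?(ltW k1)//; last exact: ltW.
by rewrite lerD2l lerN2.
Qed.

Lemma mobius_fixX A z n : SU11 A -> disc z -> mobius A z = z -> mobius (A ^+ n) z = z.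
Proof.
move=> sA zd fz; elim: n => [|n IH]; first by rewrite expr0 mobius1.
rewrite exprS mobiusM ?IH//.
elim: n {IH} => [|n IH]; first by rewrite expr0; exact: SU11_1.
by rewrite exprS; exact: SU11M.
Qed.

(** All powers of A fix z, so they form a finite set by proper discontinuity; two of them coincide,
    and torsion-freeness applies to the quotient of these two. *)
Lemma Gamma_free A z : Gamma A -> disc z -> mobius A z = z -> A = 1 \/ A = - 1.
Proof.
move=> GA zd fz; have sA := Gamma_SU GA.
have fin : finite_set (range (fun n => A ^+ n)).
  have z1 : 0 < 1 - sqn z by rewrite subr_gt0; apply/disc_sqn.
  apply: (sub_finite_set _ (@proper_discontinuity (normc z) (1 - sqn z) _ z1)); last first.
    by rewrite normc_ge0.
  move=> _ [n _ <-]; split; first exact: GammaX.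
  by exists z => //; rewrite mobius_fixX.
have [n [m [nm E]]] : exists n m, (n < m)%N /\ A ^+ n = A ^+ m.
  apply: contrapT => H; apply: infinite_nat.
  have inj : {in [set: nat] &, injective (fun n => A ^+ n)}.
    move=> n m _ _ /= E; apply: contrapT => /eqP; rewrite neq_ltn => /orP[h|h]; apply: H.
      by exists n, m.
    by exists m, n.
  exact: (@finite_set_inj _ _ _ _ inj fin).
have X : A ^+ (m - n) = 1.
  have u : A ^+ n \is a GRing.unit by apply: SU11_unit; exact: Gamma_SU (GammaX n GA).
  by apply: (mulrI u); rewrite -exprD subnKC ?mulr1 ?(ltnW nm).
by apply: (surface_group_torsion_free GammaS GA (n := (m - n)%N)); rewrite ?subn_gt0//; left.
Qed.



Lemma mobius_pm A B z : SU11 A -> SU11 B -> disc z -> mobius A z = mobius B z ->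
  Gamma A -> Gamma B -> A = B \/ A = - B.
Proof.
move=> sA sB zd E GA GB.
have [] := @Gamma_free (B^-1 * A) z _ zd _.
- by apply: GammaM => //; exact: GammaV.
- by rewrite mobiusM ?E ?mobiusK//; exact: SU11V.
- move=> h; left; by rewrite -[A]mul1r -(SU11_mulr sB) -mulrA h mulr1.
- move=> h; right; by rewrite -[A]mul1r -(SU11_mulr sB) -mulrA h mulrN1.
Qed.

Lemma sigma_gt0 (z w : C) : disc z -> disc w -> z != w -> 0 < sigma z w.
Proof.
move=> /disc_sqn zd /disc_sqn wd zw; rewrite divr_gt0 ?mulr_gt0 ?subr_gt0//.
by rewrite lt0r sqn_ge0 sqn_eq0 subr_eq0 zw.
Qed.

Lemma continuous_sigma_mobius A z : SU11 A -> disc z ->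
  {for z, continuous (fun z => sigma z (mobius A z))}.
Proof.
move=> sA zd.
have cm : {for z, continuous (mobius A)}.
  by apply: cderive_continuous; have [] := is_derive_mobius sA zd.
have mzd := mobius_disc sA zd.
have c1 : {for z, continuous (fun w : C => sqn (w - mobius A w))}.
  exact: rcont_sqn (ccontB (@ccont_id _ z) cm).
have c2 : {for z, continuous (fun w : C => (1 - sqn w) * (1 - sqn (mobius A w)))}.
  apply: rcontM; apply: rcontB; [exact: rcont_cst|exact: rcont_sqn (@ccont_id _ z)|
    exact: rcont_cst|exact: rcont_sqn cm].
apply: rcontM c1 (rcontV _ c2).
by rewrite mulf_neq0// gt_eqF// subr_gt0; exact/disc_sqn.
Qed.

Lemma sigma_bounded_disc (k s : R) : 0 <= k < 1 -> 0 < s ->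
  exists2 l : R, 0 < l & forall z w, normc z <= k -> disc w -> sigma z w <= s ->
    l <= 1 - sqn w.
Proof.
move=> /andP[k0 k1] s0.
(* If |w| <= (1 + k) / 2, then 1 - |w|^2 >= 1 - |w| gives the second entry. Otherwise |z - w| >= (1
   - k) / 2, and sigma z w <= s gives the first. *)
pose m := Num.min (((1 - k) / 2) ^+ 2 / s) ((1 - k) / 2).
have k2 : 0 < (1 - k) / 2 by lra.
exists m; first by rewrite lt_min k2 divr_gt0 ?exprn_gt0.
move=> z w zk wd szw; have [h|h] := leP (normc w) ((1 + k) / 2).
  rewrite ge_min; apply/orP; right; rewrite -normc_sqn.
  have : normc w ^+ 2 <= normc w by rewrite expr2 ler_piMl ?normc_ge0//; lra.
  lra.
rewrite ge_min; apply/orP; left; rewrite ler_pdivrMr// [_ * s]mulrC.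
have z1 : normc z < 1 by lra.
have w1 : 0 < 1 - sqn w by rewrite subr_gt0; exact/disc_sqn.
have z2 : 0 < 1 - sqn z by rewrite subr_gt0; exact/disc_sqn.
move: szw; rewrite ler_pdivrMr ?mulr_gt0// => szw.
have h1 := le_normcD (w - z) z; rewrite subrK /= in h1.
have h2 : (1 - k) / 2 <= normc (z - w) by rewrite -normcN opprB; lra.
apply: (@le_trans _ _ (sqn (z - w))).
  by rewrite -normc_sqn ler_pXn2r ?nnegrE ?normc_ge0 ?(ltW k2).
apply: (le_trans szw); rewrite ler_wpM2l ?(ltW s0)//.
rewrite ler_piMl ?(ltW w1)//; have := sqn_ge0 z; lra.
Qed.

Lemma cocompact_radius : exists2 k : R, 0 <= k < 1 &
  forall z, disc z -> exists2 A, Gamma A & normc (mobius A z) <= k.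
Proof.
have [K [cK Kd HK]] := surface_group_cocompact GammaS.
have [k k01 Hk] := compact_disc_radius cK Kd.
by exists k => // z /HK[A GA KA]; exists A => //; exact: Hk.
Qed.

(** Conjugation moves z into the compact set K. There only finitely many elements of Gamma have
    displacement at most 1, and each nontrivial one has a positive lower bound on K because it has
    no fixed point. *)
Lemma displacement : exists2 c : R, 0 < c & forall A z, Gamma A -> A <> 1 -> A <> - 1 ->
  disc z -> c <= sigma z (mobius A z).
Proof.
have [K [cK Kd HK]] := surface_group_cocompact GammaS.
have [k k01 Hk] := compact_disc_radius cK Kd.
have [l l0 Hl] := sigma_bounded_disc k01 (@ltr01 R).
have /finite_seqP[s Es] := proper_discontinuity k01 l0.
have [c c0 Hc] : exists2 c : R, 0 < c & forall A z, A \in s -> Gamma A -> A <> 1 -> A <> - 1 ->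
    K z -> c <= sigma z (mobius A z).
  elim: s {Es} => [|B s [c c0 IH]]; first by exists 1.
  have [d d0 Hd] : exists2 d : R, 0 < d & forall z, Gamma B -> B <> 1 -> B <> - 1 ->
      K z -> d <= sigma z (mobius B z).
    have [[GB B1 BN1]|nB] := pselect [/\ Gamma B, B <> 1 & B <> - 1]; last first.
      by exists 1 => // z GB B1 BN1; exfalso; exact: nB.
    have [d d0 Hd] : exists2 d : R, 0 < d & forall z, K z -> d <= sigma z (mobius B z).
      apply: compact_pos_min => // z /Kd zd.
        by apply: continuous_sigma_mobius => //; exact: Gamma_SU.
      apply: sigma_gt0 => //; first by apply: mobius_disc => //; exact: Gamma_SU.
      by apply/eqP => E; have [] := Gamma_free GB zd (esym E).
    by exists d => // z _ _ _; exact: Hd.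
  exists (Num.min c d); first by rewrite lt_min c0 d0.
  move=> A z; rewrite inE => /orP[/eqP ->|As] GA A1 AN1 Kz.
    by rewrite ge_min Hd ?orbT.
  by rewrite ge_min IH.
exists (Num.min c 1); first by rewrite lt_min c0 ltr01.
move=> A z GA A1 AN1 zd.
have [B GB KB] := HK z zd.
have sA := Gamma_SU GA; have sB := Gamma_SU GB.
have sBV := SU11V sB.
have bzd := mobius_disc sB zd; have azd := mobius_disc sA zd.
have -> : sigma z (mobius A z) = sigma (mobius B z) (mobius (B * A * B^-1) (mobius B z)).
  rewrite mobiusM//; last exact: SU11M.
  by rewrite mobiusK// mobiusM// sigma_mobius.
set A' := B * A * B^-1; set w := mobius B z in KB bzd *.
have AE : B^-1 * A' * B = A.
  by rewrite /A' !mulrA SU11_mulV// mul1r -mulrA SU11_mulV// mulr1.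
have GA' : Gamma A' by apply: GammaM; [exact: GammaM|exact: GammaV].
have A'1 : A' <> 1 by move=> h; apply: A1; rewrite -AE h mulr1 SU11_mulV.
have A'N1 : A' <> - 1 by move=> h; apply: AN1; rewrite -AE h mulrN1 mulNr SU11_mulV.
have [h|h] := leP (sigma w (mobius A' w)) 1; last by rewrite ge_min (ltW h) orbT.
rewrite ge_min Hc// ?inE//.
have : [set` s] A'.
  rewrite -Es; split => //; exists w; first exact: Hk.
  by apply: (Hl w) => //; [exact: Hk|apply: mobius_disc => //; exact: Gamma_SU].
by [].
Qed.

(** Representatives of Gamma / {1, -1}: Moebius maps do not see the sign, so each pair {A, -A} must
    be counted once. The predicate [p] marks the indices that count; the values at the others are
    fillers. *)
Definition enumerates (a : nat -> 'M[C]_2) (p : nat -> bool) : Prop :=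
  [/\ forall n, Gamma (a n),
      forall A, Gamma A -> exists2 n, p n & A = a n \/ A = - a n &
      forall n m, p n -> p m -> a n = a m \/ a n = - a m -> n = m].

Lemma countable_Gamma : countable Gamma.
Proof.
have -> : Gamma = \bigcup_(n in [set: nat]) [set A | Gamma A /\ sqn (A 0 0) <= n%:R].
  apply/seteqP; split => [A GA|A [n _ [//]]].
  exists (Num.trunc (sqn (A 0 0))).+1 => //; split => //.
  by have /truncn_itv/andP[_ /ltW] := sqn_ge0 (A 0 0).
apply: bigcup_countable => // n _; apply: finite_set_countable.
exact: finite_Gamma_bounded.
Qed.

(** An injection into the naturals codes the group; of A and -A, the one with the smaller code is
    kept. *)
Lemma enumerates_ex : exists a p, enumerates a p.
Proof.
have /countable_injP[f fi] := countable_Gamma.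
pose a n := xget 1 [set A | Gamma A /\ f A = n].
have af A : Gamma A -> a (f A) = A.
  move=> GA; have [Gy fy] : [set B | Gamma B /\ f B = f A] (a (f A)).
    by apply: (@xgetPex _ 1); exists A.
  by apply: fi; rewrite ?inE.
have Ga n : Gamma (a n).
  by rewrite /a; case: xgetP => [A _ []//|_]; exact: Gamma1.
exists a, (fun n => (f (a n) == n) && (f (a n) <= f (- a n))%N); split => //.
- move=> A GA; have [h|h] := leqP (f A) (f (- A)).
    by exists (f A); [rewrite af// eqxx|left; rewrite af].
  have GN := GammaN GA.
  by exists (f (- A)); [rewrite af// eqxx opprK ltnW|right; rewrite af// opprK].
- move=> n m /andP[/eqP hn ln] /andP[/eqP hm lm] [E|E].
    by rewrite -hn -hm E.
  have E' : a m = - a n by rewrite E opprK.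
  have ff : f (a n) = f (a m).
    apply/eqP; rewrite eqn_leq; apply/andP; split.
      by rewrite (leq_trans ln)// -E'.
    by rewrite (leq_trans lm)// -E.
  by rewrite -hn ff.
Qed.

Lemma oppmxV A : SU11 A -> (- A)^-1 = - A^-1.
Proof.
move=> sA; have u : - A \is a GRing.unit by rewrite unitrN SU11_unit.
by apply: (mulrI u); rewrite mulrV// mulrNN SU11_mulr.
Qed.

Lemma enumeratesV a p : enumerates a p -> enumerates (fun n => (a n)^-1) p.
Proof.
case=> Ga surj inj; split.
- by move=> n; exact: GammaV.
- move=> A GA; have [n pn [h|h]] := surj _ (GammaV GA); exists n => //.
    by left; rewrite -h invrK.
  right; rewrite -[A]invrK h oppmxV//; exact: Gamma_SU.
- move=> n m pn pm [h|h]; apply: inj => //.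
    by left; rewrite -[a n]invrK h invrK.
  right; rewrite -[a n]invrK h oppmxV ?invrK//; first exact/SU11V/Gamma_SU.
Qed.

Variable F : set C.
Hypothesis F_fund : fundamental_set Gamma F.
Local Notation P := (R * R)%type.

Lemma fund_disc : F `<=` @disc R. Proof. by case: F_fund. Qed.

Lemma fund_measurable : measurable (@of_plane R @^-1` F : set P).
Proof. by case: F_fund. Qed.

Lemma fund_ex z : disc z -> exists2 A, Gamma A & F (mobius A z).
Proof.
case: F_fund => _ _ H /H[w [[Fw [A GA wE]] _]].
by exists A => //; rewrite -wE.
Qed.

Lemma fund_uniq z A B : disc z -> Gamma A -> Gamma B ->
  F (mobius A z) -> F (mobius B z) -> mobius A z = mobius B z.
Proof.
case: F_fund => _ _ H zd GA GB FA FB; have [w [_ U]] := H z zd.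
by rewrite -(U (mobius A z)) ?(U (mobius B z)) //; split => //; [exists B|exists A].
Qed.

Definition translate_fund A : set C := [set z | disc z /\ F (mobius A^-1 z)].

Lemma measurable_mobius_preim A (S : set C) : measurable (@of_plane R @^-1` S : set P) ->
  measurable (@of_plane R @^-1` [set z | disc z /\ S (mobius A z)] : set P).
Proof.
move=> mS.
have -> : @of_plane R @^-1` [set z | disc z /\ S (mobius A z)] =
  (@of_plane R @^-1` @disc R) `&` ((fun p : P => to_plane (mobius A (of_plane p))) @^-1` (@of_plane R @^-1` S)).
  by apply/seteqP; split => p /=; rewrite ?of_planeK.
apply: measurableI; first exact: measurable_disc.
rewrite -[X in measurable X]setTI; apply: (cmeasurable_plane (cmeasurable_mobius A)) => //.
Qed.

(** The translates of F tile the disc: every orbit meets F, its point in F is unique, and by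
    freeness that point determines the group element up to sign. Each translate is then carried back
    to F by invariance of area. *)
Lemma unfold a p (h : C -> \bar R) : enumerates a p ->
  pmeasurable (@disc R) h -> (forall z, disc z -> (0 <= h z)%E) ->
  hint (@disc R) h = (\sum_(n <oo) (if p n then hint F (fun z => h (mobius (a n) z)) else 0))%E.
Proof.
move=> [Ga surj inj] mh h0.
pose T n := if p n then translate_fund (a n) else set0.
have mT n : measurable (@of_plane R @^-1` T n : set P).
  rewrite /T; case: ifP => _; last by rewrite preimage_set0.
  exact: measurable_mobius_preim fund_measurable.
have Td : @of_plane R @^-1` @disc R = \bigcup_n (@of_plane R @^-1` T n).
  apply/seteqP; split => [q /= qd|q [n _] /=].
    have [A GA FA] := fund_ex qd.
    have [n pn nE] := surj _ (GammaV GA).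
    exists n => //; rewrite /T pn /translate_fund /=; split => //.
    have sa := Gamma_SU (Ga n).
    case: nE => nE; [have <- : A = (a n)^-1 by rewrite -nE invrK|] => //.
    have AE : A = - (a n)^-1 by rewrite -[A]invrK nE oppmxV.
    by rewrite -mobiusN -AE.
  by rewrite /T; case: ifP => // _ [].
rewrite /hint Td ge0_integral_bigcup//.
- apply: eq_eseriesr => n _; rewrite /T; case: ifP => pn; last first.
    by rewrite preimage_set0 integral_set0.
  have sa := Gamma_SU (Ga n).
  have := @hint_mobius _ (a n) (translate_fund (a n)) h sa.
  rewrite /hint => <-.
  + congr (integral _ _ _); apply/seteqP; split => q /=.
      move=> [qd [mqd]]; by rewrite mobiusK.
    move=> Fq; have qd := fund_disc Fq; split => //; split; first exact: mobius_disc.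
    by rewrite mobiusK.
  + exact: measurable_mobius_preim fund_measurable.
  + by move=> z [].
  + by apply: measurable_funS mh => //; [exact: measurable_disc|move=> q []].
  + by move=> z [zd _]; exact: h0.
- rewrite -Td; apply: emeasurable_funM => //.
  by apply/measurable_EFinP/measurable_funTS; exact: measurable_rho.
- by move=> q; rewrite -Td => qd; rewrite mule_ge0 ?h0// lee_fin rho_ge0.
- apply/trivIsetP => n m _ _ nm; apply/seteqP; split => // q [] /=.
  rewrite /T; case: ifP => // pn; case: ifP => // pm [qd Fn] [_ Fm].
  move/eqP: nm; apply; apply: inj => //.
  have GVn := GammaV (Ga n); have GVm := GammaV (Ga m).
  have E := fund_uniq qd GVn GVm Fn Fm.
  have [e|e] := mobius_pm (Gamma_SU GVn) (Gamma_SU GVm) qd E GVn GVm.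
    by left; rewrite -[a n]invrK e invrK.
  by right; rewrite -[a n]invrK e oppmxV ?invrK//; exact: Gamma_SU.
Qed.

(** The area density cut off to S: integrals over S become integrals over the whole plane, the form
    in which Tonelli is applied. *)
Definition hweight (S : set C) (p : P) : R := rho (of_plane p) * \1_(@of_plane R @^-1` S) p.

Lemma hweight_ge0 S p : 0 <= hweight S p.
Proof. by rewrite mulr_ge0 ?rho_ge0. Qed.

Lemma measurable_hweight S : measurable (@of_plane R @^-1` S : set P) ->
  measurable_fun setT (hweight S).
Proof.
by move=> mS; apply: measurable_funM; [exact: measurable_rho|exact: measurable_indic].
Qed.

Lemma hintE S (g : C -> \bar R) : hint S g =
  (\int[@area R]_p (g (of_plane p) * (hweight S p)%:E))%E.
Proof.
rewrite /hint integral_mkcond; apply: eq_integral => p _.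
rewrite patchE /hweight indicE; case: ifP => _; rewrite ?mulr1 ?mulr0 ?mule0//.
Qed.

Lemma eq_hint S (g h : C -> \bar R) : (forall z, S z -> g z = h z) -> hint S g = hint S h.
Proof. by move=> E; apply: eq_integral => p /[!inE] Sp; rewrite E. Qed.

(** Both inner integrals are unfolded to sums over the group. Invariance moves the group element
    from one variable to the other, N(z, a w) = N(a^-1 z, w), after which Tonelli exchanges the two
    integrals over F. *)
Lemma symmetric_unfold (N : C -> C -> \bar R) :
  measurable_fun setT (fun x : P * P => N (of_plane x.1) (of_plane x.2)) ->
  (forall z w, (0 <= N z w)%E) ->
  (forall A z w, Gamma A -> disc z -> disc w -> N (mobius A z) (mobius A w) = N z w) ->
  hint F (fun z => hint (@disc R) (N z)) = hint F (fun w => hint (@disc R) (N ^~ w)).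
Proof.
move=> mN N0 NA; have [a [p ap]] := enumerates_ex; have [Ga _ _] := ap.
have mF := measurable_hweight fund_measurable.
pose T n (x : P * P) : \bar R :=
  if p n then N (mobius (a n)^-1 (of_plane x.1)) (of_plane x.2) else 0%E.
have T0 n x : (0 <= T n x)%E by rewrite /T; case: ifP.
have mT n : measurable_fun setT (T n).
  rewrite /T; case: (p n) => //.
  have -> : (fun x : P * P => N (mobius (a n)^-1 (of_plane x.1)) (of_plane x.2)) =
    (fun x : P * P => N (of_plane x.1) (of_plane x.2)) \o
    (fun x : P * P => (to_plane (mobius (a n)^-1 (of_plane x.1)), x.2)).
    by apply/funext => x /=; rewrite of_planeK.
  apply: measurableT_comp => //; apply: measurable_fun_pair => //.
  by apply: (measurableT_comp (cmeasurable_plane (cmeasurable_mobius (a n)^-1))).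
have mT2 n : measurable_fun setT (fun x : P * P => T n x * (hweight F x.2)%:E)%E.
  apply: emeasurable_funM => //; apply/measurable_EFinP.
  exact: (measurableT_comp mF).
have mT1 n : measurable_fun setT (fun x : P * P => T n x * (hweight F x.1)%:E)%E.
  apply: emeasurable_funM => //; apply/measurable_EFinP.
  exact: (measurableT_comp mF).
have mT12 n : measurable_fun setT
    (fun x : P * P => T n x * (hweight F x.2)%:E * (hweight F x.1)%:E)%E.
  apply: emeasurable_funM => //; apply/measurable_EFinP.
  exact: (measurableT_comp mF).
have w0 q : (0 <= (hweight F q)%:E)%E by rewrite lee_fin hweight_ge0.
have G1 z : F z -> hint (@disc R) (N z) =
   (\sum_(n <oo) \int[@area R]_q (T n (to_plane z, q) * (hweight F q)%:E))%E.
  move=> Fz; have zd := fund_disc Fz.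
  rewrite (unfold ap)//; last first.
    apply: measurable_funTS.
    by have := measurable_fun_pair2 (to_plane z) mN; rewrite /= of_planeK.
  apply: eq_eseriesr => n _; rewrite /T /=; case: ifP => pn; last first.
    by rewrite integral0_eq// => q _; rewrite mul0e.
  rewrite -hintE of_planeK; apply: eq_hint => w Fw; have wd := fund_disc Fw.
  have sa := Gamma_SU (Ga n).
  have zd' := mobius_disc (SU11V sa) zd.
  by rewrite -[RHS](NA (a n) _ _ (Ga n) zd' wd) mobiusVK.
(* This side is unfolded along the inverses [(a n)^-1], so that both sides produce the same terms
   [T n]. *)
have G2 w : F w -> hint (@disc R) (N ^~ w) =
   (\sum_(n <oo) \int[@area R]_q (T n (q, to_plane w) * (hweight F q)%:E))%E.
  move=> Fw; have wd := fund_disc Fw.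
  rewrite (unfold (enumeratesV ap))//; last first.
    apply: measurable_funTS.
    by have := measurable_fun_pair1 (to_plane w) mN; rewrite /= of_planeK.
  apply: eq_eseriesr => n _; rewrite /T /=; case: ifP => pn; last first.
    by rewrite integral0_eq// => q _; rewrite mul0e.
  by rewrite hintE of_planeK.
have m1 n : measurable_fun setT (fun q : P => \int[@area R]_q' (T n (q, q') * (hweight F q')%:E))%E.
  apply: (measurable_area1 (mT2 n)).
  by move=> x; rewrite mule_ge0.
have m2 n : measurable_fun setT (fun q' : P => \int[@area R]_q (T n (q, q') * (hweight F q)%:E))%E.
  apply: (measurable_area2 (mT1 n)).
  by move=> x; rewrite mule_ge0.
transitivity (\sum_(n <oo) \int[@area R]_q
  ((\int[@area R]_q' (T n (q, q') * (hweight F q')%:E)) * (hweight F q)%:E))%E.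
  rewrite (eq_hint G1) hintE -integral_nneseries//; last 2 first.
  - by move=> n; apply: emeasurable_funM; [exact: m1|exact/measurable_EFinP].
  - by move=> n q _; rewrite mule_ge0// integral_ge0// => q' _; rewrite mule_ge0.
  apply: eq_integral => q _; rewrite muleC -nneseriesZl//.
    by apply: eq_eseriesr => n _; rewrite to_planeK muleC.
  by move=> n _; rewrite integral_ge0// => q' _; rewrite mule_ge0.
transitivity (\sum_(n <oo) \int[@area R]_q'
  ((\int[@area R]_q (T n (q, q') * (hweight F q)%:E)) * (hweight F q')%:E))%E; last first.
  rewrite (eq_hint G2) hintE -integral_nneseries//; last 2 first.
  - by move=> n; apply: emeasurable_funM; [exact: m2|exact/measurable_EFinP].
  - by move=> n q _; rewrite mule_ge0// integral_ge0// => q' _; rewrite mule_ge0.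
  apply: eq_integral => q _; rewrite [in RHS]muleC -nneseriesZl//.
    by apply: eq_eseriesr => n _; rewrite to_planeK muleC.
  by move=> n _; rewrite integral_ge0// => q' _; rewrite mule_ge0.
apply: eq_eseriesr => n _.
transitivity (\int[@area R]_q \int[@area R]_q'
   (T n (q, q') * (hweight F q')%:E * (hweight F q)%:E))%E.
  apply: eq_integral => q _; rewrite ge0_integralZr//.
    exact: (measurable_fun_pair2 q (mT2 n)).
  by move=> q' _; rewrite mule_ge0.
rewrite (tonelli_area (mT12 n)); last first.
  by move=> x; rewrite !mule_ge0.
apply: eq_integral => q' _; rewrite -ge0_integralZr//.
- by apply: eq_integral => q _; rewrite -!muleA [((hweight F q')%:E * _)%E]muleC.
- exact: (measurable_fun_pair1 q' (mT1 n)).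
- by move=> q _; rewrite mule_ge0.
Qed.

Lemma hweight_in S p : S (of_plane p) -> hweight S p = rho (of_plane p).
Proof. by move=> Sp; rewrite /hweight indicE mem_set// mulr1. Qed.

Lemma hweight_out S p : ~ S (of_plane p) -> hweight S p = 0.
Proof. by move=> Sp; rewrite /hweight indicE memNset// mulr0. Qed.

(** Unfolding g cut off to S gives integrals over the sets of z in F with a_n z in S. Since S
    injects into X, these subsets of F are disjoint. *)
Lemma hint_injective_le (S : set C) (g : C -> \bar R) :
  measurable (@of_plane R @^-1` S : set P) -> S `<=` @disc R ->
  (forall A z, Gamma A -> S z -> S (mobius A z) -> A = 1 \/ A = - 1) ->
  pmeasurable (@disc R) g -> (forall z, disc z -> (0 <= g z)%E) ->
  (forall A z, Gamma A -> disc z -> g (mobius A z) = g z) ->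
  (hint S g <= hint F g)%E.
Proof.
move=> mS Sd Sinj mg g0 gA; have [a [p ap]] := enumerates_ex; have [Ga _ inj] := ap.
pose gS := (g \_ S : C -> \bar R).
have gSE z : gS z = if z \in S then g z else 0%E by rewrite /gS patchE.
have mgS : pmeasurable (@disc R) gS.
  apply: measurable_funTS; rewrite (_ : (fun p : P => gS (of_plane p)) =
    (fun p : P => g (of_plane p)) \_ (@of_plane R @^-1` S)).
    apply/(measurable_restrictT _ mS); apply: measurable_funS mg => //; [exact: measurable_disc|move=> q; exact: Sd].
  apply/funext => q; rewrite gSE patchE.
  by case: ifPn => [/[!inE] h|/negP h]; rewrite ?mem_set//; case: ifP => // /[!inE] /= k; case: h; rewrite inE.
have -> : hint S g = hint (@disc R) gS.
  rewrite !hintE; apply: eq_integral => q _; rewrite gSE.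
  have [Sq|nSq] := pselect (S (of_plane q)).
    by rewrite mem_set// !hweight_in//; exact: Sd.
  by rewrite (memNset nSq) hweight_out// mule0 mul0e.
rewrite (unfold ap)//; last by move=> z zd; rewrite gSE; case: ifP => // _; exact: g0.
pose E n : set C := if p n then [set z | F z /\ S (mobius (a n) z)] else set0.
have mE n : measurable (@of_plane R @^-1` E n : set P).
  rewrite /E; case: ifP => _; last by rewrite preimage_set0.
  have -> : [set z | F z /\ S (mobius (a n) z)] = F `&` [set z | disc z /\ S (mobius (a n) z)].
    by apply/seteqP; split => z [/= Fz]; [move=> ?; split => //; split => //; exact: fund_disc|case].
  by apply: measurableI; [exact: fund_measurable|exact: measurable_mobius_preim].
have mgr D : D `<=` @of_plane R @^-1` (@disc R) ->
    measurable_fun D (fun p : P => g (of_plane p) * (rho (of_plane p))%:E)%E.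
  move=> Dd; apply: emeasurable_funM.
    by apply: measurable_funS mg => //; exact: measurable_disc.
  by apply/measurable_EFinP/measurable_funTS; exact: measurable_rho.
have EF n q : (@of_plane R @^-1` E n) q -> F (of_plane q).
  by rewrite /E /=; case: ifP => // _ [].
have -> : (\sum_(n <oo) (if p n then hint F (fun z => gS (mobius (a n) z)) else 0))%E =
    (\sum_(n <oo) hint (E n) g)%E.
  apply: eq_eseriesr => n _; rewrite /E; case: ifP => pn; last first.
    by rewrite /hint preimage_set0 integral_set0.
  rewrite !hintE; apply: eq_integral => q _; rewrite gSE.
  have [Fq|nFq] := pselect (F (of_plane q)); last first.
    by rewrite !hweight_out ?mule0// => -[].
  have [Sq|nSq] := pselect (S (mobius (a n) (of_plane q))).
    by rewrite mem_set// !hweight_in// gA//; exact: fund_disc.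
  by rewrite (memNset nSq) mul0e [in RHS]hweight_out ?mule0// => -[].
rewrite /hint -ge0_integral_bigcup//.
- apply: ge0_subset_integral => //.
  + exact: bigcupT_measurable.
  + exact: fund_measurable.
  + by apply: mgr => q /fund_disc.
  + by move=> q /= /fund_disc qd; rewrite mule_ge0 ?g0// lee_fin rho_ge0.
  + by move=> q [n _ /EF].
- by apply: mgr => q [n _ /EF /fund_disc].
- by move=> q [n _ /EF /fund_disc qd]; rewrite mule_ge0 ?g0// lee_fin rho_ge0.
- apply/trivIsetP => n m _ _ nm; apply/seteqP; split => // q [] /=.
  rewrite /E; case: ifP => // pn; case: ifP => // pm [Fq Sn] [_ Sm].
  move/eqP: nm; apply; apply: inj => //.
  have qd := fund_disc Fq; have sn := Gamma_SU (Ga n); have sm := Gamma_SU (Ga m).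
  have [] := Sinj (a n * (a m)^-1) _ _ Sm.
  + by apply: GammaM => //; exact: GammaV.
  + by rewrite -mobiusM ?SU11V// -?mulrA ?SU11_mulV ?mulr1//; [exact: SU11M sn (SU11V sm)].
  + by move=> h; left; rewrite -[a n]mulr1 -(SU11_mulV sm) mulrA h mul1r.
  + by move=> h; right; rewrite -[a n]mulr1 -(SU11_mulV sm) mulrA h mulN1r.
Qed.

Lemma measurable_normc_le (k : R) : 0 <= k ->
  measurable (@of_plane R @^-1` [set z | normc z <= k] : set P).
Proof.
move=> k0; rewrite (_ : _ @^-1` _ = (fun p : P => sqn (of_plane p)) @^-1` `]-oo, k ^+ 2]).
  rewrite -[X in measurable X]setTI.
  exact: (measurable_csqn cmeasurable_id measurableT (measurable_itv _)).
by apply/seteqP; split => p /=; rewrite in_itv/= -normc_sqn ler_pXn2r ?nnegrE ?normc_ge0.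
Qed.

Lemma hint_cst_lty (k : R) (c : R) : 0 <= k < 1 -> 0 <= c ->
  (hint [set z : C | (normc z <= k)%R] (fun=> c%:E) < +oo)%E.
Proof.
move=> /andP[k0 k1] c0; set S := [set z | _].
have mS : measurable (@of_plane R @^-1` S : set P) by exact: measurable_normc_le.
pose B : set P := `[-1, 1]%classic `*` `[-1, 1]%classic.
have mB : measurable B by apply: measurableX.
pose K := c * (4 / (1 - k ^+ 2) ^+ 2).
have k2 : 0 < 1 - k ^+ 2 by rewrite subr_gt0 expr_lt1.
have K0 : 0 <= K by rewrite mulr_ge0// divr_ge0// sqr_ge0.
apply: (@le_lt_trans _ _ (\int[@area R]_(p in B) K%:E)%E); last first.
  rewrite integral_cst//; apply: lte_mul_pinfty => //.
  change ((@lebesgue_measure R \x @lebesgue_measure R)%E B < +oo)%E.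
  rewrite /B product_measure1E// -[X in (X * _)%E]/(lebesgue_measure _).
  rewrite -[X in (_ * X)%E]/(lebesgue_measure _) !lebesgue_measure_itv/= lte_fin.
  by rewrite (_ : -1 < 1 = true) ?ltry//; apply/idP; lra.
rewrite hintE [leRHS]integral_mkcond; apply: ge0_le_integral => //.
- by move=> p _; rewrite mule_ge0// lee_fin// hweight_ge0.
- by apply: emeasurable_funM => //; apply/measurable_EFinP; exact: measurable_hweight.
- by apply/(measurable_restrictT _ mB).
- move=> p _; rewrite patchE; have [Sp|nSp] := pselect (S (of_plane p)); last first.
    by rewrite hweight_out// mule0; case: ifP => // _; rewrite lee_fin.
  have sk : sqn (of_plane p : C) <= k ^+ 2.
    by rewrite -normc_sqn ler_pXn2r ?nnegrE ?normc_ge0.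
  have B1 : B p.
    case: p Sp sk => x y _; rewrite /B /of_plane /sqn /= => sk.
    have h : k ^+ 2 <= 1 by lra.
    have hx : `|x| <= 1.
      rewrite -(ler_pXn2r (_ : (0 < 2)%N))// ?nnegrE// real_normK ?num_real// expr1n.
      by have := sqr_ge0 y; lra.
    have hy : `|y| <= 1.
      rewrite -(ler_pXn2r (_ : (0 < 2)%N))// ?nnegrE// real_normK ?num_real// expr1n.
      by have := sqr_ge0 x; lra.
    by split => /=; rewrite in_itv/= -ler_norml.
  rewrite mem_set// hweight_in// -EFinM lee_fin ler_wpM2l//.
  rewrite rhoE ler_pM2l// lef_pV2 ?posrE ?exprn_gt0//; last by lra.
  by rewrite ler_pXn2r// ?nnegrE; lra.
Qed.

(** The indicator of a closed disc that meets every orbit unfolds to a series that is at least 1 on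
    F, so the area of F is at most that of the disc. *)
Lemma hint_fund_lty : (hint F (fun=> 1%:E) < +oo)%E.
Proof.
have [k k01 Hk] := cocompact_radius; have /andP[k0 k1] := k01.
have [a [p ap]] := enumerates_ex; have [Ga surj _] := ap.
pose D : set C := [set z | normc z <= k].
have mD : measurable (@of_plane R @^-1` D : set P) by exact: measurable_normc_le.
pose h (z : C) : \bar R := (\1_D z)%:E.
have mh : measurable_fun setT (fun q : P => h (of_plane q)).
  apply/measurable_EFinP.
  rewrite (_ : (fun q : P => \1_D (of_plane q)) = \1_(@of_plane R @^-1` D)); first exact: measurable_indic.
  by apply/funext => q; rewrite !indicE; congr (_%:R); apply/idP/idP; rewrite !inE.
have h0 z : (0 <= h z)%E by rewrite lee_fin.
have E : hint (@disc R) h = hint D (fun=> 1%:E).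
  rewrite !hintE; apply: eq_integral => q _; rewrite /h indicE.
  have [Dq|nDq] := pselect (D (of_plane q)).
    rewrite mem_set// !hweight_in// /disc /=; exact: le_lt_trans k1.
  by rewrite (memNset nDq) (hweight_out nDq) mul0e mule0.
apply: le_lt_trans (hint_cst_lty k01 ler01).
rewrite -/D -E (unfold ap)//; last exact: measurable_funTS.
pose T n (q : P) : \bar R := if p n then h (mobius (a n) (of_plane q)) else 0%E.
have mT n : measurable_fun setT (T n).
  rewrite /T; case: (p n) => //.
  rewrite (_ : (fun q : P => h (mobius (a n) (of_plane q))) =
    (fun q : P => h (of_plane q)) \o (fun q : P => to_plane (mobius (a n) (of_plane q)))).
    by apply: measurableT_comp => //; exact: cmeasurable_plane (cmeasurable_mobius _).
  by apply/funext => q /=; rewrite of_planeK.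
have T0 n q : (0 <= T n q)%E by rewrite /T; case: ifP.
have mw := measurable_hweight fund_measurable.
have w0 q : (0 <= (hweight F q)%:E)%E by rewrite lee_fin hweight_ge0.
rewrite (_ : (\sum_(n <oo) _)%E = (\sum_(n <oo) \int[@area R]_q (T n q * (hweight F q)%:E))%E); last first.
  apply: eq_eseriesr => n _; rewrite /T; case: ifP => pn; last first.
    by rewrite integral0_eq// => q _; rewrite mul0e.
  by rewrite hintE.
rewrite -integral_nneseries//; last 2 first.
- by move=> n; apply: emeasurable_funM; [exact: mT|exact/measurable_EFinP].
- by move=> n q _; rewrite mule_ge0.
have mm n : measurable_fun setT (fun q : P => T n q * (hweight F q)%:E)%E.
  by apply: emeasurable_funM => //; exact/measurable_EFinP.
rewrite hintE; apply: ge0_le_integral => //.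
- by move=> q _; rewrite mul1e.
- by under eq_fun do rewrite mul1e; exact/measurable_EFinP.
- apply: (@ge0_emeasurable_sum _ _ _ _ (fun n q => T n q * (hweight F q)%:E)%E predT) => [n q _ _|n _].
    by rewrite mule_ge0.
  exact: mm.
- move=> q _; rewrite mul1e.
  have [Fq|nFq] := pselect (F (of_plane q)); last first.
    by rewrite hweight_out//; apply: nneseries_ge0 => n _ _; rewrite mule0.
  have [A GA Ak] := Hk _ (fund_disc Fq).
  have [n pn nE] := surj _ GA.
  have DA : D (mobius (a n) (of_plane q)).
    by case: nE => nE; rewrite nE ?mobiusN in Ak.
  have Tn : T n q = 1%E by rewrite /T pn /h indicE mem_set.
  apply: le_trans (nneseries_lim_ge n.+1 _); last by move=> m _ _; rewrite mule_ge0.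
  rewrite big_nat_recr//= Tn mul1e leeDr// sume_ge0// => m _; by rewrite mule_ge0.
Qed.

End Discrete.

(** * The mean value property *)

Section Goursat.
Context {R : realType}.
Local Notation leb := (@lebesgue_measure R).

Section NestedRectangles.
Variable L : R -> R -> R -> R -> R.
Hypothesis Lx : forall a m b c d, a <= m <= b -> c <= d ->
  L a b c d = L a m c d + L m b c d.
Hypothesis Ly : forall a b c m d, a <= b -> c <= m <= d ->
  L a b c d = L a b c m + L a b m d.

Lemma rectangle_quarter (a b c d : R) : a <= b -> c <= d ->
  exists a' c', [/\ a <= a', a' + (b - a) / 2 <= b, c <= c', c' + (d - c) / 2 <= d &
    `|L a b c d| / 4 <= `|L a' (a' + (b - a) / 2) c' (c' + (d - c) / 2)|].
Proof.
move=> ab cd; pose m := a + (b - a) / 2; pose n := c + (d - c) / 2.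
have mb : m + (b - a) / 2 = b by rewrite /m; field.
have nd : n + (d - c) / 2 = d by rewrite /n; field.
have am : a <= m <= b by rewrite /m; apply/andP; split; lra.
have cn : c <= n <= d by rewrite /n; apply/andP; split; lra.
have /andP[am1 am2] := am; have /andP[cn1 cn2] := cn.
have E : L a b c d = L a m c n + L a m n d + (L m b c n + L m b n d).
  by rewrite (Lx am)// (Ly _ cn)// (Ly _ cn).
have T : `|L a b c d| <= `|L a m c n| + `|L a m n d| + (`|L m b c n| + `|L m b n d|).
  by rewrite E; do ?[apply: (le_trans (ler_normD _ _)); apply: lerD] => //; exact: ler_normD.
have [h1|h1] := leP (`|L a b c d| / 4) `|L a m c n|.
  by exists a, c; split => //; rewrite -/m -/n.
have [h2|h2] := leP (`|L a b c d| / 4) `|L a m n d|.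
  by exists a, n; split; rewrite -/m -/n ?nd.
have [h3|h3] := leP (`|L a b c d| / 4) `|L m b c n|.
  by exists m, c; split; rewrite -/m -/n ?mb.
exists m, n; split; rewrite ?mb ?nd//; lra.
Qed.

(** Repeated bisection keeps a quarter carrying at least a quarter of |L|. The rectangles shrink to
    a point (X, Y), where the local bound, quadratic in the sides, scales by the same factor 4^-n
    and forces L below any e. *)
Lemma additive_rectangle_eq0 (a b c d : R) : a <= b -> c <= d ->
  (forall x y, a <= x <= b -> c <= y <= d -> forall e, 0 < e -> exists2 r, 0 < r &
     forall a' b' c' d', a' <= x <= b' -> c' <= y <= d' ->
       a <= a' -> b' <= b -> c <= c' -> d' <= d ->
       (b' - a') + (d' - c') < r ->
       `|L a' b' c' d'| <= e * ((b' - a') + (d' - c')) ^+ 2) ->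
  L a b c d = 0.
Proof.
move=> ab cd H; set w := b - a; set h := d - c.
have w0 : 0 <= w by rewrite subr_ge0.
have h0 : 0 <= h by rewrite subr_ge0.
pose good n (p : R * R) := [/\ a <= p.1, p.1 + w / 2 ^+ n <= b, c <= p.2,
  p.2 + h / 2 ^+ n <= d & `|L a b c d| / 4 ^+ n <=
     `|L p.1 (p.1 + w / 2 ^+ n) p.2 (p.2 + h / 2 ^+ n)|].
have p2 n : 0 < (2 : R) ^+ n by rewrite exprn_gt0.
have step n p : exists p', good n p -> good n.+1 p' /\
    [/\ p.1 <= p'.1, p'.1 + w / 2 ^+ n.+1 <= p.1 + w / 2 ^+ n, p.2 <= p'.2 &
        p'.2 + h / 2 ^+ n.+1 <= p.2 + h / 2 ^+ n].
  have [G|] := pselect (good n p); last by exists p.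
  have [g1 g2 g3 g4 g5] := G.
  have wn : 0 <= w / 2 ^+ n by rewrite divr_ge0// ltW.
  have hn : 0 <= h / 2 ^+ n by rewrite divr_ge0// ltW.
  have [] := @rectangle_quarter p.1 (p.1 + w / 2 ^+ n) p.2 (p.2 + h / 2 ^+ n).
  - by rewrite lerDl.
  - by rewrite lerDl.
  move=> a' [c' [q1 q2 q3 q4 q5]].
  have ew : (p.1 + w / 2 ^+ n - p.1) / 2 = w / 2 ^+ n.+1.
    by rewrite exprSr; field; rewrite gt_eqF.
  have eh : (p.2 + h / 2 ^+ n - p.2) / 2 = h / 2 ^+ n.+1.
    by rewrite exprSr; field; rewrite gt_eqF.
  rewrite ew eh in q2 q4 q5.
  exists (a', c') => _; split; last by split.
  split => //=; [exact: le_trans q1|exact: le_trans g2|exact: le_trans q3|exact: le_trans g4|].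
  apply: le_trans q5; apply: le_trans (_ : (`|L a b c d| / 4 ^+ n) / 4 <= _).
    by rewrite exprSr invfM mulrA.
  by rewrite ler_wpM2r// invr_ge0.
have [f Hf] := choice (fun np : nat * (R * R) => step np.1 np.2).
pose s := fix s n := if n is m.+1 then f (m, s m) else (a, c).
have sg n : good n (s n).
  elim: n => [|n IH /=].
    by split => //=; rewrite expr0 !divr1 ?subrKC//.
  by have [] := Hf (n, s n) IH.
have smono n : [/\ (s n).1 <= (s n.+1).1, (s n.+1).1 + w / 2 ^+ n.+1 <= (s n).1 + w / 2 ^+ n,
    (s n).2 <= (s n.+1).2 & (s n.+1).2 + h / 2 ^+ n.+1 <= (s n).2 + h / 2 ^+ n].
  by have [_] := Hf (n, s n) (sg n).
have mono n m : (n <= m)%N -> [/\ (s n).1 <= (s m).1, (s m).1 + w / 2 ^+ m <= (s n).1 + w / 2 ^+ n,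
    (s n).2 <= (s m).2 & (s m).2 + h / 2 ^+ m <= (s n).2 + h / 2 ^+ n].
  move=> /subnK <-; elim: (m - n)%N => [//|k [k1 k2 k3 k4]].
  have [l1 l2 l3 l4] := smono (k + n)%N; rewrite addSn.
  by split; [exact: le_trans l1|exact: le_trans k2|exact: le_trans l3|exact: le_trans k4].
have cross (n m : nat) : (s n).1 <= (s m).1 + w / 2 ^+ m /\ (s n).2 <= (s m).2 + h / 2 ^+ m.
  have wn k : 0 <= w / 2 ^+ k by rewrite divr_ge0// ltW.
  have hn k : 0 <= h / 2 ^+ k by rewrite divr_ge0// ltW.
  have [nm|/ltnW mn] := leqP n m.
    have [m1 _ m3 _] := mono _ _ nm.
    by have := wn m; have := hn m; split; lra.
  have [_ m2 _ m4] := mono _ _ mn.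
  by have := wn n; have := hn n; split; lra.
pose X := sup (range (fun n => (s n).1)); pose Y := sup (range (fun n => (s n).2)).
have hX : has_sup (range (fun n => (s n).1)).
  split; first by exists (s 0%N).1, 0%N.
  by exists ((s 0%N).1 + w / 2 ^+ 0) => _ [n _ <-]; have [] := cross n 0%N.
have hY : has_sup (range (fun n => (s n).2)).
  split; first by exists (s 0%N).2, 0%N.
  by exists ((s 0%N).2 + h / 2 ^+ 0) => _ [n _ <-]; have [] := cross n 0%N.
have Xn n : (s n).1 <= X <= (s n).1 + w / 2 ^+ n.
  apply/andP; split; first by apply: sup_upper_bound => //; exists n.
  by apply: ge_sup => [|_ [m _ <-]]; [case: hX|have [] := cross m n].
have Yn n : (s n).2 <= Y <= (s n).2 + h / 2 ^+ n.
  apply/andP; split; first by apply: sup_upper_bound => //; exists n.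
  by apply: ge_sup => [|_ [m _ <-]]; [case: hY|have [] := cross m n].
apply/eqP; rewrite -normr_le0; apply/ler_addgt0Pl => e e0.
(* The added 1 covers a rectangle reduced to a point. *)
pose e' := e / ((w + h) ^+ 2 + 1).
have q0 : 0 < (w + h) ^+ 2 + 1 by rewrite ltr_pwDr// sqr_ge0.
have e'0 : 0 < e' by rewrite divr_gt0.
have Xab : a <= X <= b by have := Xn 0%N; rewrite /= expr0 divr1 /w subrKC.
have Ycd : c <= Y <= d by have := Yn 0%N; rewrite /= expr0 divr1 /h subrKC.
have [r r0 Hr] := H X Y Xab Ycd e' e'0.
have [n Hn] : exists n, (w + h) / 2 ^+ n < r.
  exists (Num.trunc ((w + h) / r)).+1; rewrite ltr_pdivrMr//.
  have k0 : 0 <= (w + h) / r := divr_ge0 (addr_ge0 w0 h0) (ltW r0).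
  have /andP[_ k1] := truncn_itv k0.
  rewrite mulrC -ltr_pdivrMr//; apply: lt_trans k1 _.
  by rewrite -natrX ltr_nat ltn_expl.
have [g1 g2 g3 g4 g5] := sg n.
have := Hr _ _ _ _ (Xn n) (Yn n) g1 g2 g3 g4.
have -> : (s n).1 + w / 2 ^+ n - (s n).1 + ((s n).2 + h / 2 ^+ n - (s n).2) = (w + h) / 2 ^+ n by ring.
move=> /(_ Hn) Hb; have := le_trans g5 Hb.
rewrite ler_pdivrMr ?exprn_gt0// exprMn exprVn.
have -> : e' * ((w + h) ^+ 2 / (2 ^+ n) ^+ 2) * 4 ^+ n = e' * (w + h) ^+ 2.
  have -> : (4 : R) ^+ n = (2 ^+ n) ^+ 2 by rewrite -exprM mulnC exprM; congr (_ ^+ n); rewrite expr2; ring.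
  by field; rewrite gt_eqF.
move=> /le_trans; apply; rewrite addr0 /e' mulrAC ler_pdivrMr// ler_pM2l//.
by rewrite lerDl.
Qed.
End NestedRectangles.

Lemma continuous_integrable (g : R -> R) (a b : R) :
  (forall x, a <= x <= b -> {for x, continuous g}) ->
  leb.-integrable `[a, b] (EFin \o g).
Proof.
move=> cg; apply: continuous_compact_integrable; first exact: segment_compact.
by apply: continuous_in_subspaceT => x /[!inE] /= /[!in_itv] /=; exact: cg.
Qed.

Lemma Rintegral_split (g : R -> R) (a m b : R) : a <= m <= b ->
  (forall x, a <= x <= b -> {for x, continuous g}) ->
  \int[leb]_(x in `[a, b]) g x = \int[leb]_(x in `[a, m]) g x + \int[leb]_(x in `[m, b]) g x.
Proof.
move=> /andP[am mb] cg.
have := @Rintegral_itvB R g (BLeft a) (BRight b) m.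
rewrite !bnd_simp => /(_ (continuous_integrable cg)) H.
have {H} := H am mb.
rewrite Rintegral_itv_obnd_cbnd; last first.
  apply: (integrableS _ _ _ (continuous_integrable cg)) => //.
  by move=> x /=; rewrite !in_itv/= => /andP[/ltW h ->]; rewrite (le_trans am h).
by move=> /eqP; rewrite subr_eq addrC => /eqP.
Qed.

Lemma Rintegral_dist_le (g : R -> R) (a b k e : R) : a <= b ->
  (forall x, a <= x <= b -> {for x, continuous g}) ->
  (forall x, a <= x <= b -> `|g x - k| <= e) ->
  `|\int[leb]_(x in `[a, b]) g x - k * (b - a)| <= e * (b - a).
Proof.
move=> ab cg H.
have cst_int (c : R) : \int[leb]_(x in `[a, b]) c = c * (b - a).
  rewrite Rintegral_cst// -[X in fine X]/(lebesgue_measure _) lebesgue_measure_itv/= lte_fin.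
  by move: ab; rewrite le_eqVlt => /predU1P[->|->] //; rewrite ltxx subrr.
have ig := continuous_integrable cg.
have ic (c : R) : leb.-integrable `[a, b] (EFin \o (fun=> c)).
  by apply: continuous_integrable => x _; exact: cvg_cst.
have lo : (k - e) * (b - a) <= \int[leb]_(x in `[a, b]) g x.
  rewrite -cst_int; apply: le_Rintegral => // x /= /[!in_itv]/= /H.
  by rewrite ler_norml => /andP[h1 h2]; lra.
have hi : \int[leb]_(x in `[a, b]) g x <= (k + e) * (b - a).
  rewrite -cst_int; apply: le_Rintegral => // x /= /[!in_itv]/= /H.
  by rewrite ler_norml => /andP[h1 h2]; lra.
move: (\int[leb]_(x in `[a, b]) g x) lo hi => I lo hi.
by rewrite ler_norml; apply/andP; split; lra.
Qed.

(** Total differentiability with gradient (A, B), at one point only: Goursat's argument must not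
    presuppose continuous partial derivatives. *)
Definition differentiable2 (P : R -> R -> R) (x0 y0 A B : R) : Prop :=
  forall e, 0 < e -> exists2 r, 0 < r & forall x y, `|x - x0| + `|y - y0| < r ->
    `|P x y - P x0 y0 - A * (x - x0) - B * (y - y0)| <= e * (`|x - x0| + `|y - y0|).

Lemma differentiable2_cont (P : R -> R -> R) (x0 y0 A B : R) :
  differentiable2 P x0 y0 A B ->
  {for x0, continuous (P^~ y0)} /\ {for y0, continuous (P x0)}.
Proof.
move=> H; have [r r0 Hr] := H 1 ltr01.
have aux (f : R -> R) (t0 C : R) : (forall t, `|t - t0| < r -> `|f t - f t0 - C * (t - t0)| <= `|t - t0|) ->
   {for t0, continuous f}.
  move=> Hf; apply/cvgrPdist_lt => e e0; near=> t.
  have tr : `|t - t0| < r.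
    near: t; apply/nbhs_ballP; exists r => //= t; rewrite /ball /= distrC //.
  have te : `|t - t0| < e / (`|C| + 1).
    near: t; apply/nbhs_ballP; exists (e / (`|C| + 1)) => /=.
      by rewrite divr_gt0// ltr_pwDr.
    by move=> t; rewrite /ball /= distrC.
  rewrite distrC.
  have -> : f t - f t0 = (f t - f t0 - C * (t - t0)) + C * (t - t0) by ring.
  apply: (le_lt_trans (ler_normD _ _)).
  have := Hf t tr; rewrite normrM => h1.
  move: te; rewrite ltr_pdivlMr ?ltr_pwDr// => te.
  by move: te; rewrite mulrDr mulr1 mulrC; apply: le_lt_trans; rewrite addrC lerD2l.
split.
  apply: (aux _ _ A) => t ht; have := Hr t y0; rewrite subrr normr0 addr0 => /(_ ht).
  by rewrite mul1r mulr0 subr0.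
apply: (aux _ _ B) => t ht; have := Hr x0 t; rewrite subrr normr0 add0r => /(_ ht).
by rewrite mul1r mulr0 subr0.
Unshelve. all: by end_near. Qed.

(* Goursat's bisection argument for a closed form P dx + Q dy whose coefficients
   are only differentiable. *)
Lemma closed_form_rectangle (P Q : R -> R -> R) (a b c d : R) : a <= b -> c <= d ->
  (forall x y, a <= x <= b -> c <= y <= d -> exists A B C D,
     [/\ differentiable2 P x y A B, differentiable2 Q x y C D & B = C]) ->
  \int[leb]_(x in `[a, b]) P x c - \int[leb]_(x in `[a, b]) P x d
  + (\int[leb]_(y in `[c, d]) Q b y - \int[leb]_(y in `[c, d]) Q a y) = 0.
Proof.
move=> ab cd H.
have cP x y : a <= x <= b -> c <= y <= d -> {for x, continuous (P^~ y)}.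
  by move=> hx hy; have [A [B [C [D [/differentiable2_cont[? _] _ _]]]]] := H x y hx hy.
have cQ x y : a <= x <= b -> c <= y <= d -> {for y, continuous (Q x)}.
  by move=> hx hy; have [A [B [C [D [_ /differentiable2_cont[_ ?] _]]]]] := H x y hx hy.
(* [additive_rectangle_eq0] is stated for a function additive on all rectangles, whereas P and Q are
   controlled only on the given one; endpoints are therefore clipped to it. *)
pose clip (l u t : R) := Num.max l (Num.min u t).
have clipI l u t : l <= u -> l <= clip l u t <= u.
  by move=> lu; rewrite /clip le_max lexx /= ge_max lu /= ge_min lexx.
have clipE l u t : l <= t <= u -> clip l u t = t.
  by move=> /andP[h1 h2]; rewrite /clip (min_idPr h2) (max_idPr h1).
pose L a' b' c' d' : R :=
  let a' := clip a b a' in let b' := clip a b b' in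
  let c' := clip c d c' in let d' := clip c d d' in
  \int[leb]_(x in `[a', b']) P x c' - \int[leb]_(x in `[a', b']) P x d'
  + (\int[leb]_(y in `[c', d']) Q b' y - \int[leb]_(y in `[c', d']) Q a' y).
have clip_mono l u s t : s <= t -> clip l u s <= clip l u t.
  move=> st; rewrite /clip; case: (leP u s) => ?; case: (leP u t) => ?.
  - by [].
  - lra.
  - by case: (leP l s) => ?; case: (leP l u) => ?; lra.
  - by case: (leP l s) => ?; case: (leP l t) => ?; lra.
have inab x a' b' : clip a b a' <= x <= clip a b b' -> a <= x <= b.
  move=> /andP[h1 h2]; have /andP[k1 _] := clipI a b a' ab; have /andP[_ k2] := clipI a b b' ab.
  by rewrite (le_trans k1 h1) (le_trans h2 k2).
have incd x a' b' : clip c d a' <= x <= clip c d b' -> c <= x <= d.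
  move=> /andP[h1 h2]; have /andP[k1 _] := clipI c d a' cd; have /andP[_ k2] := clipI c d b' cd.
  by rewrite (le_trans k1 h1) (le_trans h2 k2).
have L0 : L a b c d = 0.
  apply: additive_rectangle_eq0 => //.
  - move=> a' m b' c' d' /andP[am mb] cd'; rewrite /L.
    have mm : clip a b a' <= clip a b m <= clip a b b' by rewrite !clip_mono.
    rewrite (Rintegral_split mm); last by move=> x /inab hx; apply: cP hx (clipI _ _ _ cd).
    rewrite (Rintegral_split (g := fun x => P x (clip c d d')) mm); last first.
      by move=> x /inab hx; apply: cP hx (clipI _ _ _ cd).
    by do 6?[move: (Rintegral _ _ _) => ?]; ring.
  - move=> a' b' c' m d' ab' /andP[am mb]; rewrite /L.
    have mm : clip c d c' <= clip c d m <= clip c d d' by rewrite !clip_mono.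
    rewrite (Rintegral_split (g := Q (clip a b b')) mm); last by move=> x /incd hx; apply: cQ (clipI _ _ _ ab) hx.
    rewrite (Rintegral_split (g := Q (clip a b a')) mm); last first.
      by move=> x /incd hx; apply: cQ (clipI _ _ _ ab) hx.
    by do 6?[move: (Rintegral _ _ _) => ?]; ring.
  - move=> x y hx hy e e0; have [A [B [C [D [dP dQ BC]]]]] := H x y hx hy.
    have e4 : 0 < e / 4 by lra.
    have [r1 r10 H1] := dP _ e4; have [r2 r20 H2] := dQ _ e4.
    exists (Num.min r1 r2); first by rewrite lt_min r10.
    move=> a' b' c' d' /andP[xa xb] /andP[yc yd] aa bb cc dd.
    rewrite lt_min => /andP[s1 s2].
    have ab' := le_trans xa xb; have cd' := le_trans yc yd.
    have a'ab : a <= a' <= b by rewrite aa (le_trans ab').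
    have b'ab : a <= b' <= b by rewrite bb (le_trans aa).
    have c'cd : c <= c' <= d by rewrite cc (le_trans cd').
    have d'cd : c <= d' <= d by rewrite dd (le_trans cc).
    have [ea eb] := (clipE _ _ _ a'ab, clipE _ _ _ b'ab).
    have [ec ed] := (clipE _ _ _ c'cd, clipE _ _ _ d'cd).
    rewrite /L ea eb ec ed; set w := b' - a' in s1 s2 *; set h := d' - c' in s1 s2 *.
    have w0 : 0 <= w by rewrite subr_ge0.
    have h0 : 0 <= h by rewrite subr_ge0.
    have dist_le (l u s t : R) : l <= s <= u -> l <= t <= u -> `|t - s| <= u - l.
      by move=> /andP[l1 l2] /andP[l3 l4]; rewrite ler_norml opprB !lerB.
    have sub1 t : a' <= t <= b' -> `|t - x| <= w by apply: dist_le; rewrite xa.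
    have sub2 t : c' <= t <= d' -> `|t - y| <= h by apply: dist_le; rewrite yc.
    (* The values on two opposite sides are both compared with the linear approximation at (x, y);
       each comparison costs e / 4, and their difference e / 2. *)
    have half (A1 A2 E0 s1' s2' : R) : `|A1| <= e / 4 * s1' -> `|A2| <= e / 4 * s2' ->
        s1' <= w + h -> s2' <= w + h -> E0 = A1 - A2 -> `|E0| <= e / 2 * (w + h).
      move=> q1 q2 q3 q4 ->; apply: (le_trans (ler_normB _ _)).
      have -> : e / 2 * (w + h) = e / 4 * (w + h) + e / 4 * (w + h) by field.
      by apply: lerD; [apply: (le_trans q1)|apply: (le_trans q2)]; rewrite ler_wpM2l// ltW.
    have eP t : a' <= t <= b' -> `|(P t c' - P t d') - B * (c' - d')| <= e / 2 * (w + h).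
      move=> ht; have t1 := sub1 _ ht.
      have u1 := sub2 c' _; have u2 := sub2 d' _; rewrite !lexx cd' in u1 u2.
      have {}u1 := u1 isT; have {}u2 := u2 isT.
      have n1 := lerD t1 u1; have n2 := lerD t1 u2.
      apply: (half _ _ _ _ _ (H1 _ _ (le_lt_trans n1 s1)) (H1 _ _ (le_lt_trans n2 s1)) n1 n2).
      by ring.
    have eQ t : c' <= t <= d' -> `|(Q b' t - Q a' t) - C * (b' - a')| <= e / 2 * (w + h).
      move=> ht; have t1 := sub2 _ ht.
      have u1 := sub1 a' _; have u2 := sub1 b' _; rewrite !lexx ab' in u1 u2.
      have {}u1 := u1 isT; have {}u2 := u2 isT.
      have n1 := lerD u2 t1; have n2 := lerD u1 t1.
      apply: (half _ _ _ _ _ (H2 _ _ (le_lt_trans n1 s2)) (H2 _ _ (le_lt_trans n2 s2)) n1 n2).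
      by ring.
    have iab t : a' <= t <= b' -> a <= t <= b.
      by move=> /andP[t1 t2]; rewrite (le_trans aa) ?(le_trans t2).
    have icd t : c' <= t <= d' -> c <= t <= d.
      by move=> /andP[t1 t2]; rewrite (le_trans cc) ?(le_trans t2).
    have cPP t : a' <= t <= b' -> {for t, continuous (fun t => P t c' - P t d' : R)}.
      by move=> /iab ht; apply: rcontB; apply: cP.
    have cQQ t : c' <= t <= d' -> {for t, continuous (fun t => Q b' t - Q a' t)}.
      by move=> /icd ht; apply: rcontB; apply: cQ.
    rewrite -!RintegralB//; try by apply: continuous_integrable => t ?; (apply: cP || apply: cQ) => //; (exact: iab || exact: icd).
    have j1 := Rintegral_dist_le ab' cPP eP.
    have j2 := Rintegral_dist_le cd' cQQ eQ.
    rewrite -BC -/w -/h in j1 j2; move: j1 j2; do 2?[move: (Rintegral _ _ _) => ?].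
    move=> j1 j2; set I := (X in X + _); set J := (X in _ + X).
    (* The linear parts - B h w and C w h cancel: this is where closedness, B = C, enters. *)
    have -> : I + J = (I - B * (c' - d') * w) + (J - B * w * h) by rewrite /w /h; ring.
    have -> : e * (w + h) ^+ 2 = e * (w + h) * w + e * (w + h) * h by ring.
    have ee : e / 2 * (w + h) <= e * (w + h).
      by apply: ler_wpM2r; [exact: addr_ge0|rewrite ler_pdivrMr// ler_peMr ?(ltW e0)// ler1n].
    apply: (le_trans (ler_normD _ _)); apply: lerD.
      by apply: (le_trans j1); apply: ler_wpM2r.
    by apply: (le_trans j2); apply: ler_wpM2r.
by move: L0; rewrite /L !clipE ?lexx ?ab ?cd.
Qed.
End Goursat.

(** * Circular means of holomorphic functions *)

Section MeanValue.
Context {R : realType}.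
Local Notation C := R[i].
Local Notation leb := (@lebesgue_measure R).

Lemma is_derive_linear (f : R -> R) (t l : R) : is_derive t 1 f l ->
  forall e : R, 0 < e -> exists2 r : R, 0 < r & forall h, `|h| < r ->
    `|f (t + h) - f t - l * h| <= e * `|h|.
Proof.
move=> [df dl] e e0; move: df; rewrite /derivable => df.
have : (fun h : R => h^-1 *: ((f \o shift t) (h *: 1) - f t)) @ 0^' --> l.
  by rewrite -dl; exact: df.
move=> /cvgrPdist_lt /(_ e e0) /nbhs_ballP[r /= r0 H]; exists r => // h hr.
have [->|h0] := eqVneq h 0; first by rewrite addr0 subrr mulr0 subr0 !normr0 mulr0.
have := H h; rewrite /ball /= sub0r normrN => /(_ hr h0).
rewrite distrC /GRing.scale /= mulr1 => /ltW.
have -> : f (t + h) - f t - l * h = (h^-1 * (f (h + t) - f t) - l) * h.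
  by rewrite (addrC h); field.
by rewrite normrM => hh; rewrite ler_wpM2r.
Qed.

Definition cis (t : R) : C := cos t +i* sin t.

Lemma cisD s t : cis (s + t) = cis s * cis t.
Proof. by rewrite /cis cosD sinD; apply/eqP; rewrite eq_complex /= eqxx addrC eqxx. Qed.

Lemma sqn_cis t : sqn (cis t) = 1.
Proof. exact: cos2Dsin2. Qed.

(** The complex exponential of x + i y: a circle about 0 becomes a vertical segment of length 2 pi,
    and the radius tends to 0 as x tends to minus infinity. *)
Definition polar (x y : R) : C := (expR x)%:C * cis y.

Lemma polarD x y a b : polar (x + a) (y + b) = polar x y * polar a b.
Proof. by rewrite /polar expRD cisD rmorphM /=; ring. Qed.

Lemma normc_polar x y : normc (polar x y) = expR x.
Proof.
apply/eqP; rewrite -(eqrXn2 (_ : (0 < 2)%N)) ?normc_ge0 ?expR_ge0// normc_sqn sqnM sqn_cis mulr1.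
by rewrite /sqn /= expr0n /= addr0.
Qed.

Lemma normc_le_abs (z : C) : normc z <= `|complex.Re z| + `|complex.Im z|.
Proof.
rewrite -(ler_pXn2r (_ : (0 < 2)%N)) ?nnegrE ?normc_ge0 ?addr_ge0// normc_sqn /sqn.
by rewrite sqrrD !real_normK ?num_real// addrAC lerDl mulrn_wge0// mulr_ge0.
Qed.

Lemma abs_Re_le (z : C) : `|complex.Re z| <= normc z.
Proof.
rewrite -(ler_pXn2r (_ : (0 < 2)%N)) ?nnegrE ?normc_ge0// normc_sqn /sqn.
by rewrite real_normK ?num_real// lerDl sqr_ge0.
Qed.

Lemma abs_Im_le (z : C) : `|complex.Im z| <= normc z.
Proof.
rewrite -(ler_pXn2r (_ : (0 < 2)%N)) ?nnegrE ?normc_ge0// normc_sqn /sqn.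
by rewrite real_normK ?num_real// lerDr sqr_ge0.
Qed.

Lemma polar_linear (e : R) : 0 < e -> exists2 r : R, 0 < r & forall a b, `|a| + `|b| < r ->
  normc (polar a b - 1 - (a +i* b)) <= e * (`|a| + `|b|).
Proof.
(* The errors of exp, cos and sin add up to d (5 |a| + 3 |b|), which is at most 8 d (|a| + |b|). *)
move=> e0; pose d := Num.min (e / 8) 1.
have d0 : 0 < d by rewrite lt_min divr_gt0 ?ltr01.
have [de d1] : d <= e / 8 /\ d <= 1 by rewrite !ge_min !lexx orbT.
clearbody d.
have [r1 r10 H1] := is_derive_linear (is_derive_expR (0 : R)) d0.
have [r2 r20 H2] := is_derive_linear (is_derive_cos (0 : R)) d0.
have [r3 r30 H3] := is_derive_linear (is_derive_sin (0 : R)) d0.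
exists (Num.min d (Num.min r1 (Num.min r2 r3))); first by rewrite !lt_min d0 r10 r20.
move=> a b; rewrite !lt_min => /and4P[k0 k1 k2 k3].
have a0 := normr_ge0 a; have b0 := normr_ge0 b.
have := H1 a (le_lt_trans _ k1); have := H2 b (le_lt_trans _ k2); have := H3 b (le_lt_trans _ k3).
rewrite !add0r expR0 cos0 sin0 oppr0 mul0r ?subr0 !addr0 !mul1r lerDl lerDr a0 b0 => /(_ isT) g3 /(_ isT) g2 /(_ isT) g1.
apply: (le_trans (normc_le_abs _)).
have -> : complex.Re (polar a b - 1 - (a +i* b)) = (expR a - 1 - a) * cos b + (1 + a) * (cos b - 1).
  by rewrite /polar /=; ring.
have -> : complex.Im (polar a b - 1 - (a +i* b)) = (expR a - 1 - a + a) * sin b + (sin b - b).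
  by rewrite /polar /=; ring.
have cb : `|cos b| <= 1 by rewrite ler_norml cos_geN1 cos_le1.
have ad : `|a| <= d by apply: le_trans (ltW k0); rewrite lerDl.
have bd : `|b| <= d by apply: le_trans (ltW k0); rewrite lerDr.
have sb : `|sin b| <= 2 * d.
  rewrite -[sin b](subrK b); apply: (le_trans (ler_normD _ _)).
  have : d * `|b| <= 1 * d by apply: ler_pM => //; exact: ltW.
  lra.
have t1 : `|(expR a - 1 - a) * cos b| <= d * `|a|.
  by rewrite normrM -[leRHS]mulr1; exact: ler_pM.
have t2 : `|(1 + a) * (cos b - 1)| <= 2 * (d * `|b|).
  rewrite normrM; apply: ler_pM => //; apply: (le_trans (ler_normD _ _)).
  by rewrite normr1; lra.
have t3 : `|(expR a - 1 - a + a) * sin b| <= 2 * `|a| * (2 * d).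
  rewrite normrM; apply: ler_pM => //; apply: (le_trans (ler_normD _ _)).
  have : d * `|a| <= 1 * `|a| by rewrite ler_wpM2r.
  lra.
apply: (le_trans (lerD (ler_normD _ _) (ler_normD _ _))).
have t4 := lerD (lerD t1 t2) (lerD t3 g3).
apply: (le_trans t4).
have -> : d * `|a| + 2 * (d * `|b|) + (2 * `|a| * (2 * d) + d * `|b|) = d * (5 * `|a| + 3 * `|b|) by ring.
have : d * (5 * `|a| + 3 * `|b|) <= e / 8 * (8 * (`|a| + `|b|)).
  by apply: ler_pM => //; lra.
by have -> : e / 8 * (8 * (`|a| + `|b|)) = e * (`|a| + `|b|) by field.
Qed.

Lemma cderive_linear (f : C -> C) (z l : C) : is_derive z 1 f l -> forall e : R, 0 < e ->
  exists2 r : R, 0 < r & forall h, normc h < r ->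
    normc (f (z + h) - f z - l * h) <= e * normc h.
Proof.
move=> /cderivP H e e0; have [r r0 Hr] := H e e0; exists r => // h hr.
have [->|h0] := eqVneq h 0.
  by rewrite addr0 subrr mulr0 subr0 (_ : normc 0 = 0) ?mulr0//= expr0n /= addr0 sqrtr0.
have -> : f (z + h) - f z - l * h = (h^-1 * (f (z + h) - f z) - l) * h.
  by rewrite mulrBl mulrAC mulVf// mul1r.
by rewrite normcM; apply: ler_wpM2r; [exact: normc_ge0|exact: ltW (Hr h h0 hr)].
Qed.

Lemma polar_derive (f : C -> C) (w l : C) : is_derive w 1 f l -> forall e : R, 0 < e ->
  exists2 r : R, 0 < r & forall a b, `|a| + `|b| < r ->
    normc (f (w * polar a b) - f w - l * w * (a +i* b)) <= e * (`|a| + `|b|).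
Proof.
move=> df e e0.
pose M := 2 * (normc w + 1) * (normc l + 1).
have w0 := normc_ge0 w; have l0 := normc_ge0 l.
have M0 : 0 < M by rewrite /M !mulr_gt0// ltr_pwDr.
pose d := Num.min (e / M / 2) 1.
have d0 : 0 < d by rewrite lt_min !divr_gt0 ?ltr01.
have [de d1] : d <= e / M / 2 /\ d <= 1 by rewrite !ge_min !lexx orbT.
clearbody d.
have [r1 r10 H1] := cderive_linear df d0.
have [r2 r20 H2] := polar_linear d0.
exists (Num.min (r1 / M) r2); first by rewrite lt_min divr_gt0.
move=> a b; rewrite lt_min => /andP[k1 k2].
have := H2 a b k2; set s := `|a| + `|b| => g2.
have s0 : 0 <= s by rewrite addr_ge0.
set p := polar a b in g2 *.
have n1 : normc (a +i* b) <= s by exact: normc_le_abs.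
have n2 : normc (p - 1) <= 2 * s.
  have -> : p - 1 = (p - 1 - (a +i* b)) + (a +i* b) by rewrite subrK.
  have ds : d * s <= 1 * s by rewrite ler_wpM2r.
  by apply: (le_trans (le_normcD _ _)); lra.
have hn : normc (w * (p - 1)) <= 2 * (normc w + 1) * s.
  have -> : 2 * (normc w + 1) * s = (normc w + 1) * (2 * s) by ring.
  by rewrite normcM; apply: ler_pM; rewrite ?normc_ge0// lerDl.
have M2 : 2 * (normc w + 1) <= M by rewrite /M ler_peMr ?lerDr// mulr_ge0// addr_ge0.
have hr : normc (w * (p - 1)) < r1.
  apply: (le_lt_trans hn); apply: (@le_lt_trans _ _ (M * s)); first by rewrite ler_wpM2r.
  by rewrite mulrC -ltr_pdivlMr.
have := H1 _ hr => g1.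
have -> : f (w * p) - f w - l * w * (a +i* b) =
   (f (w + w * (p - 1)) - f w - l * (w * (p - 1))) + l * w * (p - 1 - (a +i* b)).
  by rewrite (_ : w + w * (p - 1) = w * p); ring.
apply: (le_trans (le_normcD _ _)).
have g3 : normc (l * w * (p - 1 - (a +i* b))) <= M * (d * s).
  rewrite normcM; apply: ler_pM; rewrite ?normc_ge0//.
  rewrite normcM /M mulrC -mulrA; apply: (@le_trans _ _ ((normc w + 1) * (normc l + 1))).
    by apply: ler_pM => //; rewrite lerDl.
  by rewrite ler_peMl ?ler1n// mulr_ge0// addr_ge0.
have g4 : d * normc (w * (p - 1)) <= M * (d * s).
  rewrite mulrCA; apply: ler_wpM2l; first exact: ltW.
  by apply: (le_trans hn); rewrite ler_wpM2r.
have g5 : M * (d * s) <= e / 2 * s.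
  rewrite mulrA; apply: ler_wpM2r => //.
  have -> : e / 2 = M * (e / M / 2) by field; rewrite gt_eqF.
  by rewrite ler_wpM2l// ltW.
have := lerD g1 g3; have -> : e * s = e / 2 * s + e / 2 * s by field.
by move/le_trans; apply; apply: lerD => //; exact: le_trans g5.
Qed.
Lemma Re_mul_bound (c : C) (a b : R) :
  complex.Im (c * (a +i* b)) = complex.Im c * a + complex.Re c * b /\
  complex.Re (c * (a +i* b)) = complex.Re c * a - complex.Im c * b.
Proof. by case: c => u v /=; split; rewrite 1?addrC. Qed.

Section HolomorphicOnDisc.
Variable f : C -> C.
Hypothesis df : forall z, disc z -> derivable f z 1.

(** Both gradients are read off from l w (dx + i dy), with l the derivative at w. That [B] occurs in
    both is the Cauchy--Riemann equation making Im f dx + Re f dy = Im(f d(x + i y)) closed. *)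
Lemma differentiable2_polar (z : C) (x y : R) : disc (z * polar x y) ->
  exists A B, differentiable2 (fun x y => complex.Im (f (z * polar x y))) x y A B /\
              differentiable2 (fun x y => complex.Re (f (z * polar x y))) x y B (- A).
Proof.
move=> wd; set w := z * polar x y in wd *.
have [l fl] : exists l, is_derive w 1 f l by eexists; exact/derivableP/df.
exists (complex.Im (l * w)), (complex.Re (l * w)).
have wE x' y' : w * polar (x' - x) (y' - y) = z * polar x' y'.
  by rewrite /w -mulrA -polarD !subrKC.
split => e e0; have [r r0 H] := polar_derive fl e0; exists r => // x' y' /H; rewrite wE => h.
- apply: le_trans h; apply: le_trans (abs_Im_le _).
  rewrite raddfB /= raddfB /=; have [-> _] := Re_mul_bound (l * w) (x' - x) (y' - y).
  by rewrite opprD addrA.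
- apply: le_trans h; apply: le_trans (abs_Re_le _).
  rewrite raddfB /= raddfB /=; have [_ ->] := Re_mul_bound (l * w) (x' - x) (y' - y).
  by rewrite opprB addrA addrAC mulNr opprK.
Qed.

Let two_pi_ge0 : 0 <= pi *+ 2 :> R. Proof. by rewrite mulrn_wge0// pi_ge0. Qed.

Lemma disc_polar (z : C) (x y : R) : disc z -> x <= 0 -> disc (z * polar x y).
Proof.
rewrite /disc /= normcM normc_polar => zd x0.
apply: le_lt_trans zd; rewrite -[leRHS]mulr1; apply: ler_wpM2l; first exact: normc_ge0.
by rewrite -expR0 ler_expR.
Qed.

Lemma Re_polar_continuous (z : C) (x y : R) : disc z -> x <= 0 ->
  {for y, continuous (fun y => complex.Re (f (z * polar x y)))}.
Proof.
move=> zd x0; have [A [B [_ /differentiable2_cont[_]]]] := differentiable2_polar (disc_polar y zd x0).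
by [].
Qed.

(** On the rectangle with sides x, 0 and 0, 2 pi the two horizontal integrals agree by periodicity,
    so the mean over the circle of radius e^x |z| does not depend on x <= 0. As x tends to minus
    infinity it tends to Re f(0) by continuity. *)
Lemma mean_Re (z : C) : disc z ->
  \int[leb]_(t in `[0, pi *+ 2]) complex.Re (f (z * cis t)) = complex.Re (f 0) * (pi *+ 2).
Proof.
move=> zd.
have Q0 x : x <= 0 -> \int[leb]_(t in `[0, pi *+ 2]) complex.Re (f (z * polar 0 t)) =
    \int[leb]_(t in `[0, pi *+ 2]) complex.Re (f (z * polar x t)).
  move=> x0; have := @closed_form_rectangle _ (fun x y => complex.Im (f (z * polar x y)))
    (fun x y => complex.Re (f (z * polar x y))) x 0 0 (pi *+ 2) x0 two_pi_ge0.
  have -> : (fun x => complex.Im (f (z * polar x 0))) = (fun x => complex.Im (f (z * polar x (pi *+ 2)))).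
    by apply/funext => u; rewrite /polar /cis cos2pi sin2pi cos0 sin0.
  rewrite subrr add0r => h; apply/eqP; rewrite -subr_eq0; apply/eqP; apply: h => u v /andP[_ u0] _.
  have [A [B [h1 h2]]] := differentiable2_polar (disc_polar v zd u0).
  by exists A, B, B, (- A).
have -> : (fun t => complex.Re (f (z * cis t))) = (fun t => complex.Re (f (z * polar 0 t))).
  by apply/funext => t; rewrite /polar expR0 mul1r.
apply/eqP; rewrite -subr_eq0 -normr_le0; apply/ler_addgt0Pl => e e0.
have e1 : 0 < e / (pi *+ 2 + 1) by rewrite divr_gt0// ltr_pwDr.
have [d d0 Hd] : exists2 d : R, 0 < d & forall w, normc (w - 0) < d -> normc (f w - f 0) < e / (pi *+ 2 + 1).
  have /continuous_normcP : {for (0 : C), continuous f} by apply: cderive_continuous; exact/df/disc0.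
  exact.
(* A nonpositive x with e^x < d, so that the small circle lies in the neighbourhood given by
   continuity. *)
pose x := Num.min 0 (ln d - 1).
have x0 : x <= 0 by rewrite ge_min lexx.
have xd : expR x < d.
  rewrite -[ltRHS](lnK (x := d))// ltr_expR; apply: (@le_lt_trans _ _ (ln d - 1)).
    by rewrite ge_min lexx orbT.
  by rewrite ltrBlDr ltrDl.
rewrite (Q0 x x0) addr0; have := @Rintegral_dist_le _ (fun t => complex.Re (f (z * polar x t))) 0
  (pi *+ 2) (complex.Re (f 0)) (e / (pi *+ 2 + 1)) two_pi_ge0.
rewrite subr0 => h; apply: le_trans (h _ _) _ => [t _|t _|].
- exact: Re_polar_continuous.
- rewrite -raddfB; apply: (le_trans (abs_Re_le _)); apply/ltW/Hd.
  rewrite subr0 normcM normc_polar; apply: le_lt_trans xd.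
  by rewrite ler_piMl ?expR_ge0//; exact: ltW.
- by rewrite -mulrA ler_piMr ?(ltW e0)// mulrC ler_pdivrMr ?mul1r ?lerDl// ltr_pwDr.
Qed.

End HolomorphicOnDisc.

Lemma derivable_cmul (f : C -> C) (c z : C) : derivable f z 1 -> derivable (fun w => c * f w) z 1.
Proof. by move=> h; exact: (@derivableZ _ _ _ f c z 1 h). Qed.

Lemma Re_cos2 (f : C -> C) (z : C) (t : R) : (forall z, disc z -> derivable f z 1) -> disc z ->
  {for t, continuous (fun t => complex.Re (f (z * cis t)))}.
Proof.
move=> df zd; rewrite (_ : (fun t => _) = (fun t => complex.Re (f (z * polar 0 t)))).
  exact: Re_polar_continuous.
by apply/funext => s; rewrite /polar expR0 mul1r.
Qed.

Lemma sqn_circle_continuous (f : C -> C) (z : C) (t : R) : (forall z, disc z -> derivable f z 1) ->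
  disc z -> {for t, continuous (fun t => sqn (f (z * cis t)))}.
Proof.
move=> df zd.
(* Up to sign, Im f is the real part of i f, so the continuity already known for real parts
   suffices. *)
have -> : (fun t => sqn (f (z * cis t))) = (fun t => complex.Re (f (z * cis t)) * complex.Re (f (z * cis t)) +
   complex.Re ('i%C * f (z * cis t)) * complex.Re ('i%C * f (z * cis t))).
  by apply/funext => s; case: (f _) => a b; rewrite /sqn /= !mul0r !mul1r sub0r mulrNN -!expr2.
have h1 := Re_cos2 (t := t) df zd.
have h2 := Re_cos2 (f := fun w => 'i%C * f w) (t := t) (fun w wd => derivable_cmul (c := 'i%C) (df w wd)) zd.
by apply: rcontD; apply: rcontM.
Qed.

(** The mean value property for conj(f(0)) f gives |f(0)|^2 as a mean, and 2 Re(conj(f(0)) f) <=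
    |f|^2 + |f(0)|^2 because the difference is |f - f(0)|^2. *)
Lemma submean_sqn (f : C -> C) (z : C) : (forall z, disc z -> derivable f z 1) -> disc z ->
  sqn (f 0) * (pi *+ 2) <= \int[leb]_(t in `[0, pi *+ 2]) sqn (f (z * cis t)).
Proof.
move=> df zd; set c := (f 0)^*%C.
have dg w : disc w -> derivable (fun w => c * f w) w 1 by move=> wd; apply: derivable_cmul; exact: df.
have M := mean_Re dg zd.
have E0 : complex.Re (c * f 0) = sqn (f 0) by rewrite /c mulrC -sqn_conj.
have i1 : leb.-integrable `[0, pi *+ 2] (EFin \o (fun t => complex.Re (c * f (z * cis t)))).
  by apply: continuous_integrable => t _; exact: (Re_cos2 (f := fun w => c * f w)).
have i2 : leb.-integrable `[0, pi *+ 2] (EFin \o (fun t => sqn (f (z * cis t)))).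
  by apply: continuous_integrable => t _; exact: sqn_circle_continuous.
have i3 : leb.-integrable `[0, pi *+ 2] (EFin \o (fun t => sqn (f 0) : R)).
  by apply: continuous_integrable => t _; exact: cvg_cst.
have i4 : leb.-integrable `[0, pi *+ 2] (EFin \o (fun t => complex.Re (c * f (z * cis t)) + complex.Re (c * f (z * cis t)))).
  by apply: continuous_integrable => t _; apply: rcontD; exact: (Re_cos2 (f := fun w => c * f w)).
have : \int[leb]_(t in `[0, pi *+ 2]) (complex.Re (c * f (z * cis t)) + complex.Re (c * f (z * cis t)))
   <= \int[leb]_(t in `[0, pi *+ 2]) (sqn (f (z * cis t)) + sqn (f 0)).
  apply: le_Rintegral => // [|t _].
    by apply: continuous_integrable => t _; apply: rcontD; [exact: sqn_circle_continuous|exact: cvg_cst].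
  rewrite /c; move: (f 0) (f (z * cis t)) => [a b] [u v]; rewrite /sqn /=.
  have := sqr_ge0 (u - a); have := sqr_ge0 (v - b); nra.
have addI (g h : R -> R) : leb.-integrable `[0, pi *+ 2] (EFin \o g) ->
    leb.-integrable `[0, pi *+ 2] (EFin \o h) ->
    \int[leb]_(t in `[0, pi *+ 2]) (g t + h t) =
    \int[leb]_(t in `[0, pi *+ 2]) g t + \int[leb]_(t in `[0, pi *+ 2]) h t.
  by move=> ig ih; rewrite RintegralD.
rewrite (addI _ _ i1 i1) (addI _ _ i2 i3) M E0 Rintegral_cst// -[X in fine X]/(lebesgue_measure _) lebesgue_measure_itv/=.
have p0 : 0 < pi *+ 2 :> R by rewrite mulrn_wgt0// pi_gt0.
rewrite lte_fin p0 /= subr0 -mulr2n.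
by move: (Rintegral _ _ _) => I; rewrite mulr2n lerD2r.
Qed.
End MeanValue.

(** * Radial integrals and the submean inequality on discs *)

Section RadialWeight.
Context {R : realType}.
Local Notation C := R[i].
Local Notation P := (R * R)%type.
Local Notation leb := (@lebesgue_measure R).

Lemma even_integral (f : R -> \bar R) : measurable_fun setT f ->
  (forall x, (0 <= f x)%E) -> (forall x, f (- x) = f x) ->
  (\int[leb]_x f x = 2%:E * \int[leb]_(x in `[0%R, +oo[) f x)%E.
Proof.
move=> mf f0 fN.
have m1 : measurable (`]-oo, 0%R[%classic : set (measurableTypeR R)) by [].
have m2 : measurable (`[0%R, +oo[%classic : set (measurableTypeR R)) by [].
have mS (S : set (measurableTypeR R)) : measurable S -> measurable_fun setT (f \_ S).
  by move=> ms; apply/(measurable_restrictT _ ms); exact: measurable_funTS.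
have S0 (S : set R) x : (0 <= (f \_ S) x)%E by rewrite patchE; case: ifP.
rewrite (_ : setT = `]-oo, 0%R[%classic `|` `[0%R, +oo[%classic); last first.
  apply/seteqP; split => // x _; case: (ltP x 0) => h; [left|right]; rewrite /= in_itv/= ?h//.
rewrite ge0_integral_setU//=; last 2 first.
- by rewrite (_ : _ `|` _ = setT)//; apply/seteqP; split => // x _; case: (ltP x 0) => h; [left|right]; rewrite /= in_itv/= ?h.
- by apply/disj_setPS => x [] /=; rewrite !in_itv/= andbT => h1; rewrite leNgt h1.
have -> : (\int[leb]_(x in `]-oo, 0%R[) f x = \int[leb]_(x in `[0%R, +oo[) f x)%E.
  rewrite -(integral_itv_obnd_cbnd (r := 0) (b := BInfty _ false)); last exact: measurable_funTS.
  rewrite integral_mkcond [RHS]integral_mkcond.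
  have N1 : -1 != 0 :> R by rewrite oppr_eq0 oner_eq0.
  have [_ _ _ H] := @change1_affine R (-1) 0 N1.
  rewrite -(H (f \_ `]-oo, 0%R[%classic))//; last exact: mS.
  apply: eq_integral => x _; rewrite mulN1r addr0 normrN1 mule1 !patchE fN.
  congr (if _ then _ else _); apply/idP/idP => /set_mem /=; rewrite in_itv/= => h; apply/mem_set; rewrite /= in_itv/=.
    by rewrite oppr_lt0 in h; rewrite h.
  by rewrite oppr_lt0; move: h; rewrite andbT.
by rewrite -mule2n mule_natl.
Qed.

Lemma integral_oneDsqrV : (\int[leb]_x ((1 + x ^+ 2)^-1)%:E = pi%:E)%E.
Proof.
rewrite even_integral.
- by rewrite (integral0y_oneDsqr R) -EFinM; congr (_%:E); field.
- apply/measurable_EFinP; apply: (measurableT_comp measurable_inv).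
  by apply: measurable_funD => //; exact: measurable_funX.
- by move=> x; rewrite lee_fin invr_ge0 addr_ge0// sqr_ge0.
- by move=> x; rewrite sqrrN.
Qed.

(** Polar coordinates with a signed radius s and the slope t in place of the angle: the Jacobian is
    |s| / (1 + t^2), its angular factor integrates to pi, and the two signs of s supply the factor
    2. *)
Lemma radial_integral (phi : R -> \bar R) : measurable_fun setT phi -> (forall x, (0 <= phi x)%E) ->
  (\int[@area R]_p phi (p.1 ^+ 2 + p.2 ^+ 2)%R =
   (pi *+ 2)%:E * \int[leb]_(s in `[0%R, +oo[) (phi (s ^+ 2)%R * s%:E))%E.
Proof.
move=> mphi phi0.
have m1t : measurable_fun setT (fun p : P => 1 + p.2 ^+ 2 : R).
  by apply: measurable_funD => //; apply: measurable_funX.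
have c0 (t : R) : 0 < 1 + t ^+ 2 by rewrite ltr_pwDl ?sqr_ge0.
pose c (t : R) : R := (Num.sqrt (1 + t ^+ 2))^-1.
have cp t : 0 < c t by rewrite invr_gt0 sqrtr_gt0.
have mc : measurable_fun setT (fun p : P => c p.2).
  apply: (measurableT_comp measurable_inv).
  apply: (@measurableT_comp _ _ _ _ _ _ (@Num.sqrt R)) => //.
  exact: continuous_measurable_fun (@sqrt_continuous R).
have S : change2 (fun p : P => (p.1, p.1 * p.2 + 0)) (fun p => `|p.1|).
  apply: (@change2_snd _ (fun p : P => p.1 * p.2 + 0)) => //.
  - apply: measurable_funD => //; apply: measurable_funM => //.
  - by apply: measurableT_comp.
  - by move=> x x0; exact: change1_affine.
have Q : change2 (fun p : P => (c p.2 * p.1 + 0, p.2)) (fun p => `|c p.2|).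
  apply: (@change2_fst _ (fun p : P => c p.2 * p.1 + 0)).
  - by apply: measurable_funD => //; apply: measurable_funM.
  - by apply: measurableT_comp.
  - by move=> y /=; apply: change1_affine; rewrite gt_eqF.
have [_ _ _ H] := change2_comp Q S.
have mq : measurable_fun setT (fun p : P => phi (p.1 ^+ 2 + p.2 ^+ 2)).
  by apply: (measurableT_comp mphi); apply: measurable_funD; apply: measurable_funX.
rewrite -(H (fun p => phi (p.1 ^+ 2 + p.2 ^+ 2)))//=.
have mg : measurable_fun setT (fun x : R => phi (x ^+ 2)%R * `|x|%R%:E)%E.
  apply: emeasurable_funM; first by apply: (measurableT_comp mphi); exact: measurable_funX.
  apply/measurable_EFinP; exact: normr_measurable.
transitivity (\int[@area R]_p (phi (p.1 ^+ 2)%R * `|p.1|%R%:E * ((1 + p.2 ^+ 2)^-1)%R%:E))%E.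
  apply: eq_integral => -[s t] _ /=; rewrite -muleA -EFinM !addr0.
  have cc : c t ^+ 2 = (1 + t ^+ 2)^-1 by rewrite exprVn sqr_sqrtr// ltW.
  congr (phi _ * _%:E)%E.
    have -> : (c t * s) ^+ 2 + (c t * s * t) ^+ 2 = c t ^+ 2 * (1 + t ^+ 2) * s ^+ 2 by ring.
    by rewrite cc mulVf ?gt_eqF// mul1r.
  by rewrite normrM (gtr0_norm (cp t)) -cc; ring.
rewrite tonelli2/=; last 2 first.
- apply: emeasurable_funM; first exact: (measurableT_comp mg).
  by apply/measurable_EFinP; exact: (measurableT_comp measurable_inv).
- by move=> p; rewrite !mule_ge0// lee_fin// invr_ge0 ltW.
have g0 (x : R) : (0 <= phi (x ^+ 2)%R * `|x|%R%:E)%E by rewrite mule_ge0.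
transitivity (\int[leb]_y ((\int[leb]_x (phi (x ^+ 2)%R * `|x|%R%:E)) * ((1 + y ^+ 2)^-1)%R%:E))%E.
  apply: eq_integral => t _; rewrite ge0_integralZr//.
  by rewrite lee_fin invr_ge0 ltW.
have mV : measurable_fun setT (fun x : R => ((1 + x ^+ 2)^-1)%:E).
  apply/measurable_EFinP; apply: (measurableT_comp measurable_inv).
  by apply: measurable_funD => //; exact: measurable_funX.
rewrite ge0_integralZl//; last 2 first.
- by move=> x _; rewrite lee_fin invr_ge0 ltW.
- by apply: integral_ge0 => x _; rewrite mule_ge0.
rewrite integral_oneDsqrV even_integral//; last first.
  by move=> x; rewrite sqrrN normrN.
rewrite muleAC -EFinM mulr_natl; congr (_ * _)%E.
apply: eq_integral => x /[!inE] /=; rewrite in_itv/= andbT => x0.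
by rewrite ger0_norm.
Qed.
End RadialWeight.
Section SubmeanWeight.
Context {R : realType}.
Local Notation C := R[i].
Local Notation P := (R * R)%type.
Local Notation leb := (@lebesgue_measure R).

Definition ebdisc (m : R) : set C := [set z | sqn z < m].

Lemma ebdisc_disc (m : R) : m <= 1 -> ebdisc m `<=` @disc R.
Proof. by move=> m1 z zm; apply/disc_sqn; exact: lt_le_trans m1. Qed.

Lemma measurable_ebdisc (m : R) : measurable (@of_plane R @^-1` ebdisc m : set P).
Proof.
rewrite (_ : _ @^-1` _ = (fun p : P => sqn (of_plane p)) @^-1` `]-oo, m[).
  by rewrite -[X in measurable X]setTI; exact: (measurable_csqn cmeasurable_id measurableT (measurable_itv _)).
by apply/seteqP; split => p /=; rewrite in_itv.
Qed.

(** Against rho d^2z the weight rho^-2 is (1 - |z|^2)^2 / 4, whose radial primitive is - (1 - s^2)^3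
    / 24. This is the source of the cube in [C_const]. *)
Lemma weight_integral (m : R) : 0 < m <= 1 ->
  hint (ebdisc m) (fun z => (rho z ^- 2)%:E) = (pi / 12 * (1 - (1 - m) ^+ 3))%:E.
Proof.
move=> /andP[m0 m1]; pose phi (u : R) : R := if u < m then (1 - u) ^+ 2 / 4 else 0.
have phi0 u : (0 <= (phi u)%:E)%E.
  by rewrite lee_fin /phi; case: ifP => _ //; rewrite divr_ge0// sqr_ge0.
have mphi : measurable_fun setT (fun u : R => (phi u)%:E).
  apply/measurable_EFinP; apply: measurable_fun_ifT => //; first exact: measurable_fun_ltr.
  by apply: measurable_funM => //; apply: measurable_funX; exact: measurable_funB.
rewrite hintE (_ : integral _ _ _ = (\int[@area R]_p (phi (p.1 ^+ 2 + p.2 ^+ 2))%:E)%E); last first.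
  apply: eq_integral => p _; rewrite -EFinM; congr (_%:E).
  rewrite /hweight indicE /phi; case: ifPn => h.
    rewrite mem_set//= mulr1 rhoE; have : 0 < 1 - sqn (of_plane p) by rewrite subr_gt0; exact: lt_le_trans m1.
    by rewrite /sqn /= => h'; field; rewrite gt_eqF.
  by rewrite memNset ?mulr0//=; apply/negP.
rewrite (radial_integral mphi phi0).
have r0 : 0 <= Num.sqrt m by exact: sqrtr_ge0.
have -> : (\int[leb]_(s in `[0%R, +oo[) ((phi (s ^+ 2))%:E * s%:E) =
   \int[leb]_(s in `[0%R, (Num.sqrt m)%R]) (s * (1 - s ^+ 2) ^+ 2 / 4)%R%:E)%E.
  rewrite -integral_itv_bndo_bndc; last first.
    apply: measurable_funTS; apply/measurable_EFinP; apply: measurable_funM => //; apply: measurable_funM => //.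
    by apply: measurable_funX; apply: measurable_funB => //; exact: measurable_funX.
  rewrite integral_mkcond [RHS]integral_mkcond; apply: eq_integral => s _.
  rewrite !patchE /=; have [s0|s0] := leP 0 s; last first.
    by rewrite !memNset//= in_itv/= leNgt s0.
  rewrite mem_set/=; last by rewrite in_itv/= s0.
  rewrite -EFinM /phi.
  have -> : (s ^+ 2 < m) = (s < Num.sqrt m).
    by rewrite -[in LHS](sqr_sqrtr (ltW m0)) ltr_pXn2r// nnegrE.
  case: ifPn => h; first by rewrite mem_set/= ?in_itv/= ?s0//; congr (_%:E); ring.
  by rewrite mul0r memNset//= in_itv/= s0 (negbTE h).
have d (s : R) : is_derive s 1 (fun s : R => - (1 - s ^+ 2) ^+ 3 / 24) (s * (1 - s ^+ 2) ^+ 2 / 4).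
  apply: is_derive_eq.
  rewrite /GRing.scale /= !(subr0, sub0r, mulr1, mul1r, expr1, addr0, add0r, oppr0); by field.
transitivity ((pi *+ 2)%:E * ((- (1 - Num.sqrt m ^+ 2) ^+ 3 / 24) - (- (1 - 0 ^+ 2) ^+ 3 / 24))%:E)%E.
  congr (_ * _)%E; apply: (@FTC_is_derive R (fun s => s * (1 - s ^+ 2) ^+ 2 / 4)) => // s _.
  apply: rcontM; last exact: cvg_cst; apply: rcontM; first exact: cvg_id.
  have h : {for s, continuous (fun s : R => 1 - s ^+ 2)} by apply: rcontB; [exact: cvg_cst|exact: exprn_continuous].
  exact: (rcontM h h).
rewrite sqr_sqrtr ?(ltW m0)// -EFinM; congr (_%:E); rewrite mulr2n.
by field.
Qed.

(** The half angle appears because diag(a, conj a) with |a| = 1 acts as multiplication by a^2. *)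
Lemma rotation_mx (t : R) : exists2 A : 'M[C]_2, SU11 A & forall z, mobius A z = z * cis t.
Proof.
exists (su_mx (cis (t / 2)) 0); first by apply: SU11_mx; rewrite sqn_cis /sqn /= expr0n /= addr0 subr0.
move=> z; have [e00 e01 e10 e11] := su_mxE (cis (t / 2)) (0 : C).
have n0 : (cis (t / 2))^*%C != 0 by rewrite -sqn_eq0 sqnJ sqn_cis oner_eq0.
rewrite /mobius e00 e01 e10 e11 rmorph0 mul0r addr0 add0r.
apply: (mulIf n0); rewrite mulfVK//.
have := sqn_conj (cis (t / 2)); rewrite sqn_cis => h.
rewrite (_ : cis t = cis (t / 2) * cis (t / 2)); last by rewrite -cisD; congr cis; field.
by rewrite -!mulrA -h mulr1 mulrC.
Qed.

(** Tonelli on S times [0, 2 pi]: for each angle the integral over S is that of g, since rotations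
    preserve S and the area. Measurability of the circular mean comes from the same theorem. *)
Lemma rotation_average (S : set C) (g : C -> \bar R) :
  measurable (@of_plane R @^-1` S : set P) -> S `<=` @disc R ->
  (forall z t, S (z * cis t) <-> S z) ->
  measurable_fun setT (fun p : P => g (of_plane p)) -> (forall z, (0 <= g z)%E) ->
  let avg z := (\int[leb]_(t in `[0%R, (pi *+ 2)%R]) g (z * cis t)%R)%E in
  measurable_fun (@of_plane R @^-1` S : set P) (fun p => avg (of_plane p) * (rho (of_plane p))%:E)%E /\
  (hint S g * (pi *+ 2)%:E = hint S avg)%E.
Proof.
move=> mS Sd Srot mg g0 avg.
have mrot : measurable_fun setT (fun x : P * R => to_plane (of_plane x.1 * cis x.2)).
  have mc : measurable_fun setT (fun x : P * R => cos x.2).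
    by apply: (measurableT_comp (f := cos)) => //; exact: continuous_measurable_fun (@continuous_cos R).
  have ms : measurable_fun setT (fun x : P * R => sin x.2).
    by apply: (measurableT_comp (f := sin)) => //; exact: continuous_measurable_fun (@continuous_sin R).
  have m1 : measurable_fun setT (fun x : P * R => x.1.1) by exact: measurableT_comp.
  have m2 : measurable_fun setT (fun x : P * R => x.1.2) by exact: measurableT_comp.
  apply: measurable_fun_pair => /=.
    by apply: measurable_funB; exact: measurable_funM.
  by apply: measurable_funD; exact: measurable_funM.
pose I (t : R) : R := \1_(`[0, pi *+ 2]%classic : set R) t.
have mI : measurable_fun setT I by exact: measurable_indic.
pose G (x : P * R) : \bar R := (g (of_plane x.1 * cis x.2)%R * (hweight S x.1)%:E * (I x.2)%:E)%E.
have mG : measurable_fun setT G.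
  apply: emeasurable_funM; last by apply/measurable_EFinP; exact: (measurableT_comp mI).
  apply: emeasurable_funM; last by apply/measurable_EFinP; exact: (measurableT_comp (measurable_hweight mS)).
  have := measurableT_comp mg mrot; apply: eq_measurable_fun => x _ /=.
  by rewrite of_planeK.
have w0 p : (0 <= (hweight S p)%:E)%E by rewrite lee_fin hweight_ge0.
have I0 t : (0 <= (I t)%:E)%E by rewrite lee_fin /I indicE.
have G0 x : (0 <= G x)%E by rewrite !mule_ge0.
have := @fubini_tonelli _ _ _ _ R (@plane_area R) leb G mG G0.
have -> : (\int[leb]_t \int[@plane_area R]_p G (p, t) = hint S g * (pi *+ 2)%:E)%E.
  have p0 : 0 < pi *+ 2 :> R by rewrite mulrn_wgt0// pi_gt0.
  rewrite (_ : (pi *+ 2)%:E = leb `[0%R, (pi *+ 2)%R]); last first.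
    by rewrite lebesgue_measure_itv/= lte_fin p0 sube0.
  have mi : measurable (`[0%R, (pi *+ 2)%R]%classic : set (measurableTypeR R)) by [].
  rewrite -(integral_cst leb mi (hint S g)) [RHS]integral_mkcond.
  apply: (@eq_integral _ _ _ leb) => t _.
  rewrite patchE /G /= /I indicE; case: (t \in _); last first.
    by rewrite integral0_eq// => p _; rewrite mule0.
  under eq_integral do rewrite mule1.
  rewrite -[LHS](@hintE R S (fun z => g (z * cis t))).
  have [A sA Az] := rotation_mx t.
  rewrite -[RHS](hint_mobius sA mS Sd); [|exact: measurable_funTS|by []].
  rewrite (_ : [set z | _] = S); first by apply: eq_hint => z _; rewrite Az.
  apply/seteqP; split => z /=; rewrite Az; first by move=> [_ /Srot].
  by move=> Sz; split; [exact: Sd|exact/Srot].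
have avgE p : (\int[leb]_t G (p, t) = avg (of_plane p) * (hweight S p)%:E)%E.
have mp : measurable_fun setT (fun t : R => g (of_plane p * cis t)).
    have := measurable_fun_pair2 p (measurableT_comp mg mrot).
    by apply: eq_measurable_fun => t _ /=; rewrite of_planeK.
  rewrite /avg -ge0_integralZr//; last exact: measurable_funTS.
  rewrite [RHS]integral_mkcond; apply: (@eq_integral _ _ _ leb) => t _.
  by rewrite /G /I /= patchE indicE; case: (t \in _); rewrite ?mule1// mule0.
move=> <-; split.
  have := measurable_funTS (D := @of_plane R @^-1` S : set P) (@measurable_fun_fubini_tonelli_F _ _ _ _ R leb G mG G0).
  apply: eq_measurable_fun => p /[!inE] Sp /=.
  by rewrite /fubini_F avgE /hweight indicE mem_set// mulr1.
by rewrite hintE; apply: eq_integral => p _; rewrite avgE.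
Qed.

(** The submean inequality on each circle, weighted by the radial function rho^-2 and integrated;
    both sides are multiplied by 2 pi so that the circular means need no normalization. *)
Lemma hint_submean (f : C -> C) (m : R) : (forall z, disc z -> derivable f z 1) -> 0 < m <= 1 ->
  ((sqn (f 0))%:E * (pi / 12 * (1 - (1 - m) ^+ 3))%:E <=
   hint (ebdisc m) (fun z => (sqn (f z) * rho z ^- 2)%:E))%E.
Proof.
move=> df m01; have /andP[m0 m1] := m01; have Sd := ebdisc_disc m1.
(* Extension by 0, since nothing is known about f outside the disc and the averaging lemma asks for
   measurability on the plane. *)
pose g (z : C) : \bar R := if normc z < 1 then (sqn (f z) * rho z ^- 2)%:E else 0%E.
have g0 z : (0 <= g z)%E.
  by rewrite /g; case: ifP => // _; rewrite lee_fin mulr_ge0 ?sqn_ge0 ?invr_ge0 ?exprn_ge0 ?rho_ge0.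
have mg : measurable_fun setT (fun p : P => g (of_plane p)).
  rewrite (_ : (fun p : P => _) = (fun p : P => (sqn (f (of_plane p)) * rho (of_plane p) ^- 2)%:E) \_ (@of_plane R @^-1` @disc R)).
    apply/(measurable_restrictT _ measurable_disc)/measurable_EFinP/measurable_funM.
      have [h1 h2] := @ccontinuous_measurable R (@disc R) f (@open_disc R) (fun z zd => cderive_continuous (df z zd)).
      by apply: measurable_funD; apply: measurable_funX.
    apply: measurable_funTS; apply: (measurableT_comp measurable_inv); apply: measurable_funX; exact: measurable_rho.
  apply/funext => p; rewrite patchE /g; case: ifPn => h; first by rewrite mem_set.
  by rewrite memNset//=; apply/negP.
have p0 : 0 < pi *+ 2 :> R by rewrite mulrn_wgt0// pi_gt0.
rewrite -(weight_integral m01) (_ : hint _ (fun z => (sqn (f z) * _)%:E) = hint (ebdisc m) g); last first.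
  by apply: eq_hint => z /Sd zd; rewrite /g ifT.
rewrite -(@lee_pmul2r _ (pi *+ 2)%:E) ?fin_numE ?lte_fin//.
have [|mavg ->] := rotation_average (measurable_ebdisc m) Sd _ mg g0.
  by move=> z t; rewrite /ebdisc /= sqnM sqn_cis mulr1.
have mr : measurable_fun setT (fun p : P => (rho (of_plane p) ^- 2)%:E).
  apply/measurable_EFinP; apply: (measurableT_comp measurable_inv); apply: measurable_funX; exact: measurable_rho.
have c0 : 0 <= sqn (f 0) * (pi *+ 2) by rewrite mulr_ge0 ?sqn_ge0// ltW.
have -> : ((sqn (f 0))%:E * hint (ebdisc m) (fun z => (rho z ^- 2)%:E) * (pi *+ 2)%:E =
    hint (ebdisc m) (fun z => (sqn (f 0) * (pi *+ 2) * rho z ^- 2)%:E))%E.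
  rewrite muleAC -EFinM /hint -ge0_integralZl//=.
  - by apply: eq_integral => p _; rewrite muleA EFinM.
  - exact: measurable_ebdisc.
  - apply: measurable_funTS; apply: emeasurable_funM => //; apply/measurable_EFinP; exact: measurable_rho.
  - by move=> p _; rewrite -EFinM lee_fin mulr_ge0 ?rho_ge0// invr_ge0 exprn_ge0// rho_ge0.
have avg z : ebdisc m z -> (\int[leb]_(t in `[0%R, (pi *+ 2)%R]) g (z * cis t)%R =
    (\int[leb]_(t in `[0%R, (pi *+ 2)%R]) sqn (f (z * cis t)) * rho z ^- 2)%R%:E)%E.
  move=> /Sd zd.
  have ir : leb.-integrable `[0, pi *+ 2] (EFin \o (fun t => sqn (f (z * cis t)))).
    by apply: continuous_integrable => t _; exact: sqn_circle_continuous.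
  rewrite EFinM -[X in (X%:E * _)%E]/(fine _) fineK; last first.
    exact: (integrable_fin_num _ ir).
  rewrite -ge0_integralZr//.
  - apply: eq_integral => t _.
    have nz : normc (z * cis t) = normc z.
      by rewrite normcM (_ : normc (cis t) = 1) ?mulr1//= cos2Dsin2 sqrtr1.
    by rewrite /g nz ifT//= EFinM /rho nz.
  - exact: (measurable_int _ ir).
  - by move=> t _; rewrite lee_fin sqn_ge0.
  - by rewrite lee_fin invr_ge0 exprn_ge0// rho_ge0.
rewrite [leRHS](eq_hint avg) /hint; apply: ge0_le_integral.
- exact: measurable_ebdisc.
- by move=> p _; rewrite -EFinM lee_fin mulr_ge0 ?rho_ge0// mulr_ge0// invr_ge0 exprn_ge0// rho_ge0.
- apply: measurable_funTS; apply: emeasurable_funM; last by apply/measurable_EFinP; exact: measurable_rho.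
  by under eq_fun do rewrite EFinM; exact: measurable_funeM.
- apply: eq_measurable_fun mavg => p /[!inE] /avg -> //.
- move=> p /= /Sd zd; rewrite -!EFinM lee_fin; apply: ler_wpM2r; first exact: rho_ge0.
  by apply: ler_wpM2r; [rewrite invr_ge0 exprn_ge0// rho_ge0|exact: submean_sqn].
Qed.
End SubmeanWeight.

(** * Hyperbolic distance and injectivity radius *)

Section Hdist.
Context {R : realType}.
Local Notation C := R[i].
Local Notation leb := (@lebesgue_measure R).
Implicit Types (z w : C) (c : R -> C).

Lemma linear_is_derive (f : R -> R) (t l : R) :
  (forall e : R, 0 < e -> exists2 r : R, 0 < r & forall h : R, `|h| < r ->
    `|f (t + h) - f t - l * h| <= e * `|h|) -> is_derive t 1 f l.
Proof.
move=> H.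
have cv : (fun h : R => h^-1 *: ((f \o shift t) (h *: 1) - f t)) @ 0^' --> l.
  apply/cvgrPdist_le => e e0; have [r r0 Hr] := H e e0.
  apply/nbhs_ballP; exists r => //= h; rewrite /ball /= sub0r normrN => hr h0.
  rewrite distrC /GRing.scale /= mulr1 -(@ler_pM2r _ `|h|) ?normr_gt0// -normrM mulrBl mulrAC mulVf// mul1r addrC.
  by rewrite (addrC h); have := Hr h hr; rewrite addrC.
by split; [apply/cvg_ex; exists l|exact: (cvg_lim _ cv)].
Qed.

Lemma path_comp_linear (g : C -> C) c (t a b : R) (l : C) : is_derive (c t) 1 g l ->
  is_derive t 1 (fun s => complex.Re (c s)) a -> is_derive t 1 (fun s => complex.Im (c s)) b ->
  forall e : R, 0 < e -> exists2 r : R, 0 < r & forall h : R, `|h| < r ->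
    normc (g (c (t + h)) - g (c t) - l * (a +i* b) * h%:C) <= e * `|h|.
Proof.
move=> dg da db e e0.
have [l0 k0] := (normc_ge0 l, normc_ge0 (a +i* b)).
pose d := Num.min (e / 4 / (normc l + 1)) 1.
have d0 : 0 < d by rewrite lt_min ltr01 !divr_gt0// ltr_pwDr.
have [de d1] : d <= e / 4 / (normc l + 1) /\ d <= 1 by rewrite !ge_min !lexx orbT.
clearbody d.
pose M := normc (a +i* b) + 2.
have M0 : 0 < M by rewrite /M ltr_pwDr.
have eM : 0 < e / 2 / M by rewrite !divr_gt0.
have [r1 r10 H1] := is_derive_linear da d0.
have [r2 r20 H2] := is_derive_linear db d0.
have [r3 r30 H3] := cderive_linear dg eM.
exists (Num.min (Num.min r1 r2) (r3 / M)); first by rewrite !lt_min r10 r20 divr_gt0.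
move=> h; rewrite !lt_min => /andP[/andP[q1 q2] q3].
have g1 := H1 h q1; have g2 := H2 h q2.
set k := c (t + h) - c t.
have hk : normc (k - (a +i* b) * h%:C) <= 2 * d * `|h|.
  apply: (le_trans (normc_le_abs _)).
  have -> : complex.Re (k - (a +i* b) * h%:C) = complex.Re (c (t + h)) - complex.Re (c t) - a * h.
    by rewrite /k; case: (c (t + h)) (c t) => ? ? [? ?] /=; ring.
  have -> : complex.Im (k - (a +i* b) * h%:C) = complex.Im (c (t + h)) - complex.Im (c t) - b * h.
    by rewrite /k; case: (c (t + h)) (c t) => ? ? [? ?] /=; ring.
  have -> : 2 * d * `|h| = d * `|h| + d * `|h| by ring.
  exact: lerD.
have nh : normc h%:C = `|h| by rewrite /= expr0n /= addr0 sqrtr_sqr.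
have nk : normc k <= M * `|h|.
  rewrite -[k](subrK ((a +i* b) * h%:C)); apply: (le_trans (le_normcD _ _)).
  rewrite normcM nh /M mulrDl addrC lerD2l; apply: (le_trans hk).
  by rewrite ler_wpM2r// ler_piMr.
have kr : normc k < r3.
  by apply: (le_lt_trans nk); rewrite mulrC -ltr_pdivlMr.
have := H3 k kr; rewrite (_ : c t + k = c (t + h)); last by rewrite /k; ring.
move=> g3.
have -> : g (c (t + h)) - g (c t) - l * (a +i* b) * h%:C =
  (g (c (t + h)) - g (c t) - l * k) + l * (k - (a +i* b) * h%:C) by ring.
apply: (le_trans (le_normcD _ _)).
have -> : e * `|h| = e / 2 / M * (M * `|h|) + e / 2 * `|h| by field; rewrite gt_eqF.
apply: lerD; first by apply: (le_trans g3); rewrite ler_wpM2l// ltW.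
rewrite normcM; apply: (@le_trans _ _ (normc l * (2 * d * `|h|))).
  by apply: ler_wpM2l.
rewrite !mulrA; apply: ler_wpM2r => //.
have -> : e / 2 = (normc l + 1) * 2 * (e / 4 / (normc l + 1)) by field; rewrite gt_eqF// ltr_pwDr.
apply: ler_pM => //; first by rewrite mulr_ge0.
  exact: ltW.
by rewrite ler_wpM2r// lerDl.
Qed.

Lemma path_comp_derive (g : C -> C) c (t a b : R) (l : C) : is_derive (c t) 1 g l ->
  is_derive t 1 (fun s => complex.Re (c s)) a -> is_derive t 1 (fun s => complex.Im (c s)) b ->
  is_derive t 1 (fun s => complex.Re (g (c s))) (complex.Re (l * (a +i* b))) /\
  is_derive t 1 (fun s => complex.Im (g (c s))) (complex.Im (l * (a +i* b))).
Proof.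
move=> dg da db; have H := path_comp_linear dg da db.
have E (z : C) (h : R) : complex.Re (z * h%:C) = complex.Re z * h /\ complex.Im (z * h%:C) = complex.Im z * h.
  by case: z => x y /=; split; ring.
split; apply: linear_is_derive => e /H[r r0 Hr]; exists r => // h /Hr; apply: le_trans.
  apply: le_trans (abs_Re_le _); rewrite raddfB /= raddfB /=.
  by have [-> _] := E (l * (a +i* b)) h.
apply: le_trans (abs_Im_le _); rewrite raddfB /= raddfB /=.
by have [_ ->] := E (l * (a +i* b)) h.
Qed.

Lemma sqrt_rho z : disc z -> Num.sqrt (rho z) = 2 / (1 - sqn z).
Proof.
move=> /disc_sqn zd; rewrite rhoE (_ : 4 / _ = (2 / (1 - sqn z)) ^+ 2).
  by rewrite sqrtr_sqr ger0_norm// divr_ge0// subr_ge0 ltW.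
by field; rewrite gt_eqF// subr_gt0.
Qed.

(** 2 artanh x, the hyperbolic distance from 0 to a point of modulus x. *)
Definition ell (x : R) : R := ln (1 + x) - ln (1 - x).

Lemma is_derive_ell (f : R -> R) (t d : R) : `|f t| < 1 -> is_derive t 1 f d ->
  is_derive t 1 (fun s => ell (f s)) (2 * d / (1 - f t ^+ 2)).
Proof.
rewrite ltr_norml => /andP[f1 f2] df.
have p1 : 0 < 1 + f t by lra.
have p2 : 0 < 1 - f t by lra.
have l1 := is_derive1_ln p1; have l2 := is_derive1_ln p2.
have d1 : is_derive t 1 (fun s : R => 1 + f s : R) d.
  by have := is_deriveD (is_derive_cst (1 : R) t 1) df; rewrite add0r.
have d2 : is_derive t 1 (fun s : R => 1 - f s : R) (- d).
  by have := is_deriveB (is_derive_cst (1 : R) t 1) df; rewrite sub0r.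
have c1 : is_derive t 1 (fun s : R => ln (1 + f s)) ((1 + f t)^-1 * d).
  by apply: (@is_derive1_comp _ (@ln R) (fun s : R => 1 + f s)).
have c2 : is_derive t 1 (fun s : R => ln (1 - f s)) ((1 - f t)^-1 * - d).
  by apply: (@is_derive1_comp _ (@ln R) (fun s : R => 1 - f s)).
have := is_deriveB c1 c2; rewrite (_ : (1 + f t)^-1 * d - _ = 2 * d / (1 - f t ^+ 2))//.
rewrite (_ : 1 - f t ^+ 2 = (1 + f t) * (1 - f t)); last by ring.
by field; rewrite !gt_eqF.
Qed.

Lemma path_continuous c (t : R) : rderivable c t -> {for t, continuous c}.
Proof.
move=> [/derivable1_diffP/differentiable_continuous c1 /derivable1_diffP/differentiable_continuous c2].
have : {for t, continuous (fun s => of_plane (complex.Re (c s), complex.Im (c s)) : C)}.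
  apply: (@continuous_comp _ _ _ (fun s : R => (complex.Re (c s), complex.Im (c s)) : R * R)).
    exact: (cvg_pair c1 c2).
  exact: continuous_of_planeP.
by rewrite (_ : (fun s => of_plane _) = c)//; apply/funext => s; rewrite /of_plane /=; case: (c s).
Qed.

Lemma unit_rotation (w : C) : exists2 k : C, sqn k = 1 & k * w = (normc w)%:C.
Proof.
have [->|w0] := eqVneq w 0.
  by exists 1; rewrite ?mulr0 /sqn /= ?expr0n ?expr1n /= ?addr0 ?sqrtr0.
have n0 : 0 < normc w by rewrite lt0r normc_ge0 andbT; apply: contra w0 => /eqP/eq0_normc ->.
exists (w^*%C / (normc w)%:C).
  rewrite sqnM sqnV sqnJ -!normc_sqn (_ : normc (normc w)%:C = normc w); last first.
    by rewrite /= expr0n /= addr0 sqrtr_sqr ger0_norm// normc_ge0.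
  by rewrite divff// expf_neq0// gt_eqF.
rewrite mulrAC (mulrC _ w) -sqn_conj -normc_sqn.
by rewrite -fmorphV -rmorphM /= expr2 mulfK// gt_eqF.
Qed.

(** After z is moved to 0 and the end rotated onto the positive axis, the path is projected to the
    real axis. The projection decreases both the Euclidean speed and the conformal factor, and its
    signed hyperbolic speed integrates to [ell] of the endpoint. *)
Lemma hlength_ge z w c : disc z -> disc w -> C1_path z w c ->
  ell (normc (mobius (shift_mx z)^-1 w)) <= hlength c.
Proof.
move=> zd wd [dc cd c0 c1]; set B := (shift_mx z)^-1.
have sB : SU11 B by apply/SU11V/SU11_shift.
have [k k1 kw] := unit_rotation (mobius B w).
(* The real part is used instead of the modulus because it stays differentiable when the path passes
   through 0. *)
pose x (t : R) : R := complex.Re (k * mobius B (c t)).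
pose y (t : R) : R := 2 * complex.Re (k * (den B (c t) ^- 2 * rderive c t)) / (1 - x t ^+ 2).
have xn (t : R) : 0 <= t <= 1 -> `|x t| <= normc (mobius B (c t)).
  move=> t01; apply: (le_trans (abs_Re_le _)); rewrite normcM.
  by rewrite (_ : normc k = 1) ?mul1r//; apply/eqP; rewrite -(eqrXn2 (_ : (0 < 2)%N)) ?normc_ge0// normc_sqn k1 expr1n.
have x1 (t : R) : 0 <= t <= 1 -> `|x t| < 1.
  move=> t01; apply: (le_lt_trans (xn t t01)); exact: (mobius_disc sB (cd t t01)).
have dx (t : R) : 0 <= t <= 1 -> is_derive t 1 x (complex.Re (k * (den B (c t) ^- 2 * rderive c t))).
  move=> t01; have [[d1 d2] _] := dc t; have ctd := cd t t01.
  have dm := is_derive_mobius sB ctd.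
  have dk : is_derive (c t) 1 (fun u => k * mobius B u) (k * den B (c t) ^- 2).
    exact: (@is_deriveZ _ _ _ (mobius B) k).
  have := (path_comp_derive dk (derivableP d1) (derivableP d2)).1.
  by rewrite -mulrA /rderive !derive1E.
have dG (t : R) : 0 <= t <= 1 -> is_derive t 1 (fun s => ell (x s)) (y t).
  by move=> t01; apply: is_derive_ell; [exact: x1|exact: dx].
have px (t : R) : 0 <= t <= 1 -> 0 < 1 - x t ^+ 2.
  move=> t01; rewrite subr_gt0 -[x t ^+ 2]real_normK ?num_real// expr_lt1//; exact: x1.
have cc t : {for t, continuous c} by apply: path_continuous; have [] := dc t.
have cy (t : R) : 0 <= t <= 1 -> {for t, continuous y}.
  move=> t01; have [_ cr] := dc t; have ctd := cd t t01.
  have cB : {for t, continuous (fun s => (den B (c s))^-1)}.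
    apply: (@continuous_comp _ _ _ (fun s => den B (c s)) (fun u : C => u^-1)).
      apply: ccontD; last exact: ccont_cst.
      apply: ccontM; first exact: ccont_cst; exact: cc.
    by apply: inv_continuous; exact: den_neq0.
  have cRe (f : R -> C) : {for t, continuous f} -> {for t, continuous (fun s => complex.Re (f s))}.
    by move=> cf; apply: (@continuous_comp _ _ _ f (fun z => complex.Re z)) => //; exact: continuous_Re.
  have cx : {for t, continuous x}.
    by have [dx' _] := dx t t01; apply: differentiable_continuous; exact/derivable1_diffP.
  apply: rcontM; last first.
    apply: rcontV; first by rewrite gt_eqF// px.
    by apply: rcontB; [exact: rcont_cst|exact: (rcontM cx cx)].
  apply: rcontM; first exact: rcont_cst.
  apply: cRe; apply: ccontM; first exact: ccont_cst.
  apply: ccontM; last exact: cr.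
  rewrite (_ : (fun s => _) = (fun s => (den B (c s))^-1 * (den B (c s))^-1)); first exact: ccontM.
  by apply/funext => s; rewrite expr2 invfM.
have cspeed (t : R) : 0 <= t <= 1 -> {for t, continuous (fun t => 2 / (1 - sqn (c t)) * normc (rderive c t))}.
  move=> t01; have [_ cr] := dc t; have /disc_sqn ctd := cd t t01.
  apply: rcontM.
    apply: rcontM; first exact: rcont_cst.
    apply: rcontV; first by rewrite gt_eqF// subr_gt0.
    by apply: rcontB; [exact: rcont_cst|apply: rcont_sqn; exact: cc].
  by apply: (@continuous_comp _ _ _ (rderive c) (@normc R)) => //; exact: continuous_normc.
have -> : ell (normc (mobius B w)) = \int[leb]_(t in `[0, 1]) y t.
  rewrite /Rintegral (FTC_is_derive ler01 dG cy) /=.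
  rewrite /x c1 c0 kw shift0_mobius// mulr0 /=.
  by rewrite (_ : ell 0 = 0) ?subr0// /ell addr0 subr0 subrr.
have -> : hlength c = \int[leb]_(t in `[0, 1]) (2 / (1 - sqn (c t)) * normc (rderive c t)).
  rewrite /hlength; apply: eq_Rintegral => t /[!inE] /=; rewrite in_itv/= => t01.
  by rewrite sqrt_rho//; exact: cd.
apply: le_Rintegral => //; [exact: continuous_integrable|exact: continuous_integrable|].
move=> t t01'; have t01 : 0 <= t <= 1 by move: t01'; rewrite /= in_itv.
have ctd := cd t t01; have pt := px t t01; have /disc_sqn c1' := ctd.
have f1 : 0 < 1 - sqn (mobius B (c t)) by rewrite subr_gt0; apply/disc_sqn; exact: mobius_disc.
have dp := sqn_den_gt0 sB ctd.
apply: (le_trans (ler_norm _)); rewrite /y normrM normfV (gtr0_norm pt) normrM (@ger0_norm _ 2)//.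
apply: (@le_trans _ _ (2 * normc (den B (c t) ^- 2 * rderive c t) / (1 - sqn (mobius B (c t))))).
  apply: ler_pM.
  - by rewrite mulr_ge0.
  - by rewrite invr_ge0 ltW.
  - rewrite ler_wpM2l//; apply: (le_trans (abs_Re_le _)); rewrite normcM.
    by rewrite (_ : normc k = 1) ?mul1r//; apply/eqP; rewrite -(eqrXn2 (_ : (0 < 2)%N)) ?normc_ge0// normc_sqn k1 expr1n.
  - rewrite lef_pV2 ?posrE// lerD2l lerN2 -normc_sqn -[x t ^+ 2]real_normK ?num_real//.
    by rewrite ler_pXn2r ?nnegrE ?normc_ge0//; exact: xn.
rewrite normcM mobius_sqn// (_ : normc (den B (c t) ^- 2) = (sqn (den B (c t)))^-1); last first.
  apply/eqP; rewrite -(eqrXn2 (_ : (0 < 2)%N)) ?normc_ge0 ?invr_ge0 ?sqn_ge0// normc_sqn sqnV.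
  by rewrite expr2 sqnM -expr2 exprVn.
move: (normc (rderive c t)) => N; rewrite le_eqVlt; apply/orP; left; apply/eqP.
by field; rewrite !gt_eqF// subr_gt0.
Qed.
Lemma normc_unit (k : C) : sqn k = 1 -> normc k = 1.
Proof.
by move=> k1; apply/eqP; rewrite -(eqrXn2 (_ : (0 < 2)%N)) ?normc_ge0// normc_sqn k1 expr1n.
Qed.

Lemma ell_expR (x : R) : 0 <= x < 1 -> (expR (ell x) - 1) / (expR (ell x) + 1) = x.
Proof.
move=> /andP[x0 x1]; have p1 : 0 < 1 + x by lra.
have p2 : 0 < 1 - x by lra.
rewrite /ell expRD expRN !lnK ?posrE//; field.
by rewrite !gt_eqF// addr_gt0.
Qed.

(** The diameter of the disc in the parametrization tanh(la t / 2), of constant hyperbolic speed la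
    = d(z, w), carried to z and w by a rotation and [shift_mx z]. The formula is defined and smooth
    for all real t, as [C1_path] demands. *)
Lemma geodesic z w : disc z -> disc w ->
  exists2 c, C1_path z w c & hlength c = ell (normc (mobius (shift_mx z)^-1 w)).
Proof.
move=> zd wd; have sS := SU11_shift zd.
set bw := mobius _ w; have bd : disc bw by apply: mobius_disc => //; exact: SU11V.
have [k k1 kw] := unit_rotation bw; set d := normc bw in kw *.
have d01 : 0 <= d < 1 by rewrite normc_ge0.
pose la := ell d; pose E (t : R) := expR (la * t).
pose th (t : R) : R := (E t - 1) / (E t + 1).
have Ep t : 0 < E t by exact: expR_gt0.
have E1 t : 0 < E t + 1 by rewrite addr_gt0.
pose dth (t : R) : R := la * 2 * E t / (E t + 1) ^+ 2.
have dE (t : R) : is_derive t 1 E (la * E t).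
  rewrite /E; apply: is_derive_eq; rewrite /GRing.scale /= mulr1; ring.
have dthP (t : R) : is_derive t 1 th (dth t).
  have n1 := lt0r_neq0 (E1 t).
  have h1 : is_derive t 1 (fun s : R => E s - 1 : R) (la * E t).
    by have := is_deriveB (dE t) (is_derive_cst (1 : R) t 1); rewrite subr0.
  have h2 : is_derive t 1 (fun s : R => E s + 1 : R) (la * E t).
    by have := is_deriveD (dE t) (is_derive_cst (1 : R) t 1); rewrite addr0.
  have h3 := @is_deriveV R (fun s => E s + 1) t _ 1 n1 h2.
  have := is_deriveM h1 h3; rewrite (_ : _ *: _ + _ *: _ = dth t)//.
  rewrite /dth /GRing.scale /=; field => //.
have th1 t : 1 - th t ^+ 2 = 4 * E t / (E t + 1) ^+ 2 by rewrite /th; field; rewrite gt_eqF.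
have thlt t : sqn ((th t)%:C) < 1.
  by rewrite /sqn /= expr0n /= addr0 -subr_gt0 th1 divr_gt0 ?mulr_gt0// exprn_gt0.
pose u : C := k^*%C.
have u1 : sqn u = 1 by rewrite sqnJ.
pose c0 (t : R) : C := u * (th t)%:C.
have c0d t : disc (c0 t) by apply/disc_sqn; rewrite sqnM u1 mul1r.
have mulCr (a : C) (x : R) : a * x%:C = (complex.Re a * x) +i* (complex.Im a * x).
  by case: a => a b; apply/eqP; rewrite eq_complex /= !mulr0 subr0 add0r !eqxx.
have Re0 (t : R) : is_derive t 1 (fun s => complex.Re (c0 s)) (complex.Re u * dth t).
  rewrite (_ : (fun s => _) = (fun s => complex.Re u * th s)); first exact: (is_deriveZ (complex.Re u) (dthP t)).
  by apply/funext => s; rewrite /c0 mulCr.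
have Im0 (t : R) : is_derive t 1 (fun s => complex.Im (c0 s)) (complex.Im u * dth t).
  rewrite (_ : (fun s => _) = (fun s => complex.Im u * th s)); first exact: (is_deriveZ (complex.Im u) (dthP t)).
  by apply/funext => s; rewrite /c0 mulCr.
pose S := shift_mx z; pose c (t : R) := mobius S (c0 t).
pose v (t : R) : C := den S (c0 t) ^- 2 * (u * (dth t)%:C).
have dc (t : R) : is_derive t 1 (fun s => complex.Re (c s)) (complex.Re (v t)) /\
    is_derive t 1 (fun s => complex.Im (c s)) (complex.Im (v t)).
  have := path_comp_derive (is_derive_mobius sS (c0d t)) (Re0 t) (Im0 t).
  by rewrite -mulCr.
have rc t : rderive c t = v t.
  have [h1 h2] := dc t; rewrite /rderive !derive1E.
  by rewrite (@derive_val _ _ _ _ _ _ _ h1) (@derive_val _ _ _ _ _ _ _ h2); case: (v t).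
have contE (t : R) : {for t, continuous E}.
  by have [h _] := dE t; apply: differentiable_continuous; exact/derivable1_diffP.
have contD (f f' : R -> R) (t : R) : is_derive t 1 f (f' t) -> {for t, continuous (fun s => (f s)%:C)}.
  move=> [h _]; apply: path_continuous; split => //=; exact: derivable_cst.
have cden (t : R) : {for t, continuous (fun s => (den S (c0 s))^-1)}.
  apply: (@continuous_comp _ _ _ (fun s => den S (c0 s)) (fun x : C => x^-1)).
    apply: ccontD; last exact: ccont_cst.
    apply: ccontM; first exact: ccont_cst.
    apply: ccontM; first exact: ccont_cst; exact: (contD _ _ _ (dthP t)).
  by apply: inv_continuous; exact: den_neq0.
have dthE t : (dth t)%:C = (2 * (E t))%:C * (la / (E t + 1))%:C * (E t + 1)^-1%:C.
  by rewrite -!rmorphM /dth; congr (_%:C); field; rewrite gt_eqF.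
have cv (t : R) : {for t, continuous v}.
  apply: ccontM.
    rewrite (_ : (fun s => _) = (fun s => (den S (c0 s))^-1 * (den S (c0 s))^-1)); first exact: ccontM.
    by apply/funext => s; rewrite expr2 invfM.
  apply: ccontM; first exact: ccont_cst.
  have cE : {for t, continuous E} by have [h _] := dE t; apply: differentiable_continuous; exact/derivable1_diffP.
  have cd : {for t, continuous dth}.
    apply: rcontM; first by apply: rcontM; [exact: rcont_cst|exact: cE].
    have h : {for t, continuous (fun s => E s + 1)} by apply: rcontD; [exact: cE|exact: rcont_cst].
    apply: rcontV; last exact: (rcontM h h).
    by rewrite expf_neq0// gt_eqF.
  apply: (@continuous_comp _ _ _ dth (fun x : R => x%:C)); first exact: cd.
  by apply: path_continuous; split => /=; [exact: derivable_id|exact: derivable_cst].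
exists c.
  split.
  - move=> t; have [[h1 _] [h2 _]] := dc t; split; first by split.
    have -> : rderive c = v by apply/funext => s; exact: rc.
    exact: cv.
  - by move=> t _; apply: mobius_disc.
  - by rewrite /c /c0 /th /E mulr0 expR0 subrr mul0r mulr0 mobius_shift0.
  - rewrite /c /c0 /th /E mulr1 ell_expR// /u -kw mulrA (mulrC _ k) -sqn_conj k1 mul1r.
    by rewrite /bw mobiusVK.
rewrite /hlength (_ : \int[leb]_(t in `[0, 1]) _ = \int[leb]_(t in `[(0 : R), 1]) la).
  rewrite Rintegral_cst// -[X in fine X]/(lebesgue_measure _) lebesgue_measure_itv/=.
  by rewrite lte_fin ltr01 /= oppr0 addr0 mulr1.
apply: eq_Rintegral => t _; rewrite rc sqrt_rho; last exact: mobius_disc.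
rewrite /c mobius_sqn// /v normcM (_ : normc (den S (c0 t) ^- 2) = (sqn (den S (c0 t)))^-1); last first.
  apply/eqP; rewrite -(eqrXn2 (_ : (0 < 2)%N)) ?normc_ge0 ?invr_ge0 ?sqn_ge0// normc_sqn sqnV.
  by rewrite expr2 sqnM -expr2 exprVn.
rewrite normcM (normc_unit u1) mul1r (_ : 1 - sqn (c0 t) = 4 * E t / (E t + 1) ^+ 2); last first.
  by rewrite sqnM u1 mul1r /sqn /= expr0n /= addr0 th1.
have la0 : 0 <= la.
  have /andP[d0 d1] := d01; rewrite /la /ell subr_ge0 ler_ln ?posrE; lra.
rewrite (_ : normc (dth t)%:C = dth t); last first.
  rewrite /= expr0n /= addr0 sqrtr_sqr ger0_norm// /dth divr_ge0// ?exprn_ge0// ?(ltW (E1 t))//.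
  by rewrite !mulr_ge0// ltW.
have dp := sqn_den_gt0 sS (c0d t).
by rewrite /dth; field; rewrite !gt_eqF.
Qed.

Lemma hdistE z w : disc z -> disc w ->
  hdist z w = ell (normc (mobius (shift_mx z)^-1 w)).
Proof.
move=> zd wd; have [c pc hc] := geodesic zd wd.
have lb : lbound [set hlength c | c in C1_path z w] (ell (normc (mobius (shift_mx z)^-1 w))).
  by move=> _ [c' pc' <-]; exact: hlength_ge.
apply/eqP; rewrite eq_le; apply/andP; split.
  by rewrite -hc; apply: ge_inf; [exists (ell (normc (mobius (shift_mx z)^-1 w)))|exists c].
by apply: lb_le_inf => //; exists (hlength c), c.
Qed.
End Hdist.

(** * Distance as a function of the point-pair invariant *)

Section Metric.
Context {R : realType}.
Local Notation C := R[i].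
Implicit Types z w : C.

Lemma sigma_ge0 z w : disc z -> disc w -> 0 <= sigma z w.
Proof.
move=> /disc_sqn z1 /disc_sqn w1; rewrite divr_ge0 ?sqn_ge0// mulr_ge0// subr_ge0 ltW//.
Qed.

Lemma sigma_shift z w : disc z -> disc w ->
  sigma z w = sqn (mobius (shift_mx z)^-1 w) / (1 - sqn (mobius (shift_mx z)^-1 w)).
Proof.
move=> zd wd; have sB := SU11V (SU11_shift zd).
by rewrite -(sigma_mobius sB zd wd) shift0_mobius// /sigma sub0r sqnN {2}/sqn /= expr0n /= addr0 subr0 mul1r.
Qed.

(** For s = sinh^2(d / 2) the quotient s / (1 + s) is tanh^2(d / 2), so this recovers d; it is
    increasing, and distance inequalities turn into inequalities for [sigma]. *)
Definition arsigma (s : R) : R := ell (Num.sqrt (s / (1 + s))).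

Lemma arsigma_sqr (x : R) : 0 <= x < 1 -> arsigma (x ^+ 2 / (1 - x ^+ 2)) = ell x.
Proof.
move=> /andP[x0 x1]; have x2 : 0 < 1 - x ^+ 2 by rewrite subr_gt0 expr_lt1.
rewrite /arsigma (_ : _ / (1 + _) = x ^+ 2); first by rewrite sqrtr_sqr ger0_norm.
by field; rewrite subrK oner_eq0 gt_eqF.
Qed.

Lemma hdist_sigma z w : disc z -> disc w -> hdist z w = arsigma (sigma z w).
Proof.
move=> zd wd; rewrite sigma_shift// -normc_sqn arsigma_sqr ?hdistE// normc_ge0/=.
by apply: mobius_disc => //; exact: SU11V (SU11_shift zd).
Qed.

Lemma ell_lt (x y : R) : 0 <= x < 1 -> 0 <= y < 1 -> (ell x < ell y) = (x < y).
Proof.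
move=> /andP[x0 x1] /andP[y0 y1].
have mono (u v : R) : 0 <= u -> v < 1 -> u < v -> ell u < ell v.
  move=> u0 v1 uv; rewrite /ell.
  have h1 : ln (1 + u) < ln (1 + v) by rewrite ltr_ln ?posrE; lra.
  have h2 : ln (1 - v) < ln (1 - u) by rewrite ltr_ln ?posrE; lra.
  lra.
case: (ltgtP x y) => [h|h|->]; last by rewrite ltxx.
  exact: mono.
by apply/negbTE; rewrite -leNgt ltW// mono.
Qed.

Lemma sqrt_sigma_lt1 (s : R) : 0 <= s -> 0 <= Num.sqrt (s / (1 + s)) < 1.
Proof.
move=> s0; have s1 : 0 < 1 + s by rewrite ltr_pwDl.
rewrite sqrtr_ge0 /= -[ltRHS]sqrtr1 ltr_sqrt// ltr_pdivrMr// mul1r; lra.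
Qed.

Lemma arsigma_lt (s t : R) : 0 <= s -> 0 <= t -> (arsigma s < arsigma t) = (s < t).
Proof.
move=> s0 t0; rewrite ell_lt ?sqrt_sigma_lt1//.
have s1 : 0 < 1 + s by rewrite ltr_pwDl.
have t1 : 0 < 1 + t by rewrite ltr_pwDl.
rewrite !sqrtrM// !sqrtrV ?(ltW s1) ?(ltW t1)//.
rewrite -!sqrtrV ?(ltW s1) ?(ltW t1)// -!sqrtrM//.
have [t00|tp] := eqVneq t 0.
  by rewrite t00 mul0r sqrtr0 !ltNge sqrtr_ge0 s0.
rewrite ltr_sqrt; last by rewrite divr_gt0// lt0r tp.
by rewrite ltr_pdivrMr// mulrAC ltr_pdivlMr// !mulrDr !mulr1 (mulrC t s) ltrD2r.
Qed.

Lemma arsigma_inj (s t : R) : 0 <= s -> 0 <= t -> arsigma s = arsigma t -> s = t.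
Proof.
move=> s0 t0 E; have := arsigma_lt s0 t0; have := arsigma_lt t0 s0; rewrite E ltxx.
by case: (ltgtP s t).
Qed.

Lemma arsigma_le (s t : R) : 0 <= s -> 0 <= t -> s <= t -> arsigma s <= arsigma t.
Proof. by move=> s0 t0; rewrite !leNgt arsigma_lt. Qed.

(** tanh(r / 2), the Euclidean radius of the hyperbolic ball of radius r about 0. *)
Definition thalf (r : R) : R := (expR r - 1) / (expR r + 1).

Lemma thalf_itv (r : R) : 0 <= r -> 0 <= thalf r < 1.
Proof.
move=> r0; have e1 : 1 <= expR r by rewrite -expR0 ler_expR.
by rewrite /thalf divr_ge0 ?ltr_pdivrMr; lra.
Qed.

Lemma ell_thalf (r : R) : ell (thalf r) = r.
Proof.
have ep : 0 < expR r := expR_gt0 r.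
have e1 : 0 < expR r + 1 by lra.
have n1 := lt0r_neq0 e1.
rewrite /ell /thalf (_ : 1 + _ = 2 * expR r / (expR r + 1)); last by field.
rewrite (_ : 1 - _ = 2 / (expR r + 1)); last by field.
by rewrite -mulrA mulrCA lnM ?posrE ?divr_gt0// expRK addrK.
Qed.

Lemma hdist_lt z w (r : R) : disc z -> disc w -> 0 <= r ->
  (hdist z w < r) = (sqn (mobius (shift_mx z)^-1 w) < thalf r ^+ 2).
Proof.
move=> zd wd r0; rewrite hdistE// -[in LHS](ell_thalf r) ell_lt ?thalf_itv//; last first.
  by rewrite normc_ge0; apply: mobius_disc => //; exact: SU11V (SU11_shift zd).
by rewrite -normc_sqn ltr_pXn2r ?nnegrE ?normc_ge0//; have /andP[] := thalf_itv r0.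
Qed.

Lemma hdistC z w : disc z -> disc w -> hdist z w = hdist w z.
Proof. by move=> zd wd; rewrite !hdist_sigma// sigmaC. Qed.

Lemma hdist_mobius A z w : SU11 A -> disc z -> disc w ->
  hdist (mobius A z) (mobius A w) = hdist z w.
Proof.
by move=> sA zd wd; rewrite !hdist_sigma// ?sigma_mobius//; exact: mobius_disc.
Qed.

Lemma hdist0 z : disc z -> hdist z z = 0.
Proof.
move=> zd; rewrite hdist_sigma// /sigma subrr {1}/sqn /= expr0n /= addr0 mul0r.
by rewrite /arsigma mul0r sqrtr0 /ell addr0 subr0 subrr.
Qed.

Lemma hdist_ge0 z w : disc z -> disc w -> 0 <= hdist z w.
Proof.
move=> zd wd; rewrite -(hdist0 zd) !hdist_sigma//; apply: arsigma_le; rewrite ?sigma_ge0//.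
by rewrite {1}/sigma subrr {1}/sqn /= expr0n /= addr0 mul0r sigma_ge0.
Qed.

(** The addition formula for tanh: q = (x + y) / (1 + x y) satisfies ell q = ell x + ell y, and q^2
    / (1 - q^2) is the displayed quotient. *)
Lemma ell_add (x y : R) : 0 <= x < 1 -> 0 <= y < 1 ->
  arsigma ((x + y) ^+ 2 / ((1 - x ^+ 2) * (1 - y ^+ 2))) = ell x + ell y.
Proof.
move=> /andP[x0 x1] /andP[y0 y1].
have xy : 0 < 1 + x * y by rewrite ltr_pwDl// mulr_ge0.
have px : 0 < (1 - x) * (1 - y) by rewrite mulr_gt0; lra.
have qx : 0 < (1 + x) * (1 + y) by rewrite mulr_gt0; lra.
pose q := (x + y) / (1 + x * y).
have q1 : 1 - q = (1 - x) * (1 - y) / (1 + x * y) by rewrite /q; field; exact: lt0r_neq0.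
have q2 : 1 + q = (1 + x) * (1 + y) / (1 + x * y) by rewrite /q; field; exact: lt0r_neq0.
have q0 : 0 <= q < 1.
  by rewrite /q divr_ge0 ?addr_ge0 ?mulr_ge0//= -subr_gt0 q1 divr_gt0.
rewrite (_ : _ / _ = q ^+ 2 / (1 - q ^+ 2)).
  rewrite arsigma_sqr// /ell q1 q2 !lnM ?posrE ?invr_gt0//; lra.
rewrite (_ : 1 - q ^+ 2 = (1 - q) * (1 + q)); last by ring.
rewrite q1 q2 /q; field.
by rewrite !gt_eqF//; nra.
Qed.

Lemma hdist_triangle (b a c : C) : disc a -> disc b -> disc c -> hdist a c <= hdist a b + hdist b c.
Proof.
move=> ad bd cd; have sB := SU11V (SU11_shift bd).
rewrite (hdistC ad bd) (hdistE bd ad) (hdistE bd cd) -(hdist_mobius sB ad cd).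
have := mobius_disc sB ad; have := mobius_disc sB cd.
move: (mobius _ a) (mobius _ c) => {}a {}c {}cd {}ad.
have x1 : 0 <= normc a < 1 by rewrite normc_ge0.
have y1 : 0 <= normc c < 1 by rewrite normc_ge0.
rewrite -ell_add// hdist_sigma//; have /andP[x0 xl] := x1; have /andP[y0 yl] := y1.
have px : 0 < 1 - normc a ^+ 2 by rewrite subr_gt0 expr_lt1.
have py : 0 < 1 - normc c ^+ 2 by rewrite subr_gt0 expr_lt1.
apply: arsigma_le; first exact: sigma_ge0.
  by rewrite divr_ge0 ?sqr_ge0// mulr_ge0// ltW.
rewrite /sigma -!normc_sqn ler_wpM2r ?invr_ge0 ?(ltW (mulr_gt0 px py))//.
rewrite ler_pXn2r ?nnegrE ?normc_ge0 ?addr_ge0//.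
by apply: (le_trans (le_normcD _ _)); rewrite normcN.
Qed.

Lemma hdist_small (e : R) : 0 < e -> exists2 s : R, 0 < s & forall z w, disc z -> disc w ->
  sigma z w < s -> hdist z w < e.
Proof.
move=> e0; have /andP[t0 t1] := thalf_itv (ltW e0).
have tp : 0 < thalf e.
  by rewrite divr_gt0 ?subr_gt0 ?expR_gt1// addr_gt0 ?expR_gt0.
have t2 : 0 < 1 - thalf e ^+ 2 by rewrite subr_gt0 expr_lt1.
exists (thalf e ^+ 2 / (1 - thalf e ^+ 2)); first by rewrite divr_gt0// exprn_gt0.
move=> z w zd wd; rewrite hdist_sigma// -arsigma_lt ?sigma_ge0 ?divr_ge0 ?sqr_ge0 ?(ltW t2)//.
by rewrite arsigma_sqr ?t0// ell_thalf.
Qed.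
End Metric.

(** * Rigidity of hyperbolic isometries *)

Section Isometries.
Context {R : realType}.
Local Notation C := R[i].
Implicit Types z w : C.

(** Connectedness of [0, 1] as an induction principle: near each t the property passes between any
    two points, so it spreads to the supremum of the set where it holds and beyond it. *)
Lemma unit_interval_ind (Q : R -> Prop) : Q 0 ->
  (forall t, 0 <= t <= 1 -> exists2 d : R, 0 < d & forall s s', 0 <= s <= 1 -> 0 <= s' <= 1 ->
     `|s - t| < d -> `|s' - t| < d -> Q s -> Q s') -> Q 1.
Proof.
move=> Q0 H; pose S : set R := [set t | 0 <= t <= 1 /\ Q t].
have S0 : S 0 by split; rewrite ?lexx ?ler01.
have hS : has_sup S by split; [exists 0|exists 1 => t [/andP[]]].
have m01 : 0 <= sup S <= 1.
  apply/andP; split; first exact: ub_le_sup hS.2 _ S0.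
  by apply: ge_sup; [exists 0|move=> t [/andP[]]].
have [d d0 Hd] := H _ m01.
have [s [s01 Qs] sd] := sup_adherent d0 hS.
have sm : s <= sup S by apply: ub_le_sup hS.2 _ _.
have ds : `|s - sup S| < d by rewrite distrC ger0_norm ?subr_ge0//; lra.
pose t := Num.min 1 (sup S + d / 2).
have [/andP[m0 m1] d2] := (m01, divr_gt0 d0 (ltr0n R 2)).
have t01 : 0 <= t <= 1 by rewrite le_min ge_min lexx ler01 /=; lra.
have tm : sup S <= t by rewrite le_min m1 /=; lra.
have td : t <= sup S + d / 2 by rewrite ge_min lexx orbT.
have dt : `|t - sup S| < d by rewrite ger0_norm ?subr_ge0//; lra.
have Qt := Hd s t s01 t01 ds dt Qs.
have tS : t <= sup S by apply: ub_le_sup hS.2 _ _.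
have [t1|t1] : t = 1 \/ t = sup S + d / 2 by rewrite /t; case: leP; [left|right].
  by rewrite -t1.
lra.
Qed.

Lemma sqn_scale (t : R) z : sqn (t%:C * z) = t ^+ 2 * sqn z.
Proof. by rewrite sqnM {1}/sqn /= expr0n /= addr0. Qed.

(** The radius from 0 to the image of w, carried back. It serves as the path for continuation
    arguments, so a uniform modulus of continuity matters and the parametrization does not. *)
Lemma segment z w : disc z -> disc w -> exists p : R -> C,
  [/\ p 0 = z, p 1 = w,
      forall t, 0 <= t <= 1 -> disc (p t) /\ hdist z (p t) <= hdist z w &
      forall e : R, 0 < e -> exists2 d : R, 0 < d & forall t s, 0 <= t <= 1 -> 0 <= s <= 1 ->
        `|s - t| < d -> hdist (p t) (p s) < e].
Proof.
move=> zd wd; have sS := SU11_shift zd; pose b := mobius (shift_mx z)^-1 w.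
have bd : disc b by apply: mobius_disc => //; exact: SU11V.
have tbd t : 0 <= t <= 1 -> sqn (t%:C * b) <= sqn b /\ disc (t%:C * b).
  move=> /andP[t0 t1]; have h : sqn (t%:C * b) <= sqn b.
    by rewrite sqn_scale ler_piMl ?sqn_ge0// expr_le1.
  split => //; apply/disc_sqn; apply: le_lt_trans h _; exact/disc_sqn.
have b1 : 0 < 1 - sqn b by rewrite subr_gt0; apply/disc_sqn.
exists (fun t => mobius (shift_mx z) (t%:C * b)); split.
- by rewrite mul0r mobius_shift0.
- by rewrite mul1r /b mobiusVK.
- move=> t t01; have [h1 h2] := tbd t t01; split; first exact: mobius_disc.
  rewrite -{1}(mobius_shift0 zd) (hdist_mobius sS disc0 h2).
  have -> : hdist z w = hdist 0 b.
    by rewrite -(hdist_mobius sS disc0 bd) mobius_shift0// /b mobiusVK.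
  have s0 u : sigma 0 u = sqn u / (1 - sqn u).
    by rewrite /sigma sub0r sqnN {2}/sqn /= expr0n /= addr0 subr0 mul1r.
  rewrite !hdist_sigma//; try exact: disc0.
  apply: arsigma_le; rewrite ?sigma_ge0 ?s0//; try exact: disc0.
  by apply: ler_pM; rewrite ?sqn_ge0 ?invr_ge0 ?lef_pV2 ?posrE ?subr_ge0 ?subr_gt0; try (by apply/ltW/disc_sqn); try (by apply/disc_sqn); rewrite // lerD2l lerN2.
- move=> e e0; have [s0 s00 Hs] := hdist_small e0.
  exists (Num.min 1 (s0 * (1 - sqn b) ^+ 2)); first by rewrite lt_min ltr01 mulr_gt0// exprn_gt0.
  move=> t s t01 s01; rewrite lt_min => /andP[d1 d2].
  have [ht td] := tbd t t01; have [hs sd] := tbd s s01.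
  apply: Hs; [exact: mobius_disc|exact: mobius_disc|rewrite sigma_mobius// /sigma -mulrBl -rmorphB /= sqn_scale].
  have p1 : 0 < 1 - sqn (t%:C * b) by rewrite subr_gt0; apply/disc_sqn.
  have p2 : 0 < 1 - sqn (s%:C * b) by rewrite subr_gt0; apply/disc_sqn.
  rewrite ltr_pdivrMr ?mulr_gt0//.
  apply: (@le_lt_trans _ _ `|s - t|).
    apply: (@le_trans _ _ ((t - s) ^+ 2)).
      by rewrite ler_piMr ?sqr_ge0//; apply/ltW/disc_sqn.
    rewrite -real_normK ?num_real// distrC expr2 ler_piMl//; exact: ltW.
  apply: (lt_le_trans d2); rewrite ler_pM2l// expr2; apply: ler_pM; lra.
Qed.

Lemma small_point (e : R) : 0 < e -> exists2 h : R, 0 < h & forall y, sqn y = h ^+ 2 ->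
  disc y /\ hdist 0 y < e.
Proof.
move=> e0; have [s s0 Hs] := hdist_small e0.
have h0 : 0 < Num.min (2^-1) (s / 2) by rewrite lt_min invr_gt0 ltr0n divr_gt0.
have [h1 h2] : Num.min (2^-1) (s / 2) <= 2^-1 /\ Num.min (2^-1) (s / 2) <= s / 2.
  by rewrite !ge_min !lexx orbT.
exists (Num.min (2^-1) (s / 2)) => // y; move: (Num.min _ _) h0 h1 h2 => h h0 h1 h2 yh.
have hh : h ^+ 2 <= h / 2 by rewrite expr2 ler_pM2l.
have yd : disc y by apply/disc_sqn; rewrite yh; lra.
split => //; apply: Hs => //; first exact: disc0.
rewrite /sigma sub0r sqnN yh {1}/sqn /= expr0n /= addr0 subr0 mul1r.
rewrite ltr_pdivrMr; last lra.
have : s / 2 <= s * (1 - h ^+ 2) by rewrite ler_pM2l//; lra.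
lra.
Qed.

Lemma ratio_inj (u v : R) : u < 1 -> v < 1 -> u / (1 - u) = v / (1 - v) -> u = v.
Proof.
move=> u1 v1; have E (x : R) : x < 1 -> x / (1 - x) = (1 - x)^-1 - 1.
  by move=> x1; field; rewrite gt_eqF// subr_gt0.
by rewrite !E// => /addIr/invr_inj/addrI/oppr_inj.
Qed.

(** With a moved to 0, comparison with the three points 0, h and i h suffices: the first gives the
    modulus, and the other two then give the coordinates. *)
Lemma sigma_determined (a x x' : C) (e : R) : disc a -> disc x -> disc x' -> 0 < e ->
  (forall y, disc y -> hdist a y < e -> sigma x y = sigma x' y) -> x = x'.
Proof.
move=> ad xd xd' e0 H; have sS := SU11_shift ad; have sB := SU11V sS.
have Xd := mobius_disc sB xd; have Xd' := mobius_disc sB xd'.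
have H0 y : disc y -> hdist 0 y < e -> sigma (mobius (shift_mx a)^-1 x) y = sigma (mobius (shift_mx a)^-1 x') y.
  move=> yd ye; rewrite -(sigma_mobius sS Xd yd) -(sigma_mobius sS Xd' yd) !mobiusVK//.
  apply: H; first exact: mobius_disc.
  by rewrite -{1}(mobius_shift0 ad) hdist_mobius//; exact: disc0.
suff E : mobius (shift_mx a)^-1 x = mobius (shift_mx a)^-1 x'.
  by rewrite -(mobiusVK sS xd) E mobiusVK.
move: (mobius _ x) (mobius _ x') Xd Xd' H0 => X X' Xd Xd' {}H.
have [h h0 Hh] := small_point e0.
have X1 : 0 < 1 - sqn X by rewrite subr_gt0; apply/disc_sqn.
have X1' : 0 < 1 - sqn X' by rewrite subr_gt0; apply/disc_sqn.
have n0 : sqn (0 : C) = 0 by rewrite /sqn /= expr0n /= addr0.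
have EX : sqn X = sqn X'.
  have := H 0 (disc0 (R := R)); rewrite hdist0; last exact: disc0.
  move=> /(_ e0); rewrite /sigma !subr0 n0 subr0 !mulr1; apply: ratio_inj; rewrite -subr_gt0//.
have EY y : sqn y = h ^+ 2 -> sqn (X - y) = sqn (X' - y).
  move=> yh; have [yd ye] := Hh y yh; have := H y yd ye; rewrite /sigma EX.
  by move/mulIf; apply; rewrite invr_eq0 gt_eqF// mulr_gt0// ?subr_gt0; apply/disc_sqn.
have E1 := EY h%:C; have E2 := EY (0 +i* h).
move: EX E1 E2; rewrite /sqn /= expr0n /= addr0 add0r => EX /(_ erefl) E1 /(_ erefl) E2.
case: X X' EX E1 E2 {X1 X1' Xd Xd' H EY} => u v [u' v'] /= EX E1 E2.
have h2 : h != 0 by rewrite gt_eqF.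
have Eu : u = u' by apply: (mulIf h2); nra.
by rewrite Eu; congr Complex; apply: (mulIf h2); nra.
Qed.

(** Orientation-reversing maps are included, because [isometric_to_disc] does not prescribe an
    orientation. *)
Record isometry (T : C -> C) : Prop := {
  isometry_disc : forall z, disc z -> disc (T z);
  isometry_sigma : forall z w, disc z -> disc w -> sigma (T z) (T w) = sigma z w;
  isometry_surj : forall w, disc w -> exists2 z, disc z & T z = w }.

Lemma isometry_hdist T z w : isometry T -> disc z -> disc w -> hdist (T z) (T w) = hdist z w.
Proof.
move=> [Td Ts _] zd wd; rewrite !hdist_sigma ?Ts//; exact: Td.
Qed.

Lemma isometry_mobius A : SU11 A -> isometry (mobius A).
Proof.
move=> sA; split; [by move=> z; exact: mobius_disc|by move=> z w; exact: sigma_mobius|].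
by move=> w wd; exists (mobius A^-1 w); [apply: mobius_disc => //; exact: SU11V|exact: mobiusVK].
Qed.

Lemma isometry_comp S T : isometry S -> isometry T -> isometry (S \o T).
Proof.
move=> [Sd Ss Sr] [Td Ts Tr]; split => /=.
- by move=> z zd; exact/Sd/Td.
- by move=> z w zd wd; rewrite Ss ?Ts//; exact: Td.
- by move=> w /Sr[y yd <-]; have [z zd <-] := Tr y yd; exists z.
Qed.

Lemma isometry_conj : isometry (fun z => z^*%C).
Proof.
split.
- by move=> z /disc_sqn h; apply/disc_sqn; rewrite sqnJ.
- by move=> z w _ _; rewrite /sigma -rmorphB /= !sqnJ.
- by move=> w /disc_sqn wd; exists w^*%C; rewrite ?conjcK//; apply/disc_sqn; rewrite sqnJ.
Qed.

Lemma isometry_rotation (k : C) : sqn k = 1 -> isometry (fun z => k * z).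
Proof.
move=> k1; split.
- by move=> z /disc_sqn h; apply/disc_sqn; rewrite sqnM k1 mul1r.
- by move=> z w _ _; rewrite /sigma -mulrBr !sqnM k1 !mul1r.
- move=> w /disc_sqn wd; exists (k^*%C * w); first by apply/disc_sqn; rewrite sqnM sqnJ k1 mul1r.
  by rewrite mulrA -sqn_conj k1 mul1r.
Qed.

(** S z and T z have the same [sigma] to every point of the ball about S a, which by surjectivity
    consists of common images; a point is determined by these values. *)
Lemma isometry_eq S T (a : C) (e : R) : isometry S -> isometry T -> disc a -> 0 < e ->
  (forall z, disc z -> hdist a z < e -> S z = T z) -> forall z, disc z -> S z = T z.
Proof.
move=> iS iT ad e0 H z zd.
apply: (@sigma_determined (S a) _ _ e) => //; try exact: isometry_disc.
move=> y yd; have [x xd <-] := isometry_surj iS yd.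
rewrite isometry_hdist// => /(H _ xd) E.
by rewrite isometry_sigma// E isometry_sigma.
Qed.

(** Preservation of [sigma] together with f 0 = 0 gives preservation of the modulus, then of
    Euclidean distances and hence of scalar products. The images of h and i h form an orthogonal
    frame, whose orientation decides between a rotation and a reflection. *)
Lemma rigidity0 (f : C -> C) (e : R) : 0 < e -> f 0 = 0 ->
  (forall z, disc z -> hdist 0 z < e -> disc (f z)) ->
  (forall z w, disc z -> disc w -> hdist 0 z < e -> hdist 0 w < e -> sigma (f z) (f w) = sigma z w) ->
  exists2 T, isometry T & forall z, disc z -> hdist 0 z < e -> f z = T z.
Proof.
move=> e0 f0 fd fs; have [h h0 Hh] := small_point e0.
have d0 := disc0 (R := R).
have he0 : hdist 0 0 < e by rewrite hdist0.
have n0 : sqn (0 : C) = 0 by rewrite /sqn /= expr0n /= addr0.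
have N z : disc z -> hdist 0 z < e -> sqn (f z) = sqn z.
  move=> zd ze; have := fs z 0 zd d0 ze he0; rewrite f0 /sigma !subr0 n0 subr0 !mulr1 => E.
  by apply: ratio_inj E; apply/disc_sqn => //; exact: fd.
have D z w : disc z -> disc w -> hdist 0 z < e -> hdist 0 w < e -> sqn (f z - f w) = sqn (z - w).
  move=> zd wd ze we; have := fs z w zd wd ze we; rewrite /sigma !N//.
  by move/mulIf; apply; rewrite invr_eq0 gt_eqF// mulr_gt0// subr_gt0; apply/disc_sqn.
have s1 : sqn (h%:C : C) = h ^+ 2 by rewrite /sqn /= expr0n /= addr0.
have s2 : sqn (0 +i* h : C) = h ^+ 2 by rewrite /sqn /= expr0n /= add0r.
have [pd pe] := Hh _ s1; have [qd qe] := Hh _ s2.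
have NP := N _ pd pe; have NQ := N _ qd qe; have DPQ := D _ _ pd qd pe qe.
have DP z zd ze := D z _ zd pd ze pe; have DQ z zd ze := D z _ zd qd ze qe.
rewrite s1 in NP; rewrite s2 in NQ.
case EP : (f h%:C) => [p1 p2] in NP DPQ DP.
case EQ : (f (0 +i* h)) => [q1 q2] in NQ DPQ DQ.
rewrite /sqn /= in NP NQ DPQ.
have h2 : h != 0 by rewrite gt_eqF.
have PQ : p1 * q1 + p2 * q2 = 0 by nra.
pose k : C := (p1 / h) +i* (p2 / h).
have k1 : sqn k = 1 by rewrite /sqn /= !expr_div_n -mulrDl NP divff// sqrf_eq0.
have W z : disc z -> hdist 0 z < e -> let: x +i* y := z in let: u +i* v := f z in
    u * p1 + v * p2 = h * x /\ u * q1 + v * q2 = h * y.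
  move=> zd ze; have := DP z zd ze; have := DQ z zd ze; have := N z zd ze.
  case: z {zd ze} => x y; case: (f _) => u v; rewrite /sqn /= => a1 a2 a3; split; nra.
(* The determinant of the image frame is h^2 or - h^2, and equality in the determinant bound fixes
   the second vector. *)
have [E|E] : (q1 = - p2 /\ q2 = p1) \/ (q1 = p2 /\ q2 = - p1).
  have : (p1 * q2 - p2 * q1 - h ^+ 2) * (p1 * q2 - p2 * q1 + h ^+ 2) = 0.
    transitivity ((p1 ^+ 2 + p2 ^+ 2) * (q1 ^+ 2 + q2 ^+ 2) - (p1 * q1 + p2 * q2) ^+ 2 - (h ^+ 2) ^+ 2); first by ring.
    by rewrite NP NQ PQ; ring.
  have sq0 (s t : R) : s ^+ 2 + t ^+ 2 = 0 -> s = 0 /\ t = 0.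
    by move=> /eqP; rewrite paddr_eq0 ?sqr_ge0// !sqrf_eq0 => /andP[/eqP -> /eqP ->].
  move/eqP; rewrite mulf_eq0 => /orP[] /eqP E; [left|right].
    have [|a b] := sq0 (q1 + p2) (q2 - p1); first by nra.
    by split; lra.
  have [|a b] := sq0 (q1 - p2) (q2 + p1); first by nra.
  by split; lra.
- exists (fun z => k * z); first exact: isometry_rotation.
  move=> z zd ze; have := W z zd ze; case: z {zd ze} => x y; case: (f _) => u v.
  move: E => [-> ->] [a1 a2]; rewrite /k; apply/eqP; rewrite eq_complex /=.
  apply/andP; split; apply/eqP; apply: (mulIf h2); apply: (mulIf h2).
    have -> : (p1 / h * x - p2 / h * y) * h * h = p1 * (h * x) - p2 * (h * y) by field.
    rewrite -a1 -a2; have -> : u * h * h = u * (h ^+ 2) by ring.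
    by rewrite -NP; ring.
  have -> : (p1 / h * y + p2 / h * x) * h * h = p1 * (h * y) + p2 * (h * x) by field.
  rewrite -a1 -a2; have -> : v * h * h = v * (h ^+ 2) by ring.
  by rewrite -NP; ring.
- exists (fun z => k * z^*%C); first exact: (isometry_comp (isometry_rotation k1) isometry_conj).
  move=> z zd ze; have := W z zd ze; case: z {zd ze} => x y; case: (f _) => u v.
  move: E => [-> ->] [a1 a2]; rewrite /k; apply/eqP; rewrite eq_complex /=.
  apply/andP; split; apply/eqP; apply: (mulIf h2); apply: (mulIf h2).
    have -> : (p1 / h * x - p2 / h * - y) * h * h = p1 * (h * x) + p2 * (h * y) by field.
    rewrite -a1 -a2; have -> : u * h * h = u * (h ^+ 2) by ring.
    by rewrite -NP; ring.
  have -> : (p1 / h * - y + p2 / h * x) * h * h = p2 * (h * x) - p1 * (h * y) by field.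
  rewrite -a1 -a2; have -> : v * h * h = v * (h ^+ 2) by ring.
  by rewrite -NP; ring.
Qed.

Lemma rigidity (f : C -> C) (p : C) (e : R) : 0 < e -> disc p ->
  (forall z, disc z -> hdist p z < e -> disc (f z)) ->
  (forall z w, disc z -> disc w -> hdist p z < e -> hdist p w < e -> sigma (f z) (f w) = sigma z w) ->
  exists2 T, isometry T & forall z, disc z -> hdist p z < e -> f z = T z.
Proof.
move=> e0 pd fd fs; have he : hdist p p < e by rewrite hdist0.
have fpd := fd p pd he.
have [sS sT] := (SU11_shift pd, SU11_shift fpd).
have [sSV sTV] := (SU11V sS, SU11V sT).
have dS z : disc z -> hdist p (mobius (shift_mx p) z) = hdist 0 z.
  by move=> zd; rewrite -{1}(mobius_shift0 pd) hdist_mobius//; exact: disc0.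
pose g z := mobius (shift_mx (f p))^-1 (f (mobius (shift_mx p) z)).
have [||z zd ze|z w zd wd ze we|T iT HT] := @rigidity0 g e.
- by [].
- by rewrite /g mobius_shift0// shift0_mobius.
- by apply: mobius_disc => //; apply: fd; [exact: mobius_disc|rewrite dS].
- have zd' := mobius_disc sS zd; have wd' := mobius_disc sS wd.
  by rewrite /g sigma_mobius ?fs ?dS// ?sigma_mobius//; apply: fd; rewrite ?dS.
exists (mobius (shift_mx (f p)) \o T \o mobius (shift_mx p)^-1).
  apply: isometry_comp; last exact: isometry_mobius.
  by apply: isometry_comp => //; exact: isometry_mobius.
move=> z zd ze /=; have zd' := mobius_disc sSV zd.
rewrite -HT//; last by rewrite -dS// mobiusVK.
by rewrite /g mobiusVK// mobiusVK//; exact: fd.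
Qed.
End Isometries.

(** * Embedded balls and the injectivity radius *)

Section InjectivityRadius.
Context {R : realType}.
Local Notation C := R[i].
Variable Gamma : set 'M[C]_2.
Hypothesis GammaS : surface_group Gamma.
Implicit Types (A B : 'M[C]_2) (z w : C).

Lemma has_inf_sdist z w : disc z -> disc w ->
  lbound [set hdist z (mobius A w) | A in Gamma] 0.
Proof.
move=> zd wd _ [A GA <-]; apply: hdist_ge0 => //; apply: mobius_disc => //; exact: (Gamma_SU GammaS GA).
Qed.

Lemma sdist_le A z w : disc z -> disc w -> Gamma A -> surface_dist Gamma z w <= hdist z (mobius A w).
Proof.
move=> zd wd GA; apply: ge_inf; last by exists A.
by exists 0; exact: has_inf_sdist.
Qed.

Lemma sdist_lt z w (r : R) : disc z -> disc w -> surface_dist Gamma z w < r ->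
  exists2 A, Gamma A & hdist z (mobius A w) < r.
Proof.
move=> zd wd h; apply: contrapT => H; move: h; rewrite ltNge => /negP; apply.
apply: lb_le_inf; first by exists (hdist z (mobius 1 w)), 1 => //; exact: (Gamma1 GammaS).
by move=> _ [A GA <-]; rewrite leNgt; apply/negP => h; apply: H; exists A.
Qed.

Lemma sdist_mobius A B z w : Gamma A -> Gamma B -> disc z -> disc w ->
  surface_dist Gamma (mobius A z) (mobius B w) = surface_dist Gamma z w.
Proof.
have le A' B' x y : Gamma A' -> Gamma B' -> disc x -> disc y ->
    surface_dist Gamma (mobius A' x) (mobius B' y) <= surface_dist Gamma x y.
  move=> GA GB xd yd; have [sA sB] := (Gamma_SU GammaS GA, Gamma_SU GammaS GB).
  apply: lb_le_inf; first by exists (hdist x (mobius 1 y)), 1 => //; exact: (Gamma1 GammaS).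
  move=> _ [D GD <-]; have sD := Gamma_SU GammaS GD.
  have GE : Gamma (A' * D * B'^-1) by apply: (GammaM GammaS); [exact: (GammaM GammaS)|exact: (GammaV GammaS)].
  apply: le_trans (sdist_le (mobius_disc sA xd) (mobius_disc sB yd) GE) _.
  have yd' := mobius_disc sB yd.
  rewrite (mobiusM (SU11M sA sD) (SU11V sB) yd') mobiusK// (mobiusM sA sD yd).
  by rewrite hdist_mobius//; exact: mobius_disc.
move=> GA GB zd wd; have [sA sB] := (Gamma_SU GammaS GA, Gamma_SU GammaS GB).
apply/eqP; rewrite eq_le le//=.
have := le _ _ _ _ (GammaV GammaS GA) (GammaV GammaS GB) (mobius_disc sA zd) (mobius_disc sB wd).
by rewrite !mobiusK.
Qed.

Lemma fix_all A z w : Gamma A -> disc z -> disc w -> mobius A z = z -> mobius A w = w.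
Proof.
move=> GA zd wd fz; have [->|->] := Gamma_free GammaS GA zd fz; first by rewrite mobius1.
by rewrite mobiusN mobius1.
Qed.

Lemma hdisplacement : exists2 e : R, 0 < e & forall A z, Gamma A -> disc z ->
  hdist z (mobius A z) < e -> mobius A z = z.
Proof.
have [c c0 Hc] := displacement GammaS.
have a0 : arsigma 0 = 0 :> R by rewrite /arsigma mul0r sqrtr0 /ell addr0 subr0 subrr.
exists (arsigma c) => [|A z GA zd]; first by rewrite -a0 arsigma_lt// ltW.
have Azd := mobius_disc (Gamma_SU GammaS GA) zd.
rewrite hdist_sigma// arsigma_lt ?sigma_ge0 ?(ltW c0)// => h.
have [->|n1] := pselect (A = 1); first by rewrite mobius1.
have [->|n2] := pselect (A = - 1); first by rewrite mobiusN mobius1.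
by have := Hc A z GA n1 n2 zd; rewrite leNgt h.
Qed.

(** If some translate of w were nearer to z than w itself, w would be moved by less than e, hence
    fixed by that element. *)
Lemma sdist_near (e : R) z w : (forall A z, Gamma A -> disc z ->
    hdist z (mobius A z) < e -> mobius A z = z) -> disc z -> disc w ->
  hdist z w < e / 2 -> surface_dist Gamma z w = hdist z w.
Proof.
move=> He zd wd h; apply/eqP; rewrite eq_le; apply/andP; split.
  by have := sdist_le zd wd (Gamma1 GammaS); rewrite mobius1.
apply: lb_le_inf; first by exists (hdist z (mobius 1 w)), 1 => //; exact: (Gamma1 GammaS).
move=> _ [A GA <-]; have Awd := mobius_disc (Gamma_SU GammaS GA) wd.
rewrite leNgt; apply/negP => h2.
have hw : hdist w (mobius A w) < e.
  by have := hdist_triangle wd zd Awd; rewrite (hdistC wd zd); lra.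
by rewrite (He A w GA wd hw) ltxx in h2.
Qed.

Lemma same_orbit_sym z w : disc z -> same_orbit Gamma z w -> same_orbit Gamma w z.
Proof.
move=> zd [A GA ->]; exists A^-1; first exact: (GammaV GammaS).
by rewrite mobiusK//; exact: (Gamma_SU GammaS GA).
Qed.

Lemma same_orbit_trans z w y : disc z -> same_orbit Gamma z w -> same_orbit Gamma w y -> same_orbit Gamma z y.
Proof.
move=> zd [A GA ->] [B GB ->]; exists (B * A); first exact: (GammaM GammaS).
by rewrite mobiusM//; exact: (Gamma_SU GammaS _).
Qed.

Section IsometricDisc.
Variables (z w0 : C) (r : R) (phi : C -> C).
Hypotheses (zd : disc z) (w0d : disc w0).
Hypothesis phi_ball : forall p, hball w0 r p -> surface_ball Gamma z r (phi p).
Hypothesis phi_inj : forall p p', hball w0 r p -> hball w0 r p' ->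
  same_orbit Gamma (phi p) (phi p') -> p = p'.
Hypothesis phi_surj : forall w, surface_ball Gamma z r w ->
  exists2 p, hball w0 r p & same_orbit Gamma (phi p) w.
Hypothesis phi_loc : forall p, hball w0 r p -> exists2 e : R, 0 < e &
  forall p1 p2, (hball w0 r `&` hball p e) p1 -> (hball w0 r `&` hball p e) p2 ->
    surface_dist Gamma (phi p1) (phi p2) = hdist p1 p2.

Let phid p : hball w0 r p -> disc (phi p). Proof. by move=> /phi_ball[]. Qed.

(** For y near p, a group element brings phi y close to phi p. At such short range the surface
    distance equals the distance in the disc, so the corrected map preserves [sigma] and rigidity
    extends it to an isometry. *)
Let local_lift p : hball w0 r p -> exists T e, [/\ isometry T, 0 < e &
  forall y, disc y -> hdist p y < e -> hball w0 r y /\ same_orbit Gamma (phi y) (T y)].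
Proof.
move=> Bp; have [pd pr] := Bp.
have [e1 e10 H1] := phi_loc Bp; have [e2 e20 H2] := hdisplacement.
(* The three bounds serve local distance preservation, the identity of surface and disc distance for
   two lifted points at mutual distance below 2 e <= e2 / 2, and staying inside the ball. *)
pose e := Num.min (Num.min e1 (e2 / 4)) (r - hdist w0 p).
have e0 : 0 < e by rewrite !lt_min e10 divr_gt0//= subr_gt0.
have [ea eb ec] : [/\ e <= e1, e <= e2 / 4 & e <= r - hdist w0 p].
  by rewrite !ge_min !lexx !orbT.
clearbody e.
have B y : disc y -> hdist p y < e -> hball w0 r y.
  move=> yd ye; split => //; have := hdist_triangle w0d pd yd; lra.
have L y : disc y -> hdist p y < e -> (hball w0 r `&` hball p e1) y.
  by move=> yd ye; split; [exact: B|split => //; exact: lt_le_trans ea].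
have pe : hdist p p < e by rewrite hdist0.
have lift y : exists A, disc y -> hdist p y < e -> Gamma A /\ hdist (phi p) (mobius A (phi y)) < e.
  have [[yd ye]|n] := pselect (disc y /\ hdist p y < e); last by exists 1 => yd ye; case: n.
  have := H1 _ _ (L _ pd pe) (L _ yd ye) => E.
  have [|A GA h] := @sdist_lt (phi p) (phi y) e (phid Bp) (phid (B _ yd ye)); first by rewrite E.
  by exists A.
have [A HA] := choice lift.
pose psi y := mobius (A y) (phi y).
have psid y : disc y -> hdist p y < e -> disc (psi y).
  move=> yd ye; have [GA _] := HA y yd ye.
  by apply: mobius_disc (phid (B _ yd ye)); exact: (Gamma_SU GammaS GA).
have [|T iT HT] := rigidity e0 pd psid.
  move=> x y xd yd xe ye; have [GA hx] := HA x xd xe; have [GB hy] := HA y yd ye.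
  have [xb yb] := (B x xd xe, B y yd ye).
  have [fx fy] := (psid x xd xe, psid y yd ye).
  apply: arsigma_inj; rewrite ?sigma_ge0// -!hdist_sigma//.
  rewrite -(sdist_near H2)//; last first.
    have := hdist_triangle fx (phid Bp) fy; rewrite (hdistC fx (phid Bp)) /psi => h; lra.
  by rewrite sdist_mobius ?H1//; [exact: L|exact: L|exact: phid|exact: phid].
exists T, e; split => // y yd ye; split; first exact: B.
by rewrite -HT//; have [GA _] := HA y yd ye; exists (A y).
Qed.

(* Two local lifts whose values are equivalent near a point differ by an element of Gamma. *)
Let glue S T (a : C) (e : R) : isometry S -> isometry T -> disc a -> 0 < e ->
  (forall y, disc y -> hdist a y < e -> same_orbit Gamma (S y) (T y)) ->
  forall y, disc y -> same_orbit Gamma (S y) (T y).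
Proof.
move=> iS iT ad e0 H; have [e2 e20 H2] := hdisplacement.
have [Sad Tad] := (isometry_disc iS ad, isometry_disc iT ad).
have [|A GA EA] := H a ad; first by rewrite hdist0.
have sA := Gamma_SU GammaS GA.
have iAS : isometry (mobius A \o S) by apply: isometry_comp => //; exact: isometry_mobius.
pose d := Num.min e (e2 / 2).
have d0 : 0 < d by rewrite lt_min e0 divr_gt0.
have [de d2] : d <= e /\ d <= e2 / 2 by rewrite !ge_min !lexx orbT.
have E y : disc y -> hdist a y < d -> (mobius A \o S) y = T y.
  move=> yd yd'; have [|D GD ED] := H y yd; first exact: lt_le_trans de.
  have [Syd sD] := (isometry_disc iS yd, Gamma_SU GammaS GD).
  have ASyd := mobius_disc sA Syd; have ASad := mobius_disc sA Sad.
  have Tyd := isometry_disc iT yd.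
  have GDA : Gamma (D * A^-1) by apply: (GammaM GammaS) => //; exact: (GammaV GammaS).
  have DA : mobius (D * A^-1) (mobius A (S y)) = T y.
    by rewrite (mobiusM sD (SU11V sA) ASyd) mobiusK.
  rewrite -DA /=; symmetry; apply: H2 => //.
  rewrite DA; have := hdist_triangle ASyd ASad Tyd.
  rewrite (hdistC ASyd ASad) hdist_mobius// isometry_hdist// -EA isometry_hdist//; lra.
move=> y yd; exists A => //.
by rewrite -(isometry_eq iAS iT ad d0 E yd).
Qed.

(** Continuation from w0 along segments. Two local lifts near consecutive points are glued by a
    group element, so all of them agree, up to Gamma, with the lift at w0. *)
Let global_lift : 0 < r -> exists2 T, isometry T & forall p, hball w0 r p -> same_orbit Gamma (phi p) (T p).
Proof.
move=> r0; have Bw0 : hball w0 r w0 by split => //; rewrite hdist0.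
have [T [e [iT e0 HT]]] := local_lift Bw0.
exists T => // p [pd pr].
have [c [c0 c1 cB cc]] := segment w0d pd.
pose Q t := exists2 e : R, 0 < e & forall y, disc y -> hdist (c t) y < e -> same_orbit Gamma (phi y) (T y).
have : Q 1.
  apply: unit_interval_ind; first by exists e => //; rewrite c0 => y yd ye; have [] := HT y yd ye.
  move=> t t01; have [ctd ctr] := cB t t01.
  have Bct : hball w0 r (c t) by split => //; exact: le_lt_trans pr.
  have [T' [e' [iT' e'0 HT']]] := local_lift Bct.
  have [d d0 Hd] := cc _ e'0; exists d => // s s' s01 s'01 st s't [u u0 Hu].
  have [csd _] := cB s s01; have [cs'd _] := cB s' s'01.
  have hs := Hd _ _ t01 s01 st; have hs' := Hd _ _ t01 s'01 s't.
  pose v := Num.min u (e' - hdist (c t) (c s)).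
  have v0 : 0 < v by rewrite lt_min u0 subr_gt0.
  have [vu ve] : v <= u /\ v <= e' - hdist (c t) (c s) by rewrite !ge_min !lexx orbT.
  have G : forall y, disc y -> same_orbit Gamma (T' y) (T y).
    apply: (glue iT' iT csd v0) => y yd yv.
    have [By h] : hball w0 r y /\ same_orbit Gamma (phi y) (T' y).
      by apply: HT' => //; have := hdist_triangle ctd csd yd; lra.
    have h2 := Hu y yd (lt_le_trans yv vu).
    apply: same_orbit_trans (isometry_disc iT' yd) (same_orbit_sym (phid By) h) h2.
  exists (e' - hdist (c t) (c s')); first by rewrite subr_gt0.
  move=> y yd ye; have [By h] : hball w0 r y /\ same_orbit Gamma (phi y) (T' y).
    by apply: HT' => //; have := hdist_triangle ctd cs'd yd; lra.
  exact: same_orbit_trans (phid By) h (G y yd).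
by move=> [u u0 Hu]; rewrite c1 in Hu; apply: Hu => //; rewrite hdist0.
Qed.

(** The centre w0 lifts to v = T w0, not necessarily equivalent to z. Every point of the ball about
    z is within r of exactly one translate of v, and by connectedness it is the same translate for
    the whole ball. If p and A p both lie there, then A fixes this translate. *)
Lemma isometric_disc_inj A p : Gamma A -> hball z r p -> hball z r (mobius A p) -> mobius A p = p.
Proof.
move=> GA [pd pr] [Apd Apr].
have r0 : 0 < r by apply: le_lt_trans pr; exact: hdist_ge0.
have [T iT HT] := global_lift r0; have v0d := isometry_disc iT w0d.
(* Uniqueness, from [phi_inj]: two translates within r of x give two points of the model disc over
   the orbit of x, which must coincide. *)
have same B D x : Gamma B -> Gamma D -> disc x -> hdist x (mobius B (T w0)) < r ->
    hdist x (mobius D (T w0)) < r -> forall y, disc y -> mobius B y = mobius D y.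
  move=> GB GD xd hB hD y yd; have [sB sD] := (Gamma_SU GammaS GB, Gamma_SU GammaS GD).
  have pre E : Gamma E -> hdist x (mobius E (T w0)) < r ->
      exists p, [/\ hball w0 r p, T p = mobius E^-1 x & same_orbit Gamma (phi p) x].
    move=> GE hE; have sE := Gamma_SU GammaS GE.
    have Exd := mobius_disc (SU11V sE) xd; have [q qd Tq] := isometry_surj iT Exd.
    have Bq : hball w0 r q.
      split => //; rewrite -(isometry_hdist iT w0d qd) Tq.
      by rewrite -(hdist_mobius sE v0d Exd) mobiusVK// hdistC//; exact: mobius_disc.
    exists q; split => //; apply: same_orbit_trans (phid Bq) (HT q Bq) _.
    by exists E => //; rewrite Tq mobiusVK.
  have [p1 [B1 T1 o1]] := pre B GB hB; have [p2 [B2 T2 o2]] := pre D GD hD.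
  have E12 : p1 = p2.
    by apply: phi_inj => //; apply: same_orbit_trans (phid B1) o1 (same_orbit_sym (phid B2) o2).
  have E : mobius B^-1 x = mobius D^-1 x by rewrite -T1 -T2 E12.
  have fx : mobius (B * D^-1) x = x.
    by rewrite (mobiusM sB (SU11V sD) xd) -E mobiusVK.
  have GBD : Gamma (B * D^-1) by apply: (GammaM GammaS) => //; exact: (GammaV GammaS).
  have Dyd := mobius_disc sD yd.
  have := fix_all GBD xd Dyd fx.
  by rewrite (mobiusM sB (SU11V sD) Dyd) mobiusK.
(* Existence, from [phi_surj]: the preimage of x in the model disc is within r of its centre. *)
have cover x : disc x -> hdist z x < r -> exists2 B, Gamma B & hdist x (mobius B (T w0)) < r.
  move=> xd xr; have [|q Bq o] := phi_surj (w := x).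
    by split => //; apply: le_lt_trans xr; have := sdist_le zd xd (Gamma1 GammaS); rewrite mobius1.
  have [qd qr] := Bq.
  have [B GB ->] := same_orbit_trans (isometry_disc iT qd) (same_orbit_sym (phid Bq) (HT q Bq)) o.
  exists B => //; rewrite hdist_mobius ?isometry_hdist//; [|exact: (Gamma_SU GammaS GB)|exact: isometry_disc].
  by rewrite hdistC.
have [B0 GB0 hB0] : exists2 B, Gamma B & hdist z (mobius B (T w0)) < r.
  by apply: cover => //; rewrite hdist0.
have mv B : Gamma B -> disc (mobius B (T w0)) by move=> GB; apply: mobius_disc v0d; exact: (Gamma_SU GammaS GB).
have all_in x : disc x -> hdist z x < r -> hdist x (mobius B0 (T w0)) < r.
  move=> xd xr; have [c [c0 c1 cB cc]] := segment zd xd.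
  rewrite -c1; apply: (@unit_interval_ind _ (fun t => hdist (c t) (mobius B0 (T w0)) < r)); first by rewrite c0.
  move=> t t01; have [ctd ctr] := cB t t01.
  have [B GB hB] := cover _ ctd (le_lt_trans ctr xr).
  have [|d d0 Hd] := cc (r - hdist (c t) (mobius B (T w0))); first by rewrite subr_gt0.
  exists d => // s s' s01 s'01 st s't hs.
  have [csd _] := cB s s01; have [cs'd _] := cB s' s'01.
  have h1 := Hd _ _ t01 s01 st; have h2 := Hd _ _ t01 s'01 s't.
  have k1 : hdist (c s) (mobius B (T w0)) < r.
    by have := hdist_triangle csd ctd (mv B GB); rewrite (hdistC csd ctd); lra.
  have k2 : hdist (c s') (mobius B (T w0)) < r.
    by have := hdist_triangle cs'd ctd (mv B GB); rewrite (hdistC cs'd ctd); lra.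
  by rewrite (same _ _ _ GB0 GB csd hs k1 _ v0d).
have sA := Gamma_SU GammaS GA; have sB0 := Gamma_SU GammaS GB0.
have h1 := all_in _ pd pr; have h2 := all_in _ Apd Apr.
have GAB : Gamma (A^-1 * B0) by apply: (GammaM GammaS) => //; exact: (GammaV GammaS).
have h3 : hdist p (mobius (A^-1 * B0) (T w0)) < r.
  rewrite (mobiusM (SU11V sA) sB0 v0d) -(hdist_mobius sA pd) ?mobiusVK//; first exact: mv.
  by apply: mobius_disc (mv _ GB0); exact: SU11V.
have E := same _ _ _ GB0 GAB pd h1 h3 _ v0d.
have Bv := mv _ GB0.
apply: (fix_all GA Bv pd); rewrite {1}E (mobiusM (SU11V sA) sB0 v0d) mobiusVK//.
Qed.

End IsometricDisc.

Lemma isometric_inj z (r : R) A p : disc z -> isometric_to_disc Gamma z r -> Gamma A ->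
  hball z r p -> hball z r (mobius A p) -> mobius A p = p.
Proof.
move=> zd [w0 [phi [w0d h1 h2 h3 h4]]] GA pB ApB.
exact: (isometric_disc_inj zd w0d h1 h2 h3 h4 GA pB ApB).
Qed.

(** The identity serves as the isometry on balls of a quarter of the minimal displacement, where
    different lifts cannot interfere. *)
Lemma uniform_isometric : exists2 r : R, 0 < r & forall z, disc z -> isometric_to_disc Gamma z r.
Proof.
have [e e0 He] := hdisplacement; exists (e / 4); first by rewrite divr_gt0.
move=> z zd; exists z, id; split => //.
- move=> p [pd pr]; split => //; apply: le_lt_trans pr.
  by have := sdist_le zd pd (Gamma1 GammaS); rewrite mobius1.
- move=> p p' [pd pr] [p'd p'r] [A GA E]; rewrite E He// -E.
  by have := hdist_triangle pd zd p'd; rewrite (hdistC pd zd); lra.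
- move=> w [wd wr]; have [A GA hA] := sdist_lt zd wd wr.
  have sA := Gamma_SU GammaS GA; exists (mobius A w); first by split => //; exact: mobius_disc.
  by exists A^-1; [exact: (GammaV GammaS)|rewrite mobiusK].
- move=> p [pd pr]; exists (e / 4); first by rewrite divr_gt0.
  move=> p1 p2 [_ [p1d h1]] [_ [p2d h2]]; apply: (sdist_near He) => //.
  by have := hdist_triangle p1d pd p2d; rewrite (hdistC p1d pd); lra.
Qed.

(** A point closer to the circle than the compact set meeting all orbits must be moved into it. *)
Lemma nontrivial_element : exists A, [/\ Gamma A & forall z, disc z -> mobius A z <> z].
Proof.
have [k /andP[k0 k1] Hk] := cocompact_radius GammaS.
have zd : disc (((1 + k) / 2)%:C : C).
  by apply/disc_sqn; rewrite /sqn /= expr0n /= addr0 expr_lt1//; lra.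
have [A GA hA] := Hk _ zd; exists A; split => // y yd fy.
move: hA; rewrite (fix_all GA yd zd fy) /= expr0n /= addr0 sqrtr_sqr ger0_norm; lra.
Qed.

Lemma isometric_ubound z : disc z ->
  has_ubound [set r : R | 0 < r /\ isometric_to_disc Gamma z r].
Proof.
move=> zd; have [A [GA nA]] := nontrivial_element.
exists (hdist z (mobius A z)) => r [r0 ir]; rewrite leNgt; apply/negP => h.
apply: (nA z zd); apply: (isometric_inj zd ir GA); split => //; first by rewrite hdist0.
by apply: mobius_disc => //; exact: (Gamma_SU GammaS GA).
Qed.

Lemma inj_radius_gt0 : 0 < inj_radius Gamma.
Proof.
have [r r0 Hr] := uniform_isometric; apply: (lt_le_trans r0).
apply: lb_le_inf; first by exists (inj_radius_at Gamma 0), 0 => //; exact: disc0.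
move=> _ [z zd <-]; apply: ub_le_sup; first exact: isometric_ubound.
by split => //; exact: Hr.
Qed.

(** The supremum need not be attained; the strict inequalities for p and A p leave room for an
    admissible radius above both distances. *)
Lemma inj_radius_ball z A p : disc z -> Gamma A -> hball z (inj_radius Gamma) p ->
  hball z (inj_radius Gamma) (mobius A p) -> mobius A p = p.
Proof.
move=> zd GA [pd pr] [Apd Apr].
pose S := [set r : R | 0 < r /\ isometric_to_disc Gamma z r].
have le : inj_radius Gamma <= sup S.
  apply: ge_inf; last by exists z.
  exists 0 => _ [y yd <-]; have [r r0 Hr] := uniform_isometric.
  by apply: (@le_trans _ _ r); [exact: ltW|apply: ub_le_sup; [exact: isometric_ubound|split => //; exact: Hr]].
have hS : has_sup S.
  split; last exact: isometric_ubound.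
  by have [r r0 Hr] := uniform_isometric; exists r; split => //; exact: Hr.
pose m := Num.max (hdist z p) (hdist z (mobius A p)).
have mS : m < sup S by apply: lt_le_trans le; rewrite gt_max pr Apr.
have [r [r0 ir] mr] : exists2 r, S r & m < r.
  have [|s Ss sm] := sup_adherent (_ : 0 < sup S - m) hS; first by rewrite subr_gt0.
  by exists s => //; rewrite subKr in sm.
move: mr; rewrite gt_max => /andP[h1 h2].
by apply: (isometric_inj zd ir GA); split.
Qed.

End InjectivityRadius.

(** * The pointwise bound on Beltrami differentials *)

Section SupBound.
Context {R : realType}.
Local Notation C := R[i].
Local Notation P := (R * R)%type.

Lemma derivable_comp_complex (f g : C -> C) (z : C) : derivable f (g z) 1 -> derivable g z 1 ->
  derivable (fun w => f (g w)) z 1.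
Proof.
move=> /derivable1_diffP df /derivable1_diffP dg; apply/derivable1_diffP.
exact: (differentiable_comp dg df).
Qed.

Lemma derivable_mul_complex (f g : C -> C) (z : C) : derivable f z 1 -> derivable g z 1 ->
  derivable (fun w => f w * g w) z 1.
Proof. by move=> df dg; exact: (derivableM df dg). Qed.

Lemma derivable_denV A (z : C) : SU11 A -> disc z -> derivable (fun w => (den A w)^-1) z 1.
Proof.
move=> sA zd; apply: (@derivableV C C (den A) z 1); first exact: den_neq0.
apply: derivableD; last exact: derivable_cst.
by apply: derivable_cmul; exact: derivable_id.
Qed.

Lemma rho_mobius A (z : C) : SU11 A -> disc z -> rho (mobius A z) = rho z * sqn (den A z) ^+ 2.
Proof.
move=> sA zd; rewrite !rhoE mobius_sqn//; have dp := sqn_den_gt0 sA zd.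
by field; rewrite !gt_eqF// subr_gt0; apply/disc_sqn.
Qed.

Variable Gamma : set 'M[C]_2.
Hypothesis GammaS : surface_group Gamma.
Variable F : set C.
Hypothesis F_fund : fundamental_set Gamma F.

Lemma beltrami_sqn (nu q : C -> C) (z : C) : disc z -> nu z = ((rho z)^-1)%:C * (q z)^*%C ->
  sqn (nu z) = sqn (q z) * rho z ^- 2.
Proof. by move=> zd ->; rewrite sqn_scale sqnJ exprVn mulrC. Qed.

Lemma beltrami_invariant (nu : C -> C) A (z : C) : harmonic_beltrami Gamma nu -> Gamma A -> disc z ->
  sqn (nu (mobius A z)) = sqn (nu z).
Proof.
move=> [q [_ qA] nuE] GA zd; have sA := Gamma_SU GammaS GA; have Azd := mobius_disc sA zd.
rewrite (beltrami_sqn Azd (nuE _ Azd)) (beltrami_sqn zd (nuE _ zd)) -(qA A z GA zd).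
rewrite (derive1_is_cderive (is_derive_mobius sA zd)) !expr2 !sqnM !sqnV !sqnM rho_mobius//.
have := sqn_den_gt0 sA zd; have := rho_gt0 zd; move: (sqn (q _)) (rho z) (sqn (den A z)) => a b c b0 c0.
by field; rewrite !gt_eqF.
Qed.

Lemma beltrami_derivable (nu : C -> C) : harmonic_beltrami Gamma nu ->
  exists2 q, (forall z, disc z -> derivable q z 1) & forall z, disc z -> nu z = ((rho z)^-1)%:C * (q z)^*%C.
Proof. by move=> [q [dq _] nuE]; exists q. Qed.

Lemma measurable_sqn_beltrami (nu : C -> C) : harmonic_beltrami Gamma nu ->
  pmeasurable (@disc R) (fun z => (sqn (nu z))%:E).
Proof.
move=> /beltrami_derivable[q dq nuE].
have := @ccontinuous_measurable R (@disc R) q (@open_disc R) (fun z zd => cderive_continuous (dq z zd)).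
move=> [m1 m2]; apply/measurable_EFinP.
have : measurable_fun (@of_plane R @^-1` @disc R : set P) (fun p => sqn (q (of_plane p)) * rho (of_plane p) ^- 2).
  apply: measurable_funM; first by apply: measurable_funD; exact: measurable_funX.
  apply: measurable_funTS; apply: (measurableT_comp measurable_inv); apply: measurable_funX; exact: measurable_rho.
by apply: eq_measurable_fun => p /[!inE] /= pd; rewrite (beltrami_sqn pd (nuE _ pd)).
Qed.

Lemma beltrami_sup (nu : C -> C) (z : C) : harmonic_beltrami Gamma nu -> disc z ->
  ((sqn (nu z) * (4 * pi / 3 * (1 - (4 * expR (inj_radius Gamma) /
     (expR (inj_radius Gamma) + 1) ^+ 2) ^+ 3)))%:E <= hint F (fun w => (sqn (nu w))%:E))%E.
Proof.
move=> hnu zd; have [q dq nuE] := beltrami_derivable hnu.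
set r := inj_radius Gamma; have r0 : 0 < r by exact: inj_radius_gt0.
(* tanh^2(r / 2): the hyperbolic ball of radius r about 0 is the Euclidean disc |w|^2 < m. *)
pose m := thalf r ^+ 2.
have /andP[t0 t1] := thalf_itv (ltW r0).
have m1 : m <= 1 by rewrite /m expr_le1// ltW.
have e0 := expR_gt0 r.
have tp : 0 < thalf r by rewrite /thalf divr_gt0 ?subr_gt0 ?expR_gt1// addr_gt0.
have m01 : 0 < m <= 1 by rewrite m1 exprn_gt0.
have -> : 4 * expR r / (expR r + 1) ^+ 2 = 1 - m.
  by rewrite /m /thalf; field; rewrite gt_eqF// addr_gt0.
set S := shift_mx z; have sS : SU11 S by exact: SU11_shift.
(* The quadratic differential pulled back by S, namely q(S w) S'(w)^2 with S' = den^-2. *)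
pose q' w := q (mobius S w) * ((den S w)^-1 * (den S w)^-1 * ((den S w)^-1 * (den S w)^-1)).
have dq' w : disc w -> derivable q' w 1.
  move=> wd; have dd := derivable_denV sS wd.
  apply: derivable_mul_complex.
    apply: derivable_comp_complex; first exact/dq/mobius_disc.
    by have [] := is_derive_mobius sS wd.
  by apply: derivable_mul_complex; exact: derivable_mul_complex.
have q'E w : disc w -> sqn (q' w) * rho w ^- 2 = sqn (nu (mobius S w)).
  move=> wd; have Swd := mobius_disc sS wd.
  rewrite (beltrami_sqn Swd (nuE _ Swd)) rho_mobius// /q' !sqnM !sqnV.
  have := sqn_den_gt0 sS wd; have := rho_gt0 wd; move: (sqn (q _)) (rho w) (sqn (den S w)) => a b c b0 c0.
  by field; rewrite !gt_eqF.
have H := hint_submean dq' m01.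
have n0 : sqn (0 : C) = 0 by rewrite /sqn /= expr0n /= addr0.
have r00 : rho (0 : C) = 4 by rewrite rhoE n0 subr0 expr1n divr1.
(* The factor is rho(0)^2 = 16; it turns pi / 12 into the constant 4 pi / 3. *)
have E0 : sqn (q' 0) = 16 * sqn (nu z).
  have := q'E 0 (disc0 (R := R)); rewrite mobius_shift0// => <-; rewrite r00; by field.
have hb : hball z r = [set w | disc w /\ sqn (mobius S^-1 w) < m].
  by apply/seteqP; split => w [wd h]; split => //; move: h; rewrite hdist_lt// ltW.
have mdisc : ebdisc m = [set w | disc w /\ hball z r (mobius S w)].
  apply/seteqP; split => w.
    move=> wm; have wd := ebdisc_disc m1 wm; split => //; rewrite hb; split; first exact: mobius_disc.
    by rewrite mobiusK.
  by move=> [wd]; rewrite hb => -[_]; rewrite mobiusK.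
have mb : measurable (@of_plane R @^-1` hball z r : set P).
  rewrite (_ : hball z r = [set w | disc w /\ ebdisc m (mobius S^-1 w)]) ?hb//.
  by apply: measurable_mobius_preim; exact: measurable_ebdisc.
have bd : hball z r `<=` @disc R by move=> w [].
have mnu := measurable_sqn_beltrami hnu.
have nu0 w : (0 <= (sqn (nu w))%:E)%E by rewrite lee_fin sqn_ge0.
apply: (@le_trans _ _ (hint (hball z r) (fun w => (sqn (nu w))%:E))); last first.
  apply: (hint_injective_le GammaS F_fund) => //.
    move=> A w GA Bw BAw; apply: (Gamma_free GammaS GA (bd _ Bw)).
    exact: (inj_radius_ball GammaS zd GA Bw BAw).
  by move=> A w GA wd; rewrite beltrami_invariant.
rewrite -(hint_mobius sS mb bd)//; last first.
  by apply: measurable_funS mnu => //; [exact: measurable_disc|move=> p /bd].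
rewrite -mdisc; move: H; rewrite E0 -EFinM.
rewrite (_ : 16 * sqn (nu z) * _ = sqn (nu z) * (4 * pi / 3 * (1 - (1 - m) ^+ 3))); last by field.
move=> /le_trans; apply; rewrite (@eq_hint _ _ _ (fun w => (sqn (nu (mobius S w)))%:E))//.
by move=> w /(ebdisc_disc m1) wd; rewrite q'E.
Qed.

Lemma C_constP : 0 < C_const (inj_radius Gamma) ^+ 2 /\
  C_const (inj_radius Gamma) ^+ 2 * (4 * pi / 3 * (1 - (4 * expR (inj_radius Gamma) /
     (expR (inj_radius Gamma) + 1) ^+ 2) ^+ 3)) = 1.
Proof.
set r := inj_radius Gamma; have r0 : 0 < r by exact: inj_radius_gt0.
set b := 4 * pi / 3 * _.
have e0 := expR_gt0 r.
have e1 : 0 < expR r - 1 by rewrite subr_gt0 expR_gt1.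
have b0 : 0 < b.
  rewrite /b mulr_gt0 ?divr_gt0 ?mulr_gt0 ?pi_gt0// subr_gt0 expr_lt1//.
    rewrite ltr_pdivrMr ?exprn_gt0 ?addr_gt0// mul1r -subr_gt0.
    by rewrite (_ : _ - _ = (expR r - 1) ^+ 2) ?exprn_gt0//; ring.
have E : C_const r ^+ 2 = b^-1.
  by rewrite /C_const -/b powRN exprVn powR12_sqrt ?(ltW b0)// sqr_sqrtr// ltW.
by rewrite E invr_gt0 b0 mulVf// gt_eqF.
Qed.
End SupBound.

(** * The integral of the Laplacian *)

Section Taylor.
Context {R : realType}.
Local Notation C := R[i].

(** The increment is parametrized by s in [0, 1], so that both signs of a are treated at once. *)
Lemma mvt_bound (g dg : R -> R) (a e : R) :
  (forall t : R, `|t| <= `|a| -> is_derive t 1 g (dg t)) ->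
  (forall t : R, `|t| <= `|a| -> `|dg t| <= e) -> `|g a - g 0| <= e * `|a|.
Proof.
move=> H He.
have dh (s : R) : 0 <= s <= 1 -> is_derive s 1 (fun s => g (a * s)) (a * dg (a * s)).
  move=> /andP[s0 s1].
  have sa : `|a * s| <= `|a| by rewrite normrM (ger0_norm s0) ler_piMr.
  have d1 : is_derive s 1 (fun s : R => a * s : R) a.
    by have := is_deriveZ a (is_derive_id s (1 : R)); rewrite /GRing.scale /= mulr1.
  by have := @is_derive1_comp R g (fun s : R => a * s) s _ _ (H _ sa) d1; rewrite mulrC.
have [s /andP[s0 s1]] : exists2 s, 0 <= s <= 1 & g (a * 1) - g (a * 0) = a * dg (a * s) * (1 - 0).
  have [||s hs E] := @MVT R (fun s => g (a * s)) (fun s => a * dg (a * s)) 0 1 ltr01.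
  - by move=> s /[!in_itv]/= /andP[s0 s1]; apply: dh; rewrite !ltW.
  - apply: continuous_in_subspaceT => s /[!inE]/= /[!in_itv]/= /dh[d _].
    by apply: differentiable_continuous; exact/derivable1_diffP.
  by exists s => //; move: hs; rewrite in_itv/= => /andP[h1 h2]; rewrite !ltW.
rewrite mulr1 mulr0 subr0 mulr1 => ->; rewrite normrM mulrC ler_wpM2r// He//.
by rewrite normrM (ger0_norm s0) ler_piMr.
Qed.

(** The derivative is taken at parameter 0 on the line through z, as in [dx] and [dy];
    differentiability along whole lines follows by moving the base point. *)
Definition dirder (v : C) (f df : C -> R) := forall z, disc z ->
  is_derive (0 : R) 1 (fun t : R => f (z + t%:C * v)) (df z).

Lemma dirder_at (v : C) (f df : C -> R) (z : C) (t : R) : dirder v f df -> disc (z + t%:C * v) ->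
  is_derive t 1 (fun t : R => f (z + t%:C * v)) (df (z + t%:C * v)).
Proof.
move=> H /H d; apply: linear_is_derive => e e0.
have [r r0 Hr] := is_derive_linear d e0; exists r => // h /Hr.
by rewrite add0r mul0r addr0 rmorphD /= mulrDl addrA.
Qed.

Lemma dirder_taylor1 (v : C) (f df : C -> R) (z : C) (a c e : R) : dirder v f df ->
  (forall t : R, `|t| <= `|a| -> disc (z + t%:C * v) /\ `|df (z + t%:C * v) - c| <= e) ->
  `|f (z + a%:C * v) - f z - c * a| <= e * `|a|.
Proof.
move=> H He.
have := @mvt_bound (fun t => f (z + t%:C * v) - c * t) (fun t => df (z + t%:C * v) - c) a e.
rewrite mul0r addr0 mulr0 subr0 => h; rewrite addrAC; apply: h => t /He[h1 h2] //.
have d1 := dirder_at H h1.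
have d2 : is_derive t 1 (fun s : R => c * s : R) c.
  by have := is_deriveZ c (is_derive_id t (1 : R)); rewrite /GRing.scale /= mulr1.
exact: (is_deriveB d1 d2).
Qed.

Lemma dirder_taylor2 (v : C) (f df ddf : C -> R) (z : C) (a c e : R) : dirder v f df -> dirder v df ddf ->
  0 <= e ->
  (forall t : R, `|t| <= `|a| -> disc (z + t%:C * v) /\ `|ddf (z + t%:C * v) - c| <= e) ->
  `|f (z + a%:C * v) - f z - df z * a - c / 2 * a ^+ 2| <= e * a ^+ 2.
Proof.
move=> H1 H2 e0 He.
have B (t : R) : `|t| <= `|a| -> `|df (z + t%:C * v) - df z - c * t| <= e * `|a|.
  move=> ta; apply: (@le_trans _ _ (e * `|t|)); last by rewrite ler_wpM2l.
  by apply: dirder_taylor1 H2 _ => s st; apply: He; exact: le_trans ta.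
have := @mvt_bound (fun t => f (z + t%:C * v) - df z * t - c / 2 * t ^+ 2)
  (fun t => df (z + t%:C * v) - df z - c * t) a (e * `|a|).
rewrite mul0r addr0 mulr0 subr0 expr0n /= mulr0 subr0 -(mulrA e) -expr2 real_normK ?num_real// => h.
rewrite (_ : _ - _ - _ - _ = f (z + a%:C * v) - df z * a - c / 2 * a ^+ 2 - f z); last by ring.
apply: h => t ta; last exact: B.
have d1 := dirder_at H1 (He t ta).1.
have d2 : is_derive t 1 (fun s : R => df z * s : R) (df z).
  by have := is_deriveZ (df z) (is_derive_id t (1 : R)); rewrite /GRing.scale /= mulr1.
have d3 : is_derive t 1 (fun s : R => c / 2 * s ^+ 2 : R) (c * t).
  apply: is_derive_eq; rewrite /GRing.scale /= !(mulr1, expr1) mulr2n; by field.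
exact: (is_deriveB (is_deriveB d1 d2) d3).
Qed.

(** A single mixed partial, the x-derivative of [Uy], is recorded: the expansion below goes along x
    and then along y, and needs to know how [Uy] varies on the first leg. *)
Record C2_data (U Ux Uy Uxx Uxy Uyy : C -> R) : Prop := {
  C2_x : dirder 1 U Ux; C2_y : dirder 'i U Uy;
  C2_xx : dirder 1 Ux Uxx; C2_xy : dirder 1 Uy Uxy; C2_yy : dirder 'i Uy Uyy;
  C2_cont : forall z, disc z -> {for z, continuous U};
  C2_cxx : forall z, disc z -> {for z, continuous Uxx};
  C2_cxy : forall z, disc z -> {for z, continuous Uxy};
  C2_cyy : forall z, disc z -> {for z, continuous Uyy} }.

Section SecondOrder.
Variables (U Ux Uy Uxx Uxy Uyy : C -> R).
Hypothesis HU : C2_data U Ux Uy Uxx Uxy Uyy.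

Lemma taylor2 (z : C) (r cxx cxy cyy e : R) : 0 <= e ->
  (forall w, normc (w - z) < r -> [/\ disc w, `|Uxx w - cxx| <= e, `|Uxy w - cxy| <= e &
     `|Uyy w - cyy| <= e]) ->
  forall w a b, normc (w - z) < r -> w - z = a +i* b ->
    `|U w - U z - Ux z * a - Uy z * b - (cxx / 2 * a ^+ 2 + cxy * (a * b) + cyy / 2 * b ^+ 2)|
       <= 2 * e * sqn (w - z).
Proof.
move=> e0 H w a b wr ab.
have nr : sqn (w - z) = a ^+ 2 + b ^+ 2 by rewrite ab.
have wE : w = z + a%:C * 1 + b%:C * 'i.
  by rewrite mulr1 -addrA -[LHS](subrKC z); congr (_ + _); rewrite ab; simpc.
have r0 : 0 < r by apply: le_lt_trans wr; exact: normc_ge0.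
have in1 (t : R) : `|t| <= `|a| -> normc (z + t%:C * 1 - z) < r.
  move=> ta; apply: le_lt_trans wr; rewrite -(ler_pXn2r (_ : (0 < 2)%N))// ?nnegrE ?normc_ge0//.
  rewrite !normc_sqn nr addrAC subrr add0r mulr1 /sqn /= expr0n /= addr0.
  by rewrite -[t ^+ 2]real_normK ?num_real// -[a ^+ 2]real_normK ?num_real// ler_wpDr ?sqr_ge0// ler_pXn2r// nnegrE.
have in2 (t : R) : `|t| <= `|b| -> normc (z + a%:C * 1 + t%:C * 'i - z) < r.
  move=> ta; apply: le_lt_trans wr; rewrite -(ler_pXn2r (_ : (0 < 2)%N))// ?nnegrE ?normc_ge0//.
  rewrite !normc_sqn nr mulr1 (_ : z + a%:C + t%:C * 'i - z = a +i* t); last first.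
    have -> : z + a%:C + t%:C * 'i - z = a%:C + t%:C * 'i by ring.
    by simpc.
  rewrite /sqn /= lerD2l -[t ^+ 2]real_normK ?num_real// -[b ^+ 2]real_normK ?num_real//.
  by rewrite ler_pXn2r// nnegrE.
have T1 := @dirder_taylor2 1 U Ux Uxx z a cxx e (C2_x HU) (C2_xx HU) e0.
have T2 := @dirder_taylor2 'i U Uy Uyy (z + a%:C * 1) b cyy e (C2_y HU) (C2_yy HU) e0.
have T3 := @dirder_taylor1 1 Uy Uxy z a cxy e (C2_xy HU).
have {}T1 := T1 (fun t ta => let: And4 h1 h2 _ _ := H _ (in1 t ta) in conj h1 h2).
have {}T2 := T2 (fun t ta => let: And4 h1 _ _ h4 := H _ (in2 t ta) in conj h1 h4).
have {}T3 := T3 (fun t ta => let: And4 h1 _ h3 _ := H _ (in1 t ta) in conj h1 h3).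
rewrite -wE in T2.
rewrite nr.
set p := z + a%:C * 1 in T1 T2 T3.
have -> : U w - U z - Ux z * a - Uy z * b - (cxx / 2 * a ^+ 2 + cxy * (a * b) + cyy / 2 * b ^+ 2) =
  (U w - U p - Uy p * b - cyy / 2 * b ^+ 2) + (U p - U z - Ux z * a - cxx / 2 * a ^+ 2) +
  (Uy p - Uy z - cxy * a) * b by ring.
apply: (le_trans (ler_normD _ _)).
have T4 : `|(Uy p - Uy z - cxy * a) * b| <= e * (a ^+ 2 + b ^+ 2).
  rewrite normrM; apply: (@le_trans _ _ (e * `|a| * `|b|)); first by rewrite ler_wpM2r.
  rewrite -mulrA ler_wpM2l// -[a ^+ 2]real_normK ?num_real// -[b ^+ 2]real_normK ?num_real//.
  have := sqr_ge0 (`|a| - `|b|); have := normr_ge0 a; have := normr_ge0 b; nra.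
have -> : 2 * e * (a ^+ 2 + b ^+ 2) = (e * b ^+ 2 + e * a ^+ 2) + e * (a ^+ 2 + b ^+ 2) by ring.
by apply: lerD => //; apply: (le_trans (ler_normD _ _)); exact: lerD.
Qed.
End SecondOrder.
Lemma rcont_normcP (g : C -> R) (z : C) : {for z, continuous g} -> forall e : R, 0 < e ->
  exists2 d : R, 0 < d & forall w, normc (w - z) < d -> `|g w - g z| <= e.
Proof.
move=> /cvgrPdist_le cg e /cg/nbhs_normc[d d0 Hd]; exists d => // w /Hd.
by rewrite distrC.
Qed.

Lemma compact_closed_disc (k : R) : 0 <= k -> compact [set z : C | normc z <= k].
Proof.
move=> k0.
rewrite (_ : [set z | _] = (fun p : R * R => of_plane p : C) @`
    [set p : R * R | sqn (of_plane p) <= k ^+ 2]); last first.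
  apply/seteqP; split => [z zk|_ [p pk <-]] /=.
    by exists (to_plane z); rewrite /= of_planeK// -normc_sqn ler_pXn2r// nnegrE normc_ge0.
  by move: pk; rewrite /= -normc_sqn ler_pXn2r ?nnegrE ?normc_ge0.
apply: continuous_compact.
  by apply: continuous_subspaceT => p; exact: continuous_of_planeP.
apply: (@subclosed_compact _ _ (`[- k, k]%classic `*` `[- k, k]%classic)).
- rewrite (_ : [set p | _] = (fun p : R * R => sqn (of_plane p)) @^-1` [set y : R | y <= k ^+ 2]) //.
  apply: preimage_closed; last exact: closed_le.
  move=> p _; apply: (@continuous_comp _ _ _ (fun p : R * R => of_plane p : C) (@sqn R)).
    exact: continuous_of_planeP.
  exact: continuous_sqn.
- by apply: compact_setX; exact: segment_compact.
- move=> [x y] /=; rewrite /sqn /= => h.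
  have sq (s t : R) : s ^+ 2 + t ^+ 2 <= k ^+ 2 -> - k <= s <= k.
    move=> st; rewrite -ler_norml -(ler_pXn2r (_ : (0 < 2)%N)) ?nnegrE// real_normK ?num_real//.
    by apply: le_trans st; rewrite lerDl sqr_ge0.
  by split; rewrite /= in_itv/=; [exact: (sq x y)|apply: (sq y x); rewrite addrC].
Qed.

Lemma bounded_closed_disc (g : C -> R) (k : R) : (forall z, disc z -> {for z, continuous g}) ->
  0 <= k < 1 -> exists2 M : R, 0 <= M & forall z, normc z <= k -> `|g z| <= M.
Proof.
move=> cg /andP[k0 k1]; have p1 z : 0 < 1 + `|g z| by rewrite ltr_pwDl.
have Kd z : normc z <= k -> disc z by move=> zk; exact: le_lt_trans k1.
have [c c0 Hc] : exists2 c : R, 0 < c & forall z, normc z <= k -> c <= (1 + `|g z|)^-1.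
  apply: (compact_pos_min (compact_closed_disc k0)) => z zk; last by rewrite invr_gt0.
  apply: rcontV; first by rewrite gt_eqF.
  apply: rcontD; first exact: rcont_cst.
  by apply: (@continuous_comp _ _ _ g (fun x : R => `|x|)); [exact/cg/Kd|exact: norm_continuous].
exists c^-1; first by rewrite invr_ge0 ltW.
move=> z /Hc h; apply: (@le_trans _ _ (1 + `|g z|)); first by rewrite lerDr.
by rewrite -[leLHS]invrK lef_pV2 ?posrE// invr_gt0.
Qed.

Lemma shift_sub (z v : C) : disc z -> disc v ->
  mobius (shift_mx z) v - z = (1 - sqn z)%:C * (v / (1 + z^*%C * v)).
Proof.
move=> zd vd; have sS := SU11_shift zd; have d0 := disc0 (R := R).
rewrite -{2}(mobius_shift0 zd) mobius_diff ?den_neq0// subr0.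
have z1 : 0 < 1 - sqn z by rewrite subr_gt0; apply/disc_sqn.
have q0 : Num.sqrt (1 - sqn z) != 0 by rewrite gt_eqF// sqrtr_gt0.
have E w : den (shift_mx z) w = ((Num.sqrt (1 - sqn z))^-1)%:C * (1 + z^*%C * w).
  rewrite /den /shift_mx; set s := (_^-1)%:C; have [_ _ -> ->] := su_mxE s (s * z).
  have Es : s^*%C = s by rewrite /s conjc_real.
  have -> : (s * z)^*%C = s^*%C * z^*%C by exact: rmorphM.
  by rewrite Es mulrDr mulr1 addrC mulrA.
rewrite !E mulr0 addr0 mulr1 mulrAC -rmorphM /= -invfM -expr2 sqr_sqrtr ?(ltW z1)//.
by rewrite invfM fmorphV invrK mulrCA.
Qed.

Lemma normc1D_bounds (z v : C) : disc z -> 1 - normc v <= normc (1 + z^*%C * v) <= 1 + normc v.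
Proof.
move=> zd; have h : normc (z^*%C * v) <= normc v.
  rewrite normcM ler_piMl ?normc_ge0//; apply: ltW.
  by rewrite -(ltr_pXn2r (_ : (0 < 2)%N)) ?nnegrE ?normc_ge0// normc_sqn sqnJ expr1n; apply/disc_sqn.
have n1 : normc (1 : C) = 1 by rewrite /= expr0n /= addr0 expr1n sqrtr1.
have := le_normcD (1 : C) (z^*%C * v); have := le_normcD (1 + z^*%C * v) (- (z^*%C * v)).
rewrite addrK normcN n1 => h1 h2; apply/andP; split; lra.
Qed.

Lemma shift_sub_le (z v : C) : disc z -> sqn v <= 4^-1 ->
  sqn (mobius (shift_mx z) v - z) <= 4 * sqn v.
Proof.
move=> zd v4; have vd : disc v by apply/disc_sqn; lra.
have nv : normc v <= 2^-1.
  by rewrite -(ler_pXn2r (_ : (0 < 2)%N)) ?nnegrE ?normc_ge0// normc_sqn exprVn -natrX.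
have /andP[h1 _] := normc1D_bounds v zd.
have h2 : 4^-1 <= sqn (1 + z^*%C * v).
  rewrite -normc_sqn (_ : 4^-1 = 2^-1 ^+ 2); last by rewrite exprVn -natrX.
  by rewrite ler_pXn2r ?nnegrE ?normc_ge0//; lra.
have z1 : 0 <= 1 - sqn z <= 1 by have := sqn_ge0 z; have /disc_sqn := zd; lra.
rewrite shift_sub// sqn_scale sqnM sqnV mulrCA mulrC ler_wpM2r ?sqn_ge0//.
have /andP[z0 zl] := z1.
apply: (@le_trans _ _ (1 * 4)); last by rewrite mul1r.
apply: ler_pM; rewrite ?sqr_ge0 ?invr_ge0 ?sqn_ge0//; first by rewrite expr_le1.
by rewrite -[leRHS]invrK lef_pV2 ?posrE ?invr_gt0//; apply: lt_le_trans h2; rewrite invr_gt0.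
Qed.

(** The displacement is (1 - |z|^2) v / (1 + conj(z) v), and the denominator has modulus between 1 -
    d and 1 + d. *)
Lemma shift_sub_approx (z v : C) (d : R) : disc z -> 0 < d <= 2^-1 -> normc v <= d ->
  `|sqn (mobius (shift_mx z) v - z) - (1 - sqn z) ^+ 2 * sqn v| <= 10 * d * sqn v.
Proof.
move=> zd /andP[d0 d2] nv; have vd : disc v by rewrite /disc /=; lra.
have /andP[h1 h2] := normc1D_bounds v zd.
have nv0 := normc_ge0 v.
have z1 : 0 <= 1 - sqn z <= 1 by have := sqn_ge0 z; have /disc_sqn := zd; lra.
have /andP[z0 zl] := z1.
rewrite shift_sub// sqn_scale sqnM sqnV -mulrBr normrM ger0_norm ?sqr_ge0//.
rewrite -{2}[sqn v]mulr1 -mulrBr normrM ger0_norm ?sqn_ge0//.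
rewrite mulrCA [leRHS]mulrC ler_wpM2l ?sqn_ge0//.
have h3 : 4^-1 <= sqn (1 + z^*%C * v).
  rewrite -normc_sqn (_ : 4^-1 = 2^-1 ^+ 2); last by rewrite exprVn -natrX.
  by rewrite ler_pXn2r ?nnegrE ?normc_ge0//; lra.
have h4 : (1 - d) ^+ 2 <= sqn (1 + z^*%C * v) <= (1 + d) ^+ 2.
  by rewrite -normc_sqn !ler_pXn2r ?nnegrE ?normc_ge0//; lra.
move: (sqn (1 + _)) h3 h4 => x h3 /andP[h4 h5].
have x0 : 0 < x by lra.
have -> : x^-1 - 1 = (1 - x) / x by field; rewrite gt_eqF.
apply: (@le_trans _ _ (1 * `|(1 - x) / x|)).
  by rewrite ler_wpM2r// expr_le1.
rewrite mul1r normrM normfV (gtr0_norm x0) ler_pdivrMr//.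
apply: (@le_trans _ _ (10 * d * 4^-1)); last by rewrite ler_pM2l// mulr_gt0.
by rewrite ler_norml; apply/andP; split; nra.
Qed.

Section Expansion.
Variables (U Ux Uy Uxx Uxy Uyy : C -> R).
Hypothesis HU : C2_data U Ux Uy Uxx Uxy Uyy.

(** In the second-order expansion, the linear part and the trace-free quadratic part are real parts
    of holomorphic polynomials in the displacement D(v). They remain real parts of a holomorphic
    function of v vanishing at 0, whose mean over discs is 0; only the trace term survives. *)
Lemma expand (z : C) (r cxx cxy cyy e : R) : disc z -> 0 <= e -> 0 < r ->
  (forall w, normc (w - z) < r -> [/\ disc w, `|Uxx w - cxx| <= e, `|Uxy w - cxy| <= e &
     `|Uyy w - cyy| <= e]) ->
  exists f : C -> C, [/\ forall v, disc v -> derivable f v 1, f 0 = 0 &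
    forall v, sqn v <= 4^-1 -> 4 * sqn v < r ^+ 2 ->
     `|U (mobius (shift_mx z) v) - U z - complex.Re (f v)
        - (cxx + cyy) / 4 * sqn (mobius (shift_mx z) v - z)| <= 8 * e * sqn v].
Proof.
move=> zd e0 r0 H; have sS := SU11_shift zd.
pose D v := mobius (shift_mx z) v - z.
have dD v : disc v -> derivable D v 1.
  move=> vd; apply: derivableB; last exact: derivable_cst.
  by have [] := is_derive_mobius sS vd.
pose c1 : C := Ux z -i* Uy z; pose c2 : C := ((cxx - cyy) / 4) -i* (cxy / 2).
exists (fun v => c1 * D v + c2 * (D v * D v)); split.
- move=> v vd; apply: derivableD; first by apply: derivable_cmul; exact: dD.
  by apply: derivable_cmul; apply: derivable_mul_complex; exact: dD.
- by rewrite /D mobius_shift0// subrr !mulr0 addr0.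
move=> v v4 vr; have h := shift_sub_le zd v4.
have nr : normc (mobius (shift_mx z) v - z) < r by rewrite normc_lt//; exact: le_lt_trans vr.
case Eab : (mobius (shift_mx z) v - z) (nr) => [a b] _.
have T := taylor2 HU e0 H nr Eab.
rewrite /D Eab in h T *.
have -> : U (mobius (shift_mx z) v) - U z - complex.Re (c1 * (a +i* b) + c2 * ((a +i* b) * (a +i* b)))
    - (cxx + cyy) / 4 * sqn (a +i* b) =
  U (mobius (shift_mx z) v) - U z - Ux z * a - Uy z * b -
      (cxx / 2 * a ^+ 2 + cxy * (a * b) + cyy / 2 * b ^+ 2).
  by rewrite /c1 /c2 /sqn /=; field.
apply: (le_trans T); rewrite (_ : 8 * e * sqn v = 2 * e * (4 * sqn v)); last by ring.
by rewrite ler_wpM2l// mulr_ge0.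
Qed.

(** [expand] with zero second-order coefficients: the second derivatives themselves count as the
    error. This gives the uniform majorant for dominated convergence. *)
Lemma expand_uniform (k : R) : 0 <= k < 1 -> exists M m, [/\ 0 <= M, 0 < m <= 1 &
  forall z, normc z <= k -> exists f : C -> C, [/\ forall v, disc v -> derivable f v 1, f 0 = 0 &
    forall v, sqn v < m -> `|U (mobius (shift_mx z) v) - U z - complex.Re (f v)| <= M * sqn v]].
Proof.
move=> /andP[k0 k1]; pose k' := (1 + k) / 2; pose r := (1 - k) / 2.
have k'1 : 0 <= k' < 1 by rewrite /k'; apply/andP; split; lra.
have r0 : 0 < r by rewrite /r; lra.
have [M1 M10 H1] := bounded_closed_disc (C2_cxx HU) k'1.
have [M2 M20 H2] := bounded_closed_disc (C2_cxy HU) k'1.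
have [M3 M30 H3] := bounded_closed_disc (C2_cyy HU) k'1.
have s0 : 0 <= M1 + M2 + M3 by rewrite !addr_ge0.
have r2 : 0 < r ^+ 2 / 4 by rewrite divr_gt0// exprn_gt0.
exists (8 * (M1 + M2 + M3)), (Num.min (4^-1) (r ^+ 2 / 4)); split.
- by rewrite mulr_ge0.
- by rewrite lt_min invr_gt0 ltr0n r2 ge_min invf_le1// ler1n.
move=> z zk; have zd : disc z by exact: le_lt_trans k1.
have [w wr|f [df f0 Hf]] := @expand z r 0 0 0 (M1 + M2 + M3) zd s0 r0.
  have wk : normc w <= k'.
    have := le_normcD (w - z) z; rewrite subrK => h.
    apply: (le_trans h); move: wr zk; rewrite /r /k'; move: (normc _) (normc _) => s t; lra.
  split; first by have /andP[_] := k'1; exact: le_lt_trans.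
  - by rewrite subr0 (le_trans (H1 w wk))// -addrA lerDl addr_ge0.
  - by rewrite subr0 (le_trans (H2 w wk))// addrAC lerDr addr_ge0.
  - by rewrite subr0 (le_trans (H3 w wk))// lerDr addr_ge0.
exists f; split => // v; rewrite lt_min => /andP[v1 v2].
have := Hf v (ltW v1); rewrite addr0 !mul0r subr0; apply.
by rewrite mulrC -ltr_pdivlMr.
Qed.

(** [expand] with the actual second derivatives at z. The trace term is rescaled by |D(v)|^2 ~ (1 -
    |z|^2)^2 |v|^2 = 4 |v|^2 / rho(z), which gives the pointwise limit. *)
Lemma expand_local (z : C) (e : R) : disc z -> 0 < e -> exists2 m, 0 < m <= 1 &
  exists f : C -> C, [/\ forall v, disc v -> derivable f v 1, f 0 = 0 &
    forall v, sqn v < m -> `|U (mobius (shift_mx z) v) - U z - complex.Re (f v)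
       - (Uxx z + Uyy z) / rho z * sqn v| <= e * sqn v].
Proof.
move=> zd e0; have e1 : 0 < e / 16 by rewrite divr_gt0.
have [r1 r10 H1] := rcont_normcP (C2_cxx HU zd) e1.
have [r2 r20 H2] := rcont_normcP (C2_cxy HU zd) e1.
have [r3 r30 H3] := rcont_normcP (C2_cyy HU zd) e1.
have [r4 r40 H4] := (nbhs_normc z (@disc R)).1 (open_disc zd).
pose r := Num.min (Num.min r1 r2) (Num.min r3 r4).
have r0 : 0 < r by rewrite !lt_min r10 r20 r30.
have [f [df f0 Hf]] : exists f : C -> C, [/\ forall v, disc v -> derivable f v 1, f 0 = 0 &
    forall v, sqn v <= 4^-1 -> 4 * sqn v < r ^+ 2 ->
     `|U (mobius (shift_mx z) v) - U z - complex.Re (f v)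
        - (Uxx z + Uyy z) / 4 * sqn (mobius (shift_mx z) v - z)| <= 8 * (e / 16) * sqn v].
  apply: (expand (cxy := Uxy z) zd (ltW e1) r0) => w; rewrite !lt_min => /andP[/andP[w1 w2] /andP[w3 w4]].
  by split; [exact: H4|exact: H1|exact: H2|exact: H3].
(* Half of e is spent on the Taylor error, 8 e / 16, and half on replacing |D(v)|^2: |L| 10 d <= e /
   2. *)
pose L := (Uxx z + Uyy z) / 4; pose d := Num.min (2^-1) (e / 20 / (`|L| + 1)).
have L1 : 0 < `|L| + 1 by rewrite ltr_pwDr.
have d0 : 0 < d by rewrite lt_min invr_gt0 ltr0n !divr_gt0.
have [d1 d2] : d <= 2^-1 /\ d <= e / 20 / (`|L| + 1) by rewrite !ge_min !lexx orbT.
clearbody d.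
exists (Num.min (d ^+ 2) (r ^+ 2 / 4)).
  rewrite lt_min exprn_gt0//= divr_gt0 ?exprn_gt0//= ge_min expr_le1 ?(ltW d0)//; lra.
exists f; split => // v; rewrite lt_min => /andP[v1 v2].
have nv : normc v <= d by rewrite -(ler_pXn2r (_ : (0 < 2)%N)) ?nnegrE ?normc_ge0 ?(ltW d0)// normc_sqn ltW.
have d4 : d ^+ 2 <= 4^-1.
  have -> : 4^-1 = 2^-1 ^+ 2 :> R by rewrite exprVn -natrX.
  by rewrite ler_pXn2r ?nnegrE ?(ltW d0).
have := Hf v (ltW (lt_le_trans v1 d4)); rewrite mulrC -ltr_pdivlMr// => /(_ v2).
have d01 : 0 < d <= 2^-1 by rewrite d0.
have := shift_sub_approx zd d01 nv.
have zd1 : 0 < 1 - sqn z by rewrite subr_gt0; apply/disc_sqn.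
have -> : (Uxx z + Uyy z) / rho z = L * (1 - sqn z) ^+ 2.
  by rewrite rhoE /L; field; rewrite gt_eqF.
rewrite -/L; set X := _ - complex.Re _; set Y := sqn (_ - z); set V := sqn v => h1 h2.
have V0 : 0 <= V by exact: sqn_ge0.
have -> : X - L * (1 - sqn z) ^+ 2 * V = (X - L * Y) + L * (Y - (1 - sqn z) ^+ 2 * V) by ring.
apply: (le_trans (ler_normD _ _)).
have h3 : `|L * (Y - (1 - sqn z) ^+ 2 * V)| <= e / 2 * V.
  rewrite normrM; apply: (@le_trans _ _ (`|L| * (10 * d * V))); first by rewrite ler_wpM2l.
  rewrite mulrA; apply: ler_wpM2r => //.
  apply: (@le_trans _ _ ((`|L| + 1) * (10 * (e / 20 / (`|L| + 1))))).
    by apply: ler_pM => //; rewrite ?mulr_ge0 ?(ltW d0)// ?lerDl// ler_pM2l.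
  by rewrite le_eqVlt; apply/orP; left; apply/eqP; field; rewrite gt_eqF.
have -> : e * V = 8 * (e / 16) * V + e / 2 * V by field.
exact: lerD.
Qed.
End Expansion.
End Taylor.

(** * Real-valued integrals against hyperbolic area *)

Section HyperbolicIntegral.
Context {R : realType}.
Local Notation C := R[i].
Local Notation P := (R * R)%type.
Variable S : set C.
Hypothesis mS : measurable (@of_plane R @^-1` S : set P).
Implicit Types f g : C -> R.

Definition hI f : R := \int[@plane_area R]_(p in @of_plane R @^-1` S) (f (of_plane p) * rho (of_plane p)).

Definition hmeas f := measurable_fun (@of_plane R @^-1` S : set P) (fun p => f (of_plane p)).

Definition hintegrable f := (@plane_area R).-integrable (@of_plane R @^-1` S)
  (EFin \o (fun p => f (of_plane p) * rho (of_plane p))).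

Let mS' : measurable (@of_plane R @^-1` S : set (measurableTypeR R * measurableTypeR R)).
Proof. exact: mS. Qed.

Let mrho : measurable_fun (@of_plane R @^-1` S : set P) (fun p : P => rho (of_plane p)).
Proof. by apply: measurable_funTS; exact: measurable_rho. Qed.

Lemma hmeasM_rho f : hmeas f ->
  measurable_fun (@of_plane R @^-1` S : set P) (EFin \o (fun p => f (of_plane p) * rho (of_plane p))).
Proof. by move=> mf; apply/measurable_EFinP/measurable_funM. Qed.

Lemma hintE_hI f : hintegrable f -> hint S (fun z => (f z)%:E) = (hI f)%:E.
Proof.
move=> If; rewrite /hI /Rintegral fineK; first by apply: eq_integral => p _; rewrite EFinM.
exact: integrable_fin_num If.
Qed.

Lemma hintegrable_ge0 f : hmeas f -> (forall z, S z -> 0 <= f z) ->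
  (hint S (fun z => (f z)%:E) < +oo)%E -> hintegrable f.
Proof.
move=> mf f0 H; apply/integrableP; split; first exact: hmeasM_rho.
rewrite (_ : integral _ _ _ = hint S (fun z => (f z)%:E))//.
apply: eq_integral => p /[!inE] Sp; rewrite -EFinM /= ger0_norm// mulr_ge0 ?rho_ge0// f0//.
Qed.

Lemma hintegrable_le f g : hmeas f -> (forall z, S z -> `|f z| <= g z) -> hintegrable g -> hintegrable f.
Proof.
move=> mf fg; apply: le_integrable => //; first exact: hmeasM_rho.
by move=> p Sp; rewrite lee_fin !normrM ler_wpM2r// (le_trans (fg _ Sp))// ler_norm.
Qed.

Lemma hintegrableD f g : hintegrable f -> hintegrable g -> hintegrable (fun z => f z + g z).
Proof.
move=> If Ig; have := integrableD mS' If Ig; apply: eq_integrable => // p _ /=.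
by rewrite mulrDl.
Qed.

Lemma hintegrableZ (k : R) f : hintegrable f -> hintegrable (fun z => k * f z).
Proof.
move=> If; have := integrableZl mS' k If; apply: eq_integrable => // p _ /=.
by rewrite -mulrA EFinM.
Qed.

Lemma hintegrableB f g : hintegrable f -> hintegrable g -> hintegrable (fun z => f z - g z).
Proof.
move=> If Ig; have := integrableB mS' If Ig; apply: eq_integrable => // p _ /=.
by rewrite mulrBl.
Qed.

Lemma hID f g : hintegrable f -> hintegrable g -> hI (fun z => f z + g z) = hI f + hI g.
Proof.
by move=> If Ig; rewrite /hI -RintegralD//; apply: eq_Rintegral => p _; rewrite mulrDl.
Qed.

Lemma hIB f g : hintegrable f -> hintegrable g -> hI (fun z => f z - g z) = hI f - hI g.
Proof.
by move=> If Ig; rewrite /hI -RintegralB//; apply: eq_Rintegral => p _; rewrite mulrBl.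
Qed.

Lemma hIZ (k : R) f : hintegrable f -> hI (fun z => k * f z) = k * hI f.
Proof.
by move=> If; rewrite /hI -RintegralZl//; apply: eq_Rintegral => p _; rewrite mulrA.
Qed.

Lemma eq_hI f g : (forall z, S z -> f z = g z) -> hI f = hI g.
Proof. by move=> E; apply: eq_Rintegral => p /[!inE] Sp; rewrite E. Qed.

Lemma eq_hintegrable f g : (forall z, S z -> f z = g z) -> hintegrable f -> hintegrable g.
Proof. by move=> E; apply: eq_integrable => // p /[!inE] Sp /=; rewrite E. Qed.

Lemma hI_le f g : hintegrable f -> hintegrable g -> (forall z, S z -> f z <= g z) -> hI f <= hI g.
Proof.
move=> If Ig fg; apply: le_Rintegral => // p Sp; rewrite ler_wpM2r ?rho_ge0//; exact: fg.
Qed.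

Lemma hI_ge0 f : (forall z, S z -> 0 <= f z) -> 0 <= hI f.
Proof. by move=> f0; apply: Rintegral_ge0 => p Sp; rewrite mulr_ge0 ?rho_ge0// f0. Qed.

Lemma hI_norm_le f g : hintegrable f -> hintegrable g -> (forall z, S z -> `|f z| <= g z) -> `|hI f| <= hI g.
Proof.
move=> If Ig fg; rewrite ler_norml -mulN1r -hIZ//; apply/andP; split; apply: hI_le => //.
- exact: hintegrableZ.
- by move=> z /fg; rewrite mulN1r ler_norml => /andP[].
- by move=> z /fg; rewrite ler_norml => /andP[].
Qed.

Lemma hintegrable_cst (k : R) : (hint S (fun=> 1%:E) < +oo)%E -> hintegrable (fun=> k).
Proof.
move=> fin; have I1 : hintegrable (fun=> 1).
  by apply: hintegrable_ge0 => // ; exact: measurable_cst.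
by have := hintegrableZ k I1; apply: eq_hintegrable => z _; rewrite mulr1.
Qed.

Lemma hintegrable_bounded f (M : R) : (hint S (fun=> 1%:E) < +oo)%E -> hmeas f ->
  (forall z, S z -> `|f z| <= M) -> hintegrable f.
Proof. by move=> fin mf fM; apply: hintegrable_le fM _ => //; exact: hintegrable_cst. Qed.
End HyperbolicIntegral.

(** * Means over small balls *)

Section BallEstimate.
Context {R : realType}.
Local Notation C := R[i].
Local Notation P := (R * R)%type.
Local Notation leb := (@lebesgue_measure R).

Lemma hint_patch (S T : set C) (g : C -> \bar R) : S `<=` T ->
  hint S g = hint T (fun z => if z \in S then g z else 0%E).
Proof.
move=> ST; rewrite !hintE; apply: eq_integral => p _; rewrite /hweight !indicE.
have [Sp|nSp] := pselect (S (of_plane p)).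
  by rewrite !mem_set//; exact: ST.
by rewrite [p \in of_plane (R:=R) @^-1` S]memNset// [of_plane p \in S]memNset// mulr0 mule0 mul0e.
Qed.

Lemma ebdisc_fin (m : R) : 0 <= m < 1 -> (hint (ebdisc m) (fun=> 1%:E) < +oo)%E.
Proof.
move=> /andP[m0 m1]; have k01 : 0 <= Num.sqrt m < 1.
  by rewrite sqrtr_ge0 /= -[ltRHS]sqrtr1 ltr_sqrt.
have mk := measurable_normc_le (sqrtr_ge0 m).
apply: le_lt_trans (hint_cst_lty k01 (@ler01 R)); apply: ge0_subset_integral => //.
- exact: measurable_ebdisc.
- apply: emeasurable_funM => //; apply/measurable_EFinP/measurable_funTS; exact: measurable_rho.
- by move=> p _; rewrite mule_ge0// lee_fin rho_ge0.
- by move=> p h; apply: ler_wsqrtr; exact: ltW.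
Qed.

Variables (f : C -> C) (m : R).
Hypotheses (df : forall v, disc v -> derivable f v 1) (f0 : f 0 = 0) (m01 : 0 < m < 1).

Let m1 : m <= 1. Proof. by have /andP[_ /ltW] := m01. Qed.
Let mB := measurable_ebdisc m.
Let Bfin : (hint (ebdisc m) (fun=> 1%:E) < +oo)%E.
Proof. by apply: ebdisc_fin; have /andP[/ltW -> ->] := m01. Qed.

Lemma hmeas_Re : hmeas (ebdisc m) (fun z => complex.Re (f z)).
Proof.
have [mR _] := @ccontinuous_measurable R (@disc R) f (@open_disc R) (fun z zd => cderive_continuous (df zd)).
by apply: measurable_funS mR; [exact: measurable_disc|move=> p; exact: ebdisc_disc].
Qed.

(** Averaging over rotations replaces Re f by its circular means, which all equal Re f(0) = 0. *)
Lemma mean_zero (c : R) : (forall z, ebdisc m z -> `|complex.Re (f z)| <= c) ->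
  hI (ebdisc m) (fun z => complex.Re (f z)) = 0.
Proof.
move=> fc; have mR := hmeas_Re.
have IR := hintegrable_bounded mB Bfin mR fc.
have Ic := hintegrable_cst mB c Bfin.
have Is := hintegrableD mB IR Ic.
have fc0 z : ebdisc m z -> 0 <= complex.Re (f z) + c by move=> /fc; rewrite ler_norml => /andP[? _]; lra.
(* The constant c makes the function nonnegative, as the averaging lemma requires; it is removed
   again at the end. *)
pose g z : \bar R := if z \in ebdisc m then (complex.Re (f z) + c)%:E else 0%E.
have g0 z : (0 <= g z)%E by rewrite /g; case: ifPn => // /set_mem /fc0; rewrite lee_fin.
have mg : measurable_fun setT (fun p : P => g (of_plane p)).
  rewrite (_ : (fun p : P => _) = (fun p : P => (complex.Re (f (of_plane p)) + c)%:E) \_ (@of_plane R @^-1` ebdisc m)).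
    by apply/(measurable_restrictT _ mB)/measurable_EFinP/measurable_funD.
  by apply/funext => p; rewrite patchE /g.
have [|_] := rotation_average mB (ebdisc_disc m1) _ mg g0.
  by move=> z t; rewrite /ebdisc /= sqnM sqn_cis mulr1.
have -> : hint (ebdisc m) g = (hI (ebdisc m) (fun z => complex.Re (f z) + c))%:E.
  rewrite -(hintE_hI mB)//; apply: eq_hint => z zm; by rewrite /g mem_set.
rewrite [X in _ = X](_ : _ = (hI (ebdisc m) (fun=> c * (pi *+ 2)))%:E); last first.
  rewrite -(hintE_hI mB); last exact: hintegrable_cst.
  apply: eq_hint => z zm; have zd := ebdisc_disc m1 zm.
  have gE t : g (z * cis t) = (complex.Re (f (z * cis t)) + c)%:E.
    by rewrite /g mem_set//= /ebdisc /= sqnM sqn_cis mulr1.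
  under eq_integral do rewrite gE.
  have ir : leb.-integrable `[0, pi *+ 2] (EFin \o (fun t => complex.Re (f (z * cis t)) + c)).
    apply: continuous_integrable => t _; apply: rcontD; last exact: rcont_cst.
    exact: Re_cos2.
  have i1 : leb.-integrable `[0, pi *+ 2] (EFin \o (fun t => complex.Re (f (z * cis t)))).
    by apply: continuous_integrable => t _; exact: Re_cos2.
  have i2 : leb.-integrable `[0, pi *+ 2] (EFin \o (fun t : R => c)).
    by apply: continuous_integrable => t _; exact: rcont_cst.
  rewrite -[LHS]fineK; last exact: (integrable_fin_num _ ir).
  have addI : \int[leb]_(t in `[0, pi *+ 2]) (complex.Re (f (z * cis t)) + c) =
    \int[leb]_(t in `[0, pi *+ 2]) complex.Re (f (z * cis t)) + \int[leb]_(t in `[0, pi *+ 2]) c.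
    by rewrite RintegralD.
  rewrite -[X in X%:E]/(Rintegral _ _ _) addI mean_Re// f0 mul0r add0r Rintegral_cst//.
  rewrite -[X in fine X]/(lebesgue_measure _) lebesgue_measure_itv/=.
  by rewrite lte_fin mulrn_wgt0 ?pi_gt0//= oppr0 addr0.
rewrite -EFinM => -[].
rewrite (hID mB)// (_ : hI _ (fun=> c * _) = (pi *+ 2) * hI (ebdisc m) (fun=> c)); last first.
  by rewrite -(hIZ mB)//; apply: eq_hI => z _; rewrite mulrC.
rewrite mulrDl (mulrC (hI _ (fun=> c))) => /(canRL (addrK _)); rewrite subrr => /eqP; rewrite mulf_eq0.
have pp : pi *+ 2 == 0 :> R = false by rewrite gt_eqF// mulrn_wgt0// pi_gt0.
by rewrite pp orbF => /eqP.
Qed.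

Lemma hintegrable_sqn : hintegrable (ebdisc m) (@sqn R).
Proof.
apply: (hintegrable_bounded (M := 1) mB Bfin).
  by apply: measurable_funTS; exact: (measurable_csqn cmeasurable_id).
by move=> z zm; rewrite ger0_norm ?sqn_ge0//; exact: (ltW (lt_le_trans zm m1)).
Qed.

Lemma ball_estimate (V : C -> R) (c L e : R) : hmeas (ebdisc m) V ->
  (forall v, ebdisc m v -> `|V v| <= c) ->
  (forall v, ebdisc m v -> `|V v - complex.Re (f v) - L * sqn v| <= e * sqn v) ->
  `|hI (ebdisc m) V - L * hI (ebdisc m) (@sqn R)| <= e * hI (ebdisc m) (@sqn R).
Proof.
move=> mV Vc H; have Is := hintegrable_sqn; have IV := hintegrable_bounded mB Bfin mV Vc.
have q1 v : ebdisc m v -> 0 <= sqn v <= 1.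
  by move=> vm; rewrite sqn_ge0; exact: (ltW (lt_le_trans vm m1)).
have fb v : ebdisc m v -> `|complex.Re (f v)| <= c + `|L| + `|e|.
  move=> vm; have h1 := Vc v vm; have h2 := H v vm; have /andP[v0 v1] := q1 v vm.
  rewrite (_ : complex.Re (f v) = V v - L * sqn v - (V v - complex.Re (f v) - L * sqn v)); last by ring.
  apply: (le_trans (ler_normB _ _)); apply: lerD.
    apply: (le_trans (ler_normB _ _)); apply: lerD => //.
    by rewrite normrM (ger0_norm v0) ler_piMr.
  apply: (le_trans h2); apply: (@le_trans _ _ (`|e| * sqn v)); first by rewrite ler_wpM2r// ler_norm.
  by rewrite ler_piMr.
have IR := hintegrable_bounded mB Bfin hmeas_Re fb.
have IVR := hintegrableB mB IV IR.
have ILs := hintegrableZ mB L Is.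
have Id := hintegrableB mB IVR ILs.
have := hI_norm_le mB Id (hintegrableZ mB e Is) H.
by rewrite !(hIB mB)// (mean_zero fb) subr0 !(hIZ mB).
Qed.
End BallEstimate.

Section SecondMoment.
Context {R : realType}.
Local Notation C := R[i].
Local Notation P := (R * R)%type.

(** Comparison with the weight rho^-2, whose integrals over discs are explicit. On the annulus m / 2
    <= |z|^2 < m one has |z|^2 >= 8 m rho^-2, because rho >= 4, and the annulus has positive
    weighted mass. *)
Lemma second_moment_gt0 (m : R) : 0 < m < 1 -> 0 < hI (ebdisc m) (@sqn R).
Proof.
move=> m01; have /andP[m0 m1] := m01; have mB := measurable_ebdisc m.
have Bfin : (hint (ebdisc m) (fun=> 1%:E) < +oo)%E by apply: ebdisc_fin; rewrite (ltW m0).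
pose w (z : C) : R := rho z ^- 2.
have mw (T : set C) : measurable (@of_plane R @^-1` T : set P) -> hmeas T w.
  move=> _; apply: measurable_funTS; apply: (measurableT_comp measurable_inv); apply: measurable_funX; exact: measurable_rho.
have w1 z : ebdisc m z -> 0 <= w z <= 16^-1.
  move=> zm; rewrite /w invr_ge0 sqr_ge0 /=.
  have z1 : 0 < 1 - sqn z by rewrite subr_gt0; apply: lt_trans zm _.
  have r4 : 4 <= rho z.
    rewrite rhoE ler_pdivlMr ?exprn_gt0// ler_piMr// expr_le1 ?(ltW z1)//.
    by rewrite gerBl sqn_ge0.
  by rewrite lef_pV2 ?posrE ?exprn_gt0//; [nra|lra].
have m2 : 0 < m / 2 < 1 by apply/andP; split; lra.
have sub2 : ebdisc (m / 2) `<=` ebdisc m by move=> z; rewrite /ebdisc /= => h; apply: (lt_trans h); lra.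
have mB2 := measurable_ebdisc (m / 2).
have B2fin : (hint (ebdisc (m / 2)) (fun=> 1%:E) < +oo)%E by apply: ebdisc_fin; have /andP[/ltW -> ->] := m2.
have Iw : hintegrable (ebdisc m) w.
  by apply: (hintegrable_bounded mB Bfin (mw _ mB) (M := 16^-1)) => z /w1/andP[h1 h2]; rewrite ger0_norm.
have Iw2 : hintegrable (ebdisc (m / 2)) w.
  by apply: (hintegrable_bounded mB2 B2fin (mw _ mB2) (M := 16^-1)) => z /sub2/w1/andP[h1 h2]; rewrite ger0_norm.
have W (k : R) : 0 < k < 1 -> hintegrable (ebdisc k) w -> hI (ebdisc k) w = pi / 12 * (1 - (1 - k) ^+ 3).
  move=> /andP[k0 k1] Ik; have : 0 < k <= 1 by rewrite k0 ltW.
  by move=> /weight_integral; rewrite (hintE_hI (measurable_ebdisc k))// => -[].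
pose w2 (z : C) : R := if z \in ebdisc (m / 2) then w z else 0.
have w2E : hint (ebdisc m) (fun z => (w2 z)%:E) = (hI (ebdisc (m / 2)) w)%:E.
  rewrite -(hintE_hI mB2)// (hint_patch _ sub2); apply: eq_hint => z _.
  by rewrite /w2; case: ifP.
have w20 z : 0 <= w2 z by rewrite /w2; case: ifPn => // /set_mem/sub2/w1/andP[].
have mw2 : hmeas (ebdisc m) w2.
  rewrite /hmeas (_ : (fun p => _) = (fun p : P => w (of_plane p)) \_ (@of_plane R @^-1` ebdisc (m / 2))).
    by apply: measurable_funTS; apply/(measurable_restrictT _ mB2); exact: mw.
  by apply/funext => p; rewrite patchE /w2.
have Iw2' : hintegrable (ebdisc m) w2 by apply: hintegrable_ge0 => //; rewrite w2E ltry.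
have hw2 : hI (ebdisc m) w2 = hI (ebdisc (m / 2)) w.
  by have := w2E; rewrite (hintE_hI mB)// => -[].
have Id := hintegrableB mB Iw Iw2'.
have le : hI (ebdisc m) (fun z => 8 * m * (w z - w2 z)) <= hI (ebdisc m) (@sqn R).
  apply: (hI_le mB); [exact: hintegrableZ|exact: (hintegrable_sqn m01)|move=> z zm].
  have /andP[wz0 wz1] := w1 z zm.
  rewrite /w2; case: ifPn => [_|/negP nz]; first by rewrite subrr mulr0 sqn_ge0.
  have : m / 2 <= sqn z by rewrite leNgt; apply/negP => h; apply: nz; apply/mem_set.
  rewrite subr0; nra.
apply: lt_le_trans le; rewrite (hIZ mB)// (hIB mB)// hw2 !W//.
rewrite mulr_gt0 ?mulr_gt0// -mulrBr mulr_gt0 ?divr_gt0 ?pi_gt0//.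
by rewrite subr_gt0 ltrD2l ltrN2 ltr_pXn2r ?nnegrE//; lra.
Qed.
End SecondMoment.

(** * Vanishing of the integral of the Laplacian *)

Section LaplacianIntegral.
Context {R : realType}.
Local Notation C := R[i].
Local Notation P := (R * R)%type.
Variable Gamma : set 'M[C]_2.
Hypothesis GammaS : surface_group Gamma.
Variable F : set C.
Hypothesis F_fund : fundamental_set Gamma F.

Lemma invariant_bounded (g : C -> R) : (forall z, disc z -> {for z, continuous g}) ->
  (forall A z, Gamma A -> disc z -> g (mobius A z) = g z) ->
  exists2 M : R, 0 <= M & forall z, disc z -> `|g z| <= M.
Proof.
move=> cg gA; have [k k01 Hk] := cocompact_radius GammaS.
have [M M0 HM] := bounded_closed_disc cg k01; exists M => // z zd.
by have [A GA Az] := Hk z zd; rewrite -(gA A z GA zd); exact: HM.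
Qed.

Lemma sigma_lt_shift (z w : C) (m : R) : disc z -> disc w -> m < 1 ->
  (sigma z w < m / (1 - m)) = (sqn (mobius (shift_mx z)^-1 w) < m).
Proof.
move=> zd wd m1; rewrite sigma_shift//.
have : sqn (mobius (shift_mx z)^-1 w) < 1.
  by apply/disc_sqn; apply: mobius_disc => //; exact: SU11V (SU11_shift zd).
move: (sqn _) => x x1; rewrite ltr_pdivrMr ?subr_gt0// mulrAC ltr_pdivlMr ?subr_gt0//.
by rewrite !mulrBr !mulr1 (mulrC m) ltrD2r.
Qed.

Variables (U Ux Uy Uxx Uxy Uyy : C -> R).
Hypothesis HU : C2_data U Ux Uy Uxx Uxy Uyy.
Hypothesis UA : forall A z, Gamma A -> disc z -> U (mobius A z) = U z.
Variable c : R.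
Hypothesis Uc : forall z, disc z -> `|U z| <= c.

Let mF := fund_measurable F_fund.
Let Fd := @fund_disc _ _ _ F_fund.
Let Ffin := hint_fund_lty GammaS F_fund.

Section FixedRadius.
Variable m : R.
Hypothesis m01 : 0 < m < 1.
Let m0 : 0 < m. Proof. by have /andP[] := m01. Qed.
Let m1 : m < 1. Proof. by have /andP[] := m01. Qed.
Let Bd : ebdisc m `<=` @disc R. Proof. exact: ebdisc_disc (ltW m1). Qed.
Let mB := measurable_ebdisc m.
Let Bfin : (hint (ebdisc m) (fun=> 1%:E) < +oo)%E.
Proof. by apply: ebdisc_fin; rewrite (ltW m0) m1. Qed.

(** The indicator of a ball times U at its second argument. The constant c makes the kernel
    nonnegative for Tonelli and contributes equally to both sides of the exchange. *)
Let N (z w : C) : \bar R :=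
  if [&& normc z < 1, normc w < 1 & sigma z w < m / (1 - m)] then (U w + c)%:E else 0%E.

Let Uc0 z : disc z -> 0 <= U z + c.
Proof. by move=> /Uc; rewrite ler_norml => /andP[? _]; lra. Qed.

Let N0 z w : (0 <= N z w)%E.
Proof. by rewrite /N; case: ifP => // /and3P[_ wd _]; rewrite lee_fin; exact: Uc0. Qed.

Let mU : measurable_fun (@of_plane R @^-1` @disc R : set P) (fun p => U (of_plane p)).
Proof. by apply: continuous_measurable_plane => [z|z]; [exact: open_disc|exact: (C2_cont HU)]. Qed.

Let mN : measurable_fun setT (fun x : P * P => N (of_plane x.1) (of_plane x.2)).
Proof.
pose U' (p : P) : \bar R := ((fun p : P => (U (of_plane p) + c)%:E) \_ (@of_plane R @^-1` @disc R)) p.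
have mU' : measurable_fun setT U'.
  by apply/(measurable_restrictT _ measurable_disc)/measurable_EFinP/measurable_funD.
have md : measurable_fun setT (fun p : P => normc (of_plane p) < 1).
  rewrite (_ : (fun p => _) = (fun p : P => sqn (of_plane p) < 1)).
    by apply: measurable_fun_ltr => //; exact: (measurable_csqn cmeasurable_id).
  by apply/funext => p; rewrite normc_lt// expr1n.
have msub : measurable_fun setT (fun x : P * P => sqn (of_plane x.1 - of_plane x.2)).
  rewrite /sqn /=; apply: measurable_funD; apply: measurable_funX; apply: measurable_funB => /=; exact: measurableT_comp.
have ms : measurable_fun setT (fun x : P * P => sigma (of_plane x.1) (of_plane x.2)).
  apply: measurable_funM; first exact: msub.
  apply: (measurableT_comp measurable_inv); apply: measurable_funM.
    by apply: measurable_funB => //; exact: (measurableT_comp (measurable_csqn cmeasurable_id)).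
  by apply: measurable_funB => //; exact: (measurableT_comp (measurable_csqn cmeasurable_id)).
rewrite (_ : (fun x => _) = (fun x : P * P => if [&& normc (of_plane x.1) < 1, normc (of_plane x.2) < 1 &
   sigma (of_plane x.1) (of_plane x.2) < m / (1 - m)] then U' x.2 else 0%E)).
  apply: measurable_fun_ifT => //; last exact: measurableT_comp.
  apply: measurable_and; first exact: (measurableT_comp md).
  by apply: measurable_and; [exact: (measurableT_comp md)|exact: measurable_fun_ltr].
apply/funext => x; rewrite /N /U' patchE; case: ifP => // /and3P[_ wd _].
by rewrite mem_set.
Qed.

Let NA A z w : Gamma A -> disc z -> disc w -> N (mobius A z) (mobius A w) = N z w.
Proof.
move=> GA zd wd; have sA := Gamma_SU GammaS GA.
have [h1 h2] := (mobius_disc sA zd, mobius_disc sA wd).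
by rewrite /N UA// sigma_mobius// (h1 : normc _ < 1) (h2 : normc _ < 1) (zd : normc _ < 1) (wd : normc _ < 1).
Qed.

(* The hyperbolic ball around z, seen from z, is the Euclidean disc around 0. *)
Let hint_N z (g : C -> \bar R) : disc z -> pmeasurable (@disc R) g -> (forall w, (0 <= g w)%E) ->
  hint (@disc R) (fun w => if [&& normc z < 1, normc w < 1 & sigma z w < m / (1 - m)] then g w else 0%E) =
  hint (ebdisc m) (fun v => g (mobius (shift_mx z) v)).
Proof.
move=> zd mg g0; have sS := SU11_shift zd.
pose T := [set w | disc w /\ ebdisc m (mobius (shift_mx z)^-1 w)].
have mT : measurable (@of_plane R @^-1` T : set P) by exact: measurable_mobius_preim.
have Td : T `<=` @disc R by move=> w [].
transitivity (hint T g).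
  rewrite (hint_patch _ Td); apply: eq_hint => w wd.
  rewrite (zd : normc _ < 1) (wd : normc _ < 1) /= sigma_lt_shift//.
  have [h|h] := boolP (_ < m); first by rewrite mem_set.
  by rewrite memNset// => -[_]; exact/negP.
rewrite -(hint_mobius sS mT Td)//; last first.
  by apply: measurable_funS mg => //; [exact: measurable_disc|move=> p /Td].
congr hint; apply/seteqP; split => v.
  by move=> [vd [_]]; rewrite mobiusK.
by move=> vm; have vd := Bd vm; split => //; split; [exact: mobius_disc|rewrite mobiusK].
Qed.

(** Not divided by the area of the ball: the normalization used in the limit is by the second moment
    of the ball, since the first surviving term is quadratic. *)
Definition ball_mean z : R := hI (ebdisc m) (fun v => U (mobius (shift_mx z) v) - U z).

Let mUS z : disc z -> hmeas (ebdisc m) (fun v => U (mobius (shift_mx z) v)).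
Proof.
move=> zd; have sS := SU11_shift zd.
have : measurable_fun (@of_plane R @^-1` @disc R : set P) (fun p => U (mobius (shift_mx z) (of_plane p))).
  apply: (@continuous_measurable_plane R (@disc R) (fun v => U (mobius (shift_mx z) v))) => [v|v vd]; first exact: open_disc.
  apply: (@continuous_comp _ _ _ (mobius (shift_mx z)) U).
    by apply: cderive_continuous; have [] := is_derive_mobius sS vd.
  by apply: (C2_cont HU); exact: mobius_disc.
by apply: measurable_funS => //; [exact: measurable_disc|move=> p /Bd].
Qed.

Let IUS z : disc z -> hintegrable (ebdisc m) (fun v => U (mobius (shift_mx z) v)).
Proof.
move=> zd; apply: (hintegrable_bounded mB Bfin (mUS zd) (M := c)) => v /Bd vd.
by apply: Uc; apply: mobius_disc => //; exact: SU11_shift.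
Qed.

Let A0 : R := hI (ebdisc m) (fun=> 1).

Let hint_Nz z : disc z -> hint (@disc R) (N z) = (ball_mean z + (U z + c) * A0)%:E.
Proof.
move=> zd; have Ik k : hintegrable (ebdisc m) (fun=> k) by exact: hintegrable_cst.
have I1 := hintegrableB mB (IUS zd) (Ik (U z)).
have I2 := hintegrableZ mB (U z + c) (Ik 1).
pose g (w : C) : \bar R := if w \in @disc R then (U w + c)%:E else 0%E.
have g0 w : (0 <= g w)%E by rewrite /g; case: ifPn => // /set_mem wd; rewrite lee_fin Uc0.
have mg : pmeasurable (@disc R) g.
  have : measurable_fun (@of_plane R @^-1` @disc R : set P) (fun p => (U (of_plane p) + c)%:E).
    by apply/measurable_EFinP/measurable_funD.
  by apply: eq_measurable_fun => p /[!inE] pd; rewrite /g mem_set.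
rewrite (_ : hint (@disc R) (N z) = hint (@disc R)
    (fun w => if [&& normc z < 1, normc w < 1 & sigma z w < m / (1 - m)] then g w else 0%E)); last first.
  by apply: eq_hint => w wd; rewrite /N /g mem_set.
rewrite hint_N//.
rewrite (_ : _ + _ = hI (ebdisc m) (fun v => (U (mobius (shift_mx z) v) - U z) + (U z + c) * 1)); last first.
  by rewrite (hID mB I1 I2) (hIZ mB (U z + c) (Ik 1)).
rewrite -(hintE_hI mB (hintegrableD mB I1 I2)).
apply: eq_hint => v /Bd vd; rewrite /g mem_set; last by apply: mobius_disc => //; exact: SU11_shift.
by congr (_%:E); ring.
Qed.

Let hint_Nw w : disc w -> hint (@disc R) (N ^~ w) = ((U w + c) * A0)%:E.
Proof.
move=> wd; rewrite (_ : hint (@disc R) (N ^~ w) = hint (@disc R)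
    (fun z => if [&& normc w < 1, normc z < 1 & sigma w z < m / (1 - m)] then (U w + c)%:E else 0%E)); last first.
  apply: eq_hint => z zd; rewrite /N sigmaC; congr (if _ then _ else _).
  by rewrite !andbA; congr andb; rewrite andbC.
rewrite (@hint_N w (fun=> (U w + c)%:E))//; last first.
- by move=> z; rewrite lee_fin Uc0.
- exact: measurable_cst.
have Ik k : hintegrable (ebdisc m) (fun=> k) by exact: hintegrable_cst.
rewrite (hintE_hI mB)//; congr (_%:E).
by rewrite -(hIZ mB _ (Ik 1)); apply: eq_hI => v _; rewrite mulr1.
Qed.

(** [shift_mx (mobius A z)] and [A * shift_mx z] differ by a rotation; the invariance is therefore
    read off from the kernel, which involves no choice of frame. *)
Lemma ball_mean_invariant A z : Gamma A -> disc z -> ball_mean (mobius A z) = ball_mean z.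
Proof.
move=> GA zd; have sA := Gamma_SU GammaS GA; have Azd := mobius_disc sA zd.
have := hint_Nz Azd; rewrite -(hint_mobius sA measurable_disc)//; last first.
  by apply: measurable_funTS; have := measurable_fun_pair2 (to_plane (mobius A z)) mN; rewrite /= of_planeK.
rewrite (_ : [set w | _] = @disc R); last by apply/seteqP; split => w //=; [case|move=> wd; split => //; exact: mobius_disc].
rewrite (@eq_hint _ _ _ (N z)); last by move=> w wd; exact: NA.
by rewrite hint_Nz// UA// => -[] /addIr.
Qed.

Lemma hmeas_ball_mean : hmeas F ball_mean.
Proof.
have m1' : measurable_fun setT (fun p : P => hint (@disc R) (N (of_plane p))).
  rewrite (_ : (fun p => _) = (fun p : P => \int[@area R]_q (N (of_plane p) (of_plane q) * (hweight (@disc R) q)%:E))%E).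
    apply: (@measurable_area1 R (fun x : P * P => N (of_plane x.1) (of_plane x.2) * (hweight (@disc R) x.2)%:E)%E).
      apply: emeasurable_funM => //; apply/measurable_EFinP.
      exact: (measurableT_comp (measurable_hweight measurable_disc)).
    by move=> x; rewrite mule_ge0// lee_fin hweight_ge0.
  by apply/funext => p; rewrite hintE.
have m2 : measurable_fun (@of_plane R @^-1` F : set P) (fun p => (ball_mean (of_plane p) + (U (of_plane p) + c) * A0)%:E).
  have := measurable_funTS (D := @of_plane R @^-1` F : set P) m1'.
  by apply: eq_measurable_fun => p /[!inE] /Fd pd; rewrite -hint_Nz.
have mUF : measurable_fun (@of_plane R @^-1` F : set P) (fun p => U (of_plane p)).
  by apply: measurable_funS mU; [exact: measurable_disc|move=> p /Fd].
have : measurable_fun (@of_plane R @^-1` F : set P) (fun p => (ball_mean (of_plane p) + (U (of_plane p) + c) * A0) - (U (of_plane p) + c) * A0).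
  by apply: measurable_funB; [exact/measurable_EFinP|apply: measurable_funM => //; exact: measurable_funD].
by apply: eq_measurable_fun => p _; rewrite addrK.
Qed.

(** The exchange of variables equates the integral of ball_mean + A0 (U + c) with that of A0 (U +
    c), where A0 is the area of the ball. *)
Lemma hI_ball_mean (K : R) : (forall z, F z -> `|ball_mean z| <= K) -> hI F ball_mean = 0.
Proof.
move=> HK; have Im := hintegrable_bounded mF Ffin hmeas_ball_mean HK.
have mUF : hmeas F U by apply: measurable_funS mU; [exact: measurable_disc|move=> p /Fd].
have IU := hintegrable_bounded mF Ffin mUF (fun z zF => Uc (Fd zF)).
have Ic := hintegrable_cst mF c Ffin.
have IUc : hintegrable F (fun z => A0 * (U z + c)) by apply: (hintegrableZ mF); exact: (hintegrableD mF).
have := symmetric_unfold GammaS F_fund mN N0 NA.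
rewrite (@eq_hint _ _ _ (fun z => (ball_mean z + A0 * (U z + c))%:E)); last first.
  by move=> z /Fd zd; rewrite hint_Nz// (mulrC A0).
rewrite [RHS](@eq_hint _ _ _ (fun z => (A0 * (U z + c))%:E)); last first.
  by move=> z /Fd zd; rewrite hint_Nw// (mulrC A0).
rewrite !(hintE_hI mF)//; last exact: (hintegrableD mF).
by rewrite (hID mF)// => -[] /(canRL (addrK _)); rewrite subrr.
Qed.

End FixedRadius.

(* Boundedness of (Uxx + Uyy) / rho allows dominated convergence as the radius tends to 0. *)
Lemma integral_laplacian_eq0 :
  (exists M : R, forall z, disc z -> `|(Uxx z + Uyy z) / rho z| <= M) /\
  hI F (fun z => (Uxx z + Uyy z) / rho z) = 0.
Proof.
have [k k01 Hk] := cocompact_radius GammaS.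
have [M [mu [M0 mu01 HM]]] := expand_uniform HU k01.
pose q m := hI (ebdisc m) (@sqn R).
(* Squared radii tending to 0, below [mu] for the uniform expansion and below 1 for the finiteness
   of area. *)
pose ms (n : nat) : R := Num.min mu (2^-1) / n.+1%:R.
have mu0 : 0 < Num.min mu (2^-1) :> R by have /andP[h _] := mu01; rewrite lt_min h invr_gt0 ltr0n.
have n1 (n : nat) : 1 <= n.+1%:R :> R by rewrite ler1n.
have ms_le n : ms n <= mu /\ ms n <= 2^-1.
  have h : ms n <= Num.min mu (2^-1) by rewrite /ms ler_pdivrMr ?ler_peMr// ?(ltW mu0)// ltr0n.
  by move: h; rewrite le_min => /andP[].
have ms01 n : 0 < ms n < 1.
  by rewrite divr_gt0//=; have [_ h] := ms_le n; apply: (le_lt_trans h); rewrite invf_lt1// ltr1n.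
have q0 n : 0 < q (ms n) by exact: second_moment_gt0.
have mV z (n : nat) : disc z -> hmeas (ebdisc (ms n)) (fun v => U (mobius (shift_mx z) v) - U z).
  move=> zd; have sS := SU11_shift zd; have /andP[_ /ltW l1] := ms01 n.
  have mdd : measurable_fun (@of_plane R @^-1` @disc R : set P) (fun p => U (mobius (shift_mx z) (of_plane p)) - U z).
    apply: (@continuous_measurable_plane R (@disc R) (fun v => U (mobius (shift_mx z) v) - U z)) => [v|v vd]; first exact: open_disc.
    apply: rcontB; last exact: rcont_cst.
    apply: (@continuous_comp _ _ _ (mobius (shift_mx z)) U).
      by apply: cderive_continuous; have [] := is_derive_mobius sS vd.
    by apply: (C2_cont HU); exact: mobius_disc.
  by apply: measurable_funS mdd => //; [exact: measurable_disc|move=> p /(ebdisc_disc l1)].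
have V2c z n v : disc z -> ebdisc (ms n) v -> `|U (mobius (shift_mx z) v) - U z| <= c + c.
  move=> zd vm; have /andP[_ /ltW l1] := ms01 n; have vd := ebdisc_disc l1 vm.
  apply: (le_trans (ler_normB _ _)); apply: lerD; last exact: Uc.
  by apply: Uc; apply: mobius_disc => //; exact: SU11_shift.
pose g n z := ball_mean (ms n) z / q (ms n).
have gM n z : disc z -> `|g n z| <= M.
  (* Invariance of the ball mean moves z into the compact disc where the uniform expansion holds. *)
  move=> zd; have [A GA Ak] := Hk z zd; have Azd := mobius_disc (Gamma_SU GammaS GA) zd.
  rewrite /g -(ball_mean_invariant (ms01 n) GA zd) normrM normfV (gtr0_norm (q0 n)) ler_pdivrMr//.
  have [f [df f0 Hf]] := HM _ Ak.
  have := @ball_estimate R f (ms n) df f0 (ms01 n) _ (c + c) 0 M (mV _ n Azd) (fun v => V2c _ n v Azd).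
  rewrite mul0r subr0; apply => v vm; rewrite mul0r subr0; apply: Hf.
  by apply: (lt_le_trans vm); have [] := ms_le n.
have lim z : disc z -> (fun n => g n z) @ \oo --> (Uxx z + Uyy z) / rho z.
  move=> zd; apply/cvgrPdist_le => e e0.
  have [m /andP[m0 m1] [f [df f0 Hf]]] := expand_local HU zd e0.
  near=> n.
  have nm : ms n <= m.
    near: n; exists (Num.truncn (Num.min mu (2^-1) / m)).+1 => //= n /= hn.
    rewrite /ms ler_pdivrMr ?ltr0n// mulrC -ler_pdivrMr//.
    apply: (le_trans (ltW (truncnS_gt _))).
    by rewrite ler_nat; exact: leq_trans hn _.
  rewrite distrC -[X in _ - X](mulfK (lt0r_neq0 (q0 n))) /g -mulrBl normrM normfV (gtr0_norm (q0 n)) ler_pdivrMr//.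
  apply: (@ball_estimate R f (ms n) df f0 (ms01 n) _ (c + c) _ e (mV _ n zd)).
    by move=> v; exact: V2c.
  by move=> v vm; apply: Hf; exact: lt_le_trans nm.
split.
  exists M => z zd; apply/ler_addgt0Pr => e e0.
  have /cvgrPdist_le /(_ e e0) [n _ Hn] := lim z zd.
  rewrite -[X in `|X|](subrK (g n z)); apply: (le_trans (ler_normD _ _)).
  by rewrite addrC; apply: lerD; [exact: gM|exact: (Hn n (leqnn n))].
have mg n : hmeas F (g n) by apply: measurable_funM => //; exact: (hmeas_ball_mean (ms01 n)).
have Ig n : hI F (g n) = 0.
  have HK z : F z -> `|ball_mean (ms n) z| <= M * q (ms n).
    by move=> /Fd/(gM n z); rewrite /g normrM normfV (gtr0_norm (q0 n)) ler_pdivrMr.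
  have Im := hintegrable_bounded mF Ffin (hmeas_ball_mean (ms01 n)) HK.
  transitivity ((q (ms n))^-1 * hI F (ball_mean (ms n))); last by rewrite (hI_ball_mean (ms01 n) HK) mulr0.
  by rewrite -(hIZ mF)//; apply: eq_hI => z _; rewrite mulrC.
have mL : hmeas F (fun z => (Uxx z + Uyy z) / rho z).
  have mdd : measurable_fun (@of_plane R @^-1` @disc R : set P) (fun p => (Uxx (of_plane p) + Uyy (of_plane p)) / rho (of_plane p)).
    apply: measurable_funM.
      by apply: measurable_funD; apply: continuous_measurable_plane => z; [exact: open_disc|exact: (C2_cxx HU)|exact: open_disc|exact: (C2_cyy HU)].
    apply: measurable_funTS; apply: (measurableT_comp measurable_inv); exact: measurable_rho.
  by apply: measurable_funS mdd => //; [exact: measurable_disc|move=> p /Fd].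
have mF' : measurable (@of_plane R @^-1` F : set (measurableTypeR R * measurableTypeR R)) by exact: mF.
have IM := hintegrable_cst mF M Ffin.
have [] := @dominated_convergence _ _ _ (@plane_area R) _ mF'
  (fun n p => (g n (of_plane p) * rho (of_plane p))%:E)
  (fun p => ((Uxx (of_plane p) + Uyy (of_plane p)) / rho (of_plane p) * rho (of_plane p))%:E)
  (EFin \o (fun p => M * rho (of_plane p))).
- by move=> n; exact: (hmeasM_rho (mg n)).
- exact: (hmeasM_rho mL).
- apply: aeW => p /Fd pd; apply: cvg_EFin; first by near=> n.
  by apply: cvgM; [exact: lim|exact: cvg_cst].
- exact: IM.
- apply: aeW => p n /Fd pd; rewrite lee_fin normrM (ger0_norm (rho_ge0 _)).
  by apply: ler_wpM2r; [exact: rho_ge0|exact: gM].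
move=> IL _ cvI.
have E0 : (fun n => \int[@plane_area R]_(p in @of_plane R @^-1` F) (g n (of_plane p) * rho (of_plane p))%:E)%E = (fun=> 0%E).
  apply/funext => n; rewrite -[RHS](congr1 EFin (Ig n)) /hI /Rintegral fineK//.
  apply: integrable_fin_num; first exact: mF'.
  exact: (hintegrable_bounded mF Ffin (mg n) (fun z zF => gM n z (Fd zF))).
rewrite E0 in cvI.
have := cvg_unique _ cvI (cvg_cst 0%E).
by rewrite /hI /Rintegral => ->.
Unshelve. all: by end_near. Qed.

End LaplacianIntegral.

(** * Positivity of the Laplacian *)

Section LaplacePairs.
Context {R : realType}.
Local Notation C := R[i].
Local Notation P := (R * R)%type.

Lemma second_difference (v w : C) (f fv fvw : C -> R) (z : C) (h c e : R) :
  dirder v f fv -> dirder w fv fvw -> 0 <= h -> 0 <= e ->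
  (forall s t : R, `|s| <= h -> `|t| <= h -> disc (z + s%:C * v + t%:C * w) /\
     `|fvw (z + s%:C * v + t%:C * w) - c| <= e) ->
  `|f (z + h%:C * v + h%:C * w) - f (z + h%:C * v) - f (z + h%:C * w) + f z - c * h ^+ 2| <= e * h ^+ 2.
Proof.
move=> H1 H2 h0 e0 He; have hh : `|h| = h by rewrite ger0_norm.
have := @mvt_bound R (fun t => f (z + h%:C * w + t%:C * v) - f (z + t%:C * v) - c * h * t)
  (fun t => fv (z + h%:C * w + t%:C * v) - fv (z + t%:C * v) - c * h) h (e * h).
rewrite mul0r !addr0 mulr0 subr0 hh (addrAC z) => K.
have -> : f (z + h%:C * v + h%:C * w) - f (z + h%:C * v) - f (z + h%:C * w) + f z - c * h ^+ 2 =
   f (z + h%:C * v + h%:C * w) - f (z + h%:C * v) - c * h * h - (f (z + h%:C * w) - f z) by ring.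
rewrite expr2 mulrA; apply: K => t th.
  have d1 : is_derive t 1 (fun t : R => f (z + h%:C * w + t%:C * v)) (fv (z + h%:C * w + t%:C * v)).
    by apply: dirder_at => //; rewrite addrAC; have [] := He t h th; rewrite ?hh.
  have d2 : is_derive t 1 (fun t : R => f (z + t%:C * v)) (fv (z + t%:C * v)).
    by apply: dirder_at => //; have [] := He t 0 th; rewrite ?normr0// mul0r addr0.
  have d3 : is_derive t 1 (fun s : R => c * h * s : R) (c * h).
    by have := is_deriveZ (c * h) (is_derive_id t (1 : R)); rewrite /GRing.scale /= mulr1.
  exact: (is_deriveB (is_deriveB d1 d2) d3).
rewrite -[h in e * h]hh (addrAC z); apply: (dirder_taylor1 H2) => s sh; rewrite hh in sh.
exact: He.
Qed.

(** The second difference of f is symmetric in v and w, and divided by h^2 it approximates both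
    mixed derivatives. This serves to cancel the mixed terms produced by composing [dz] and
    [dzbar]. *)
Lemma schwarz (v w : C) (f fv fw fvw fwv : C -> R) (z : C) : disc z ->
  dirder v f fv -> dirder w fv fvw -> dirder w f fw -> dirder v fw fwv ->
  {for z, continuous fvw} -> {for z, continuous fwv} -> fvw z = fwv z.
Proof.
move=> zd H1 H2 H3 H4 c1 c2; apply/eqP; rewrite -subr_eq0 -normr_le0; apply/ler_addgt0Pl => e e0.
have e2 : 0 < e / 2 by rewrite divr_gt0.
have [r1 r10 K1] := rcont_normcP c1 e2; have [r2 r20 K2] := rcont_normcP c2 e2.
have [r3 r30 K3] := (nbhs_normc z (@disc R)).1 (open_disc zd).
have [nv nw] := (normc_ge0 v, normc_ge0 w).
pose r := Num.min (Num.min r1 r2) r3.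
have r0 : 0 < r by rewrite !lt_min r10 r20.
pose h := r / (normc v + normc w + 1).
have s0 : 0 < normc v + normc w + 1 by rewrite ltr_pwDr// addr_ge0.
have h0 : 0 < h by rewrite divr_gt0.
have near s t : `|s| <= h -> `|t| <= h -> normc (z + s%:C * v + t%:C * w - z) < r.
  move=> sh th; have -> : z + s%:C * v + t%:C * w - z = s%:C * v + t%:C * w by ring.
  have nC (x : R) : normc x%:C = `|x| by rewrite /= expr0n /= addr0 sqrtr_sqr.
  apply: (le_lt_trans (le_normcD _ _)); rewrite !normcM !nC.
  apply: (@le_lt_trans _ _ (h * normc v + h * normc w)); first by apply: lerD; rewrite ler_wpM2r.
  by rewrite -mulrDr /h mulrAC ltr_pdivrMr// ltr_pM2l// ltrDl.
have near' (s t : R) (sh : `|s| <= h) (th : `|t| <= h) : [/\ normc (z + s%:C * v + t%:C * w - z) < r1, normc (z + s%:C * v + t%:C * w - z) < r2 &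
    normc (z + s%:C * v + t%:C * w - z) < r3].
  by have := near s t sh th; rewrite !lt_min => /andP[/andP[]].
have D1 := @second_difference v w f fv fvw z h (fvw z) (e / 2) H1 H2 (ltW h0) (ltW e2).
have D2 := @second_difference w v f fw fwv z h (fwv z) (e / 2) H3 H4 (ltW h0) (ltW e2).
have {}D1 := D1 (fun s t sh th => let: And3 a b c := near' s t sh th in conj (K3 _ c) (K1 _ a)).
have {}D2 : `|f (z + h%:C * w + h%:C * v) - f (z + h%:C * w) - f (z + h%:C * v) + f z - fwv z * h ^+ 2| <= e / 2 * h ^+ 2.
  by apply: D2 => s t sh th; rewrite addrAC; have [a b c] := near' t s th sh; split; [exact: K3|exact: K2].
rewrite addr0 -(ler_pM2r (exprn_gt0 2 h0)) -{1}(ger0_norm (ltW (exprn_gt0 2 h0))) -normrM mulrBl.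
rewrite (addrAC z) in D2.
set a := f _ in D1 D2; set b := f _ in D1 D2; set b' := f _ in D1 D2.
have -> : fvw z * h ^+ 2 - fwv z * h ^+ 2 = (a - b' - b + f z - fwv z * h ^+ 2) - (a - b - b' + f z - fvw z * h ^+ 2) by ring.
apply: (le_trans (ler_normB _ _)).
have -> : e * h ^+ 2 = e / 2 * h ^+ 2 + e / 2 * h ^+ 2 by field.
exact: lerD.
Qed.

(* On real functions, -rho^-1 d/dz d/dzbar is -(fxx + fyy) / (4 rho). *)
Definition laplace_pair (Gamma : set 'M[C]_2) (f g : C -> R) : Prop :=
  (forall A z, Gamma A -> disc z -> f (mobius A z) = f z) /\
  exists fx fy fxx fxy fyy, [/\ C2_data f fx fy fxx fxy fyy,
    forall z, disc z -> {for z, continuous fx}, forall z, disc z -> {for z, continuous fy} &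
    forall z, disc z -> g z = - ((fxx z + fyy z) / rho z / 4)].

Lemma dirderD v (f g df dg : C -> R) (s : R) : dirder v f df -> dirder v g dg ->
  dirder v (fun z => f z + s * g z) (fun z => df z + s * dg z).
Proof. by move=> Hf Hg z zd; exact: (is_deriveD (Hf z zd) (is_deriveZ s (Hg z zd))). Qed.

Lemma dirderM v (f g df dg : C -> R) : dirder v f df -> dirder v g dg ->
  dirder v (fun z => f z * g z) (fun z => f z * dg z + g z * df z).
Proof.
move=> Hf Hg z zd; have := is_deriveM (Hf z zd) (Hg z zd).
by rewrite mul0r addr0.
Qed.

Lemma laplace_pair_lin Gamma (f g f' g' : C -> R) (s : R) : laplace_pair Gamma f g ->
  laplace_pair Gamma f' g' -> laplace_pair Gamma (fun z => f z + s * f' z) (fun z => g z + s * g' z).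
Proof.
move=> [fA [fx [fy [fxx [fxy [fyy [H cx cy gE]]]]]]] [fA' [fx' [fy' [fxx' [fxy' [fyy' [H' cx' cy' gE']]]]]]].
split; first by move=> A z GA zd; rewrite fA// fA'.
have cD (u u' : C -> R) : (forall z, disc z -> {for z, continuous u}) ->
    (forall z, disc z -> {for z, continuous u'}) -> forall z, disc z -> {for z, continuous (fun z => u z + s * u' z)}.
  move=> cu cu' z zd; apply: rcontD; first exact: cu.
  by apply: rcontM; [exact: rcont_cst|exact: cu'].
exists (fun z => fx z + s * fx' z), (fun z => fy z + s * fy' z), (fun z => fxx z + s * fxx' z),
  (fun z => fxy z + s * fxy' z), (fun z => fyy z + s * fyy' z).
case: H => h1 h2 h3 h4 h5 h6 h7 h8 h9; case: H' => k1 k2 k3 k4 k5 k6 k7 k8 k9.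
split; [split; try exact: dirderD; exact: cD|exact: cD|exact: cD|].
move=> z zd; rewrite gE// gE'//; have := rho_gt0 zd; move: (rho z) => r r0.
by field; rewrite gt_eqF.
Qed.

Variable Gamma : set 'M[C]_2.
Hypothesis GammaS : surface_group Gamma.
Variable F : set C.
Hypothesis F_fund : fundamental_set Gamma F.
Let mF := fund_measurable F_fund.
Let Fd := @fund_disc _ _ _ F_fund.
Let Ffin := hint_fund_lty GammaS F_fund.

(** The bound on f comes from cocompactness. The bound on g is the uniform bound of the normalized
    ball means, inherited in the limit. *)
Lemma laplace_pair_bounded f g : laplace_pair Gamma f g ->
  (hmeas F f /\ exists M : R, forall z, disc z -> `|f z| <= M) /\
  (hmeas F g /\ exists M : R, forall z, disc z -> `|g z| <= M).
Proof.
move=> [fA [fx [fy [fxx [fxy [fyy [H cx cy gE]]]]]]].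
have mdisc (u : C -> R) : (forall z, disc z -> {for z, continuous u}) -> hmeas F u.
  move=> cu; apply: (@measurable_funS _ _ _ _ (@of_plane R @^-1` @disc R : set P)).
  - exact: measurable_disc.
  - by move=> p /Fd.
  - by apply: continuous_measurable_plane => // z; exact: open_disc.
have [M M0 HM] := invariant_bounded GammaS (C2_cont H) fA.
have [[K HK] _] := integral_laplacian_eq0 GammaS F_fund H fA HM.
split; first by split; [exact: mdisc (C2_cont H)|exists M].
split; last first.
  exists (K / 4) => z zd; rewrite gE// normrN normrM [`|4^-1|]ger0_norm ?invr_ge0//.
  by apply: ler_wpM2r; [rewrite invr_ge0|exact: HK].
have : hmeas F (fun z => - ((fxx z + fyy z) * (rho z)^-1 * 4^-1)).
  apply: measurableT_comp => //; apply: measurable_funM => //; apply: measurable_funM.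
    by apply: measurable_funD; apply: mdisc; [exact: (C2_cxx H)|exact: (C2_cyy H)].
  by apply: measurable_funTS; apply: (measurableT_comp measurable_inv); exact: measurable_rho.
by apply: eq_measurable_fun => p /[!inE] /Fd pd; rewrite gE.
Qed.

(** Integration by parts in disguise: 2 f g plus a quarter of the rho-normalized Laplacian of f^2 is
    |grad f|^2 / (2 rho), and the second term has integral 0. *)
Lemma laplace_pair_ge0 f g : laplace_pair Gamma f g -> 0 <= hI F (fun z => f z * g z).
Proof.
move=> fg; have [[mf [M HM]] [mg [K HK]]] := laplace_pair_bounded fg.
have [fA [fx [fy [fxx [fxy [fyy [H cx cy gE]]]]]]] := fg.
case: (H) => h1 h2 h3 h4 h5 h6 h7 h8 h9.
have cM (u v : C -> R) : (forall z, disc z -> {for z, continuous u}) ->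
    (forall z, disc z -> {for z, continuous v}) -> forall z, disc z -> {for z, continuous (fun z => u z * v z)}.
  by move=> cu cv z zd; apply: rcontM; [exact: cu|exact: cv].
have cD (u v : C -> R) : (forall z, disc z -> {for z, continuous u}) ->
    (forall z, disc z -> {for z, continuous v}) -> forall z, disc z -> {for z, continuous (fun z => u z + v z)}.
  by move=> cu cv z zd; apply: rcontD; [exact: cu|exact: cv].
have dD v (a b da db : C -> R) : dirder v a da -> dirder v b db -> dirder v (fun z => a z + b z) (fun z => da z + db z).
  by move=> Ha Hb z zd; exact: (is_deriveD (Ha z zd) (Hb z zd)).
have HU : C2_data (fun z => f z * f z) (fun z => f z * fx z + f z * fx z) (fun z => f z * fy z + f z * fy z)
   (fun z => (f z * fxx z + fx z * fx z) + (f z * fxx z + fx z * fx z))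
   (fun z => (f z * fxy z + fy z * fx z) + (f z * fxy z + fy z * fx z))
   (fun z => (f z * fyy z + fy z * fy z) + (f z * fyy z + fy z * fy z)).
  by split; try (by apply: dD; exact: dirderM); try (by exact: dirderM); try (by exact: cM);
    apply: (@cD); apply: (@cD); exact: cM.
have fA2 A z : Gamma A -> disc z -> f (mobius A z) * f (mobius A z) = f z * f z by move=> GA zd; rewrite fA.
have [M2 M20 HM2] := invariant_bounded GammaS (C2_cont HU) fA2.
have [[K2 HK2] E] := integral_laplacian_eq0 GammaS F_fund HU fA2 HM2.
have Ifg : hintegrable F (fun z => f z * g z).
  apply: (hintegrable_bounded mF Ffin (M := M * K)); first exact: measurable_funM.
  by move=> z /Fd zd; rewrite normrM; apply: ler_pM => //; [exact: HM|exact: HK].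
pose w z : R := ((f z * fxx z + fx z * fx z) + (f z * fxx z + fx z * fx z) +
  ((f z * fyy z + fy z * fy z) + (f z * fyy z + fy z * fy z))) / rho z.
have mw : hmeas F w.
  apply: (@measurable_funS _ _ _ _ (@of_plane R @^-1` @disc R : set P)).
  - exact: measurable_disc.
  - by move=> p /Fd.
  apply: measurable_funM.
    apply: (@continuous_measurable_plane R (@disc R) (fun z => (f z * fxx z + fx z * fx z) +
      (f z * fxx z + fx z * fx z) + ((f z * fyy z + fy z * fy z) + (f z * fyy z + fy z * fy z)))) => [z|z zd].
      exact: open_disc.
    by apply: rcontD; [exact: (C2_cxx HU)|exact: (C2_cyy HU)].
  by apply: measurable_funTS; apply: (measurableT_comp measurable_inv); exact: measurable_rho.
have Iw : hintegrable F w by apply: (hintegrable_bounded mF Ffin mw) => z /Fd; exact: HK2.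
have I1 := hintegrableZ mF 2 Ifg; have I2 := hintegrableZ mF 4^-1 Iw.
suff : 0 <= 2 * hI F (fun z => f z * g z) + 4^-1 * hI F w by rewrite /w E mulr0 addr0 pmulr_rge0.
rewrite -(hIZ mF 2 Ifg) -(hIZ mF _ Iw) -(hID mF I1 I2); apply: hI_ge0 => z /Fd zd.
have r0 := rho_gt0 zd.
have -> : 2 * (f z * g z) + 4^-1 * w z = (fx z ^+ 2 + fy z ^+ 2) / (2 * rho z).
  by rewrite gE// /w; field; rewrite gt_eqF.
by rewrite divr_ge0 ?addr_ge0 ?sqr_ge0// mulr_ge0// ltW.
Qed.
End LaplacePairs.

(** * The Laplacian of smooth complex functions *)

Section SmoothPairs.
Context {R : realType}.
Local Notation C := R[i].

Definition part (b : bool) (z : C) : R := if b then complex.Re z else complex.Im z.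

Lemma part_inj (z w : C) : (forall b, part b z = part b w) -> z = w.
Proof. by move=> H; have := H true; have := H false; case: z {H} => a b; case: w => c d /= -> ->. Qed.

Lemma part_continuous b (f : C -> C) (z : C) : {for z, continuous f} -> {for z, continuous (fun w => part b (f w))}.
Proof.
move=> cf; case: b; apply: (@continuous_comp _ _ _ f) => //; [exact: continuous_Re|exact: continuous_Im].
Qed.

Lemma mulr_i (t : R) : t%:C * 'i%C = (0 +i* t)%C.
Proof. by simpc. Qed.

Lemma dirder_part b (f : C -> C) : class_C 1 f ->
  dirder 1 (fun z => part b (f z)) (fun z => part b (dx f z)) /\
  dirder 'i%C (fun z => part b (f z)) (fun z => part b (dy f z)).
Proof.
move=> [_ [hx hy _ _]]; split => z zd.
  have [h1 h2] := hx z zd.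
  rewrite (_ : (fun t : R => _) = (fun t : R => part b (f (z + t%:C)))); last by apply/funext => t; rewrite mulr1.
  by rewrite /dx /rderive; case: b; rewrite ?[part _ _]/= derive1E; [exact: (derivableP h1)|exact: (derivableP h2)].
have [h1 h2] := hy z zd.
rewrite (_ : (fun t : R => _) = (fun t : R => part b (f (z + (0 +i* t))))); last by apply/funext => t; rewrite mulr_i.
by rewrite /dy /rderive; case: b; rewrite ?[part _ _]/= derive1E; [exact: (derivableP h1)|exact: (derivableP h2)].
Qed.

Lemma dx_dirder (f : C -> C) (a b : C -> R) (z : C) : dirder 1 (fun z => complex.Re (f z)) a ->
  dirder 1 (fun z => complex.Im (f z)) b -> disc z -> dx f z = a z +i* b z.
Proof.
move=> ha hb zd; rewrite /dx /rderive !derive1E.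
have {}ha : is_derive (0 : R) 1 (fun t : R => complex.Re (f (z + t%:C))) (a z).
  have := ha z zd; rewrite (_ : (fun t : R => _) = (fun t : R => complex.Re (f (z + t%:C))))//.
  by apply/funext => t; rewrite mulr1.
have {}hb : is_derive (0 : R) 1 (fun t : R => complex.Im (f (z + t%:C))) (b z).
  have := hb z zd; rewrite (_ : (fun t : R => _) = (fun t : R => complex.Im (f (z + t%:C))))//.
  by apply/funext => t; rewrite mulr1.
by rewrite (@derive_val _ _ _ _ _ _ _ ha) (@derive_val _ _ _ _ _ _ _ hb).
Qed.

Lemma dy_dirder (f : C -> C) (a b : C -> R) (z : C) : dirder 'i%C (fun z => complex.Re (f z)) a ->
  dirder 'i%C (fun z => complex.Im (f z)) b -> disc z -> dy f z = a z +i* b z.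
Proof.
move=> ha hb zd; rewrite /dy /rderive !derive1E.
have {}ha : is_derive (0 : R) 1 (fun t : R => complex.Re (f (z + (0 +i* t)))) (a z).
  have := ha z zd; rewrite (_ : (fun t : R => _) = (fun t : R => complex.Re (f (z + (0 +i* t)))))//.
  by apply/funext => t; rewrite mulr_i.
have {}hb : is_derive (0 : R) 1 (fun t : R => complex.Im (f (z + (0 +i* t)))) (b z).
  have := hb z zd; rewrite (_ : (fun t : R => _) = (fun t : R => complex.Im (f (z + (0 +i* t)))))//.
  by apply/funext => t; rewrite mulr_i.
by rewrite (@derive_val _ _ _ _ _ _ _ ha) (@derive_val _ _ _ _ _ _ _ hb).
Qed.

Lemma class_C_cont n (f : C -> C) (z : C) : class_C n f -> disc z -> {for z, continuous f}.
Proof. by case: n => [|n] [h _] zd; exact: h. Qed.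

Section OneFunction.
Variable f : C -> C.
Hypothesis f2 : class_C 2 f.
Let f1 : class_C 1 f.
Proof. by case: f2 => c0 [hx hy [cx _] [cy _]]; exact: (conj c0 (And4 hx hy (conj cx I) (conj cy I))). Qed.
Let fx1 : class_C 1 (dx f). Proof. by case: f2 => _ [_ _ h _]; exact: h. Qed.
Let fy1 : class_C 1 (dy f). Proof. by case: f2 => _ [_ _ _ h]; exact: h. Qed.
Let fxx0 : class_C 0 (dx (dx f)). Proof. by case: fx1 => _ [_ _ h _]; exact: h. Qed.
Let fxy0 : class_C 0 (dx (dy f)). Proof. by case: fy1 => _ [_ _ h _]; exact: h. Qed.
Let fyx0 : class_C 0 (dy (dx f)). Proof. by case: fx1 => _ [_ _ _ h]; exact: h. Qed.
Let fyy0 : class_C 0 (dy (dy f)). Proof. by case: fy1 => _ [_ _ _ h]; exact: h. Qed.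

Lemma C2_data_part b : C2_data (fun z => part b (f z)) (fun z => part b (dx f z)) (fun z => part b (dy f z))
  (fun z => part b (dx (dx f) z)) (fun z => part b (dx (dy f) z)) (fun z => part b (dy (dy f) z)).
Proof.
have [a1 a2] := dirder_part b f1; have [b1 b2] := dirder_part b fx1; have [c1 c2] := dirder_part b fy1.
split; [exact: a1|exact: a2|exact: b1|exact: c1|exact: c2|..]; move=> z zd; apply: part_continuous.
- exact: class_C_cont f2 zd.
- exact: class_C_cont fxx0 zd.
- exact: class_C_cont fxy0 zd.
- exact: class_C_cont fyy0 zd.
Qed.

Lemma mixed_partials (z : C) : disc z -> dx (dy f) z = dy (dx f) z.
Proof.
move=> zd; apply: part_inj => b.
have [a1 a2] := dirder_part b f1; have [b1 b2] := dirder_part b fx1; have [c1 c2] := dirder_part b fy1.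
apply/esym/(schwarz zd a1 b2 a2 c1); apply: part_continuous.
  exact: class_C_cont fyx0 zd.
exact: class_C_cont fxy0 zd.
Qed.

(** Expanding dz (dzbar f) leaves the difference of the two mixed partials, which vanishes by
    symmetry; the factor 1 / 4 comes from the two halves. *)
Lemma laplacianE (z : C) : disc z ->
  laplacian f z = (- ((rho z)^-1 / 4))%:C * (dx (dx f) z + dy (dy f) z).
Proof.
move=> zd; pose g := dzbar f.
have gE w : g w = ((complex.Re (dx f w) - complex.Im (dy f w)) / 2) +i*
    ((complex.Im (dx f w) + complex.Re (dy f w)) / 2).
  rewrite /g /dzbar (_ : 2^-1 = (2^-1)%:C); last by rewrite fmorphV rmorph_nat.
  by case: (dx f w) (dy f w) => a b [c d]; apply/eqP; rewrite eq_complex /=; apply/andP; split; apply/eqP; ring.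
have -> : laplacian f z = - ((rho z)^-1)%:C * (2^-1 * (dx g z - 'i%C * dy g z)) by [].
have gRe : (fun w => complex.Re (g w)) = (fun w => 2^-1 * (part true (dx f w) + (-1) * part false (dy f w))).
  by apply/funext => w; rewrite gE /=; ring.
have gIm : (fun w => complex.Im (g w)) = (fun w => 2^-1 * (part false (dx f w) + 1 * part true (dy f w))).
  by apply/funext => w; rewrite gE /=; ring.
clearbody g.
have dZ v (s : R) (a da : C -> R) : dirder v a da -> dirder v (fun z => s * a z) (fun z => s * da z).
  by move=> h w wd; exact: (is_deriveZ s (h w wd)).
have [bx by'] := (fun b => (dirder_part b fx1).1, fun b => (dirder_part b fx1).2).
have [cx cy] := (fun b => (dirder_part b fy1).1, fun b => (dirder_part b fy1).2).
have gx : dx g z = (2^-1 * (part true (dx (dx f) z) + (-1) * part false (dx (dy f) z))) +i*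
    (2^-1 * (part false (dx (dx f) z) + 1 * part true (dx (dy f) z))).
  apply: (@dx_dirder g (fun z => 2^-1 * (part true (dx (dx f) z) + (-1) * part false (dx (dy f) z)))
    (fun z => 2^-1 * (part false (dx (dx f) z) + 1 * part true (dx (dy f) z))) z _ _ zd); [rewrite gRe|rewrite gIm]; apply: dZ; apply: dirderD;
    [exact: bx|exact: cx|exact: bx|exact: cx].
have gy : dy g z = (2^-1 * (part true (dy (dx f) z) + (-1) * part false (dy (dy f) z))) +i*
    (2^-1 * (part false (dy (dx f) z) + 1 * part true (dy (dy f) z))).
  apply: (@dy_dirder g (fun z => 2^-1 * (part true (dy (dx f) z) + (-1) * part false (dy (dy f) z)))
    (fun z => 2^-1 * (part false (dy (dx f) z) + 1 * part true (dy (dy f) z))) z _ _ zd); [rewrite gRe|rewrite gIm]; apply: dZ; apply: dirderD;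
    [exact: by'|exact: cy|exact: by'|exact: cy].
rewrite gx gy -(mixed_partials zd).
rewrite (_ : 2^-1 = (2^-1)%:C :> C); last by rewrite fmorphV rmorph_nat.
move: (rho z) (gt_eqF (rho_gt0 zd)) => r /negbT r0.
move: (dx (dx f) z) (dy (dy f) z) (dx (dy f) z) => [a b] [c d] [u v].
by apply: part_inj => -[] /=; field; exact: r0.
Qed.

Lemma laplace_pair_part (Gamma : set 'M[C]_2) b : Gamma_invariant Gamma f ->
  laplace_pair Gamma (fun z => part b (f z)) (fun z => part b (laplacian f z)).
Proof.
move=> fA; split; first by move=> A z GA zd; rewrite fA.
exists (fun z => part b (dx f z)), (fun z => part b (dy f z)), (fun z => part b (dx (dx f) z)),
  (fun z => part b (dx (dy f) z)), (fun z => part b (dy (dy f) z)).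
split.
- exact: C2_data_part.
- by move=> z zd; apply: part_continuous; exact: class_C_cont fx1 zd.
- by move=> z zd; apply: part_continuous; exact: class_C_cont fy1 zd.
- move=> z zd; rewrite laplacianE//; have := rho_gt0 zd.
  move: (dx (dx f) z) (dy (dy f) z) (rho z) => [u v] [s t] r r0.
  by case: b => /=; field; rewrite gt_eqF.
Qed.
End OneFunction.

Lemma near_rderive (c c' : R -> C) : (\forall t \near (0 : R), c t = c' t) -> rderivable c 0 ->
  rderivable c' 0 /\ rderive c' 0 = rderive c 0.
Proof.
have der (u u' : R -> R) : (\forall t \near (0 : R), u t = u' t) ->
    derivable u 0 1 -> derivable u' 0 1 /\ derive1 u' 0 = derive1 u 0.
  move=> E /derivableP du.
  have h := near_eq_is_derive E du.
  by split; [exact: ex_derive|rewrite !derive1E (@derive_val _ _ _ _ _ _ _ h)].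
move=> E [d1 d2].
have E1 : \forall t \near (0 : R), complex.Re (c t) = complex.Re (c' t) by apply: filterS E => t ->.
have E2 : \forall t \near (0 : R), complex.Im (c t) = complex.Im (c' t) by apply: filterS E => t ->.
have [e1 f1] := der _ _ E1 d1; have [e2 f2] := der _ _ E2 d2.
by split; [split|rewrite /rderive f1 f2].
Qed.

Lemma near_disc_line (f g : C -> C) (v : R -> C) z : (forall z, disc z -> f z = g z) -> disc z ->
  (forall t : R, normc (v t) = `|t|) -> \forall t \near (0 : R), f (z + v t) = g (z + v t).
Proof.
move=> fg zd nv; have [d d0 Hd] := (nbhs_normc z (@disc R)).1 (open_disc zd).
apply/nbhs_ballP; exists d => //= t; rewrite /ball /= sub0r normrN => td.
by apply: fg; apply: Hd; rewrite addrAC subrr add0r nv.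
Qed.

Lemma dx_ext (f g : C -> C) z : (forall z, disc z -> f z = g z) -> disc z ->
  rderivable (fun t : R => f (z + t%:C)) 0 -> rderivable (fun t : R => g (z + t%:C)) 0 /\ dx g z = dx f z.
Proof.
move=> fg zd; apply: near_rderive; apply: (@near_disc_line f g (fun t : R => t%:C) z fg zd).
by move=> t; rewrite /= expr0n /= addr0 sqrtr_sqr.
Qed.

Lemma dy_ext (f g : C -> C) z : (forall z, disc z -> f z = g z) -> disc z ->
  rderivable (fun t : R => f (z + (0 +i* t))) 0 -> rderivable (fun t : R => g (z + (0 +i* t))) 0 /\ dy g z = dy f z.
Proof.
move=> fg zd; apply: near_rderive; apply: (@near_disc_line f g (fun t : R => 0 +i* t) z fg zd).
by move=> t; rewrite /= expr0n /= add0r sqrtr_sqr.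
Qed.

Lemma continuous_ext_disc (f g : C -> C) : (forall z, disc z -> f z = g z) ->
  (forall z, disc z -> {for z, continuous f}) -> forall z, disc z -> {for z, continuous g}.
Proof.
move=> fg cf z zd U; rewrite -(fg _ zd) => /(cf z zd) H.
have nD : nbhs z (@disc R) := open_disc zd.
have : nbhs z (@disc R `&` f @^-1` U) by exact: filterI nD H.
by apply: filterS => w [wd]; rewrite /= fg.
Qed.

(** The disc is open, so derivatives at its points only see values in it. This matters for
    conjugation: [dx] of the conjugate is known to be the conjugate of [dx] only on the disc, where
    the derivatives exist. *)
Lemma class_C_ext n (f g : C -> C) : (forall z, disc z -> f z = g z) -> class_C n f -> class_C n g.
Proof.
elim: n f g => [|n IH] f g fg [cf H]; first by split; [exact: continuous_ext_disc fg cf|].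
case: H => hx hy cx cy; split; first exact: continuous_ext_disc fg cf.
split.
- by move=> z zd; exact: (dx_ext fg zd (hx z zd)).1.
- by move=> z zd; exact: (dy_ext fg zd (hy z zd)).1.
- by apply: IH cx => z zd; rewrite (dx_ext fg zd (hx z zd)).2.
- by apply: IH cy => z zd; rewrite (dy_ext fg zd (hy z zd)).2.
Qed.

Lemma continuous_conj (g : C -> C) (z : C) : {for z, continuous g} -> {for z, continuous (fun z => (g z)^*%C)}.
Proof.
move=> cg; apply: (@continuous_comp _ _ _ g (fun z : C => z^*%C)); first exact: cg.
move=> U /nbhs_normc[e e0 H]; apply/nbhs_normc; exists e => // w we; apply: H.
suff -> : normc (w^*%C - (g z)^*%C) = normc (w - g z) by [].
by case: w {we} => a b; case: (g z) => c d /=; congr Num.sqrt; ring.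
Qed.

Lemma rderive_conj (c : R -> C) : rderivable c 0 ->
  rderivable (fun t => (c t)^*%C) 0 /\ rderive (fun t => (c t)^*%C) 0 = (rderive c 0)^*%C.
Proof.
move=> [d1 d2].
have E1 : (fun t => complex.Re (c t)^*%C) = (fun t => complex.Re (c t)) by apply/funext => t; case: (c t).
have E2 : (fun t => complex.Im (c t)^*%C) = (fun t => - complex.Im (c t)) by apply/funext => t; case: (c t).
split; first by split; rewrite ?E1 ?E2; [exact: d1|exact: derivableN d2].
rewrite /rderive E1 E2 !derive1E; congr (_ +i* _); exact: deriveN.
Qed.

Lemma class_C_conj n (f : C -> C) : class_C n f -> class_C n (fun z => (f z)^*%C).
Proof.
elim: n f => [|n IH] f [cf H]; first by split; [exact: (fun z zd => continuous_conj (cf z zd))|].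
case: H => hx hy cx cy; split; first exact: (fun z zd => continuous_conj (cf z zd)).
split.
- by move=> z zd; exact: (rderive_conj (hx z zd)).1.
- by move=> z zd; exact: (rderive_conj (hy z zd)).1.
- by apply: class_C_ext (IH _ cx) => z zd; exact: (esym (rderive_conj (hx z zd)).2).
- by apply: class_C_ext (IH _ cy) => z zd; exact: (esym (rderive_conj (hy z zd)).2).
Qed.

Lemma laplacian_conj (f : C -> C) (z : C) : class_C 2 f -> disc z ->
  laplacian (fun z => (f z)^*%C) z = (laplacian f z)^*%C.
Proof.
move=> f2 zd; rewrite (laplacianE (class_C_conj f2) zd) (laplacianE f2 zd); case: f2 => _ [hx hy [_ [hxx _ _ _]] [_ [_ hyy _ _]]].
have Ex w : disc w -> (dx f w)^*%C = dx (fun z => (f z)^*%C) w.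
  by move=> wd; exact: (esym (rderive_conj (hx w wd)).2).
have Ey w : disc w -> (dy f w)^*%C = dy (fun z => (f z)^*%C) w.
  by move=> wd; exact: (esym (rderive_conj (hy w wd)).2).
have Hx := rderive_conj (hxx z zd); have Hy := rderive_conj (hyy z zd).
have Kx := (dx_ext Ex zd Hx.1).2; have Ky := (dy_ext Ey zd Hy.1).2.
have -> : dx (dx (fun z => (f z)^*%C)) z = (dx (dx f) z)^*%C by exact: etrans Kx Hx.2.
have -> : dy (dy (fun z => (f z)^*%C)) z = (dy (dy f) z)^*%C by exact: etrans Ky Hy.2.
move: (dx (dx f) z) (dy (dy f) z) => [a b] [c d].
by apply: part_inj => -[] /=; ring.
Qed.
End SmoothPairs.

(** * The resolvent *)

Section SquareIntegrable.
Context {R : realType}.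
Local Notation C := R[i].
Local Notation P := (R * R)%type.
Variable Gamma : set 'M[C]_2.
Hypothesis GammaS : surface_group Gamma.
Variable F : set C.
Hypothesis F_fund : fundamental_set Gamma F.
Let mF := fund_measurable F_fund.
Let Fd := @fund_disc _ _ _ F_fund.
Let Ffin := hint_fund_lty GammaS F_fund.
Implicit Types f g h u : C -> R.

Definition hL2 f := hmeas F f /\ hintegrable F (fun z => f z ^+ 2).

Lemma hL2M f g : hL2 f -> hL2 g -> hintegrable F (fun z => f z * g z).
Proof.
move=> [mf If] [mg Ig]; apply: (hintegrable_le mF _ _ (hintegrableD mF If Ig)); first exact: measurable_funM.
move=> z _; move: (f z) (g z) => a b; rewrite ler_norml.
have := sqr_ge0 (a - b); have := sqr_ge0 (a + b); have := sqr_ge0 a; have := sqr_ge0 b.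
by move=> *; apply/andP; split; nra.
Qed.

Lemma hI_lin f g (s : R) : hintegrable F f -> hintegrable F g ->
  hI F (fun z => f z + s * g z) = hI F f + s * hI F g.
Proof. by move=> If Ig; rewrite (hID mF If (hintegrableZ mF s Ig)) (hIZ mF s Ig). Qed.

Lemma hintegrable_lin f g (s : R) : hintegrable F f -> hintegrable F g ->
  hintegrable F (fun z => f z + s * g z).
Proof. by move=> If Ig; exact: (hintegrableD mF If (hintegrableZ mF s Ig)). Qed.

Let sqr_lin (a b s : R) : (a + s * b) ^+ 2 <= 2 * a ^+ 2 + 2 * s ^+ 2 * b ^+ 2.
Proof. by have := sqr_ge0 (a - s * b); nra. Qed.

Lemma hL2_lin f g (s : R) : hL2 f -> hL2 g -> hL2 (fun z => f z + s * g z).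
Proof.
move=> [mf If] [mg Ig].
have m : hmeas F (fun z => f z + s * g z) by apply: measurable_funD => //; apply: measurable_funM.
split=> //; apply: (hintegrable_le mF _ _ (hintegrable_lin (2 * s ^+ 2) (hintegrableZ mF 2 If) Ig)).
  exact: measurable_funX.
by move=> z _; rewrite ger0_norm ?sqr_ge0//; exact: sqr_lin.
Qed.

Lemma hI_sqr_lin f g (s : R) : hL2 f -> hL2 g ->
  hI F (fun z => (f z + s * g z) ^+ 2) <= 2 * hI F (fun z => f z ^+ 2) + 2 * s ^+ 2 * hI F (fun z => g z ^+ 2).
Proof.
move=> Lf Lg; have [mf If] := Lf; have [mg Ig] := Lg.
rewrite -(hIZ mF 2 If) -(hI_lin _ (hintegrableZ mF 2 If) Ig).
apply: (hI_le mF (hL2_lin s Lf Lg).2 (hintegrable_lin (2 * s ^+ 2) (hintegrableZ mF 2 If) Ig)).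
by move=> z _; exact: sqr_lin.
Qed.

Lemma hL2_bounded f (M : R) : hmeas F f -> (forall z, F z -> `|f z| <= M) -> hL2 f.
Proof.
move=> mf fM; split=> //; apply: (hintegrable_bounded (M := M ^+ 2) mF Ffin); first exact: measurable_funX.
by move=> z Fz; rewrite normrX ler_pXn2r ?nnegrE ?fM// (le_trans _ (fM _ Fz)).
Qed.

Lemma hI_young f g (s : R) : 0 < s -> hL2 f -> hL2 g ->
  hI F (fun z => f z * g z) <= s * hI F (fun z => f z ^+ 2) + (4 * s)^-1 * hI F (fun z => g z ^+ 2).
Proof.
move=> s0 Lf Lg; have [mf If] := Lf; have [mg Ig] := Lg.
rewrite -(hIZ mF s If) -(hI_lin _ (hintegrableZ mF s If) Ig).
apply: (hI_le mF (hL2M Lf Lg) (hintegrable_lin _ (hintegrableZ mF s If) Ig)).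
move=> z _; move: (f z) (g z) => a b.
rewrite -subr_ge0 (_ : _ - _ = (4 * s)^-1 * (2 * s * a - b) ^+ 2); last by field; rewrite gt_eqF.
by rewrite mulr_ge0 ?sqr_ge0// invr_ge0 mulr_ge0 ?ltW.
Qed.

(** Young's inequality with arbitrarily large s gives the upper bound 0; the same for - g gives the
    lower one. *)
Lemma hI_null f g : hL2 f -> hL2 g -> hI F (fun z => f z ^+ 2) = 0 -> hI F (fun z => f z * g z) = 0.
Proof.
move=> Lf Lg f0.
have le0 h : hL2 h -> hI F (fun z => f z * h z) <= 0.
  move=> Lh; rewrite leNgt; apply/negP => c0.
  have G0 : 0 <= hI F (fun z => h z ^+ 2) by apply: hI_ge0 => z _; exact: sqr_ge0.
  have := fun s s0 => @hI_young f h s s0 Lf Lh; rewrite f0.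
  (* With s = (G + 1) / c the bound G / (4 s) falls strictly below c; the added 1 covers G = 0. *)
  move: (hI _ _) (hI F (fun z => h z ^+ 2)) c0 G0 => c G c0 G0 /(_ ((G + 1) / c)).
  have G1 : 0 < G + 1 by rewrite ltr_wpDl.
  move=> /(_ (divr_gt0 G1 c0)); rewrite mulr0 add0r leNgt => /negP; apply.
  rewrite (_ : _ * G = c * (G / (4 * (G + 1)))); last by field; rewrite !gt_eqF.
  rewrite gtr_pMr// ltr_pdivrMr ?mulr_gt0//; lra.
apply/le_anti; rewrite le0//=.
have I0 := hL2M Lf Lg.
have LN : hL2 (fun z => 0 + (-1) * g z).
  by apply: hL2_lin => //; apply: (@hL2_bounded _ 0); [exact: measurable_cst|move=> *; rewrite normr0].
have := le0 _ LN; rewrite (@eq_hI _ F _ (fun z => (-1) * (f z * g z))); last by move=> z _; ring.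
by rewrite (hIZ mF (-1) I0) mulN1r oppr_le0.
Qed.
End SquareIntegrable.

(** * Positivity on the closure of the Laplacian *)

Section Resolvent.
Context {R : realType}.
Local Notation C := R[i].
Local Notation P := (R * R)%type.
Variable Gamma : set 'M[C]_2.
Hypothesis GammaS : surface_group Gamma.
Variable F : set C.
Hypothesis F_fund : fundamental_set Gamma F.
Let mF := fund_measurable F_fund.
Let Fd := @fund_disc _ _ _ F_fund.
Local Notation hL2 := (hL2 F).
Local Notation hL2_lin := (hL2_lin F_fund).
Local Notation sqI f := (hI F (fun z => f z ^+ 2)).

(** The closure of the graph of classical pairs, for real functions and with finite integrals: the
    form into which both coordinates of [L2_laplacian] are translated. *)
Definition weak_laplace_pair (u h : C -> R) : Prop := [/\ hL2 u, hL2 h &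
  forall d : R, 0 < d -> exists f g, [/\ laplace_pair Gamma f g,
    sqI (fun z => f z - u z) <= d & sqI (fun z => g z - h z) <= d]].

Lemma laplace_pair_hL2 f g : laplace_pair Gamma f g -> hL2 f /\ hL2 g.
Proof.
move=> fg; have [[mf [M HM]] [mg [K HK]]] := laplace_pair_bounded GammaS F_fund fg.
by split; [apply: (hL2_bounded GammaS F_fund mf (M := M))|apply: (hL2_bounded GammaS F_fund mg (M := K))] => z /Fd;
  [exact: HM|exact: HK].
Qed.

Lemma sqI_ge0 (f : C -> R) : 0 <= sqI f.
Proof. by apply: hI_ge0 => z _; exact: sqr_ge0. Qed.

Lemma hL2B f g : hL2 f -> hL2 g -> hL2 (fun z => f z - g z).
Proof. by move=> Lf Lg; have := hL2_lin (-1) Lf Lg; under eq_fun do rewrite mulN1r. Qed.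

Lemma weak_laplace_pair_lin u h u' h' (s : R) : weak_laplace_pair u h -> weak_laplace_pair u' h' ->
  weak_laplace_pair (fun z => u z + s * u' z) (fun z => h z + s * h' z).
Proof.
move=> [Lu Lh H] [Lu' Lh' H']; split; [exact: hL2_lin|exact: hL2_lin|move=> d d0].
have k0 : 0 < 2 + 2 * s ^+ 2 by have := sqr_ge0 s; lra.
have [f [g [fg Ef Eg]]] := H _ (divr_gt0 d0 k0); have [f' [g' [fg' Ef' Eg']]] := H' _ (divr_gt0 d0 k0).
have [Lf Lg] := laplace_pair_hL2 fg; have [Lf' Lg'] := laplace_pair_hL2 fg'.
have key a b a' b' : hL2 a -> hL2 b -> hL2 a' -> hL2 b' -> sqI (fun z => a z - b z) <= d / (2 + 2 * s ^+ 2) ->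
    sqI (fun z => a' z - b' z) <= d / (2 + 2 * s ^+ 2) ->
    sqI (fun z => a z + s * a' z - (b z + s * b' z)) <= d.
  move=> La Lb La' Lb' Ea Ea'.
  rewrite (@eq_hI _ F _ (fun z => ((a z - b z) + s * (a' z - b' z)) ^+ 2)); last by move=> z _; congr (_ ^+ 2); ring.
  apply: (le_trans (hI_sqr_lin F_fund s (hL2B La Lb) (hL2B La' Lb'))).
  rewrite (_ : d = 2 * (d / (2 + 2 * s ^+ 2)) + 2 * s ^+ 2 * (d / (2 + 2 * s ^+ 2))); last by field; rewrite gt_eqF.
  by apply: lerD; apply: ler_wpM2l => //; rewrite mulr_ge0 ?sqr_ge0.
exists (fun z => f z + s * f' z), (fun z => g z + s * g' z); split.
- exact: laplace_pair_lin.
- exact: key.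
- exact: key.
Qed.

Lemma weak_laplace_pair_ge0 u h : weak_laplace_pair u h -> 0 <= hI F (fun z => u z * h z).
Proof.
move=> [Lu Lh H]; have U0 := sqI_ge0 u; have H0 := sqI_ge0 h.
have Iuh := hL2M F_fund Lu Lh.
(* The approximation is taken to within 4 e^2 in squared norm. The two linear error terms then cost
   at most e (|h|^2 + 1) and e (|u|^2 + 1), and the quadratic one 4 e^2 <= 4 e, whence the 6. *)
have key (e : R) : 0 < e -> e <= 1 -> - hI F (fun z => u z * h z) <= e * (sqI u + sqI h + 6).
  move=> e0 e1; have d0 : 0 < 4 * e ^+ 2 by rewrite mulr_gt0 ?exprn_gt0.
  have [f [g [fg Ef Eg]]] := H _ d0; have [Lf Lg] := laplace_pair_hL2 fg.
  have La := hL2B Lf Lu; have Lb := hL2B Lg Lh.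
  have P0 := laplace_pair_ge0 GammaS F_fund fg.
  have E : hI F (fun z => f z * g z) = hI F (fun z => u z * h z) + 1 * hI F (fun z => h z * (f z - u z))
      + 1 * hI F (fun z => u z * (g z - h z)) + 1 * hI F (fun z => (f z - u z) * (g z - h z)).
    have I1 := hL2M F_fund Lh La; have I2 := hL2M F_fund Lu Lb; have I3 := hL2M F_fund La Lb.
    have J1 := hintegrable_lin F_fund 1 Iuh I1; have J2 := hintegrable_lin F_fund 1 J1 I2.
    rewrite -(hI_lin F_fund 1 Iuh I1) -(hI_lin F_fund 1 J1 I2) -(hI_lin F_fund 1 J2 I3).
    by apply: eq_hI => z _; ring.
  have Y1 := hI_young F_fund e0 Lh La; have Y2 := hI_young F_fund e0 Lu Lb.
  have Y3 := hI_young F_fund (ltac:(lra) : (0 : R) < 2^-1) La Lb.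
  have B1 : (4 * e)^-1 * sqI (fun z => f z - u z) <= e.
    by rewrite ler_pdivrMl ?mulr_gt0// (le_trans Ef)// expr2 mulrA.
  have B2 : (4 * e)^-1 * sqI (fun z => g z - h z) <= e.
    by rewrite ler_pdivrMl ?mulr_gt0// (le_trans Eg)// expr2 mulrA.
  have ee : e ^+ 2 <= e by rewrite expr2 ler_piMr// ltW.
  move: E Y1 Y2 Y3 B1 B2 Ef Eg P0 => ->.
  move: (hI _ _) (hI _ _) (hI _ _) (hI _ _) (hI _ _) (hI _ _) (hI _ _) (hI _ _) ((4 * e)^-1 * _) ((4 * e)^-1 * _) => *.
  lra.
rewrite leNgt; apply/negP => neg.
move: (hI F _) (sqI u) (sqI h) neg U0 H0 key {Iuh} => x U K neg U0 K0 key.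
have S0 : 0 < U + K + 6 by lra.
have D0 : 0 < U + K + 6 - x by lra.
(* For a negative product x and S = U + K + 6, this e lies between 0 and 1 and e S < - x,
   contradicting [key]. *)
have := key (- x / (U + K + 6 - x)) ltac:(by rewrite divr_gt0 // oppr_gt0) ltac:(by rewrite ler_pdivrMr // mul1r; lra).
rewrite leNgt => /negP; apply; rewrite mulrAC ltr_pdivrMr// ltr_pM2l ?oppr_gt0//; lra.
Qed.

Lemma L2_part (f : C -> C) : hmeas F (fun z => complex.Re (f z)) -> hmeas F (fun z => complex.Im (f z)) ->
  (L2_sqnorm F f < +oo)%E -> forall b, hL2 (fun z => part b (f z)) /\
    ((sqI (fun z => part b (f z)))%:E <= L2_sqnorm F f)%E.
Proof.
move=> mR mI fin b.
have E : L2_sqnorm F f = hint F (fun z => (sqn (f z))%:E).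
  by apply: eq_integral => p _; rewrite normc_sqn EFinM.
have ms : hmeas F (fun z => sqn (f z)) by apply: measurable_funD; apply: measurable_funX.
have Is : hintegrable F (fun z => sqn (f z)).
  by apply: hintegrable_ge0 => //; [move=> z _; exact: sqn_ge0|rewrite -E].
have mb : hmeas F (fun z => part b (f z)) by case: b.
have le z : part b (f z) ^+ 2 <= sqn (f z) by case: (b); rewrite ?lerDl ?lerDr ?sqr_ge0.
have Ib : hintegrable F (fun z => part b (f z) ^+ 2).
  by apply: (hintegrable_le mF _ _ Is); [exact: measurable_funX|move=> z _; rewrite ger0_norm ?sqr_ge0].
split=> //; rewrite E (hintE_hI mF Is) lee_fin; exact: (hI_le mF Ib Is).
Qed.

Lemma L2_laplacian_weak (w k : C -> C) b : L2_laplacian Gamma F w k ->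
  weak_laplace_pair (fun z => part b (w z)) (fun z => part b (k z)).
Proof.
move=> [[wA mwR mwI wfin] [kA mkR mkI kfin] [phi [Hphi cw ck]]].
have sub f : measurable_fun (@of_plane R @^-1` @disc R : set P) (fun p => f (of_plane p)) -> hmeas F f.
  by apply: measurable_funS; [exact: measurable_disc|move=> p; exact: Fd].
have {}mwR : hmeas F (fun z => complex.Re (w z)) by exact: (sub (fun z => complex.Re (w z)) mwR).
have {}mwI : hmeas F (fun z => complex.Im (w z)) by exact: (sub (fun z => complex.Im (w z)) mwI).
have {}mkR : hmeas F (fun z => complex.Re (k z)) by exact: (sub (fun z => complex.Re (k z)) mkR).
have {}mkI : hmeas F (fun z => complex.Im (k z)) by exact: (sub (fun z => complex.Im (k z)) mkI).
split; [exact: (L2_part mwR mwI wfin b).1|exact: (L2_part mkR mkI kfin b).1|move=> d d0].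
have small (s : nat -> \bar R) : s @ \oo --> 0%E -> \forall n \near \oo, (s n < d%:E)%E.
  have d0' : (0 < d%:E)%E by rewrite lte_fin.
  by move=> cs; exact: (cs [set x | (x < d%:E)%E] (open_ereal_lt' d0')).
have [n [Hw Hk]] := filter_ex (filterI (small _ cw) (small _ ck)).
have [nA ns] := Hphi n; have pr b' := laplace_pair_part (ns 2) b' nA.
have [mR _] := laplace_pair_bounded GammaS F_fund (pr true).
have [mI _] := laplace_pair_bounded GammaS F_fund (pr false).
have [_ [lR _]] := laplace_pair_bounded GammaS F_fund (pr true).
have [_ [lI _]] := laplace_pair_bounded GammaS F_fund (pr false).
have partB (x y : C) b' : part b' (x - y) = part b' x - part b' y by case: x y b' => [? ?] [? ?] [].
have small2 (f g : C -> C) : hmeas F (fun z => part true (f z)) -> hmeas F (fun z => part false (f z)) ->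
    hmeas F (fun z => complex.Re (g z)) -> hmeas F (fun z => complex.Im (g z)) ->
    (L2_sqnorm F (fun z => f z - g z)%R < d%:E)%E -> sqI (fun z => part b (f z) - part b (g z)) <= d.
  move=> fR fI gR gI lt.
  have m1 : hmeas F (fun z => complex.Re (f z - g z)).
    by rewrite (_ : (fun z => _) = (fun z => part true (f z) - complex.Re (g z)));
      [exact: measurable_funB|apply/funext => z; exact: (partB _ _ true)].
  have m2 : hmeas F (fun z => complex.Im (f z - g z)).
    by rewrite (_ : (fun z => _) = (fun z => part false (f z) - complex.Im (g z)));
      [exact: measurable_funB|apply/funext => z; exact: (partB _ _ false)].
  have [_] := L2_part m1 m2 (lt_trans lt (ltry d)) b.
  under [X in hI F X]eq_fun do rewrite partB.
  by move=> /le_lt_trans/(_ lt); rewrite lte_fin => /ltW.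
exists (fun z => part b (phi n z)), (fun z => part b (laplacian (phi n) z)); split.
- exact: pr.
- exact: (small2 _ _ mR.1 mI.1 mwR mwI Hw).
- exact: (small2 _ _ lR lI mkR mkI Hk).
Qed.
End Resolvent.

(** * Resolvent and Green operator *)

Section GreenOperator.
Context {R : realType}.
Local Notation C := R[i].
Local Notation P := (R * R)%type.
Variable Gamma : set 'M[C]_2.
Hypothesis GammaS : surface_group Gamma.
Variable F : set C.
Hypothesis F_fund : fundamental_set Gamma F.
Let mF := fund_measurable F_fund.
Let Fd := @fund_disc _ _ _ F_fund.
Local Notation hL2 := (hL2 F).
Local Notation sqI f := (hI F (fun z => f z ^+ 2)).
Local Notation dotI f g := (hI F (fun z => f z * g z)).
Local Notation resolvent := (resolvent Gamma F).

Lemma half_complex : 2^-1 = (2^-1)%:C :> C.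
Proof. by rewrite fmorphV rmorph_nat. Qed.

Lemma part_subhalf b (x y : C) : part b (x - 2^-1 * y) = part b x + (- 2^-1) * part b y.
Proof. by rewrite half_complex; case: b x y => -[a c] [d e] /=; ring. Qed.

Lemma hL2_zero : hL2 (fun=> 0).
Proof. by apply: (hL2_bounded GammaS F_fund (M := 0)); [exact: measurable_cst|move=> *; rewrite normr0]. Qed.

Lemma sqI_zero : sqI (fun=> 0 : R) = 0.
Proof.
rewrite -[RHS](mul0r (sqI (fun=> 0 : R))) -(hIZ mF 0 hL2_zero.2).
by apply: eq_hI => z _; rewrite mul0r expr0n.
Qed.

Lemma part_zero b : part b (0 : C) = 0.
Proof. by case: b. Qed.

(** Positivity applied to the pair (w, f - w / 2) gives the inequality when w exists; the default
    value 0 satisfies it trivially. *)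
Lemma resolvent_energy (f : C -> C) b : hL2 (fun z => part b (f z)) ->
  hL2 (fun z => part b (resolvent f z)) /\
  2^-1 * sqI (fun z => part b (resolvent f z)) <= dotI (fun z => part b (resolvent f z)) (fun z => part b (f z)).
Proof.
move=> Lf; rewrite /Defs.resolvent; case: xgetP => [w _ Hw|_].
  have H := L2_laplacian_weak GammaS F_fund b Hw; have [Lw _ _] := H; split=> //.
  have := weak_laplace_pair_ge0 GammaS F_fund H.
  have Iw := hL2M F_fund Lw Lf.
  rewrite (@eq_hI _ F _ (fun z => part b (w z) * part b (f z) + (- 2^-1) * part b (w z) ^+ 2)); last first.
    by move=> z _; rewrite part_subhalf; ring.
  by rewrite (hI_lin F_fund _ Iw Lw.2) mulNr subr_ge0.
under eq_fun do rewrite part_zero.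
split; first exact: hL2_zero.
under [X in _ * hI F X <= _]eq_fun do rewrite part_zero; under [X in _ <= hI F X]eq_fun do rewrite part_zero.
rewrite sqI_zero mulr0 (@eq_hI _ F _ (fun=> 0 ^+ 2)) ?sqI_zero//.
by move=> z _; rewrite mul0r expr0n.
Qed.

(** Young's inequality with s = 1/4 bounds <w, t> by |w|^2 / 4 + |t|^2. With t = f and the energy
    inequality it also gives |w|^2 / 4 <= |f|^2. *)
Lemma resolvent_dot (f : C -> C) b (t : C -> R) : hL2 (fun z => part b (f z)) -> hL2 t ->
  dotI (fun z => part b (resolvent f z)) t <= sqI (fun z => part b (f z)) + sqI t.
Proof.
move=> Lf Lt; have [Lw E] := resolvent_energy Lf.
have q0 : (0 : R) < 4^-1 by lra.
have := hI_young F_fund q0 Lw Lt; have := hI_young F_fund q0 Lw Lf.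
rewrite (_ : (4 * 4^-1 : R)^-1 = 1); last by field.
move: E; move: (hI _ _) (hI _ _) (hI _ _) (hI _ _) (hI _ _) => *; lra.
Qed.

Lemma resolvent_dot_ge0 (f : C -> C) b : hL2 (fun z => part b (f z)) ->
  0 <= dotI (fun z => part b (resolvent f z)) (fun z => part b (f z)).
Proof.
by move=> Lf; apply: le_trans (resolvent_energy Lf).2; rewrite mulr_ge0 ?sqI_ge0// invr_ge0.
Qed.

(** The difference of two solutions is paired with - 1/2 of itself, so positivity makes its squared
    norm nonpositive. *)
Lemma L2_laplacian_uniq (f v w : C -> C) b : L2_laplacian Gamma F v (fun z => f z - 2^-1 * v z) ->
  L2_laplacian Gamma F w (fun z => f z - 2^-1 * w z) -> sqI (fun z => part b (v z) - part b (w z)) = 0.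
Proof.
move=> /(L2_laplacian_weak GammaS F_fund b) Hv /(L2_laplacian_weak GammaS F_fund b) Hw.
have [Lv _ _] := Hv; have [Lw _ _] := Hw.
have := weak_laplace_pair_ge0 GammaS F_fund (weak_laplace_pair_lin GammaS F_fund (-1) Hv Hw).
have Ld := hL2B F_fund Lv Lw.
rewrite (@eq_hI _ F _ (fun z => (- 2^-1) * (part b (v z) - part b (w z)) ^+ 2)); last first.
  by move=> z _; rewrite !part_subhalf; ring.
rewrite (hIZ mF _ Ld.2) mulNr oppr_ge0 => H; apply/le_anti; rewrite sqI_ge0 andbT.
by move: H; rewrite pmulr_rle0 ?invr_gt0.
Qed.

Lemma L2_surface_conj (f : C -> C) : L2_surface Gamma F f -> L2_surface Gamma F (fun z => (f z)^*%C).
Proof.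
move=> [fA mR mI fin]; split.
- by move=> A z GA zd; rewrite fA.
- by rewrite (_ : (fun p => _) = (fun p => complex.Re (f (of_plane p))))//; apply/funext => p; case: (f _).
- rewrite (_ : (fun p => _) = (fun p => - complex.Im (f (of_plane p)))); last by apply/funext => p; case: (f _).
  exact: measurable_funN.
- rewrite (_ : L2_sqnorm F _ = L2_sqnorm F f)//.
  by apply: eq_integral => p _; rewrite !normc_sqn sqnJ.
Qed.

Lemma L2_laplacian_conj (w k : C -> C) : L2_laplacian Gamma F w k ->
  L2_laplacian Gamma F (fun z => (w z)^*%C) (fun z => (k z)^*%C).
Proof.
move=> [Lw Lk [phi [Hphi cw ck]]]; split; [exact: L2_surface_conj|exact: L2_surface_conj|].
exists (fun n z => (phi n z)^*%C); split.
- move=> n; have [nA ns] := Hphi n; split; first by move=> A z GA zd; rewrite nA.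
  by move=> m; exact: class_C_conj (ns m).
- rewrite (_ : (fun n => _) = (fun n => L2_sqnorm F (fun z => phi n z - w z)))//.
  by apply/funext => n; apply: eq_integral => p _; rewrite -rmorphB !normc_sqn sqnJ.
- rewrite (_ : (fun n => _) = (fun n => L2_sqnorm F (fun z => laplacian (phi n) z - k z)))//.
  apply/funext => n; apply: eq_integral => p /[!inE] /Fd pd.
  by rewrite (laplacian_conj ((Hphi n).2 2) pd) -rmorphB !normc_sqn sqnJ.
Qed.

Lemma L2_resolvent_conj (f v : C -> C) : L2_laplacian Gamma F v (fun z => f z - 2^-1 * v z) ->
  L2_laplacian Gamma F (fun z => (v z)^*%C) (fun z => (f z)^*%C - 2^-1 * (v z)^*%C).
Proof.
move=> /L2_laplacian_conj; rewrite [X in L2_laplacian _ _ _ X](_ : _ = (fun z => (f z)^*%C - 2^-1 * (v z)^*%C))//.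
apply/funext => z; rewrite half_complex; case: (f z) (v z) => a b [c d].
by apply: part_inj => -[] /=; ring.
Qed.

(** [resolvent] is an arbitrary choice among solutions, so it commutes with conjugation only up to a
    null function. Conjugation carries solutions for f to solutions for conj f, so either both exist
    and uniqueness applies, or both resolvents are 0. *)
Lemma resolvent_conj (f : C -> C) b :
  sqI (fun z => part b (resolvent f z) - part b (resolvent (fun z => (f z)^*%C) z)^*%C) = 0.
Proof.
have [[v Hv]|nv] := pselect (exists v, L2_laplacian Gamma F v (fun z => f z - 2^-1 * v z)).
  have H1 : L2_laplacian Gamma F (resolvent f) (fun z => f z - 2^-1 * resolvent f z).
    by apply: (@xgetPex _ _ [set v | L2_laplacian Gamma F v (fun z => f z - 2^-1 * v z)]); exists v.
  set f' := fun z => (f z)^*%C.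
  have H2 : L2_laplacian Gamma F (resolvent f') (fun z => f' z - 2^-1 * resolvent f' z).
    apply: (@xgetPex _ _ [set v | L2_laplacian Gamma F v (fun z => f' z - 2^-1 * v z)]).
    by exists (fun z => (v z)^*%C); exact: L2_resolvent_conj Hv.
  apply: L2_laplacian_uniq H1 _.
  by have := L2_resolvent_conj H2; rewrite /f'; under [X in L2_laplacian _ _ _ X]eq_fun do rewrite conjcK.
have -> : resolvent f = (fun=> 0) by apply: xgetPN => v Hv; apply: nv; exists v.
have -> : resolvent (fun z => (f z)^*%C) = (fun=> 0).
  apply: xgetPN => v /= /L2_resolvent_conj; under [X in L2_laplacian _ _ _ X]eq_fun do rewrite conjcK.
  by move=> Hv; apply: nv; exists (fun z => (v z)^*%C).
rewrite -[RHS]sqI_zero; apply: eq_hI => z _; rewrite (_ : (0 : C)^*%C = 0) ?part_zero ?subrr//.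
by rewrite /= oppr0.
Qed.

Lemma green_integral (f la de : C -> C) : (forall b, hL2 (fun z => part b (f z))) ->
  (forall b, hL2 (fun z => part b (la z * (de z)^*%C))) ->
  integral_d2z F (fun z => green Gamma F f z * la z * (de z)^*%C * (rho z)%:C) =
  (2^-1 * (dotI (fun z => part true (resolvent f z)) (fun z => part true (la z * (de z)^*%C))
         - dotI (fun z => part false (resolvent f z)) (fun z => part false (la z * (de z)^*%C)))) +i*
  (2^-1 * (dotI (fun z => part true (resolvent f z)) (fun z => part false (la z * (de z)^*%C))
         + dotI (fun z => part false (resolvent f z)) (fun z => part true (la z * (de z)^*%C)))).
Proof.
move=> Lf Ly; have Lw b := (resolvent_energy (Lf b)).1.
have I b b' := hL2M F_fund (Lw b) (Ly b').
have alg (w l d : C) (r : R) : part true (2^-1 * w * l * d * r%:C) =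
    2^-1 * (part true w * part true (l * d) - part false w * part false (l * d)) * r.
  by rewrite half_complex; case: w l d => [? ?] [? ?] [? ?] /=; ring.
have alg' (w l d : C) (r : R) : part false (2^-1 * w * l * d * r%:C) =
    2^-1 * (part true w * part false (l * d) + part false w * part true (l * d)) * r.
  by rewrite half_complex; case: w l d => [? ?] [? ?] [? ?] /=; ring.
congr (_ +i* _).
  rewrite -(hIB mF (I true true) (I false false)) -(hIZ mF _ (hintegrableB mF (I true true) (I false false))).
  by apply: eq_Rintegral => p _; exact: alg.
rewrite -(hID mF (I true false) (I false true)) -(hIZ mF _ (hintegrableD mF (I true false) (I false true))).
by apply: eq_Rintegral => p _; exact: alg'.
Qed.
End GreenOperator.

(** * Curvature bounds *)

Section Curvature.
Context {R : realType}.
Local Notation C := R[i].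
Local Notation P := (R * R)%type.
Variable Gamma : set 'M[C]_2.
Hypothesis GammaS : surface_group Gamma.
Variable F : set C.
Hypothesis F_fund : fundamental_set Gamma F.
Let mF := fund_measurable F_fund.
Let Fd := @fund_disc _ _ _ F_fund.
Local Notation hL2 := (hL2 F).
Local Notation sqI f := (hI F (fun z => f z ^+ 2)).
Local Notation dotI f g := (hI F (fun z => f z * g z)).
Local Notation resolvent := (resolvent Gamma F).
Local Notation K := (C_const (inj_radius Gamma) ^+ 2).

(* The bound on a unit vector: the integral of sqn nu over the surface is 1, so that the
   submean value property bounds sqn nu pointwise. *)
Lemma unit_beltrami nu : harmonic_beltrami Gamma nu -> wp_norm F nu = 1 ->
  [/\ forall b, hmeas F (fun z => part b (nu z)), forall z, F z -> sqn (nu z) <= K & hI F (fun z => sqn (nu z)) = 1].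
Proof.
move=> hnu n1.
have h1 : hI F (fun z => sqn (nu z)) = 1.
  have E : complex.Re (wp_product F nu nu) = hI F (fun z => sqn (nu z)).
    by apply: eq_Rintegral => p _; rewrite -sqn_conj -rmorphM.
  have h0 : 0 <= hI F (fun z => sqn (nu z)) by apply: hI_ge0 => z _; exact: sqn_ge0.
  by rewrite -[LHS]sqr_sqrtr// -E -/(wp_norm F nu) n1 expr1n.
split=> //.
- have [q dq nuE] := beltrami_derivable hnu => b.
  have [mR mI] := @ccontinuous_measurable R (@disc R) q (@open_disc R) (fun z zd => cderive_continuous (dq z zd)).
  apply: (@measurable_funS _ _ _ _ (@of_plane R @^-1` @disc R : set P)); first exact: measurable_disc.
    by move=> p; exact: Fd.
  have mr : measurable_fun (@of_plane R @^-1` @disc R : set P) (fun p => (rho (of_plane p))^-1).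
    by apply: measurable_funTS; apply: (measurableT_comp measurable_inv); exact: measurable_rho.
  have [mR' mI'] := (measurable_funM mr mR, measurable_funM mr (measurable_funN mI)).
  have alg (r : R) (z : C) : part true (r%:C * z^*%C) = r * complex.Re z /\ part false (r%:C * z^*%C) = r * - complex.Im z.
    by case: z => c d; split => /=; ring.
  by case: b; [move: mR'|move: mI']; apply: eq_measurable_fun => p /[!inE] pd; rewrite nuE// ?(alg _ _).1 ?(alg _ _).2.
- move=> z /Fd zd; have := beltrami_sup GammaS F_fund hnu zd.
  have -> : hint F (fun w => (sqn (nu w))%:E) = 1%:E.
    have : fine (hint F (fun w => (sqn (nu w))%:E)) = 1.
      by rewrite -h1; congr fine; apply: eq_integral => p _; rewrite EFinM.
    by case: (hint _ _) => [r /= ->//| /= /esym/eqP|/= /esym/eqP]; rewrite oner_eq0.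
  rewrite lee_fin => H; have [K0 KE] := C_constP GammaS; move: H KE K0; set k := (_ * (1 - _)) => H KE K0.
  by rewrite -[leLHS]mulr1 -KE mulrCA ger_pMr.
Qed.

Section Pair.
Variables al be : C -> C.
Hypotheses (ma : forall b, hmeas F (fun z => part b (al z))) (mb : forall b, hmeas F (fun z => part b (be z)))
  (aK : forall z, F z -> sqn (al z) <= K) (bK : forall z, F z -> sqn (be z) <= K)
  (a1 : hI F (fun z => sqn (al z)) = 1) (b1 : hI F (fun z => sqn (be z)) = 1).
Let h z := al z * (be z)^*%C.

Lemma hmeas_prod b : hmeas F (fun z => part b (h z)).
Proof.
have E b' z : part b' (h z) = if b' then part true (al z) * part true (be z) + part false (al z) * part false (be z)
    else part false (al z) * part true (be z) - part true (al z) * part false (be z).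
  by rewrite /h; case: b'; case: (al z) (be z) => c d [e f] /=; ring.
rewrite /hmeas; under eq_fun do rewrite E; case: b {E}.
  by apply: measurable_funD; apply: measurable_funM; [exact: (ma true)|exact: (mb true)|exact: (ma false)|exact: (mb false)].
by apply: measurable_funB; apply: measurable_funM; [exact: (ma false)|exact: (mb true)|exact: (ma true)|exact: (mb false)].
Qed.

Lemma part_sqr_le b (z : C) : part b z ^+ 2 <= sqn z.
Proof. by case: b; rewrite ?lerDl ?lerDr ?sqr_ge0. Qed.

Lemma sqn_prod z : sqn (h z) = sqn (al z) * sqn (be z).
Proof. by rewrite /h sqnM sqnJ. Qed.

Lemma K_ge0 : 0 <= K. Proof. exact: sqr_ge0. Qed.

Lemma hL2_prod b : hL2 (fun z => part b (h z)).
Proof.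
apply: (hL2_bounded GammaS F_fund (M := K)); first exact: hmeas_prod.
move=> z Fz; rewrite -(@ler_pXn2r _ 2) ?nnegrE ?K_ge0// real_normK ?num_real//.
apply: (le_trans (part_sqr_le _ _)); rewrite sqn_prod expr2.
by apply: ler_pM; rewrite ?sqn_ge0 ?aK ?bK.
Qed.

(** One factor is bounded pointwise, |al|^2 <= K, and the other has integral 1; this keeps the bound
    linear in K. *)
Lemma sqI_prod b : sqI (fun z => part b (h z)) <= K.
Proof.
have mbe : hmeas F (fun z => sqn (be z)).
  by apply: measurable_funD; apply: measurable_funX; [exact: (mb true)|exact: (mb false)].
have Ib : hintegrable F (fun z => sqn (be z)).
  apply: (hintegrable_bounded (M := K) mF (hint_fund_lty GammaS F_fund) mbe) => z Fz.
  by rewrite ger0_norm ?sqn_ge0 ?bK.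
rewrite -[leRHS]mulr1 -b1 -(hIZ mF _ Ib); apply: (hI_le mF (hL2_prod b).2 (hintegrableZ mF _ Ib)) => z Fz.
apply: (le_trans (part_sqr_le _ _)); rewrite sqn_prod ler_wpM2r ?sqn_ge0//; exact: aK.
Qed.
End Pair.

Definition unit_form (al : C -> C) : Prop :=
  [/\ forall b, hmeas F (fun z => part b (al z)), forall z, F z -> sqn (al z) <= K & hI F (fun z => sqn (al z)) = 1].

Lemma part_self (z : C) : part false (z * z^*%C) = 0.
Proof. by case: z => a b /=; ring. Qed.

Lemma hI_eq0 (f : C -> R) : (forall z, f z = 0) -> hI F f = 0.
Proof. by move=> f0; rewrite -[RHS](sqI_zero GammaS F_fund); apply: eq_hI => z _; rewrite f0 expr0n. Qed.

(** |al|^2 is real, so by the energy inequality the imaginary part of its resolvent is null; a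
    single real product remains, bounded by the squared norms of |al|^2 and |be|^2, at most K
    each. *)
Lemma green_self (al be : C -> C) : unit_form al -> unit_form be ->
  exists2 X : R, X <= 2 * K & integral_d2z F (fun z =>
    green Gamma F (fun w => al w * (al w)^*%C) z * be z * (be z)^*%C * (rho z)%:C) = (2^-1 * X)%:C.
Proof.
move=> [ma aK a1] [mb bK b1]; have La := hL2_prod ma ma aK aK; have Lb := hL2_prod mb mb bK bK.
have [Lp E] := resolvent_energy GammaS F_fund (La false).
set p := resolvent (fun w => al w * (al w)^*%C) in Lp E *.
have p0 : sqI (fun z => part false (p z)) = 0.
  apply/le_anti; rewrite sqI_ge0 andbT -(@pmulr_rle0 _ 2^-1) ?invr_gt0//; apply: (le_trans E).
  by rewrite hI_eq0// => z; rewrite part_self mulr0.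
exists (dotI (fun z => part true (p z)) (fun z => part true (be z * (be z)^*%C))).
  apply: (le_trans (resolvent_dot GammaS F_fund (La true) (Lb true))).
  have := sqI_prod ma ma aK aK a1 true; have := sqI_prod mb mb bK bK b1 true.
  by move: (hI _ _) (hI _ _) K => *; lra.
rewrite (green_integral GammaS F_fund La Lb) -/p.
rewrite (hI_null GammaS F_fund Lp (Lb true) p0).
have z0 b : dotI (fun z => part b (p z)) (fun z => part false (be z * (be z)^*%C)) = 0.
  by apply: hI_eq0 => z; rewrite part_self mulr0.
rewrite !z0.
by rewrite subr0 addr0 mulr0.
Qed.

Lemma holomorphic_sectional_bound (nu : C -> C) : unit_form nu ->
  (- 2 * K)%:C <= holomorphic_sectional_curvature Gamma F nu.
Proof.
move=> U; have [X X2 E] := green_self U U.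
rewrite /holomorphic_sectional_curvature /wp_curvature E.
rewrite (_ : _ - _ = (- X)%:C) ?lecR ?mulNr ?lerN2//.
by apply: part_inj => -[] /=; field.
Qed.

Local Notation G al be la de := (integral_d2z F (fun z =>
  green Gamma F (fun w => al w * (be w)^*%C) z * la z * (de z)^*%C * (rho z)%:C)).

(** With al conj(be) = u + i v, the numbers are A = <w_u, u>, B = <w_v, v>, c = <w_u, v>, d = <w_v,
    u>. Exchanging al and be conjugates both the function and its resolvent, which only changes
    signs. *)
Lemma green_cross (al be : C -> C) : unit_form al -> unit_form be ->
  exists A B c d : R, [/\ 0 <= A /\ B <= 2 * K,
    G al be be al = (2^-1 * (A + B)) +i* (2^-1 * (d - c)), G be al al be = (2^-1 * (A + B)) +i* (2^-1 * (c - d)),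
    G al be al be = (2^-1 * (A - B)) +i* (2^-1 * (c + d)) & G be al be al = (2^-1 * (A - B)) +i* (2^-1 * (- c - d))].
Proof.
move=> Ua Ub; have [[ma aK a1] [mb bK b1]] := (Ua, Ub).
pose h w := al w * (be w)^*%C; pose h' w := be w * (al w)^*%C.
have Lh : forall b, hL2 (fun z => part b (h z)) by exact: hL2_prod.
have Lh' : forall b, hL2 (fun z => part b (h' z)) by exact: hL2_prod.
pose D (x y : C -> C) b b' := dotI (fun z => part b (x z)) (fun z => part b' (y z)).
pose J x y := (2^-1 * (D x y true true - D x y false false)) +i* (2^-1 * (D x y true false + D x y false true)).
have E1 : G al be be al = J (resolvent h) h' by exact: (@green_integral R Gamma GammaS F F_fund h be al Lh Lh').
have E2 : G be al al be = J (resolvent h') h by exact: (@green_integral R Gamma GammaS F F_fund h' al be Lh' Lh).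
have E3 : G al be al be = J (resolvent h) h by exact: (green_integral GammaS F_fund Lh Lh).
have E4 : G be al be al = J (resolvent h') h' by exact: (green_integral GammaS F_fund Lh' Lh').
have hJ z : h' z = (h z)^*%C.
  by rewrite /h /h'; case: (al z) (be z) => a b [c d]; apply: part_inj => -[] /=; ring.
have N b := resolvent_conj GammaS F_fund h b; rewrite -(funext hJ) in N.
have Lw b := (resolvent_energy GammaS F_fund (Lh b)).1.
have Lw' b := (resolvent_energy GammaS F_fund (Lh' b)).1.
have A0 := resolvent_dot_ge0 GammaS F_fund (Lh true).
have B0 := resolvent_dot GammaS F_fund (Lh false) (Lh false).
have V : sqI (fun z => part false (h z)) <= K by exact: sqI_prod.
set w := resolvent h in Lw N A0 B0 E1 E3 *; set w' := resolvent h' in Lw' N E2 E4 *.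
clearbody w w' h h'.
have pJ b (z : C) : part b z^*%C = (if b then 1 else -1) * part b z by case: b z => -[c d] /=; ring.
have hB x b b' : (forall b, hL2 (fun z => part b (x z))) -> D x h' b b' = (if b' then 1 else -1) * D x h b b'.
  move=> Lx; rewrite -(hIZ mF _ (hL2M F_fund (Lx b) (Lh b'))); apply: eq_hI => z _.
  by rewrite hJ pJ mulrCA.
(* [w'] equals the conjugate of [w] only up to a null function, which products with a
   square-integrable function do not see. *)
have wB b b' : D w' h b b' = (if b then 1 else -1) * D w h b b'.
  have s2 : (if b then 1 else -1) * (if b then 1 else -1) = 1 :> R by case: (b); ring.
  have Ld : hL2 (fun z => part b (w z) - part b (w' z)^*%C).
    have := hL2_lin F_fund (- (if b then 1 else -1)) (Lw b) (Lw' b).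
    by rewrite (_ : (fun z => _) = (fun z => part b (w z) - part b (w' z)^*%C))//; apply/funext => z; rewrite pJ mulNr.
  have := hI_null GammaS F_fund Ld (Lh b') (N b).
  rewrite (@eq_hI _ F _ (fun z => part b (w z) * part b' (h z) +
      (- (if b then 1 else -1)) * (part b (w' z) * part b' (h z)))); last by move=> z _; rewrite pJ; ring.
  rewrite (hI_lin F_fund _ (hL2M F_fund (Lw b) (Lh b')) (hL2M F_fund (Lw' b) (Lh b'))).
  rewrite -/(D w h b b') -/(D w' h b b'); move: (D w h b b') (D w' h b b') => x y /eqP.
  by rewrite addr_eq0 mulNr opprK => /eqP ->; rewrite mulrA s2 mul1r.
exists (D w h true true), (D w h false false), (D w h true false), (D w h false true).
split; last first.
- rewrite E4 /J !(hB _ _ _ Lw') !wB; congr (_ +i* _); ring.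
- rewrite E3 /J; congr (_ +i* _); ring.
- rewrite E2 /J !wB; congr (_ +i* _); ring.
- rewrite E1 /J !(hB _ _ _ Lw); congr (_ +i* _); ring.
move: A0 B0 V; rewrite -/(D w h true true) -/(D w h false false).
by move: (D w h true true) (D w h false false) (hI _ _) K => x1 x2 x3 k *; split; lra.
Qed.

Lemma sectional_bound (al be : C -> C) : unit_form al -> unit_form be ->
  (- 2 * K)%:C <= sectional_curvature Gamma F al be.
Proof.
move=> Ua Ub; have [Xa Xa2 Ea] := green_self Ua Ub; have [Xb Xb2 Eb] := green_self Ub Ua.
have [A [B [c [d [[A0 B0] E1 E2 E3 E4]]]]] := green_cross Ua Ub.
rewrite /sectional_curvature.
have -> : wp_curvature Gamma F al be be al = - ((2^-1 * (A + B)) +i* (2^-1 * (d - c))) - (2^-1 * Xa)%:C.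
  by rewrite -E1 -Ea.
have -> : wp_curvature Gamma F be al al be = - ((2^-1 * (A + B)) +i* (2^-1 * (c - d))) - (2^-1 * Xb)%:C.
  by rewrite -E2 -Eb.
have -> : wp_curvature Gamma F al be al be =
    - ((2^-1 * (A - B)) +i* (2^-1 * (c + d))) - ((2^-1 * (A - B)) +i* (2^-1 * (c + d))) by rewrite -E3.
have -> : wp_curvature Gamma F be al be al =
    - ((2^-1 * (A - B)) +i* (2^-1 * (- c - d))) - ((2^-1 * (A - B)) +i* (2^-1 * (- c - d))) by rewrite -E4.
clear Ea Eb E1 E2 E3 E4.
have -> : 4^-1 = (4^-1)%:C :> C by rewrite fmorphV rmorph_nat.
move: K A0 B0 Xa2 Xb2 => k A0 B0 Xa2 Xb2.
(* The terms c and d cancel, so the curvature is real. With A >= 0 and B, Xa, Xb <= 2 K it is at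
   least 1/4 (- 6 K - K - K) = - 2 K. *)
set x : C := (X in _ <= X); have -> : x = (4^-1 * (A - 3 * B - 2^-1 * Xa - 2^-1 * Xb))%:C.
  by apply: part_inj => -[] /=; rewrite /x /=; field.
by rewrite lecR; lra.
Qed.
End Curvature.
(* The curvatures are elements of R[i]; in R[i], x <= y means that y - x is a
   nonnegative real, so the bounds also say that the curvatures are real. *)
Theorem proposition3p3 (R : realType) (g : nat) (Gamma : set 'M[R[i]]_2)
    (F : set R[i]) (g_ge2 : (2 <= g)%N) (Gamma_surface : surface_group Gamma)
    (Gamma_genus : has_genus Gamma g) (F_fund : fundamental_set Gamma F) :
  (forall nu : R[i] -> R[i],
     harmonic_beltrami Gamma nu -> wp_norm F nu = 1 ->
     (- 2 * C_const (inj_radius Gamma) ^+ 2)%:C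
       <= holomorphic_sectional_curvature Gamma F nu) /\
  (forall al be : R[i] -> R[i],
     harmonic_beltrami Gamma al -> harmonic_beltrami Gamma be ->
     wp_norm F al = 1 -> wp_norm F be = 1 ->
     complex.Re (wp_product F al be) = 0 ->
     (- 2 * C_const (inj_radius Gamma) ^+ 2)%:C
       <= sectional_curvature Gamma F al be).
Proof.
split=> [nu hnu n1|al be hal hbe na nb _].
  exact: (holomorphic_sectional_bound Gamma_surface F_fund (unit_beltrami Gamma_surface F_fund hnu n1)).
exact: (sectional_bound Gamma_surface F_fund (unit_beltrami Gamma_surface F_fund hal na)
  (unit_beltrami Gamma_surface F_fund hbe nb)).
Qed.
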